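(* Let $(\lambda,\nu,s)$ be a co-Pieri triple, put $r=|\lambda|+s$, let $n$ be sufficiently large compared with $r$, and let $\mu\vdash s$. For each $\mathsf T\in\mathrm{SStd}^0_s(\nu\setminus\lambda,\mu)$ (viewed as a subset of $\mathrm{Std}^0_s(\nu\setminus\lambda)$) let $\varphi_{\mathsf T}:\mathsf M(\mu)\to\Delta^0_s(\nu\setminus\lambda)$ be the $\mathbb Q\mathfrak S_s$-module homomorphism sending the generator $1\otimes1$ of $\mathsf M(\mu)$ to $\sum_{\mathsf s\in\mathsf T}(m_{\mathsf s}+\mathsf{DR}_s(\nu\setminus\lambda))$. Then $\{\varphi_{\mathsf T}:\mathsf T\in\mathrm{SStd}^0_s(\nu\setminus\lambda,\mu)\}$ is a basis of $\mathrm{Hom}_{\mathfrak S_s}(\mathsf M(\mu),\Delta^0_s(\nu\setminus\lambda))$.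
   Context: Notation: $|\lambda|$ size, $\ell(\lambda)$ number of nonzero parts, $[\lambda]_a=\lambda_1+\dots+\lambda_a$, $[\lambda]_0=0$; $\lambda\cap\nu$ componentwise minimum; $\beta\ominus\alpha$ difference of Young diagrams. $\pm\varepsilon_i$ ($i\ge1$) adds/removes a box in row $i$, $\varepsilon_0=0$. Kronecker tableaux. For partitions $\lambda,\nu$, $s\ge0$ with $|\nu|\le|\lambda|+s$: $\mathrm{Std}_s(\nu\setminus\lambda)$ is the set of $\mathsf t=(-\varepsilon_{i_1},+\varepsilon_{j_1},\dots,-\varepsilon_{i_s},+\varepsilon_{j_s})$ with $\mathsf t(0)=\lambda$, $\mathsf t(k-\frac12)=\mathsf t(k-1)-\varepsilon_{i_k}$, $\mathsf t(k)=\mathsf t(k-\frac12)+\varepsilon_{j_k}$ all partitions, $\mathsf t(s)=\nu$; $(-\varepsilon_{i_k},+\varepsilon_{j_k})$ is the $k$-th integral step. $\mathrm{Std}^0_s(\nu\setminus\lambda)$: no integral step $(-\varepsilon_0,+\varepsilon_0)$ and $\#\{k:i_k=i\}\le\lambda_i$ for all $i\ge1$. $\mathsf t_{k\leftrightarrow k+1}$ interchanges the $k$-th and $(k+1)$-th integral steps. For a composition $\mu=(\mu_1,\dots,\mu_l)$ of $s$ with $[\mu]_c=\mu_1+\dots+\mu_c$: $\mathsf s\sim_\mu\mathsf t$ in $\mathrm{Std}^0_s(\nu\setminus\lambda)$ if they are joined by a chain in $\mathrm{Std}^0_s(\nu\setminus\lambda)$ of moves $\mathsf v\mapsto\mathsf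 v_{k\leftrightarrow k+1}$ with $k\notin\{[\mu]_1,\dots,[\mu]_{l-1}\}$; a class $[\mathsf t]_\mu$ is semistandard if for all $1\le c\le l$ neither $\mathsf t([\mu]_c)\ominus(\mathsf t([\mu]_{c-1})\cap\mathsf t([\mu]_c))$ nor $\mathsf t([\mu]_{c-1})\ominus(\mathsf t([\mu]_{c-1})\cap\mathsf t([\mu]_c))$ has two boxes in one column. $\mathrm{SStd}^0_s(\nu\setminus\lambda,\mu)$ is the set of semistandard classes. Co-Pieri triple: $|\nu|\le|\lambda|+s$, $\mathrm{Std}^0_s(\nu\setminus\lambda)\ne\emptyset$, and $s=1$, or $s>1$ and, if $\max\{\ell(\lambda),\ell(\nu)\}\ge2$, $s\le\max\{|\lambda\ominus(\lambda\cap\nu)|,|\nu\ominus(\lambda\cap\nu)|\}+\min_{2\le i\le\max\{\ell(\lambda),\ell(\nu)\}}(\min\{\lambda_{i-1},\nu_{i-1}\}-\max\{\lambda_i,\nu_i\})$. Partition algebra. $P_r(n)$ over $\mathbb Q$: basis the set partitions of $\{1,\dots,r,\bar1,\dots,\bar r\}$ (diagrams, northern $\bar i$, southern $i$); $xy$: $x$ above $y$, identify southern of $x$ with northern of $y$, delete the $t$ purely-middle components, multiply by $n^t$. $s_{k,k+1}$: blocks $\{\bar k,k+1\},\{\overline{k+1},k\}$, else $\{\bar i,i\}$; $p_k$: $\{\bar k\},\{k\}$, else $\{\bar i,i\}$; $p_{k+\frac12}$: $\{k,k+1,\bar k,\overline{k+1}\}$, else $\{\bar i,i\}$. $e^{(l)}_k=p_{k-l+1}\cdots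 p_k$, $e^{(l)}_{k+\frac12}=p_{k-l+\frac32}\cdots p_{k+\frac12}$ ($l$ factors; $=1$ if $k=0$ or $l=0$). $s_{l,k}=s_{l,l+1}\cdots s_{k-1,k}$ ($1\le l\le k$), $s_{k,l}^{-1}$ ($k<l$), $1$ if $l=0$ or $k=0$. $M_{\gamma,b}=\sum_{i=0}^{\gamma_b-1}s_{[\gamma]_b-i,[\gamma]_b}$ ($b\ge1$), $M_{\gamma,0}=1$. For $\mathsf t\in\mathrm{Std}_r(\nu)=\mathrm{Std}_r(\nu\setminus\varnothing)$ and $0\le k<r$, $\mathsf t(k)=\alpha\xrightarrow{-\varepsilon_a}\beta\xrightarrow{+\varepsilon_b}\gamma$: $u_{\mathsf t(k)\to\mathsf t(k+\frac12)}=e^{(k-|\beta|)}_{k+\frac12}s_{|\alpha|,[\alpha]_a}$, $u_{\mathsf t(k+\frac12)\to\mathsf t(k+1)}=e^{(k+1-|\gamma|)}_{k+1}M_{\gamma,b}s_{[\gamma]_b,|\gamma|}$, $d_{\mathsf t(k)\to\mathsf t(k+\frac12)}=e^{(k-|\alpha|)}_kM_{\alpha,a}s_{[\alpha]_a,|\alpha|}$, $d_{\mathsf t(k+\frac12)\to\mathsf t(k+1)}=e^{(k-|\beta|)}_{k+\frac12}s_{|\gamma|,[\gamma]_b}$; $u_{\mathsf t}=u_{\mathsf t(r-\frac12)\to\mathsf t(r)}\cdots u_{\mathsf t(0)\to\mathsf t(\frac12)}$, $d_{\mathsf t}=d_{\mathsf t(0)\to\mathsf t(\frac12)}\cdots d_{\mathsf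 t(r-\frac12)\to\mathsf t(r)}$. Modules. $\alpha\trianglerighteq\beta$ if $|\alpha|<|\beta|$, or $|\alpha|=|\beta|$ and $[\alpha]_a\ge[\beta]_a$ for all $a$; $\rhd$ strict version. $P^{\rhd\nu}_r(n)=\mathrm{span}\{d_{\mathsf q}u_{\mathsf w}:\mathsf q,\mathsf w\in\mathrm{Std}_r(\mu),\mu\rhd\nu\}$; $\Delta_r(\nu)$ is the right $P_r(n)$-module with basis $u_{\mathsf t}+P^{\rhd\nu}_r(n)$. For $\lambda\vdash r-s$, $\mathsf t^\lambda\in\mathrm{Std}_{r-s}(\lambda)$ has integral steps $(-\varepsilon_0,+\varepsilon_1)$ ($\lambda_1$ times), $(-\varepsilon_0,+\varepsilon_2)$ ($\lambda_2$ times), etc. $P_s(n)\subseteq P_r(n)$ by shifting diagrams onto the last $s$ vertices and adding $\{\bar i,i\}$ for $i\le r-s$. $\Delta_r(\nu;\rhd\lambda)$: span of basis elements with $\mathsf t(r-s)\rhd\lambda$; $\Delta_r(\nu;\mathsf t^\lambda)$: span of those whose first $r-s$ integral steps are $\mathsf t^\lambda$. $\Delta_s(\nu\setminus\lambda)=(\Delta_r(\nu;\mathsf t^\lambda)+\Delta_r(\nu;\rhd\lambda))/\Delta_r(\nu;\rhd\lambda)$, basis $m_{\mathsf t}$ = image of $u_{\mathsf t^\lambda\circ\mathsf t}+P^{\rhd\nu}_r(n)$ ($\mathsf t\in\mathrm{Std}_s(\nu\setminus\lambda)$, $\circ$ concatenation). $\mathsf{DR}_s(\nu\setminus\lambda)=\Delta_s(\nu\setminus\lambda)P_s(n)p_rP_s(n)$,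 $\Delta^0_s(\nu\setminus\lambda)=\Delta_s(\nu\setminus\lambda)/\mathsf{DR}_s(\nu\setminus\lambda)$; it is a module over $P_s(n)/P_s(n)p_rP_s(n)\cong\mathbb Q\mathfrak S_s$ ($s_{k,k+1}\mapsto(k,k+1)$). $\mathsf M(\mu)=\mathbb Q\otimes_{\mathbb Q\mathfrak S_\mu}\mathbb Q\mathfrak S_s$ is the Young permutation module, $\mathfrak S_\mu=\mathfrak S_{\mu_1}\times\cdots\times\mathfrak S_{\mu_l}$. *)

(* Defs.v *)
From mathcomp Require Import all_boot all_algebra all_fingroup.
Set Implicit Arguments. Unset Strict Implicit. Unset Printing Implicit Defensive.
Import GRing.Theory.

Definition is_part (l : seq nat) : bool := sorted geq l && all (fun x => 0 < x) l.

Definition psum (l : seq nat) (a : nat) : nat := sumn (take a l).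

Definition pcap (a b : seq nat) : seq nat := [seq minn x.1 x.2 | x <- zip a b].

Definition strip0 (l : seq nat) : seq nat :=
  take (size l - find (fun x => x != 0) (rev l)) l.

(* l - eps_i  (i >= 1, rows 1-indexed; eps_0 = 0); None if not a partition *)
Definition rmbox (l : seq nat) (i : nat) : option (seq nat) :=
  if i is i'.+1 then
    let m := strip0 (set_nth 0 l i' (nth 0 l i').-1) in
    if (i' < size l) && is_part m then Some m else None
  else Some l.

Definition adbox (l : seq nat) (i : nat) : option (seq nat) :=
  if i is i'.+1 then
    let m := incr_nth l i' in if is_part m then Some m else None
  else Some l.

(* Kronecker tableaux: a sequence of integral steps (i_k, j_k) meaning *)
(* (-eps_{i_k}, +eps_{j_k}).                                           *)
Fixpoint kend (al : seq nat) (t : seq (nat * nat)) : option (seq nat) :=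
  match t with
  | [::] => Some al
  | (a, b) :: t' =>
      match rmbox al a with
      | None => None
      | Some be => match adbox be b with
                   | None => None
                   | Some ga => kend ga t'
                   end
      end
  end.

Definition tat (lam : seq nat) (t : seq (nat * nat)) (k : nat) : seq nat :=
  odflt [::] (kend lam (take k t)).

Fixpoint seqs (m B : nat) : seq (seq (nat * nat)) :=
  if m is m'.+1 then
    [seq x :: y | x <- [seq (i, j) | i <- iota 0 B, j <- iota 0 B], y <- seqs m' B]
  else [:: [::]].

(* Std_s(nu \ lam).  Every such tableau has all entries < |lam| + s + 2. *)
Definition stdl (lam nu : seq nat) (s : nat) : seq (seq (nat * nat)) :=
  [seq t <- seqs s (sumn lam + s + 2) | kend lam t == Some nu].

Definition std0 (lam nu : seq nat) (s : nat) : seq (seq (nat * nat)) :=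
  [seq t <- stdl lam nu s |
     ((0, 0) \notin t) &&
     all (fun i => count (fun st => st.1 == i) t <= nth 0 lam i.-1)
         (iota 1 (sumn lam + s + 2))].

(* t_{k <-> k+1}  (k is 1-indexed) *)
Definition swapk (t : seq (nat * nat)) (k : nat) : seq (nat * nat) :=
  set_nth (0, 0) (set_nth (0, 0) t k.-1 (nth (0, 0) t k)) k (nth (0, 0) t k.-1).

Definition allowed (mu : seq nat) (s k : nat) : bool :=
  (0 < k < s) && (k \notin [seq psum mu c | c <- iota 1 (size mu).-1]).

Definition nbrs (mu : seq nat) (s : nat) (S0 : seq (seq (nat * nat)))
    (t : seq (nat * nat)) : seq (seq (nat * nat)) :=
  [seq swapk t k | k <- iota 1 s & allowed mu s k && (swapk t k \in S0)].

Fixpoint closit (mu : seq nat) (s : nat) (S0 : seq (seq (nat * nat))) (m : nat)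
    (L : seq (seq (nat * nat))) : seq (seq (nat * nat)) :=
  if m is m'.+1 then
    closit mu s S0 m' (undup (L ++ flatten [seq nbrs mu s S0 x | x <- L]))
  else L.

Definition cls (lam nu : seq nat) (s : nat) (mu : seq nat) (t : seq (nat * nat))
    : seq (seq (nat * nat)) :=
  let S0 := std0 lam nu s in
  [seq x <- S0 | x \in closit mu s S0 (size S0) [:: t]].

Definition twocol (be al : seq nat) : bool :=
  has (fun c => 1 < count (fun i => (nth 0 al i < c) && (c <= nth 0 be i))
                          (iota 0 (size be)))
      (iota 1 (head 0 be)).

Definition ssrep (lam mu : seq nat) (t : seq (nat * nat)) : bool :=
  all (fun c =>
         let al := tat lam t (psum mu c.-1) in
         let be := tat lam t (psum mu c) in
         let ch := pcap al be in
         ~~ twocol be ch && ~~ twocol al ch)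
      (iota 1 (size mu)).

Definition sstd (lam nu : seq nat) (s : nat) (mu : seq nat)
    : seq (seq (seq (nat * nat))) :=
  undup [seq cls lam nu s mu t | t <- std0 lam nu s & ssrep lam mu t].

Definition copieri (lam nu : seq nat) (s : nat) : bool :=
  let L := maxn (size lam) (size nu) in
  let ch := pcap lam nu in
  let X := maxn (sumn lam - sumn ch) (sumn nu - sumn ch) in
  let f (i : nat) : int :=
      ((minn (nth 0 lam i.-2) (nth 0 nu i.-2))%:Z
       - (maxn (nth 0 lam i.-1) (nth 0 nu i.-1))%:Z)%R in
  [&& sumn nu <= sumn lam + s, std0 lam nu s != [::] &
    (s == 1) || (1 < s) &&
      ((L < 2) ||
       (s%:Z <= X%:Z + foldr Num.min (f 2) [seq f i | i <- iota 3 (L - 2)])%R)].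

Definition domi (al be : seq nat) : bool :=
  (sumn al < sumn be) ||
  (sumn al == sumn be) &&
    all (fun a => psum be a <= psum al a) (iota 1 (maxn (size al) (size be))).
Definition gdom (al be : seq nat) : bool := domi al be && (al != be).

Definition tlam (lam : seq nat) : seq (nat * nat) :=
  flatten [seq nseq (nth 0 lam i) (0, i.+1) | i <- iota 0 (size lam)].

(* Partition algebra P_r(n).  Vertices 0..2r-1: northern vertex bar i *)
(* is i-1, southern vertex i is r+i-1.  A set partition is stored as a *)
(* map sending each vertex to the least element of its block.         *)
Definition osub (m v : nat) : option 'I_m :=
  (if v < m as b return (v < m = b -> option 'I_m)
   then fun h => Some (Ordinal h) else fun _ => None) (erefl _).

Definition dg (r : nat) := {ffun 'I_(r + r) -> 'I_(r + r)}.
Definition isdg (r : nat) (d : dg r) : bool := [forall x, (d (d x) == d x) && (d x <= x)].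

Definition nap (m : nat) (d : {ffun 'I_m -> 'I_m}) (v : nat) : nat :=
  if osub m v is Some w then val (d w) else v.

Definition nconn (m : nat) (E : nat -> nat -> bool) (u v : nat) : bool :=
  match osub m u, osub m v with
  | Some a, Some b => connect (fun x y : 'I_m => E x y || E y x) a b
  | _, _ => false
  end.

Definition mkdg (r : nat) (C : nat -> nat -> bool) : dg r :=
  [ffun w : 'I_(r + r) => odflt w (osub (r + r) (find (fun w' => C w' w) (iota 0 (r + r))))].

Definition dgrel (r : nat) (P : nat -> nat -> bool) : dg r := mkdg r (nconn (r + r) P).

(* stacking x above y: vertices 0..r-1 top, r..2r-1 middle, 2r..3r-1 bottom *)
Definition cE (r : nat) (x y : dg r) (a b : nat) : bool :=
  ((a < r + r) && (b < r + r) && (nap x a == nap x b)) ||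
  ((r <= a) && (r <= b) && (nap y (a - r) == nap y (b - r))).
Definition ew (r w : nat) : nat := if w < r then w else w + r.
Definition comp (r : nat) (x y : dg r) : dg r :=
  mkdg r (fun w' w => nconn (r + r + r) (cE x y) (ew r w') (ew r w)).
Definition midc (r : nat) (x y : dg r) : nat :=
  count (fun m => all (fun a => nconn (r + r + r) (cE x y) a m ==>
                                 [&& r <= a, a < r + r & m <= a])
                      (iota 0 (r + r + r)))
        (iota r r).

Definition alg (r : nat) := {ffun dg r -> rat}.
Definition bas (r : nat) (d : dg r) : alg r := [ffun z => ((z == d)%:R)%R].
Definition amul (r : nat) (n : rat) (f g : alg r) : alg r :=
  [ffun z => (\sum_(x : dg r) \sum_(y : dg r)
                f x * g y * (if comp x y == z then n ^+ midc x y else 0))%R].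
Definition scl (r : nat) (c : rat) (v : alg r) : alg r := [ffun z => (c * v z)%R].

Definition aone (r : nat) : alg r := bas (dgrel r (fun a b => (a < r) && (b == a + r))).
Definition aprod (r : nat) (n : rat) (l : seq (alg r)) : alg r := foldr (amul n) (aone r) l.

Definition sg (r k : nat) : alg r :=
  bas (dgrel r (fun a b => (a < r) &&
         (b == r + (if a == k.-1 then k else if a == k then k.-1 else a)))).
Definition pg (r k : nat) : alg r :=
  bas (dgrel r (fun a b => (a < r) && (a != k.-1) && (b == a + r))).
Definition phg (r k : nat) : alg r :=
  bas (dgrel r (fun a b => (a < r) && (b == a + r) || (a == k.-1) && (b == k)
                          || (a == r + k.-1) && (b == r + k))).

Definition sLK (r : nat) (n : rat) (l k : nat) : alg r :=
  if (l == 0) || (k == 0) then aone r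
  else if l <= k then aprod n [seq sg r i | i <- iota l (k - l)]
  else aprod n [seq sg r i | i <- rev (iota k (l - k))].
Definition ei (r : nat) (n : rat) (l k : nat) : alg r :=
  if (k == 0) || (l == 0) then aone r else aprod n [seq pg r i | i <- iota (k - l).+1 l].
Definition eh (r : nat) (n : rat) (l k : nat) : alg r :=
  if (k == 0) || (l == 0) then aone r else aprod n [seq phg r i | i <- iota (k - l).+1 l].
Definition Mg (r : nat) (n : rat) (ga : seq nat) (b : nat) : alg r :=
  if b == 0 then aone r
  else (\sum_(0 <= i < nth 0 ga b.-1) sLK r n (psum ga b - i) (psum ga b))%R.

(* factors of u_t, listed as u_{t(r-1/2)->t(r)}, ..., u_{t(0)->t(1/2)} *)
Fixpoint ufac (r : nat) (n : rat) (k : nat) (al : seq nat) (t : seq (nat * nat))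
    : seq (alg r) :=
  match t with
  | [::] => [::]
  | (a, b) :: t' =>
      let be := odflt [::] (rmbox al a) in
      let ga := odflt [::] (adbox be b) in
      ufac r n k.+1 ga t' ++
      [:: amul n (amul n (ei r n (k.+1 - sumn ga) k.+1) (Mg r n ga b))
                 (sLK r n (psum ga b) (sumn ga));
          amul n (eh r n (k - sumn be) k) (sLK r n (sumn al) (psum al a))]
  end.
(* factors of d_t, listed as d_{t(0)->t(1/2)}, ..., d_{t(r-1/2)->t(r)} *)
Fixpoint dfac (r : nat) (n : rat) (k : nat) (al : seq nat) (t : seq (nat * nat))
    : seq (alg r) :=
  match t with
  | [::] => [::]
  | (a, b) :: t' =>
      let be := odflt [::] (rmbox al a) in
      let ga := odflt [::] (adbox be b) in
      [:: amul n (amul n (ei r n (k - sumn al) k) (Mg r n al a))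
                 (sLK r n (psum al a) (sumn al));
          amul n (eh r n (k - sumn be) k) (sLK r n (sumn ga) (psum ga b))] ++
      dfac r n k.+1 ga t'
  end.
Definition uT (r : nat) (n : rat) (t : seq (nat * nat)) : alg r := aprod n (ufac r n 0 [::] t).
Definition dT (r : nat) (n : rat) (t : seq (nat * nat)) : alg r := aprod n (dfac r n 0 [::] t).

Unset Implicit Arguments.

Definition spanP (r : nat) (S : alg r -> Prop) (w : alg r) : Prop :=
  exists (L : seq (alg r)) (c : seq rat),
    (forall v, v \in L -> S v) /\ w = (\sum_(i < size L) scl (nth 0 c i) (nth 0 L i))%R.

Definition alltab (r : nat) : seq (seq (nat * nat)) :=
  [seq t <- seqs r (r + 2) | kend [::] t != None].
Definition shp (t : seq (nat * nat)) : seq nat := odflt [::] (kend [::] t).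

(* spanning set of P^{|> nu}_r(n) *)
Definition Pgt (r : nat) (n : rat) (nu : seq nat) : seq (alg r) :=
  [seq amul n (dT r n q) (uT r n w) | q <- alltab r,
     w <- [seq w <- alltab r | (shp w == shp q) && gdom (shp q) nu]].
(* lifts of the basis of Delta_r(nu; t^lam) *)
Definition Dlam (r : nat) (n : rat) (lam nu : seq nat) (s : nat) : seq (alg r) :=
  [seq uT r n t | t <- stdl [::] nu r & take (r - s) t == tlam lam].
(* lifts of the basis of Delta_r(nu; |> lam) *)
Definition Dgt (r : nat) (n : rat) (lam nu : seq nat) (s : nat) : seq (alg r) :=
  [seq uT r n t | t <- stdl [::] nu r & gdom (tat [::] t (r - s)) lam].

(* preimage in P_r(n) of Delta_s(nu\lam) *)
Definition Aset (r : nat) (n : rat) (lam nu : seq nat) (s : nat) : alg r -> Prop :=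
  spanP r (fun v => v \in Pgt r n nu ++ Dlam r n lam nu s ++ Dgt r n lam nu s).

Definition emv (r s v : nat) : option nat :=
  if v < r then (if v < r - s then None else Some (v - (r - s)))
  else (if v - r < r - s then None else Some (s + (v - r - (r - s)))).
Definition embd (r s : nat) (e : dg s) : dg r :=
  dgrel r (fun a b => [&& a < r - s & b == a + r] ||
             match emv r s a, emv r s b with
             | Some a', Some b' => nap e a' == nap e b'
             | _, _ => false
             end).

Definition Iset (r s : nat) (n : rat) : alg r -> Prop :=
  spanP r (fun v => exists x y : dg s, [/\ isdg x, isdg y &
           v = amul n (amul n (bas (embd r s x)) (pg r r)) (bas (embd r s y))]).

(* preimage in P_r(n) of DR_s(nu\lam); Delta^0 = Aset / Bset *)
Definition Bset (r : nat) (n : rat) (lam nu : seq nat) (s : nat) : alg r -> Prop :=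
  spanP r (fun v => v \in Pgt r n nu ++ Dgt r n lam nu s \/
                  exists w a, [/\ Aset r n lam nu s w, Iset r s n a & v = amul n w a]).

Definition pap (s : nat) (sg : 'S_s) (i : nat) : nat :=
  if osub s i is Some j then val (sg j) else i.
Definition permd (r s : nat) (sg : 'S_s) : alg r :=
  bas (embd r s (dgrel s (fun a b => (a < s) && (b == s + pap s sg a)))).

Definition blk (mu : seq nat) (i : nat) : nat := count (fun c => psum mu c <= i) (iota 1 (size mu)).
Definition young (s : nat) (mu : seq nat) (x : 'S_s) : bool :=
  [forall i : 'I_s, blk mu (x i) == blk mu i].

(* A linear map Q S_s -> Delta^0_s(nu\lam) given by (lifts of) the images of the
   basis elements g in S_s; it is an S_s-hom M(mu) -> Delta^0_s(nu\lam), with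
   M(mu) = Q S_s / span{x g - g | x in S_mu}, iff: *)
Definition isHom (r : nat) (n : rat) (lam nu : seq nat) (s : nat) (mu : seq nat)
    (F : 'S_s -> alg r) : Prop :=
  [/\ forall g, Aset r n lam nu s (F g),
      forall x g, young s mu x -> Bset r n lam nu s (F (x * g)%g - F g)%R &
      forall g h, Bset r n lam nu s (F (g * h)%g - amul n (F g) (permd r s h))%R].

Definition phiT (r : nat) (n : rat) (lam : seq nat) (s : nat)
    (T : seq (seq (nat * nat))) (g : 'S_s) : alg r :=
  amul n (\sum_(t <- T) uT r n (tlam lam ++ t))%R (permd r s g).

(* Main.v *)
(* A diagram acts as a kernel on pairs of words over [{0..n}], namely the indicator of the words that
   are constant on its blocks; the product becomes the product of kernels and the action is faithful
   for large [n].  The kernel of [u_t] is then the vector obtained from the vacuum of a Fock space by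
   the letters of [t] acting as polarization operators [y_(b,v) d_(a,v)], and [d_q u_w] becomes a
   matrix coefficient.

   Vectors of arbitrary (not necessarily dominant) words are straightened with the commuting [gl]
   action: [F_i E_i + c] is onto on weight spaces of negative [sl_2]-weight, so every such vector lies
   in the [F]-span of vectors of tableaux.  As the letters of a word commute up to terms with a
   diagram in the ideal of [p_r], the space defining [Delta_s(nu\lam)] is stable under [S_s] and
   [u_t s_k = u_(t_(k <-> k+1))] modulo the relations; if [t] has a step [(0,0)] or removes too many
   boxes from a row, [u_t] is itself a relation.  Hence [Std^0] spans [Delta^0].

   For independence, test kernels on words carrying mean-zero weights with disjoint supports, one
   per untouched box or integral step, antisymmetrized along the columns of [lam] and [nu]: antisymmetry
   kills [P^(> nu)] and the terms dominating [lam], the mean-zero condition kills [DR].  The co-Pieri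
   inequality leaves each row enough untouched boxes for the resulting functionals to be triangular
   on [Std^0] in the componentwise order.  The same inequality makes [Std^0] closed under
   permutations of its integral steps and all classes semistandard.  Thus [Delta^0] is the
   permutation module on [Std^0], and homomorphisms from [M(mu)] into it are functions on the
   orbits of the Young subgroup. *)
From HB Require Import structures.
Require Import Defs.
From mathcomp Require Import all_boot all_order all_algebra all_fingroup.
From mathcomp Require Import zify ring lra boolp functions.
Set Implicit Arguments. Unset Strict Implicit. Unset Printing Implicit Defensive.
Import GRing.Theory.

(** The obstacle is that neither exchanging two integral steps nor multiplying in the algebra keeps
    one inside tableaux. Vectors of arbitrary words absorb this. A contraction of two letters is
    again a pair of steps, through an auxiliary colour used nowhere before. A lowering operator
    produced by straightening is moved by contravariance onto the other argument of the pairing,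
    where it raises the weight and so lands in the span of the [d_q u_w] of dominating shape.
    Relations in the quotient need to be tested only on words whose last [s] letters are distinct:
    the ideal contains an idempotent acting as the identity on all other words, built by inclusion
    and exclusion. The mean-zero weights take the values 2, -1, -1. A class met by [k] operators
    contributes a [k]-th power sum, here [2^k + 2(-1)^k], which vanishes for [k = 1] and is positive
    for all [k >= 2]. The values 1, -1 would fail, because a chain box, step, box has [k = 3]. With
    this positivity the only signs left are those of the column permutations. *)

Lemma osub_ord m (a : 'I_m) : osub m a = Some a.
Proof.
rewrite /osub; move: (erefl (a < m)).
(* Only the right side of the equality and the scrutinee are generalized: the dependent [if] then
   reduces while [h] still speaks of [a < m]. *)
generalize (a < m) at 2 3 => -[] h.
  by congr Some; apply: val_inj.
by move: h; rewrite ltn_ord.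
Qed.

Definition symr m (E : nat -> nat -> bool) : rel 'I_m := fun x y => E x y || E y x.

Lemma nconn_ord m E (a b : 'I_m) : nconn m E a b = connect (symr E) a b.
Proof. by rewrite /nconn !osub_ord. Qed.

Lemma symr_sym m E : connect_sym (@symr m E).
Proof. by apply: sym_connect_sym => x y; rewrite /symr orbC. Qed.

(** * Least-representative form of a set partition *)

Section Mkdg.
Variables (r : nat) (C : nat -> nat -> bool).
Hypothesis Cr : forall a : 'I_(r + r), C a a.
Hypothesis Cs : forall a b : 'I_(r + r), C a b = C b a.
Hypothesis Ct : forall a b c : 'I_(r + r), C a b -> C b c -> C a c.

Lemma mkdg_spec (w : 'I_(r + r)) :
  [/\ C (mkdg r C w) w, mkdg r C w <= w & forall v : 'I_(r + r), C v w -> mkdg r C w <= v].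
Proof.
rewrite /mkdg ffunE; set p := fun w' : nat => C w' w.
have hp : has p (iota 0 (r + r)).
  by apply/hasP; exists (val w); rewrite ?mem_iota ?ltn_ord //; apply: Cr.
have hf := hp; rewrite has_find size_iota in hf.
rewrite -[find _ _]/(val (Ordinal hf)) osub_ord /=.
have mn (v : 'I_(r + r)) : C v w -> find p (iota 0 (r + r)) <= v.
  move=> Cv; rewrite leqNgt; apply/negP => h.
  by have := before_find 0 h; rewrite nth_iota ?ltn_ord //= /p Cv.
split=> //; last exact/mn/Cr.
by have := nth_find 0 hp; rewrite nth_iota.
Qed.

Lemma mkdg_eq (a b : 'I_(r + r)) : (mkdg r C a == mkdg r C b) = C a b.
Proof.
have [ca _ ma] := mkdg_spec a; have [cb _ mb] := mkdg_spec b.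
apply/eqP/idP => [e | Cab]; first by rewrite e in ca; apply: Ct cb; rewrite Cs.
apply/val_inj/eqP; rewrite eqn_leq ma ?mb //; first exact: Ct Cab.
by apply: Ct cb _; rewrite Cs.
Qed.

Lemma mkdg_isdg : isdg (mkdg r C).
Proof.
apply/forallP => x; have [cx lx _] := mkdg_spec x.
by rewrite mkdg_eq cx lx.
Qed.
End Mkdg.

(** The map [h] is the identity for a diagram given by generating edges, and [ew] for a composite,
    whose outer vertices sit inside a stack of three rows. *)
Lemma nconn_mkdg r m E (h : nat -> nat) : (forall a, a < r + r -> h a < m) ->
  let C := fun a b => nconn m E (h a) (h b) in
  [/\ forall a : 'I_(r + r), C a a, forall a b : 'I_(r + r), C a b = C b a
    & forall a b c : 'I_(r + r), C a b -> C b c -> C a c].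
Proof.
move=> hm C.
have K (a : 'I_(r+r)) : exists a' : 'I_m, h a = a' by exists (Ordinal (hm _ (ltn_ord a))).
split=> [a|a b|a b c]; rewrite /C.
- by have [a' ->] := K a; rewrite nconn_ord connect0.
- by have [a' ->] := K a; have [b' ->] := K b; rewrite !nconn_ord symr_sym.
- have [a' ->] := K a; have [b' ->] := K b; have [c' ->] := K c; rewrite !nconn_ord.
  exact: connect_trans.
Qed.

(** * Diagrams as kernels on words *)

Section Rho.
Variable n : nat.
Local Notation I := 'I_n.+1.

Definition cst r (d : dg r) (h : nat -> I) : bool :=
  [forall a : 'I_(r + r), forall b : 'I_(r + r), (d a == d b) ==> (h a == h b)].

Lemma cstP r (d : dg r) (h : nat -> I) :
  reflect (forall a b : 'I_(r + r), d a = d b -> h a = h b) (cst d h).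
Proof.
apply: (iffP forallP) => H a; first by move=> b /eqP; move/forallP: (H a) => /(_ b) /implyP K /K /eqP.
by apply/forallP => b; apply/implyP => /eqP /H ->.
Qed.

Lemma cst_connect m (E : nat -> nat -> bool) (h : 'I_m -> I) :
  (forall a b : 'I_m, E a b -> h a = h b) ->
  forall a b, connect (symr E) a b -> h a = h b.
Proof.
move=> H a b /connectP [p]; elim: p a => [|c p IH] a /=; first by move=> _ ->.
by case/andP => /orP [] /H e hp hl; rewrite -(IH c) // e.
Qed.

(** A labelling constant along the generating edges is constant on components, so the blocks of
    [dgrel] never have to be computed. *)
Lemma cst_dgrel r (P : nat -> nat -> bool) (h : nat -> I) :
  reflect (forall a b : 'I_(r + r), P a b -> h a = h b) (cst (dgrel r P) h).
Proof.
have [H1 H2 H3] := @nconn_mkdg r (r + r) P id (fun a ha => ha).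
apply: (iffP (cstP _ _)) => H a b.
  move=> hP; apply: H; apply/eqP; rewrite mkdg_eq // nconn_ord.
  by apply: connect1; rewrite /symr hP.
move/eqP; rewrite mkdg_eq // nconn_ord.
exact: (@cst_connect _ P (fun a : 'I_(r+r) => h a)).
Qed.

Lemma dgrel_isdg r P : isdg (dgrel r P).
Proof.
have [H1 H2 H3] := @nconn_mkdg r (r + r) P id (fun a ha => ha).
exact: mkdg_isdg.
Qed.

Lemma ew_lt r a : a < r + r -> ew r a < r + r + r.
Proof. by rewrite /ew; case: ifP; lia. Qed.

Lemma comp_isdg r (x y : dg r) : isdg (Defs.comp x y).
Proof.
have [H1 H2 H3] := @nconn_mkdg r (r + r + r) (cE x y) (ew r) (@ew_lt r).
exact: mkdg_isdg.
Qed.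

(** Words are lists, not finite functions, so that letters can be cut out and concatenated;
    [sum_alls] passes to a finite type when a count is needed. *)
Fixpoint alls (k : nat) : seq (seq I) :=
  if k is k'.+1 then [seq v :: g | v <- enum I, g <- alls k'] else [:: [::]].

Lemma mem_alls k g : (g \in alls k) = (size g == k).
Proof.
elim: k g => [|k IH] [|v g] //=.
  by apply/allpairsP => -[[a b] [_ _]].
rewrite eqSS -IH; apply/allpairsP/idP => [[[a b] /= [_ hb [_ ->]]] // | hg].
by exists (v, g); rewrite mem_enum.
Qed.

Lemma uniq_alls k : uniq (alls k).
Proof.
elim: k => //= k IH; apply: allpairs_uniq; rewrite ?enum_uniq //.
by move=> [a b] [c d] _ _ /= [-> ->].
Qed.

Lemma nth_codom_ord k (f : {ffun 'I_k -> I}) (i : 'I_k) : nth ord0 (codom f) i = f i.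
Proof.
by rewrite codomE (nth_map i) ?size_enum_ord ?ltn_ord // nth_ord_enum.
Qed.

Lemma sum_alls k (R : nmodType) (F : seq I -> R) :
  (\sum_(g <- alls k) F g = \sum_(h : {ffun 'I_k -> I}) F (codom h))%R.
Proof.
rewrite -(big_map (fun h : {ffun 'I_k -> I} => codom h) xpredT F).
apply: perm_big; apply: uniq_perm; first exact: uniq_alls.
  rewrite map_inj_uniq ?enum_uniq // ?/index_enum -?enumT ?enum_uniq //.
  move=> f g e; apply/ffunP => i.
  have := congr1 (fun s => nth ord0 s i) e.
  by rewrite !nth_codom_ord.
move=> g; rewrite mem_alls; apply/eqP/mapP => [sg | [h _ ->]]; last first.
  by rewrite size_codom card_ord.
exists [ffun i : 'I_k => nth ord0 g i]; first by rewrite mem_index_enum.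
apply: (@eq_from_nth _ ord0); first by rewrite size_codom card_ord.
move=> i hi; rewrite sg in hi.
by rewrite codomE (nth_map (Ordinal hi)) ?size_enum_ord // ffunE nth_enum_ord.
Qed.

Definition vals (f g : seq I) : nat -> I := nth ord0 (f ++ g).

Definition rho r (a : alg r) (f g : seq I) : rat :=
  (\sum_(d : dg r) a d * (cst d (vals f g))%:R)%R.

Lemma rho_bas r (d : dg r) f g : rho (bas d) f g = ((cst d (vals f g))%:R)%R.
Proof.
rewrite /rho (bigD1 d) //= ffunE eqxx mul1r big1 ?addr0 // => e /negPf he.
by rewrite ffunE he mul0r.
Qed.

Lemma rhoD r (a b : alg r) f g : (rho (a + b) f g = rho a f g + rho b f g)%R.
Proof. by rewrite -big_split; apply: eq_bigr => d _; rewrite ffunE mulrDl. Qed.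
Lemma rhoN r (a : alg r) f g : (rho (- a) f g = - rho a f g)%R.
Proof. by rewrite -sumrN; apply: eq_bigr => d _; rewrite ffunE mulNr. Qed.
Lemma rho0 r f g : (rho (0 : alg r) f g = 0)%R.
Proof. by apply: big1 => d _; rewrite ffunE mul0r. Qed.
Lemma rho_scl r c (a : alg r) f g : (rho (scl c a) f g = c * rho a f g)%R.
Proof. by rewrite mulr_sumr; apply: eq_bigr => d _; rewrite ffunE mulrA. Qed.
Lemma rho_sum r (J : Type) (s : seq J) (P : pred J) (a : J -> alg r) f g :
  (rho (\sum_(i <- s | P i) a i) f g = \sum_(i <- s | P i) rho (a i) f g)%R.
Proof. by elim/big_rec2: _ => [|i x y _ <-]; rewrite ?rho0 ?rhoD. Qed.

End Rho.

(** * Composition of diagrams as multiplication of kernels *)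

Section RhoMul.
Variable n : nat.
Local Notation I := 'I_n.+1.
Variables (r : nat) (x y : dg r) (f g : seq I).
Hypotheses (sf : size f = r) (sg : size g = r).
Local Notation V3 := 'I_(r + r + r).
Let con : rel V3 := connect (symr (cE x y)).
Let outer (a : V3) : bool := (a < r) || (r + r <= a).
Let W (h : seq I) (a : nat) : I := nth ord0 (f ++ h ++ g) a.

Lemma mid_lt (i : 'I_r) : r + i < r + r + r.
Proof. by have := ltn_ord i; lia. Qed.
Let mid (i : 'I_r) : V3 := Ordinal (mid_lt i).

Lemma conC a b : con a b = con b a. Proof. exact: symr_sym. Qed.

Lemma nap_ord m (d : {ffun 'I_m -> 'I_m}) (a : 'I_m) : nap d a = d a.
Proof. by rewrite /nap osub_ord. Qed.

Definition compat (h : seq I) : bool :=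
  [forall a : V3, forall b : V3, cE x y a b ==> (W h a == W h b)].

Lemma compatE h : size h = r -> cst x (vals f h) && cst y (vals h g) = compat h.
Proof.
move=> sh.
have Wx a : a < r + r -> W h a = vals f h a.
  by move=> ha; rewrite /W /vals catA nth_cat size_cat sf sh ha.
have Wy a : r <= a -> W h a = vals h g (a - r).
  by move=> ha; rewrite /W /vals nth_cat sf ltnNge ha.
apply/andP/forallP => [[/cstP cx /cstP cy] a | H].
  apply/forallP => b; apply/implyP => /orP [|] /andP [/andP [ha hb]].
    rewrite !Wx // -[a : nat]/(val (Ordinal ha)) -[b : nat]/(val (Ordinal hb)) !nap_ord.
    by move=> /eqP/val_inj/cx ->.
  have ha' : a - r < r + r by have := ltn_ord a; lia.
  have hb' : b - r < r + r by have := ltn_ord b; lia.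
  rewrite !Wy // -[a - r]/(val (Ordinal ha')) -[b - r]/(val (Ordinal hb')) !nap_ord.
  by move=> /eqP/val_inj/cy ->.
split; apply/cstP => a b e.
  have ha : a < r + r + r by have := ltn_ord a; lia.
  have hb : b < r + r + r by have := ltn_ord b; lia.
  have /forallP/(_ (Ordinal hb))/implyP := H (Ordinal ha).
  rewrite /= !Wx ?ltn_ord // => K; apply/eqP/K.
  by rewrite /cE !nap_ord e eqxx !ltn_ord.
have ha : r + a < r + r + r by have := ltn_ord a; lia.
have hb : r + b < r + r + r by have := ltn_ord b; lia.
have /forallP/(_ (Ordinal hb))/implyP := H (Ordinal ha).
rewrite /= !Wy ?leq_addr // !addKn => K; apply/eqP/K.
by rewrite /cE !addKn !nap_ord e eqxx !leq_addr orbT.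
Qed.

Lemma compat_con h : compat h -> forall a b : V3, con a b -> W h a = W h b.
Proof.
move=> /forallP H; apply: (@cst_connect _ _ _ (fun a : V3 => W h a)) => a b e.
by have /forallP/(_ b)/implyP/(_ e)/eqP := H a.
Qed.

Lemma con_compat h : (forall a b : V3, con a b -> W h a = W h b) -> compat h.
Proof.
move=> H; apply/forallP => a; apply/forallP => b; apply/implyP => e.
by apply/eqP/H/connect1; rewrite /symr e.
Qed.

(** One representative, the least vertex, for each component that avoids both outer rows. *)
Let R : {pred 'I_r} := [pred i : 'I_r | [forall a : V3, con a (mid i) ==>
   [&& r <= a, a < r + r & r + i <= a]]].

Lemma midcE : midc x y = #|R|.
Proof.
rewrite /midc (_ : iota r r = map (addn r) (iota 0 r)); last by rewrite -iotaDl addn0.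
rewrite count_map cardE -[LHS]size_filter.
rewrite -(val_enum_ord r) filter_map size_map /enum_mem; congr size.
rewrite /enum_mem filter_predT; apply: eq_filter => i /=.
rewrite [RHS]inE; apply/allP/forallP => H a.
  have := H a; rewrite mem_iota ltn_ord => /(_ isT).
  by rewrite -[r + i]/(val (mid i)) nconn_ord.
rewrite mem_iota add0n => /= ha; have := H (Ordinal ha).
by rewrite -[r + i]/(val (mid i)) -[a in nconn _ _ a]/(val (Ordinal ha)) nconn_ord.
Qed.

Let W0 := W (nseq r ord0).

Lemma W_outer h a : size h = r -> outer a -> W h a = W0 a.
Proof.
move=> sh; rewrite /outer /W0 /W !nth_cat sf sh size_nseq.
case: ltnP => //= h1 h2; rewrite ifN; first by rewrite ifN //; lia.
by lia.
Qed.

Lemma W_mid h (i : 'I_r) : size h = r -> W h (mid i) = nth ord0 h i.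
Proof.
move=> sh; rewrite /W /= !nth_cat sf sh ltnNge leq_addr /= addKn ltn_ord //.
Qed.

Lemma outerP (a : V3) : outer a -> exists w : 'I_(r + r), a = ew r w :> nat.
Proof.
case/orP => h.
  have hw : a < r + r by lia.
  by exists (Ordinal hw); rewrite /ew /= h.
have hw : a - r < r + r by have := ltn_ord a; lia.
by exists (Ordinal hw); rewrite /ew /= ifN; lia.
Qed.

Lemma outer_mid (a : V3) : ~~ outer a -> exists i : 'I_r, a = mid i.
Proof.
rewrite /outer negb_or -leqNgt -ltnNge => /andP [h1 h2].
have hi : a - r < r by lia.
by exists (Ordinal hi); apply: val_inj => /=; lia.
Qed.

Lemma vals_ew (w : 'I_(r + r)) : vals f g w = W0 (ew r w).
Proof.
rewrite /vals /W0 /W /ew !nth_cat sf size_nseq; case: ltnP => h; rewrite ?h //.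
by rewrite !ifN; [congr nth; lia | lia | lia].
Qed.

Lemma cst_comp : reflect (forall a b : V3, outer a -> outer b -> con a b -> W0 a = W0 b)
  (cst (Defs.comp x y) (vals f g)).
Proof.
have [H1 H2 H3] := @nconn_mkdg r (r + r + r) (cE x y) (ew r) (@ew_lt r).
apply: (iffP (cstP _ _)) => H a b.
  move=> /outerP [w ea] /outerP [w' eb] e; rewrite ea eb -!vals_ew.
  by apply: H; apply/eqP; rewrite mkdg_eq // -ea -eb nconn_ord.
move/eqP; rewrite mkdg_eq // !vals_ew.
rewrite -[ew r a]/(val (Ordinal (ew_lt (ltn_ord a)))) -[ew r b]/(val (Ordinal (ew_lt (ltn_ord b)))).
rewrite nconn_ord => e; apply: H => //; rewrite /outer /= /ew; case: ifP => //; lia.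
Qed.

Lemma R_uniq (i j : 'I_r) (a : V3) : i \in R -> j \in R -> con (mid i) a -> con (mid j) a -> i = j.
Proof.
rewrite !inE => /forallP Hi /forallP Hj ci cj.
have c : con (mid i) (mid j) by apply: connect_trans ci _; rewrite -/con conC.
have /implyP/(_ c)/and3P [_ _ h1] := Hj (mid i).
have /implyP := Hi (mid j); rewrite conC => /(_ c)/and3P [_ _ h2].
by apply: val_inj; move: h1 h2 => /=; lia.
Qed.

Lemma R_outer (i : 'I_r) (a : V3) : i \in R -> outer a -> con a (mid i) = false.
Proof.
rewrite inE => /forallP/(_ a)/implyP H o; apply/negP => /H /and3P [h1 h2 _].
by move: o; rewrite /outer; lia.
Qed.

Lemma R_exists (a : V3) : (forall c, outer c -> ~~ con c a) -> exists2 i, i \in R & con (mid i) a.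
Proof.
move=> H; have ca : con a a by apply: connect0.
case: (@arg_minnP _ a (fun c => con c a) (fun c : V3 => val c) ca) => c cc mc.
have /outer_mid [i ei] : ~~ outer c by apply/negP => /H; rewrite cc.
exists i; last by rewrite -ei.
rewrite inE; apply/forallP => b; apply/implyP => cb.
have cba : con b a by apply: connect_trans cb _; rewrite -ei.
have /outer_mid [j ej] : ~~ outer b by apply/negP => /H; rewrite cba.
have := mc _ cba; rewrite ei ej /=; have := ltn_ord j; lia.
Qed.

(** Inverse to restricting a compatible labelling to [R]: the outer words force the label of every
    component meeting them, [phi] chooses the others. By [R_exists] the default [ord0] is never
    reached. *)
Definition vphi (phi : {ffun 'I_r -> I}) (a : V3) : I :=
  if [pick c | outer c && con c a] is Some c then W0 c
  else if [pick i | (i \in R) && con (mid i) a] is Some i then phi i else ord0.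
Definition hphi phi : {ffun 'I_r -> I} := [ffun i => vphi phi (mid i)].

Lemma vphi_con phi a b : con a b -> vphi phi a = vphi phi b.
Proof.
move=> e; have E c : con c a = con c b.
  apply/idP/idP => h; first exact: connect_trans h e.
  by apply: connect_trans h _; rewrite -/con conC.
rewrite /vphi (@eq_pick _ _ (fun c => outer c && con c b)) => [|c]; last by rewrite E.
case: pickP => // _.
by rewrite (@eq_pick _ _ (fun i => (i \in R) && con (mid i) b)) // => i; rewrite E.
Qed.

Lemma W_hphi phi (a : V3) : cst (Defs.comp x y) (vals f g) -> W (codom (hphi phi)) a = vphi phi a.
Proof.
move=> /cst_comp H; case: (boolP (outer a)) => [o | /outer_mid [i ->]].
  rewrite W_outer ?size_codom ?card_ord // /vphi; case: pickP => [c /andP [oc cc] | /(_ a)].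
    exact/esym/H.
  by rewrite o /con connect0.
by rewrite W_mid ?size_codom ?card_ord // nth_codom_ord ffunE.
Qed.

Lemma hphi_R phi i : i \in R -> hphi phi i = phi i.
Proof.
move=> iR; rewrite ffunE /vphi; case: pickP => [c /andP [oc] | _].
  by rewrite R_outer.
case: pickP => [j /andP [jR cj] | /(_ i)]; last by rewrite iR /con connect0.
by congr (phi _); apply: (R_uniq jR iR cj); apply: connect0.
Qed.

(** Compatible middle words are free choices of a label on each element of [R]; this count is the
    loop factor of the algebra. *)
Lemma card_compat : #|[set h : {ffun 'I_r -> I} | compat (codom h)]| =
  if cst (Defs.comp x y) (vals f g) then n.+1 ^ midc x y else 0.
Proof.
case: ifP => H; last first.
  apply: eq_card0 => h; rewrite inE; apply/negP => /compat_con K.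
  move/negP: H; apply; apply/cst_comp => a b oa ob /K.
  by rewrite !W_outer ?size_codom ?card_ord.
rewrite midcE; have <- : #|pffun_on (ord0 : I) R predT| = n.+1 ^ #|R|.
  by rewrite card_pffun_on card_ord.
have inj : {in pffun_on (ord0 : I) R predT &, injective hphi}; last rewrite -(card_in_imset inj).
  move=> p q; case/pffun_onP => p0 _; case/pffun_onP => q0 _ e; apply/ffunP => i.
  have [iR | iR] := boolP (i \in R); first by rewrite -(hphi_R p iR) -(hphi_R q iR) e.
  have z (u : {ffun 'I_r -> I}) : ord0.-support u \subset R -> u i = ord0.
    move/subsetP/(_ i); rewrite supportE; case: eqP => // _ /(_ isT); by rewrite (negPf iR).
  by rewrite !z.
congr #|pred_of_set _|; apply/setP => h; rewrite inE; apply/idP/imsetP => [ch | [p _ ->]]; last first.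
  by apply: con_compat => a b e; rewrite !W_hphi // (vphi_con _ e).
exists [ffun i => if i \in R then h i else ord0].
  apply/pffun_onP; split=> //; apply/subsetP => i; rewrite supportE ffunE.
  by case: ifP => //; rewrite eqxx.
apply/ffunP => i; rewrite ffunE /vphi.
have hm j : W (codom h) (mid j) = h j.
  by rewrite W_mid ?size_codom ?card_ord // nth_codom_ord.
case: pickP => [c /andP [oc cc] | N].
  by rewrite -(hm i) -(compat_con ch cc) W_outer ?size_codom ?card_ord.
case: pickP => [j /andP [jR cj] | N'].
  by rewrite ffunE jR -!hm (compat_con ch cj).
have [c oc | j jR cj] := @R_exists (mid i); first by have := N c; rewrite oc /= => ->.
by have := N' j; rewrite jR cj.
Qed.

Lemma sum_compat : (\sum_(h <- alls n r) (cst x (vals f h))%:R * (cst y (vals h g))%:R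
  = (n.+1%:R ^+ midc x y) * (cst (Defs.comp x y) (vals f g))%:R :> rat)%R.
Proof.
rewrite sum_alls; under eq_bigr => h _ do
  rewrite -natrM mulnb compatE ?size_codom ?card_ord //.
transitivity ((\sum_(h : {ffun 'I_r -> I}) (if compat (codom h) then 1 else 0)%N)%:R : rat)%R.
  by rewrite natr_sum; apply: eq_bigr => h _; case: compat.
rewrite -big_mkcond sum1dep_card card_compat.
by case: ifP => _; rewrite ?mulr0 // mulr1 natrX.
Qed.
End RhoMul.

Lemma sum_conv (T : finType) (a b c : T -> rat) (e : T -> T -> T) (m : T -> T -> rat) :
  (\sum_z (\sum_x \sum_y a x * b y * (if e x y == z then m x y else 0)) * c z
   = \sum_x \sum_y a x * b y * (m x y * c (e x y)))%R.
Proof.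
under eq_bigr => z _ do rewrite mulr_suml.
rewrite exchange_big /=; apply: eq_bigr => x _.
under eq_bigr => z _ do rewrite mulr_suml.
rewrite exchange_big /=; apply: eq_bigr => y _.
rewrite (bigD1 (e x y)) //= eqxx big1 ?addr0 ?mulrA // => z.
by rewrite eq_sym => /negPf ->; rewrite mulr0 mul0r.
Qed.

Lemma sum_prod (T : finType) (J : eqType) (s : seq J) (a b : T -> rat) (c d : T -> J -> rat) :
  (\sum_(h <- s) (\sum_x a x * c x h) * (\sum_y b y * d y h)
   = \sum_x \sum_y a x * b y * (\sum_(h <- s) c x h * d y h))%R.
Proof.
under eq_bigr => h _ do rewrite mulr_suml.
rewrite exchange_big /=; apply: eq_bigr => x _.
under eq_bigr => h _ do rewrite mulr_sumr.
rewrite exchange_big /=; apply: eq_bigr => y _.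
by rewrite mulr_sumr; apply: eq_bigr => h _; rewrite mulrACA.
Qed.

Lemma rho_amul n r (a b : alg r) f g : size f = r -> size g = r ->
  (rho (amul n.+1%:R a b) f g = \sum_(h <- alls n r) rho a f h * rho b h g)%R.
Proof.
move=> sf sg.
have e1 := sum_conv a b (fun d => (cst d (vals f g))%:R)%R (@Defs.comp r)
  (fun x y => n.+1%:R ^+ midc x y)%R.
have e2 := sum_prod (alls n r) a b (fun x h => (cst x (vals f h))%:R)%R
  (fun y h => (cst y (vals h g))%:R)%R.
rewrite /rho; transitivity (\sum_(x : dg r) \sum_(y : dg r) a x * b y *
   (n.+1%:R ^+ midc x y * (cst (Defs.comp x y) (vals f g))%:R))%R.
  by rewrite -e1; apply: eq_bigr => z _; rewrite ffunE.
rewrite {}e2; apply: eq_bigr => x _; apply: eq_bigr => y _.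
by rewrite sum_compat.
Qed.

Lemma amul_isdg r q (a b : alg r) d : ~~ isdg d -> amul q a b d = 0%R.
Proof.
move=> hd; rewrite ffunE big1 // => x _; rewrite big1 // => y _.
case: eqP => [e | _]; last by rewrite mulr0.
by rewrite -e comp_isdg in hd.
Qed.

(** An element of [alg r] may charge maps that are not in least-representative form. Kernels see
    only the fibres of a map, so faithfulness needs this support condition, which every product
    satisfies. *)
Definition good r (a : alg r) := forall d, ~~ isdg d -> a d = 0%R.

Lemma good_bas r (d : dg r) : isdg d -> good (bas d).
Proof. by move=> hd e he; rewrite ffunE; case: eqP he => // ->; rewrite hd. Qed.

Lemma isdgP r (d : dg r) : isdg d -> forall x, d (d x) = d x /\ d x <= x.
Proof. by move=> /forallP H x; case/andP: (H x) => /eqP. Qed.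

(* A finest diagram of the support is seen alone by an injective labelling of its blocks. *)
Lemma rho_inj n r (a : alg r) : r + r <= n.+1 -> good a ->
  (forall f g, size f = r -> size g = r -> rho (n:=n) a f g = 0%R) -> a = 0%R.
Proof.
move=> hn ga H; apply/ffunP => d0; rewrite ffunE; apply/eqP/negPn/negP => a0.
pose nb (d : dg r) := #|[set x | d x == x]|.
case: (@arg_maxnP _ d0 (fun d => a d != 0%R) nb a0) => d ad md {d0 a0}.
have dd : isdg d by apply/negPn/negP => /ga /eqP; rewrite (negPf ad).
pose h (v : nat) : 'I_n.+1 := inord (nap d v).
have hv (v : 'I_(r + r)) : h v = d v :> nat.
  rewrite /h nap_ord; rewrite inordK //; apply: leq_trans hn; apply: ltn_ord.
pose f := mkseq h r; pose g := mkseq (fun i => h (r + i)) r.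
have vfg (v : 'I_(r + r)) : vals f g v = h v.
  rewrite /vals nth_cat size_mkseq; case: ltnP => hvr; rewrite nth_mkseq //; first by congr h; lia.
  by have := ltn_ord v; lia.
have := H f g; rewrite !size_mkseq => /(_ erefl erefl); rewrite /rho (bigD1 d) //= big1; last first.
  move=> e ed; have [-> | ae] := eqVneq (a e) 0%R; first by rewrite mul0r.
  have de : isdg e by apply/negPn/negP => /ga /eqP; rewrite (negPf ae).
  case: (boolP (cst e _)) => [/cstP C | _]; last by rewrite mulr0.
  case/eqP: ed; have C' u v : e u = e v -> d u = d v.
    by move=> /C; rewrite !vfg => e2; apply: val_inj; rewrite /= -!hv e2.
  have S : [set x | d x == x] \subset [set x | e x == x].
    apply/subsetP => x; rewrite !inE => /eqP dx; have [ee le] := isdgP de x.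
    have := C' _ _ ee; rewrite dx => dex; have [_] := isdgP dd (e x); rewrite dex => l2.
    by apply/eqP/val_inj/eqP; rewrite eqn_leq le.
  have E : [set x | d x == x] = [set x | e x == x].
    by apply/eqP; rewrite eqEcard S; apply: md.
  apply/ffunP => x; have [ee le] := isdgP de x.
  have : e x \in [set x | e x == x] by rewrite inE ee.
  by rewrite -E inE => /eqP <-; apply: C'.
rewrite addr0; have -> : cst d (vals f g); last by rewrite mulr1 => /eqP; rewrite (negPf ad).
by apply/cstP => u v e; apply: val_inj; rewrite !vfg /= !hv e.
Qed.

(** * Action of the generators on functions of words *)

Section Gens.
Variables (n r : nat).
Local Notation I := 'I_n.+1.
Local Notation q := (n.+1%:R : rat)%R.

(** Kernels of long products are computed by letting the factors act in turn on [P], the kernel of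
    all that follows with its bottom word fixed. *)
Definition lact (a : alg r) (P : seq I -> rat) (f : seq I) : rat :=
  (\sum_(h <- alls n r) rho a f h * P h)%R.

Lemma lact_amul a b P f : size f = r -> lact (amul q a b) P f = lact a (lact b P) f.
Proof.
move=> sf; rewrite /lact.
under eq_big_seq => h hh.
  rewrite mem_alls in hh; rewrite rho_amul ?(eqP hh) // mulr_suml.
over.
rewrite exchange_big /=; apply: eq_bigr => g _; rewrite mulr_sumr.
by apply: eq_bigr => h _; rewrite mulrA.
Qed.

Lemma lact_ext a P P' f : (forall h, size h = r -> P h = P' h) -> lact a P f = lact a P' f.
Proof.
by move=> e; apply: eq_big_seq => h; rewrite mem_alls => /eqP /e ->.
Qed.

Lemma rho_amul_act a b f g : size f = r -> size g = r ->
  rho (amul q a b) f g = lact a (fun h => rho b h g) f.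
Proof. by move=> sf sg; rewrite rho_amul. Qed.

Lemma sum_delta k F (P : seq I -> rat) : size F = k -> (\sum_(h <- alls n k) (F == h)%:R * P h = P F)%R.
Proof.
move=> sF; rewrite (bigD1_seq F) ?uniq_alls ?mem_alls ?sF //= eqxx mul1r big1 ?addr0 // => h.
by rewrite eq_sym => /negPf ->; rewrite mul0r.
Qed.

Lemma rho_dgrel (P : nat -> nat -> bool) f g (b : bool) :
  reflect (forall a b : 'I_(r + r), P a b -> vals f g a = vals f g b) b ->
  rho (n := n) (bas (dgrel r P)) f g = (b%:R)%R.
Proof.
move=> H; rewrite rho_bas (_ : cst _ _ = b) //.
by apply/idP/idP => [/cst_dgrel /H // | /H h]; apply/cst_dgrel.
Qed.

Lemma valsl (f g : seq I) a : size f = r -> a < r -> vals f g a = nth ord0 f a.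
Proof. by move=> sf ha; rewrite /vals nth_cat sf ha. Qed.
Lemma valsr (f g : seq I) a : size f = r -> vals f g (r + a) = nth ord0 g a.
Proof. by move=> sf; rewrite /vals nth_cat sf ltnNge leq_addr /= addKn. Qed.

(** Partial permutations: a top vertex outside [p] is isolated, so its letter is free. *)
Lemma rho_part (P : nat -> nat -> bool) (p : pred nat) (pi : nat -> nat) (f g : seq I) :
  size f = r -> (forall a, a < r -> pi a < r) ->
  (forall a b, P a b = [&& a < r, p a & b == r + pi a]) ->
  rho (bas (dgrel r P)) f g =
  (all (fun a => p a ==> (nth ord0 f a == nth ord0 g (pi a))) (iota 0 r))%:R%R.
Proof.
move=> sf hpi hP; apply: rho_dgrel; apply: (iffP allP) => H a; last first.
  rewrite mem_iota add0n => /= ha; apply/implyP => pa.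
  have h1 : a < r + r by lia.
  have h2 : r + pi a < r + r by rewrite ltn_add2l hpi.
  by have := H (Ordinal h1) (Ordinal h2); rewrite /= hP ha pa eqxx valsl // valsr // => ->.
move=> b; rewrite hP => /and3P [ha pa /eqP ->]; rewrite valsl // valsr //.
by have := H a; rewrite mem_iota ha pa => /(_ isT)/eqP.
Qed.

Lemma nth_all_eq (f g : seq I) : size f = r -> size g = r ->
  all (fun a => nth ord0 f a == nth ord0 g a) (iota 0 r) = (f == g).
Proof.
move=> sf sg; apply/allP/eqP => [H | -> //].
apply: (@eq_from_nth _ ord0); rewrite ?sf // => i hi; apply/eqP/H.
by rewrite mem_iota.
Qed.

Lemma rho_one (f g : seq I) : size f = r -> size g = r -> rho (aone r) f g = ((f == g)%:R)%R.
Proof.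
move=> sf sg; rewrite (@rho_part _ predT id) //; first by rewrite /= nth_all_eq.
by move=> a b; rewrite /= addnC.
Qed.

Lemma lact_one P f : size f = r -> lact (aone r) P f = P f.
Proof.
move=> sf; rewrite /lact -[RHS](@sum_delta r f) //; apply: eq_big_seq => h.
by rewrite mem_alls => /eqP sh; rewrite rho_one.
Qed.

Definition tau (k a : nat) := if a == k.-1 then k else if a == k then k.-1 else a.

Lemma rho_sg k (f g : seq I) : 0 < k < r -> size f = r -> size g = r ->
  rho (sg r k) f g = (all (fun a => nth ord0 f a == nth ord0 g (tau k a)) (iota 0 r))%:R%R.
Proof.
move=> hk sf sg; rewrite (@rho_part _ predT (tau k)) // => a ha.
by rewrite /tau; case: eqP => h1; [|case: eqP => h2]; lia.
Qed.

Lemma rho_sg_cat k (A B g : seq I) x y : size A = k.-1 -> 0 < k -> size (A ++ x :: y :: B) = r ->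
  size g = r -> rho (sg r k) (A ++ x :: y :: B) g = (A ++ y :: x :: B == g)%:R%R.
Proof.
move=> sA k0 sf sg; have s2 : size (A ++ y :: x :: B) = r by rewrite -sf !size_cat.
rewrite rho_sg //; last by move: sf; rewrite size_cat /=; lia.
congr ((_ : bool)%:R)%R; rewrite -nth_all_eq //.
have E a : nth ord0 (A ++ x :: y :: B) a = nth ord0 (A ++ y :: x :: B) (tau k a).
  have k1 : k - k.-1 = 1 by lia.
  have k2 : (k < k.-1) = false by lia.
  rewrite !nth_cat /tau sA; case: (a =P k.-1) => [-> | h].
    by rewrite ltnn subnn k1 k2.
  case: (a =P k) => [-> | h2]; first by rewrite ltnn subnn k1 k2.
  case: (ltnP a k.-1) => // h3.
  by have -> : a - k.-1 = (a - k.-1 - 2).+2 by lia.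
apply/allP/allP => H a; rewrite mem_iota add0n => /= ha.
  have := H (tau k a); rewrite E mem_iota.
  rewrite (_ : tau k (tau k a) = a); last by rewrite /tau; case: (a =P k.-1) => h1; [|case: (a =P k) => h2]; case: eqP => h3; try case: eqP => h4; lia.
  by apply; move: sf; rewrite /tau size_cat /=; case: eqP => h1; [|case: eqP => h2]; lia.
have := H (tau k a); rewrite -E mem_iota.
by apply; move: sf; rewrite /tau size_cat /=; case: eqP => h1; [|case: eqP => h2]; lia.
Qed.

Lemma lact_sg k (A B : seq I) x y P : size A = k.-1 -> 0 < k -> size (A ++ x :: y :: B) = r ->
  lact (sg r k) P (A ++ x :: y :: B) = P (A ++ y :: x :: B).
Proof.
move=> sA k0 sf; rewrite /lact -[RHS](@sum_delta r); last by rewrite -sf !size_cat.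
by apply: eq_big_seq => h; rewrite mem_alls => /eqP sh; rewrite rho_sg_cat.
Qed.

Lemma rho_pg k (A B g : seq I) x : size A = k.-1 -> 0 < k -> size (A ++ x :: B) = r ->
  size g = r -> rho (pg r k) (A ++ x :: B) g = (A ++ nth ord0 g k.-1 :: B == g)%:R%R.
Proof.
move=> sA k0 sf sg; have s2 : size (A ++ nth ord0 g k.-1 :: B) = r by rewrite -sf !size_cat.
rewrite (@rho_part _ (fun a => a != k.-1) id) //; last by move=> a b; rewrite andbA addnC.
congr ((_ : bool)%:R)%R; rewrite -nth_all_eq //.
apply: eq_in_all => a _; rewrite !nth_cat sA; case: ltngtP => h /=; first by rewrite ?implyTb.
  by rewrite (_ : a - k.-1 = (a - k).+1) //; lia.
by rewrite h subnn eqxx.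
Qed.

Lemma lact_pg k (A B : seq I) x P : size A = k.-1 -> 0 < k -> size (A ++ x :: B) = r ->
  lact (pg r k) P (A ++ x :: B) = (\sum_(v : I) P (A ++ v :: B))%R.
Proof.
move=> sA k0 sf; rewrite /lact.
transitivity (\sum_(h <- alls n r) \sum_(v : I) (A ++ v :: B == h)%:R * P h)%R.
  apply: eq_big_seq => h; rewrite mem_alls => /eqP sh; rewrite rho_pg //.
  rewrite (bigD1 (nth ord0 h k.-1)) //= big1 ?addr0 // => v /eqP hv.
  case: eqP => [e | _]; last by rewrite mul0r.
  by case: hv; rewrite -e nth_cat sA ltnn subnn.
rewrite exchange_big; apply: eq_bigr => v _; rewrite sum_delta // -sf !size_cat //.
Qed.

Lemma rho_phg k (A B g : seq I) x y : size A = k.-1 -> 0 < k -> size (A ++ x :: y :: B) = r ->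
  size g = r -> rho (phg r k) (A ++ x :: y :: B) g = ((x == y) && (A ++ x :: y :: B == g))%:R%R.
Proof.
move=> sA k0 sf sg; apply: rho_dgrel.
have hk : k < r by move: sf; rewrite size_cat /=; lia.
have nx : nth ord0 (A ++ x :: y :: B) k.-1 = x by rewrite nth_cat sA ltnn subnn.
have ny : nth ord0 (A ++ x :: y :: B) k = y.
  have k1 : k - k.-1 = 1 by lia.
  have k2 : (k < k.-1) = false by lia.
  by rewrite nth_cat sA k1 k2.
apply: (iffP andP) => [[/eqP exy /eqP eg] a b | H].
  case/orP => [/orP [] |] /andP [].
  - by move=> ha /eqP ->; rewrite addnC valsl // valsr // -eg.
  - move=> /eqP -> /eqP ->; rewrite !valsl ?nx ?ny //; lia.
  - by move=> /eqP -> /eqP ->; rewrite !valsr // -eg nx ny.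
split; last first.
  rewrite -nth_all_eq //; apply/allP => a; rewrite mem_iota add0n => /= ha.
  have h1 : a < r + r by lia.
  have h2 : r + a < r + r by lia.
  have := H (Ordinal h1) (Ordinal h2); rewrite /= ha [a + r]addnC eqxx.
  by rewrite valsl // valsr // => ->.
have h1 : k.-1 < r + r by lia.
have h2 : k < r + r by lia.
have := H (Ordinal h1) (Ordinal h2); rewrite /= !eqxx orbT /= !valsl //; try lia.
by rewrite nx ny => ->.
Qed.

Lemma lact_phg k (A B : seq I) x y P : size A = k.-1 -> 0 < k -> size (A ++ x :: y :: B) = r ->
  lact (phg r k) P (A ++ x :: y :: B) = ((x == y)%:R * P (A ++ x :: y :: B))%R.
Proof.
move=> sA k0 sf; rewrite /lact -[P (A ++ _)](@sum_delta r) // mulr_sumr.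
apply: eq_big_seq => h; rewrite mem_alls => /eqP sh; rewrite rho_phg //.
by rewrite -mulnb natrM mulrA.
Qed.

Lemma lact_aprod (a : alg r) l P f : size f = r ->
  lact (aprod q (a :: l)) P f = lact a (lact (aprod q l) P) f.
Proof. exact: lact_amul. Qed.

Lemma lact_aprod_cat l1 l2 P f : size f = r ->
  lact (aprod q (l1 ++ l2)) P f = lact (aprod q l1) (lact (aprod q l2) P) f.
Proof.
elim: l1 f => [|a l1 IH] f sf; first by rewrite lact_one.
by rewrite cat_cons !lact_aprod //; apply: lact_ext => h sh; rewrite IH.
Qed.

Lemma lact_sLK (A B D : seq I) x P : size (A ++ x :: B ++ D) = r ->
  lact (sLK r q (size A).+1 (size A + size B).+1) P (A ++ x :: B ++ D) = P (A ++ B ++ x :: D).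
Proof.
move=> sf; rewrite /sLK /= ltnS leq_addr subSS addKn.
elim: B A sf => [|y B IH] A sf; first by rewrite /= lact_one.
rewrite [size (y :: B)]/= [iota _ _]/= [map _ _]/= lact_aprod // lact_sg //.
have := IH (rcons A y); rewrite size_rcons -!cats1 -!catA /= => -> //.
by rewrite -sf !size_cat /= !size_cat /=; lia.
Qed.

Lemma lact_sKL (A B D : seq I) x P : size (A ++ x :: B ++ D) = r ->
  lact (sLK r q (size A + size B).+1 (size A).+1) P (A ++ B ++ x :: D) = P (A ++ x :: B ++ D).
Proof.
move=> sf; rewrite /sLK /= ltnS.
case: ifP => h.
  have : size B = 0 by lia.
  by move=> /size0nil e; subst B; rewrite /= addn0 subnn lact_one //; rewrite -sf !size_cat.
rewrite subSS addKn; move: sf; clear h.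
elim/last_ind: B D => [|B y IH] D sf.
  by rewrite /= lact_one.
have -> : iota (size A).+1 (size (rcons B y)) = iota (size A).+1 (size B) ++ [:: (size A).+1 + size B].
  by rewrite size_rcons -(addn1 (size B)) iotaD.
rewrite rev_cat map_cat /= lact_aprod; last first.
  by rewrite -sf !size_cat /= !size_cat !size_rcons /=; lia.
rewrite -cats1 -!catA /= (catA A B) lact_sg //; first last.
- by rewrite -sf !size_cat /= !size_cat !size_rcons /=; lia.
- by rewrite size_cat; lia.
rewrite -catA IH ?cats1 ?cat_rcons //.
by rewrite -sf !size_cat /= !size_cat !size_rcons /=; lia.
Qed.

Lemma lact_eh (A B D : seq I) x P : size (A ++ x :: B ++ D) = r ->
  lact (eh r q (size B) (size A + size B)) P (A ++ x :: B ++ D) =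
  ((all (pred1 x) B)%:R * P (A ++ x :: B ++ D))%R.
Proof.
move=> sf; rewrite /eh.
case: ifP => [h | _].
  have : size B = 0 by case/orP: h => /eqP; lia.
  by move=> /size0nil e; subst B; rewrite lact_one // mulr1n mul1r.
rewrite addnK; elim: B A x sf => [|y B IH] A x sf; first by rewrite lact_one //= mul1r.
rewrite [size (y :: B)]/= [iota _ _]/= [map _ _]/= lact_aprod // lact_phg //.
have := IH (rcons A x) y; rewrite size_rcons -!cats1 -!catA /= => ->; last first.
  by rewrite -sf !size_cat /= !size_cat /=; lia.
by rewrite mulrA -natrM mulnb eq_sym; case: eqP => [->|] //=.
Qed.

Lemma lact_ei (A B D : seq I) P : size (A ++ B ++ D) = r ->
  lact (ei r q (size B) (size A + size B)) P (A ++ B ++ D) =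
  (\sum_(B' <- alls n (size B)) P (A ++ B' ++ D))%R.
Proof.
move=> sf; rewrite /ei.
case: ifP => [h | _].
  have : size B = 0 by case/orP: h => /eqP; lia.
  by move=> /size0nil e; subst B; rewrite lact_one //= big_seq1.
rewrite addnK; elim: B A sf => [|y B IH] A sf; first by rewrite lact_one //= big_seq1.
rewrite [size (y :: B)]/= [iota _ _]/= [map _ _]/= lact_aprod // lact_pg //.
rewrite big_allpairs_dep /= -big_enum /=; apply: eq_bigr => v _.
have := IH (rcons A v); rewrite size_rcons -!cats1 -!catA /= => ->.
  by apply: eq_bigr => B' _; rewrite -catA.
by rewrite -sf !size_cat /= !size_cat /=; lia.
Qed.
End Gens.

(** * Rows as blocks of positions; adding and removing boxes *)

Fixpoint rwf (j : nat) (l : seq nat) : seq nat :=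
  if l is x :: l' then nseq x j ++ rwf j.+1 l' else [::].
(** The colour of each position: a row occupies consecutive positions, and colours start at 1
    because 0 stands for no box. *)
Definition rw := rwf 1.

Lemma size_rwf j l : size (rwf j l) = sumn l.
Proof. by elim: l j => //= x l IH j; rewrite size_cat size_nseq IH. Qed.
Lemma size_rw l : size (rw l) = sumn l. Proof. exact: size_rwf. Qed.

Lemma rwf_ge j l c : c \in rwf j l -> j <= c.
Proof.
elim: l j => //= x l IH j; rewrite mem_cat mem_nseq => /orP [/andP [_ /eqP ->] //|/IH].
exact: ltnW.
Qed.

Lemma rwf_incr j l i : exists R1 R2, [/\ rwf j l = R1 ++ nseq (nth 0 l i) (j + i) ++ R2,
  rwf j (incr_nth l i) = R1 ++ nseq (nth 0 l i).+1 (j + i) ++ R2,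
  size R1 = psum l i & (j + i \notin R1) && (j + i \notin R2)].
Proof.
elim: i j l => [|i IH] j [|x l].
- by exists [::], [::]; rewrite /= addn0.
- exists [::], (rwf j.+1 l); rewrite /= addn0; split=> //.
  by apply/negP => /rwf_ge; rewrite ltnn.
- have [R1 [R2 [e1 e2 e3 e4]]] := IH j.+1 [::].
  have e0 : ncons i 0 [:: 1] = incr_nth [::] i by case: (i).
  by exists R1, R2; rewrite addnS -addSn /= e0 e2; split=> //; move: e1; rewrite nth_nil.
- have [R1 [R2 [e1 e2 e3 /andP [e4 e5]]]] := IH j.+1 l.
  exists (nseq x j ++ R1), R2; rewrite /= e1 e2 -addSnnS -!catA; split=> //.
    by rewrite size_cat size_nseq e3.
  by rewrite mem_cat mem_nseq negb_or e4 e5 !andbT negb_and; apply/orP; right; lia.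
Qed.

Lemma psum_incr l i : psum (incr_nth l i) i.+1 = psum l i + (nth 0 l i).+1.
Proof.
elim: i l => [|i IH] [|x l] //=; rewrite /psum //=; first by rewrite take0 /= addnC.
  have e0 : ncons i 0 [:: 1] = incr_nth [::] i by case: (i).
  by have := IH [::]; rewrite /psum e0 nth_nil => ->.
by have := IH l; rewrite /psum /= => ->; rewrite addnA.
Qed.

Lemma psumS l i : psum l i.+1 = psum l i + nth 0 l i.
Proof.
elim: l i => [|x l IH] [|i] //=; rewrite /psum /= ?take0 ?addn0 ?add0n //.
by have := IH i; rewrite /psum => ->; rewrite addnA.
Qed.

Lemma nth_incr l i : nth 0 (incr_nth l i) i = (nth 0 l i).+1.
Proof. by rewrite nth_incr_nth eqxx. Qed.

Lemma sumn_incr l i : sumn (incr_nth l i) = (sumn l).+1.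
Proof.
have [R1 [R2 [e1 e2 _ _]]] := rwf_incr 1 l i.
by rewrite -(size_rwf 1) -[in RHS](size_rwf 1) e1 e2 !size_cat !size_nseq !addnS.
Qed.

Lemma strip0_rcons0 l : strip0 (rcons l 0) = strip0 l.
Proof.
rewrite /strip0 rev_rcons /= size_rcons subSS -cats1 take_cat.
case: ltnP => // h; rewrite (_ : size l - find _ _ - size l = 0) ?take0 ?cats0.
  by rewrite take_oversize //.
by lia.
Qed.

Lemma strip0_rcons l x : x != 0 -> strip0 (rcons l x) = rcons l x.
Proof. by move=> h; rewrite /strip0 rev_rcons /= h subn0 take_size. Qed.

Lemma strip0_pos l : all (fun x => 0 < x) l -> strip0 l = l.
Proof.
case/lastP: l => // l x; rewrite all_rcons lt0n => /andP [h _]; exact: strip0_rcons.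
Qed.

(** The delicate case is a row shortened to zero. It must be the last row, whose trailing zero
    [strip0] deletes; in an earlier row the zero would survive and contradict positivity. *)
Lemma rmbox_ad al a be : is_part al -> rmbox al a = Some be -> is_part be /\ adbox be a = Some al.
Proof.
case: a => [|i]; first by move=> h [<-].
move=> pal; rewrite /rmbox; case: ifP => // /andP [hi hm] [e]; rewrite e in hm; split=> //.
rewrite /adbox (_ : incr_nth be i = al) ?pal //.
have /andP [_ pos] := pal.
set l := set_nth 0 al i _ in e.
have dl : l = set_nth 0 al i (nth 0 al i).-1 by [].
have sl : size l = size al by rewrite size_set_nth; apply/maxn_idPr.
have inc m : m = l -> incr_nth m i = al.
  move=> ->; apply: (@eq_from_nth _ 0); first by rewrite size_incr_nth sl hi.
  move=> k; rewrite size_incr_nth sl hi => hk; rewrite nth_incr_nth nth_set_nth /=.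
  rewrite eq_sym; case: eqP => [-> | _] //.
  by rewrite add1n prednK //; apply: (allP pos); apply: mem_nth.
have [h | h] := posnP (nth 0 l i); last first.
  apply: inc; rewrite -e strip0_pos //; apply/(all_nthP 0) => k; rewrite sl => hk.
  have [-> // | ki] := eqVneq k i; rewrite nth_set_nth /= (negPf ki).
  by apply: (allP pos); apply: mem_nth.
have v1 : nth 0 al i = 1.
  have : 0 < nth 0 al i by apply: (allP pos); apply: mem_nth.
  by move: h; rewrite nth_set_nth /= eqxx; lia.
have [il | il] := eqVneq i (size al).-1; last first.
  have /andP [_ posm] := hm.
  have lst : strip0 l = l.
    case/lastP: al pal hi pos l dl e sl inc h v1 il => // al x pal hi pos l dl e sl inc h v1 il.
    rewrite size_rcons /= in il.
    have hil : i < size al by move: hi; rewrite size_rcons; lia.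
    have -> : l = rcons (set_nth 0 al i (nth 0 (rcons al x) i).-1) x.
      apply: (@eq_from_nth _ 0); rewrite ?sl ?size_rcons ?size_set_nth ?(maxn_idPr hil) //.
      move=> k hk; rewrite dl [LHS]nth_set_nth [RHS]nth_rcons size_set_nth (maxn_idPr hil) nth_set_nth /=.
      by case: (k =P i) => [-> | _]; rewrite !nth_rcons ?hil.
    by apply: strip0_rcons; move: pos; rewrite all_rcons lt0n => /andP [].
  move: posm; rewrite -e lst => /(all_nthP 0) /(_ i).
  by rewrite sl h => /(_ hi).
case/lastP: al pal hi pos l dl e sl inc h v1 il => // al x pal hi pos l dl e sl inc h v1 il.
rewrite size_rcons /= in il; subst i.
have x1 : x = 1 by move: v1; rewrite nth_rcons ltnn eqxx.
have el : l = rcons al 0.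
  apply: (@eq_from_nth _ 0); rewrite ?sl ?size_rcons // => k hk.
  rewrite dl nth_set_nth /= v1 !nth_rcons; case: (k =P size al) => [-> | hk2]; first by rewrite ltnn ?eqxx.
  by rewrite (_ : k < size al) //; lia.
have -> : be = al.
  rewrite -e el strip0_rcons0 strip0_pos //; by move: pos; rewrite all_rcons => /andP [].
rewrite x1; apply: (@eq_from_nth _ 0); first by rewrite size_incr_nth ltnn size_rcons.
move=> k; rewrite size_incr_nth ltnn => hk; rewrite nth_incr_nth nth_rcons eq_sym.
case: (k =P size al) => [-> | hk2]; first by rewrite ltnn nth_default.
by rewrite (_ : k < size al) //; lia.
Qed.

Lemma adbox_part be b ga : is_part be -> adbox be b = Some ga -> is_part ga.
Proof. by case: b => [|i] h /=; [case=> <- | case: ifP => // h2 [<-]]. Qed.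

Lemma adbox_rw be b ga : adbox be b.+1 = Some ga -> exists R1 c R2,
  [/\ rw be = R1 ++ nseq c b.+1 ++ R2, rw ga = R1 ++ nseq c.+1 b.+1 ++ R2,
      psum ga b.+1 = (size R1 + c).+1, nth 0 ga b = c.+1 & (b.+1 \notin R1) && (b.+1 \notin R2)].
Proof.
rewrite /adbox; case: ifP => // _ [<-].
have [R1 [R2 [e1 e2 e3 e4]]] := rwf_incr 1 be b.
exists R1, (nth 0 be b), R2; split=> //; last by rewrite nth_incr.
by rewrite psum_incr -e3 addnS.
Qed.

(** * Fock space *)

Section Fock.
Variable n : nat.
Local Notation I := 'I_n.+1.
(* [phi] stands for the formal series [\sum_m phi m * y^m / m!] in the variables [y_(b,v)], [b >= 1]:
   [dd a v] is the partial derivative in [y_(a,v)], [yy b v] the multiplication by [y_(b,v)], and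
   both are the identity for colour [0]. *)
Definition Occ := (nat * I)%type -> nat.
Definition Fck := Occ -> rat.

Definition occ (l : seq (nat * I)) : Occ := fun z => count_mem z l.
Definition oadd (x : nat * I) (m : Occ) : Occ := fun z => m z + (z == x).
Definition orem (x : nat * I) (m : Occ) : Occ := fun z => m z - (z == x).
Definition dd (a : nat) (v : I) (phi : Fck) : Fck :=
  fun m => if a == 0 then phi m else phi (oadd (a, v) m).
Definition yy (b : nat) (v : I) (phi : Fck) : Fck :=
  fun m => if b == 0 then phi m else ((m (b, v))%:R * phi (orem (b, v) m))%R.
(** The constant series 1. The test is classical because an occupation function has an infinite
    domain. *)
Definition vac : Fck := fun m => (asbool (forall z, m z = 0))%:R%R.
Definition Dop (a b : nat) (v : I) (phi : Fck) : Fck := yy b v (dd a v phi).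

Fixpoint Uf (phi : Fck) (w : seq (nat * nat)) (g : seq I) : Fck :=
  match w, g with
  | (a, b) :: w', v :: g' => Uf (Dop a b v phi) w' g'
  | _, _ => phi
  end.

Lemma occ_perm l l' : perm_eq l l' -> occ l = occ l'.
Proof. by move=> /seq.permP h; apply: funext => z; apply: h. Qed.

Lemma occ_cons x l : occ (x :: l) = oadd x (occ l).
Proof. by apply: funext => z; rewrite /occ /oadd /= addnC eq_sym. Qed.

Lemma orem_oadd x m : orem x (oadd x m) = m.
Proof. by apply: funext => z; rewrite /orem /oadd addnK. Qed.

Definition rmat (T : Type) (i : nat) (A : seq T) := take i A ++ drop i.+1 A.

Lemma zip_insert (R1 R2 : seq nat) (c : nat) (A1 A2 : seq I) x : size R1 = size A1 ->
  perm_eq (zip (R1 ++ c :: R2) (A1 ++ x :: A2)) ((c, x) :: zip (R1 ++ R2) (A1 ++ A2)).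
Proof. by move=> h; rewrite !zip_cat // perm_sym -cat1s perm_catCA. Qed.

Lemma nseq_split (c j : nat) (b : nat) (R1 R2 : seq nat) : j < c.+1 ->
  R1 ++ nseq c.+1 b ++ R2 = (R1 ++ nseq j b) ++ b :: (nseq (c - j) b ++ R2) /\
  R1 ++ nseq c b ++ R2 = (R1 ++ nseq j b) ++ (nseq (c - j) b ++ R2).
Proof.
move=> h; have e k : j <= k -> nseq k b = nseq j b ++ nseq (k - j) b.
  by move=> hk; rewrite -nseqD subnKC.
rewrite (e c.+1) ?(e c); try lia.
by rewrite subSn // -!catA.
Qed.

Lemma cut_at (A : seq I) i : i < size A -> A = take i A ++ nth ord0 A i :: drop i.+1 A.
Proof. by move=> h; rewrite -drop_nth // cat_take_drop. Qed.

Lemma occ_rmat R1 c b R2 (A : seq I) j : j < c.+1 -> size A = size R1 + c.+1 + size R2 ->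
  occ (zip (R1 ++ nseq c.+1 b ++ R2) A) =
  oadd (b, nth ord0 A (size R1 + j)) (occ (zip (R1 ++ nseq c b ++ R2) (rmat (size R1 + j) A))).
Proof.
move=> hj sA; have hi : size R1 + j < size A by lia.
have [-> ->] := nseq_split b R1 R2 hj.
rewrite {1}(cut_at hi) -occ_cons; apply/occ_perm/zip_insert.
by rewrite size_cat size_nseq size_takel // ltnW.
Qed.

Lemma count_zip_nseq (c b : nat) (A : seq I) v : size A = c ->
  count_mem (b, v) (zip (nseq c b) A) = count_mem v A.
Proof.
elim: c A => [|c IH] [|x A] //= [h]; rewrite IH //; congr (_ + _).
by rewrite xpair_eqE eqxx.
Qed.

Lemma count_zip_notin (R : seq nat) (b : nat) (A : seq I) v : b \notin R ->
  count_mem (b, v) (zip R A) = 0.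
Proof.
elim: R A => [|y R IH] [|x A] //=; rewrite inE negb_or => /andP [h1 h2]; rewrite IH //.
by rewrite xpair_eqE eq_sym (negPf h1).
Qed.

(** The multiplicity in [yy] counts the positions of the row that carry [v]; the sum over positions
    is the one occurring in [Mg]. *)
Lemma yy_zip R1 c b R2 (A : seq I) v (phi : Fck) :
  (b.+1 \notin R1) && (b.+1 \notin R2) -> size A = size R1 + c.+1 + size R2 ->
  yy b.+1 v phi (occ (zip (R1 ++ nseq c.+1 b.+1 ++ R2) A)) =
  (\sum_(0 <= j < c.+1) (nth ord0 A (size R1 + j) == v)%:R *
     phi (occ (zip (R1 ++ nseq c b.+1 ++ R2) (rmat (size R1 + j) A))))%R.
Proof.
move=> /andP [n1 n2] sA; rewrite /yy /=.
transitivity (\sum_(0 <= j < c.+1) (nth ord0 A (size R1 + j) == v)%:R *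
   phi (orem (b.+1, v) (occ (zip (R1 ++ nseq c.+1 b.+1 ++ R2) A))))%R; last first.
  apply: eq_big_nat => j /andP [_ hj]; case: eqP => [<- | _]; last by rewrite !mul0r.
  by rewrite (occ_rmat b.+1 hj) // orem_oadd.
rewrite -mulr_suml -natr_sum; congr (_%:R * _)%R.
pose A1 := take (size R1) A; pose A2 := take c.+1 (drop (size R1) A).
pose A3 := drop c.+1 (drop (size R1) A).
have s1 : size A1 = size R1 by rewrite size_takel //; lia.
have s2 : size A2 = c.+1 by rewrite size_takel // size_drop; lia.
have eA : A = A1 ++ A2 ++ A3 by rewrite !cat_take_drop.
have e : (\sum_(0 <= j < c.+1) (nth ord0 A (size R1 + j) == v) = count_mem v A2)%N.
  rewrite -sum1_count [RHS]big_mkcond [RHS](big_nth ord0) s2; apply: eq_big_nat => j /andP [_ hj].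
  by rewrite /A2 nth_take // nth_drop /=; case: eqP.
rewrite {}e /occ; clearbody A1 A2 A3; rewrite eA.
rewrite -[b.+1 :: nseq c b.+1 ++ R2]/(nseq c.+1 b.+1 ++ R2) zip_cat ?s1 // zip_cat ?size_nseq ?s2 // !count_cat.
by rewrite (count_zip_notin _ _ n1) (count_zip_notin _ _ n2) addn0 add0n count_zip_nseq.
Qed.
End Fock.

(** * Integral steps as polarization operators *)

Section Steps.
Variables (n r : nat).
Local Notation I := 'I_n.+1.
Local Notation q := (n.+1%:R : rat)%R.

Lemma lact_sum (J : Type) (s : seq J) (a : J -> alg r) P (f : seq I) :
  (lact (\sum_(i <- s) a i) P f = \sum_(i <- s) lact (a i) P f)%R.
Proof.
rewrite /lact exchange_big /=; apply: eq_bigr => h _.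
by rewrite rho_sum mulr_suml.
Qed.

(** The function sees only row contents, so inserting the letter [x] into row [a] evaluates a
    derivative in [y_(a,x)]. The parameter [G] lets it depend also on the letters from position [j]
    on. *)
Lemma lact_remove al a be (G : seq I -> Fck n) j A x B :
  adbox be a = Some al -> sumn al <= j -> size A = sumn be -> size (A ++ x :: B) = r ->
  lact (sLK r q (sumn al) (psum al a))
      (fun f => G (drop j f) (occ (zip (rw al) (take (sumn al) f)))) (A ++ x :: B) =
  dd a x (G (drop j (A ++ x :: B))) (occ (zip (rw be) A)).
Proof.
case: a => [|a] ha hj sA sf.
  case: ha hj => <- hj; rewrite /psum take0 /= /sLK orbT lact_one //.
  by rewrite /dd /= take_size_cat.
have [R1 [c [R2 [e1 e2 e3 _ _]]]] := adbox_rw ha.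
have sal : sumn al = (size R1 + c + size R2).+1.
  by rewrite -size_rw e2 !size_cat size_nseq; lia.
have sbe : size A = size R1 + c + size R2 by rewrite sA -size_rw e1 !size_cat size_nseq addnA.
pose A1 := take (size R1 + c) A; pose A2 := drop (size R1 + c) A.
have s1 : size A1 = size R1 + c by rewrite size_takel // sbe leq_addr.
have s2 : size A2 = size R2 by rewrite size_drop sbe addKn.
have eA : A = A1 ++ A2 by rewrite cat_take_drop.
clearbody A1 A2; rewrite {}eA -!catA e3 sal.
have -> : (size R1 + c + size R2).+1 = (size A1 + size A2).+1 by lia.
have -> : (size R1 + c).+1 = (size A1).+1 by lia.
have sf' : size (A1 ++ x :: A2 ++ B) = r by rewrite -sf !size_cat /= !size_cat; lia.
rewrite lact_sKL // /dd /=; congr (G _ _).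
  rewrite -cat_cons catA -[x :: B]cat1s 2!catA !drop_cat !size_cat /=.
  by rewrite !ifN; [congr (drop _ _); lia | lia | lia].
rewrite -cat_cons catA take_size_cat; last by rewrite size_cat /=; lia.
rewrite e1 e2; have [-> ->] := @nseq_split c c a.+1 R1 R2 (ltnSn c).
rewrite subnn /= -occ_cons; apply/occ_perm/zip_insert.
by rewrite size_cat size_nseq s1.
Qed.

(** The block [B] is the padding between the boxes of [be] and the current position; the chain of
    joins forces it to repeat the label [x]. *)
Lemma lact_half al a be (G : seq I -> Fck n) j k A x B D :
  adbox be a = Some al -> sumn al <= j -> size A = sumn be -> sumn be + size B = k ->
  size (A ++ x :: B ++ D) = r ->
  lact (amul q (eh r q (k - sumn be) k) (sLK r q (sumn al) (psum al a)))
      (fun f => G (drop j f) (occ (zip (rw al) (take (sumn al) f)))) (A ++ x :: B ++ D) =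
  ((all (pred1 x) B)%:R *
  dd a x (G (drop j (A ++ x :: B ++ D))) (occ (zip (rw be) A)))%R.
Proof.
move=> ha hj sA sB sf; rewrite lact_amul // -sB addKn -sA lact_eh //; congr (_ * _)%R.
by rewrite (@lact_remove al a be).
Qed.

Lemma lact_Mg be b ga (Q : seq I -> rat) (A E : seq I) : adbox be b.+1 = Some ga -> size A = sumn ga -> size (A ++ E) = r ->
  lact (Mg r q ga b.+1) (lact (sLK r q (psum ga b.+1) (sumn ga)) Q) (A ++ E) =
  (\sum_(0 <= j < nth 0 ga b) Q (rmat (psum ga b + j) A ++ nth ord0 A (psum ga b + j) :: E))%R.
Proof.
move=> hb sA sf; rewrite /Mg /= lact_sum.
have [R1 [c [R2 [e1 e2 e3 e4 _]]]] := adbox_rw hb.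
rewrite e4 [RHS]big_nat_rev /=; apply: eq_big_nat => j /andP [_ hj].
have e5 : psum ga b = size R1 by move: (psumS ga b); rewrite e3 e4; lia.
have sga : size A = size R1 + c.+1 + size R2.
  by rewrite sA -size_rw e2 !size_cat size_nseq; lia.
rewrite add0n subSS e5 e3; set p := size R1 + (c - j).
have hp : p < size A by rewrite /p; lia.
pose A1 := take p A; pose A2 := take j (drop p.+1 A); pose A3 := drop j (drop p.+1 A).
have s1 : size A1 = p by rewrite size_takel //; lia.
have s2 : size A2 = j by rewrite size_takel // size_drop /p; lia.
have s3 : size A1 + size A2 + size A3 = (sumn ga).-1.
  by rewrite s1 s2 !size_drop /p; lia.
have eA : A = A1 ++ nth ord0 A p :: A2 ++ A3 by rewrite cat_take_drop -cut_at.
have -> : rmat p A = A1 ++ A2 ++ A3 by rewrite cat_take_drop.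
move: (nth ord0 A p) eA => x eA; clearbody A1 A2 A3.
have -> : (size R1 + c).+1 - j = (size A1).+1 by rewrite /p in s1; lia.
have -> : (size R1 + c).+1 = (size A1 + size A2).+1 by rewrite /p in s1; lia.
have -> : sumn ga = (size (A1 ++ A2) + size A3).+1 by rewrite size_cat /p in s1 *; lia.
have sf' : size (A1 ++ A2 ++ A3 ++ x :: E) = r.
  by rewrite -sf eA !size_cat /= !size_cat; lia.
rewrite eA -!catA /= -catA lact_sLK; last by rewrite -sf eA !size_cat /= !size_cat; lia.
have := @lact_sLK n r (A1 ++ A2) A3 E x Q; rewrite !size_cat -!catA => -> //.
by rewrite -sf eA !size_cat /= !size_cat; lia.
Qed.

Lemma sum_all_eq l x (F : seq I -> rat) :
  (\sum_(B <- alls n l) (all (pred1 x) B)%:R * F B = F (nseq l x))%R.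
Proof.
rewrite -[RHS](@sum_delta n l) ?size_nseq //; apply: eq_big_seq => B.
rewrite mem_alls => /eqP sB; congr ((_ : bool)%:R * _)%R.
by rewrite eq_sym; apply/all_pred1P/eqP; rewrite sB.
Qed.

Lemma size_adbox be a al : adbox be a = Some al -> sumn al = sumn be + (a != 0).
Proof.
case: a => [|a] /=; first by case=> <-; rewrite addn0.
by case: ifP => // _ [<-]; rewrite sumn_incr addn1.
Qed.

Lemma drop_mid (A B D : seq I) x k : size A + size B = k ->
  drop k (A ++ x :: B ++ D) = drop (size B) (x :: B) ++ D.
Proof.
move=> <-; rewrite drop_cat ltnNge leq_addr addKn -cat_cons drop_cat /= ltnS leqnn.
by [].
Qed.

Lemma drop_nseq_self l (x : I) : drop l (x :: nseq l x) = [:: x].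
Proof. by elim: l => //= l IH. Qed.

(** The factor [drop k f == drop k g] expresses that later letters still pass straight down; the
    step consumes one of them, so the label of the step is the letter [k] of [g]. *)
Lemma u_step al a be b ga k (phi : Fck n) g f :
  adbox be a = Some al -> adbox be b = Some ga -> sumn al <= k < r ->
  size f = r -> size g = r ->
  lact (amul q (amul q (ei r q (k.+1 - sumn ga) k.+1) (Mg r q ga b)) (sLK r q (psum ga b) (sumn ga)))
   (lact (amul q (eh r q (k - sumn be) k) (sLK r q (sumn al) (psum al a)))
     (fun f => (drop k f == drop k g)%:R * phi (occ (zip (rw al) (take (sumn al) f))))%R) f =
  ((drop k.+1 f == drop k.+1 g)%:R *
     Dop a b (nth ord0 g k) phi (occ (zip (rw ga) (take (sumn ga) f))))%R.
Proof.
move=> ha hb /andP [hk kr] sf sg.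
pose G (s : seq I) : Fck n := fun m => ((s == drop k g)%:R * phi m)%R.
set P0 := fun f => _; have eP0 : P0 = fun f => G (drop k f) (occ (zip (rw al) (take (sumn al) f))) by [].
have sal := size_adbox ha; have sga := size_adbox hb.
have hbk : sumn be <= k by apply: leq_trans hk; rewrite sal leq_addr.
have eg : drop k g = nth ord0 g k :: drop k.+1 g by rewrite -drop_nth ?sg.
have half A x B D : size A = sumn be -> sumn be + size B = k -> size (A ++ x :: B ++ D) = r ->
    B = nseq (k - sumn be) x ->
    dd a x (G (drop k (A ++ x :: B ++ D))) (occ (zip (rw be) A)) =
    ((x == nth ord0 g k)%:R * ((D == drop k.+1 g)%:R * dd a (nth ord0 g k) phi (occ (zip (rw be) A))))%R.
  move=> sA sB sz eB; rewrite drop_mid ?sA // eB size_nseq drop_nseq_self /G eg /dd /= eqseq_cons -mulnb natrM -mulrA.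
  by case: (x =P _) => [->|_]; rewrite ?mul0r //; case: ifP; rewrite ?mulrA.
pose A := take (sumn ga) f; pose B := take (k.+1 - sumn ga) (drop (sumn ga) f); pose D := drop k.+1 f.
have h1 : sumn ga <= k.+1 by case: (b != 0) sga; case: (a != 0) sal; lia.
have s1 : size A = sumn ga by rewrite size_takel // sf; lia.
have s2 : size B = k.+1 - sumn ga by rewrite size_takel // size_drop sf; lia.
have ef : f = A ++ B ++ D.
  rewrite /D (_ : drop k.+1 f = drop (k.+1 - sumn ga) (drop (sumn ga) f)) ?cat_take_drop //.
  by rewrite drop_drop subnK.
rewrite -/A -/D.
rewrite lact_amul // lact_amul // {1}ef -s2 -{1}(subnKC h1) -{1}s1 -s2 lact_ei -?ef //.
(* Without an added box the label of the padding is summed freely, and comparison with [g] selects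
   it; with an added box it is the label of that box. *)
case: b hb sga h1 s1 s2 => [|b] hb sga h1 s1 s2.
  case: hb sga h1 s1 s2 => <-; rewrite addn0 => _ h1 s1 s2.
  have -> : size B = (k - sumn be).+1 by lia.
  rewrite /= big_allpairs_dep /= big_enum /=.
  transitivity (\sum_(x : I) ((x == nth ord0 g k)%:R * ((D == drop k.+1 g)%:R *
     dd a (nth ord0 g k) phi (occ (zip (rw be) A)))))%R; last first.
    rewrite (bigD1 (nth ord0 g k)) //= eqxx mul1r big1 ?addr0 // => x /negPf ->; by rewrite mul0r.
  apply: eq_bigr => x _.
  have szf B' : size B' = k - sumn be -> size (A ++ x :: B' ++ D) = r.
    by move=> e; rewrite !size_cat /= size_cat e s1 size_drop sf; lia.
  transitivity (\sum_(B' <- alls n (k - sumn be)) (all (pred1 x) B')%:R *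
     dd a x (G (drop k (A ++ x :: B' ++ D))) (occ (zip (rw be) A)))%R; last first.
    by rewrite sum_all_eq half ?size_nseq //; try lia; apply: szf; rewrite size_nseq.
  apply: eq_big_seq => B'; rewrite mem_alls => /eqP sB'.
  rewrite ?cat_cons /Mg /= lact_one ?szf //.
  rewrite /psum take0 /= /sLK /= lact_one ?szf // eP0 lact_half ?szf //; rewrite sB' subnKC //.
have [R1 [c [R2 [e1 e2 e3 e4 e6]]]] := adbox_rw hb.
have e5 : psum ga b = size R1 by move: (psumS ga b); rewrite e3 e4; lia.
have sA : size A = size R1 + c.+1 + size R2.
  by rewrite s1 -size_rw e2 !size_cat size_nseq; lia.
have sB : size B = k - sumn be by lia.
rewrite sB /Dop e2 yy_zip // mulr_sumr.
transitivity (\sum_(B' <- alls n (k - sumn be)) \sum_(0 <= j < c.+1)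
   (all (pred1 (nth ord0 A (size R1 + j))) B')%:R *
   dd a (nth ord0 A (size R1 + j)) (G (drop k (rmat (size R1 + j) A ++ nth ord0 A (size R1 + j) :: B' ++ D)))
   (occ (zip (rw be) (rmat (size R1 + j) A))))%R.
  apply: eq_big_seq => B'; rewrite mem_alls => /eqP sB'.
  have sz : size (A ++ B' ++ D) = r by rewrite !size_cat sB' s1 size_drop sf; lia.
  rewrite (lact_Mg (be := be)) // e4 e5; apply: eq_big_nat => j /andP [_ hj].
  have sr : size (rmat (size R1 + j) A) = sumn be.
    by rewrite size_cat size_takel ?size_drop sA; lia.
  rewrite eP0 lact_half // ?sB' ?subnKC //.
  by rewrite size_cat sr /= size_cat sB' size_drop sf; lia.
rewrite exchange_big /=; apply: eq_big_nat => j /andP [_ hj].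
have sr : size (rmat (size R1 + j) A) = sumn be.
  by rewrite size_cat size_takel ?size_drop sA; lia.
rewrite sum_all_eq half ?size_nseq //; try lia; last first.
  by rewrite size_cat sr /= size_cat size_nseq size_drop sf; lia.
by rewrite e1 mulrCA.
Qed.

(** Here the label comes from the top word: the letter at position [k] is appended to the padding,
    and the joins force the whole padding to equal it. *)
Lemma d_step al a be b ga k (G : seq I -> Fck n) f :
  adbox be a = Some al -> adbox be b = Some ga -> sumn al <= k < r -> size f = r ->
  lact (amul q (amul q (ei r q (k - sumn al) k) (Mg r q al a)) (sLK r q (psum al a) (sumn al)))
   (lact (amul q (eh r q (k - sumn be) k) (sLK r q (sumn ga) (psum ga b)))
     (fun f => G (drop k.+1 f) (occ (zip (rw ga) (take (sumn ga) f))))) f =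
  Dop b a (nth ord0 f k) (G (drop k.+1 f)) (occ (zip (rw al) (take (sumn al) f))).
Proof.
move=> ha hb /andP [hk kr] sf.
have sal := size_adbox ha; have sga := size_adbox hb.
have hbk : sumn be <= k by apply: leq_trans hk; rewrite sal leq_addr.
have hgk : sumn ga <= k.+1 by rewrite sga; case: (b != 0); lia.
have ef : drop k f = nth ord0 f k :: drop k.+1 f by rewrite -drop_nth ?sf.
pose A := take (sumn al) f; pose B := take (k - sumn al) (drop (sumn al) f); pose D := drop k f.
have s1 : size A = sumn al by rewrite size_takel // sf; lia.
have s2 : size B = k - sumn al by rewrite size_takel // size_drop sf; lia.
have sD : size D = r - k by rewrite size_drop sf.
have eD : f = A ++ B ++ D.
  rewrite /D (_ : drop k f = drop (k - sumn al) (drop (sumn al) f)) ?cat_take_drop //.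
  by rewrite drop_drop subnK.
rewrite -/A lact_amul // lact_amul // {1}eD -s2 -{1}(subnKC hk) -{1}s1 -s2 lact_ei -?eD // s2.
rewrite /D ef; move: (nth ord0 f k) => y.
case: a ha sal s1 s2 => [|a] ha sal s1 s2.
  case: ha sal s1 s2 => <-; rewrite addn0 => _ s1 s2.
  have fin B' (x : I) : size B' = k - sumn be -> size (A ++ B' ++ x :: drop k.+1 f) = r.
    by move=> e; rewrite !size_cat /= e s1 size_drop sf; lia.
  rewrite /Dop {1}/yy /=.
  transitivity (\sum_(B' <- alls n (k - sumn be)) (all (pred1 y) B')%:R *
     dd b y (G (drop k.+1 f)) (occ (zip (rw be) A)))%R; last by rewrite sum_all_eq.
  apply: eq_big_seq => B'; rewrite mem_alls => /eqP sB'.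
  rewrite /Mg /= lact_one ?fin // /psum take0 /= /sLK /= lact_one ?fin //.
  case: B' sB' => [|x B'] sB'.
    have := @lact_half ga b be G k.+1 k A y [::] (drop k.+1 f) hb hgk s1.
    rewrite /= => -> //; last exact: (fin [::]); last by rewrite addn0; move: sB' => /=; lia.
    congr (_ * dd b y (G _) _)%R.
    by rewrite -cat_rcons drop_size_cat // size_rcons; move: sB' => /=; lia.
  have := @lact_half ga b be G k.+1 k A x (rcons B' y) (drop k.+1 f) hb hgk s1.
  rewrite cat_rcons => -> //; first last.
  - by have := fin _ y sB'.
  - by rewrite size_rcons; move: sB' hbk => /=; lia.
  have -> : A ++ x :: B' ++ y :: drop k.+1 f = (A ++ rcons (x :: B') y) ++ drop k.+1 f.
    by rewrite -catA cat_rcons.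
  rewrite drop_size_cat; last by rewrite size_cat size_rcons; move: sB' hbk s1 => /=; lia.
  rewrite all_rcons /= -mulnb !natrM eq_sym; case: (x =P y) => [->|_]; last by rewrite !mul0r.
  by rewrite mul1r.
have [R1 [c [R2 [e1 e2 e3 e4 e6]]]] := adbox_rw ha.
have e5 : psum al a = size R1 by move: (psumS al a); rewrite e3 e4; lia.
have sA : size A = size R1 + c.+1 + size R2.
  by rewrite s1 -size_rw e2 !size_cat size_nseq; lia.
rewrite /Dop e2 yy_zip //.
transitivity (\sum_(B' <- alls n (k - sumn al)) \sum_(0 <= j < c.+1)
   (all (pred1 (nth ord0 A (size R1 + j))) (rcons B' y))%:R *
   dd b (nth ord0 A (size R1 + j)) (G (drop k.+1 f))
   (occ (zip (rw be) (rmat (size R1 + j) A))))%R.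
  apply: eq_big_seq => B'; rewrite mem_alls => /eqP sB'.
  have sz : size (A ++ B' ++ y :: drop k.+1 f) = r by rewrite !size_cat /= sB' s1 size_drop sf; lia.
  rewrite (lact_Mg (be := be)) // e4 e5; apply: eq_big_nat => j /andP [_ hj].
  have sr : size (rmat (size R1 + j) A) = sumn be.
    by rewrite size_cat size_takel ?size_drop sA; lia.
  have sB2 : sumn be + size (rcons B' y) = k by rewrite size_rcons sB'; lia.
  rewrite -(cat_rcons y B') lact_half //.
    have -> : rmat (size R1 + j) A ++ nth ord0 A (size R1 + j) :: rcons B' y ++ drop k.+1 f =
      (rmat (size R1 + j) A ++ nth ord0 A (size R1 + j) :: rcons B' y) ++ drop k.+1 f.
      by rewrite -catA.
    by rewrite drop_size_cat // size_cat sr -sB2 /= addnS.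
  by rewrite size_cat sr /= size_cat size_rcons sB' size_drop sf; lia.
rewrite exchange_big /=; apply: eq_big_nat => j /andP [_ hj].
rewrite -e1; move: (nth _ _ _) (zip _ _) => x z.
case: (x =P y) => [-> | /eqP hx].
  rewrite mul1r -[RHS](sum_all_eq (k - sumn al) y (fun=> dd b y (G (drop k.+1 f)) (occ z))).
  by apply: eq_bigr => B' _; rewrite all_rcons /= eqxx.
rewrite mul0r big1 // => B' _; rewrite all_rcons /= eq_sym (negPf hx) mul0r //.
Qed.

(** Each step is undone, its added box removed and its removed box restored, with the first step
    outermost: this is the path of [Uf] traversed backwards. *)
Fixpoint Lf (t : seq (nat * nat)) (f : seq I) (psi : Fck n) : Fck n :=
  match t, f with
  | (a, b) :: t', v :: f' => Dop b a v (Lf t' f' psi)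
  | _, _ => psi
  end.

Lemma kend_cons al a b t nu : kend al ((a, b) :: t) = Some nu -> is_part al ->
  exists be ga, [/\ rmbox al a = Some be, adbox be b = Some ga, kend ga t = Some nu,
    adbox be a = Some al & is_part be /\ is_part ga].
Proof.
rewrite /=; case ea: (rmbox al a) => [be|] //; case eb: (adbox be b) => [ga|] // ek pal.
have [pb ab] := rmbox_ad pal ea; exists be, ga; split=> //; split=> //.
exact: adbox_part eb.
Qed.

Lemma ufac_act t al k nu (phi : Fck n) f g : kend al t = Some nu -> is_part al -> sumn al <= k ->
  k + size t = r -> size f = r -> size g = r ->
  lact (aprod q (ufac r q k al t))
   (fun f => (drop k f == drop k g)%:R * phi (occ (zip (rw al) (take (sumn al) f))))%R f =
  Uf phi t (drop k g) (occ (zip (rw nu) (take (sumn nu) f))).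
Proof.
elim: t al k phi f => [|[a b] t IH] al k phi f.
  rewrite /= => [[<-]] _ _; rewrite addn0 => -> sf sg.
  by rewrite lact_one // !drop_oversize ?sf ?sg // eqxx mul1r.
move=> hk pal sal hr sf sg.
have [be [ga [ea eb ek ab [pb pg]]]] := kend_cons hk pal.
have kr : k < r by move: hr => /=; lia.
have sga : sumn ga <= k.+1.
  by rewrite (size_adbox eb); have := size_adbox ab; case: (b != 0); case: (a != 0); lia.
rewrite [ufac _ _ _ _ _]/= ea /= eb /= lact_aprod_cat //.
rewrite [in RHS](drop_nth ord0) ?sg //= -(IH ga) //; last by rewrite -hr /= addnS.
apply: lact_ext => h sh; rewrite /= lact_amul // .
rewrite (@lact_ext n r _ _ (lact (amul q (eh r q (k - sumn be) k) (sLK r q (sumn al) (psum al a)))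
   (fun f => (drop k f == drop k g)%:R * phi (occ (zip (rw al) (take (sumn al) f))))%R)).
  by rewrite u_step // sal.
move=> h' sh'; rewrite lact_amul //; apply: lact_ext => h2 sh2; by rewrite lact_one.
Qed.

Lemma rho_lact (a : alg r) (f g : seq I) : size g = r -> rho a f g = lact a (fun h => (h == g)%:R)%R f.
Proof.
move=> sg; rewrite /lact -[LHS](@sum_delta n r g (fun h => rho a f h)) //.
by apply: eq_bigr => h _; rewrite mulrC eq_sym.
Qed.

(** The top word enters only through the row contents of its first [|nu|] letters; these are the
    exponents of the coefficient that is read off. *)
Lemma rho_uT t nu f g : kend [::] t = Some nu -> size t = r -> size f = r -> size g = r ->
  rho (uT r q t) f g = Uf (@vac n) t g (occ (zip (rw nu) (take (sumn nu) f))).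
Proof.
move=> hk st sf sg; rewrite rho_lact //.
have := @ufac_act t [::] 0 nu (@vac n) f g hk isT isT st sf sg; rewrite drop0 => <-.
apply: lact_ext => h sh; rewrite !drop0 /vac /= (_ : asbool _ = true) ?mulr1 //.
by apply/asboolP => z; rewrite take0.
Qed.

Lemma dfac_act t al k nu (psi : Fck n) f : kend al t = Some nu -> is_part al -> sumn al <= k ->
  k + size t = r -> size f = r ->
  lact (aprod q (dfac r q k al t)) (fun f => psi (occ (zip (rw nu) (take (sumn nu) f)))) f =
  Lf t (drop k f) psi (occ (zip (rw al) (take (sumn al) f))).
Proof.
elim: t al k f => [|[a b] t IH] al k f.
  by rewrite /= => [[<-]] _ _ _ sf; rewrite lact_one.
move=> hk pal sal hr sf.
have [be [ga [ea eb ek ab [pb pg]]]] := kend_cons hk pal.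
have kr : k < r by move: hr => /=; lia.
have sga : sumn ga <= k.+1.
  by rewrite (size_adbox eb); have := size_adbox ab; case: (b != 0); case: (a != 0); lia.
rewrite [dfac _ _ _ _ _]/= ea /= eb /= lact_amul //.
rewrite (drop_nth ord0) ?sf //=.
rewrite -(@d_step al a be b ga k (fun s => Lf t s psi)) ?sal //.
apply: lact_ext => h sh; rewrite lact_amul //; apply: lact_ext => h' sh'.
by rewrite IH // -hr /= addnS.
Qed.

(** The path of [d_t] ends at the empty shape, so evaluation takes place at the zero occupation,
    which makes the kernel a vacuum expectation. *)
Lemma rho_dT_uT t nu w f g : kend [::] t = Some nu -> kend [::] w = Some nu ->
  size t = r -> size w = r -> size f = r -> size g = r ->
  rho (amul q (dT r q t) (uT r q w)) f g = Lf t f (Uf (@vac n) w g) (fun=> 0).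
Proof.
move=> ht hw st sw sf sg; rewrite rho_amul_act //.
have := @dfac_act t [::] 0 nu (Uf (@vac n) w g) f ht isT isT st sf.
rewrite drop0 take0 => E; transitivity (Lf t f (Uf (@vac n) w g) (occ (zip (rw [::]) [::]))) => //.
by rewrite -E; apply: lact_ext => h sh; apply: rho_uT.
Qed.
End Steps.

(** * Straightening *)

Import Order.TTheory Num.Theory.
Local Open Scope ring_scope.

(** A weight is a polynomial whose coefficient at [X^i] belongs to row [i+1]; its value at 1 is the
    size, and the derivative at 1 weighs that row by [i]. Adding a root lowers the height by one,
    which bounds the recursion. *)
Definition hgt (k : {poly int}) : int := k^`().[1].
Definition dominant (k : {poly int}) := forall i, k`_i.+1 <= k`_i.
Definition alpha (i : nat) : {poly int} := ('X^i : {poly int}) - ('X^(i.+1) : {poly int}).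

Lemma coef_alpha i k : (alpha i)`_k = (k == i)%:R - (k == i.+1)%:R.
Proof. by rewrite coefB !coefXn. Qed.
Lemma hgtD a b : hgt (a + b) = hgt a + hgt b. Proof. by rewrite /hgt derivD hornerD. Qed.
Lemma hgtN a : hgt (- a) = - hgt a. Proof. by rewrite /hgt derivN hornerN. Qed.
Lemma hgt_Xn i : hgt ('X^i) = i%:R.
Proof. by rewrite /hgt derivXn hornerMn hornerXn expr1n. Qed.
Lemma hgt_alpha i : hgt (alpha i) = -1.
Proof. by rewrite /alpha hgtD hgtN !hgt_Xn -natr1; ring. Qed.
Lemma hgt_ge0 (k : {poly int}) : (forall i, 0 <= k`_i) -> 0 <= hgt k.
Proof.
move=> H; rewrite /hgt horner_coef sumr_ge0 // => i _.
by rewrite expr1n mulr1 coef_deriv mulrn_wge0.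
Qed.

Section Straightening.
Variables (V : lmodType rat) (E F N : nat -> {linear V -> V}).

Definition wt (k : {poly int}) (x : V) := forall i, N i x = (k`_i)%:~R *: x.

Hypothesis EF : forall i x, E i (F i x) = F i (E i x) + N i x - N i.+1 x.
Hypothesis EFne : forall i j x, i != j -> E i (F j x) = F j (E i x).
Hypothesis NF : forall k i x, N k (F i x) = F i (N k x) - ((alpha i)`_k)%:~R *: F i x.
Hypothesis Nneg : forall k (c : int) x, c < 0 -> N k x = c%:~R *: x -> x = 0.

Lemma wtD k x y : wt k x -> wt k y -> wt k (x + y).
Proof. by move=> hx hy i; rewrite linearD hx hy scalerDr. Qed.
Lemma wtZ k c x : wt k x -> wt k (c *: x).
Proof. by move=> hx i; rewrite linearZ_LR hx !scalerA mulrC. Qed.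
Lemma wt0 k : wt k 0. Proof. by move=> i; rewrite linear0 scaler0. Qed.
Lemma wtF k i x : wt k x -> wt (k - alpha i) (F i x).
Proof. by move=> hx j; rewrite NF hx linearZ_LR -scalerBl (coefB k (alpha i)) rmorphB. Qed.
Lemma EFwt k i x : wt k x -> F i (E i x) = E i (F i x) + (k`_i.+1 - k`_i)%:~R *: x.
Proof.
move=> hx; by rewrite EF !hx rmorphB scalerBl /= -!addrA addKr subrr addr0.
Qed.

(** The weight is an index, so that zero belongs to every weight space and each rule records its
    shift by a root. *)
Inductive Fsp (S : {poly int} -> V -> Prop) : {poly int} -> V -> Prop :=
| Fsp_seed k x : S k x -> Fsp S k x
| Fsp_0 k : Fsp S k 0
| Fsp_D k x y : Fsp S k x -> Fsp S k y -> Fsp S k (x + y)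
| Fsp_Z k c x : Fsp S k x -> Fsp S k (c *: x)
| Fsp_F k i x : Fsp S k x -> Fsp S (k - alpha i) (F i x).

Definition Estable (S P : {poly int} -> V -> Prop) :=
  forall k x i, S k x -> P (k + alpha i) (E i x).

Lemma Fsp_eq S k k' x x' : Fsp S k x -> k = k' -> x = x' -> Fsp S k' x'.
Proof. by move=> h <- <-. Qed.

Lemma Fsp_wt (S : {poly int} -> V -> Prop) : (forall k x, S k x -> wt k x) -> forall k x, Fsp S k x -> wt k x.
Proof.
move=> HS k x; elim=> {k x} [k x /HS //|k|k x y _ h1 _ h2|k c x _ h|k i x _ h].
- exact: wt0.
- exact: wtD.
- exact: wtZ.
- exact: wtF.
Qed.

(** Commuting [E i] past a lowering operator costs only a scalar on a weight vector, so the seeds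
    decide. *)
Lemma Fsp_E (S : {poly int} -> V -> Prop) : (forall k x, S k x -> wt k x) -> Estable S (Fsp S) -> Estable (Fsp S) (Fsp S).
Proof.
move=> HS HE k x i; elim=> {k x} [k x /HE //|k|k x y _ h1 _ h2|k c x _ h|k j x hx h].
- by rewrite linear0; apply: Fsp_0.
- by rewrite linearD; apply: Fsp_D.
- by rewrite linearZ_LR; apply: Fsp_Z.
have [<- | ij] := eqVneq i j; last first.
  by rewrite EFne //; apply: Fsp_eq (Fsp_F j h) _ _ => //; rewrite addrAC.
have w := Fsp_wt HS hx.
apply: (@Fsp_eq _ k _ (F i (E i x) + (k`_i - k`_i.+1)%:~R *: x)).
- by apply: Fsp_D (Fsp_Z _ hx); apply: Fsp_eq (Fsp_F i h) _ _ => //; rewrite addrK.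
- by rewrite subrK.
- by rewrite (EFwt i w) -addrA -scalerDl -rmorphD /= subrKA subrr scale0r addr0.
Qed.

(** A vector with weight in [D] is built from seeds of higher weight, and those stay in the upward
    closed set [D]; seeds outside cannot occur. *)
Lemma Fsp_sub (S S' : {poly int} -> V -> Prop) (D : {poly int} -> Prop) :
  (forall k i, D k -> D (k + alpha i)) -> (forall k x, D k -> S k x -> S' k x) ->
  forall k x, Fsp S k x -> D k -> Fsp S' k x.
Proof.
move=> HD HS k x; elim=> {k x} [k x hx|k|k x y _ h1 _ h2|k c x _ h|k i x _ h] d.
- exact/Fsp_seed/HS.
- exact: Fsp_0.
- by apply: Fsp_D; auto.
- by apply: Fsp_Z; auto.
- by apply/Fsp_F/h; have := HD _ i d; rewrite subrK.
Qed.

Section Letters.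
Variables (L : Type) (Psi : L -> {linear V -> V}) (wL : L -> {poly int}).
Variables (Fc Ec : nat -> L -> rat) (Fl El : nat -> L -> L).
Hypothesis FPsi : forall i l x, F i (Psi l x) = Psi l (F i x) + Fc i l *: Psi (Fl i l) x.
Hypothesis EPsi : forall i l x, E i (Psi l x) = Psi l (E i x) + Ec i l *: Psi (El i l) x.
Hypothesis NPsi : forall k l x, N k (Psi l x) = Psi l (N k x) + ((wL l)`_k)%:~R *: Psi l x.
Hypothesis wFl : forall i l, Fc i l != 0 -> wL (Fl i l) = wL l - alpha i.
Hypothesis wEl : forall i l, Ec i l != 0 -> wL (El i l) = wL l + alpha i.

Variable S : {poly int} -> V -> Prop.
Hypothesis Swt : forall k x, S k x -> wt k x.
Hypothesis SE : Estable S (Fsp S).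

(** One letter applied to straightened vectors. This space is stable under both [E] and [F] because
    letters are transformed into letters. *)
Inductive Npsi : {poly int} -> V -> Prop :=
| Np_psi l k x : Fsp S k x -> Npsi (k + wL l) (Psi l x)
| Np_0 k : Npsi k 0
| Np_D k x y : Npsi k x -> Npsi k y -> Npsi k (x + y)
| Np_Z k c x : Npsi k x -> Npsi k (c *: x).

Lemma Np_eq k k' x x' : Npsi k x -> k = k' -> x = x' -> Npsi k' x'.
Proof. by move=> h <- <-. Qed.

Lemma Np_wt k x : Npsi k x -> wt k x.
Proof.
elim=> {k x} [l k x hx|k|k x y _ h1 _ h2|k c x _ h].
- move=> i; rewrite NPsi (Fsp_wt Swt hx) linearZ_LR -scalerDl coefD rmorphD //.
- exact: wt0.
- exact: wtD.
- exact: wtZ.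
Qed.

Lemma Np_F i k x : Npsi k x -> Npsi (k - alpha i) (F i x).
Proof.
elim=> {k x} [l k x hx|k|k x y _ h1 _ h2|k c x _ h].
- rewrite FPsi; apply: Np_D.
    by apply: Np_eq (Np_psi l (Fsp_F i hx)) _ _ => //; rewrite addrAC.
  have [-> | c0] := eqVneq (Fc i l) 0; first by rewrite scale0r; apply: Np_0.
  by apply/Np_Z/(Np_eq (Np_psi (Fl i l) hx)) => //; rewrite wFl // addrA.
- by rewrite linear0; apply: Np_0.
- by rewrite (linearD (F i)); apply: Np_D.
- by rewrite linearZ_LR; apply: Np_Z.
Qed.

Lemma Np_E i k x : Npsi k x -> Npsi (k + alpha i) (E i x).
Proof.
elim=> {k x} [l k x hx|k|k x y _ h1 _ h2|k c x _ h].
- rewrite EPsi; apply: Np_D.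
    by apply: Np_eq (Np_psi l (Fsp_E Swt SE i hx)) _ _ => //; rewrite addrAC.
  have [-> | c0] := eqVneq (Ec i l) 0; first by rewrite scale0r; apply: Np_0.
  by apply/Np_Z/(Np_eq (Np_psi (El i l) hx)) => //; rewrite wEl // addrA.
- by rewrite linear0; apply: Np_0.
- by rewrite (linearD (E i)); apply: Np_D.
- by rewrite linearZ_LR; apply: Np_Z.
Qed.

(* [F E + c] is onto on a weight space of negative [sl_2]-weight [-j]: if [u] solves
   [(F E + c + j) u = F x] then [(x - E u) / (c + j)] solves [(F E + c) y = x]. *)
Lemma Np_solve i (m : nat) k x (c : rat) : Npsi k x -> k`_i < k`_i.+1 -> k`_i < m%:Z -> 0 <= c ->
  exists2 y, Npsi k y & F i (E i y) + c *: y = x.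
Proof.
elim: m k x c => [|m IH] k x c hx hlt hm hc.
  exists 0; first exact: Np_0.
  by rewrite !linear0 add0r; apply/esym/(Nneg hm (Np_wt hx i)).
set j : rat := (k`_i.+1 - k`_i)%:~R.
have j0 : 0 < j by rewrite ltr0z subr_gt0.
have jc : j + c != 0 by rewrite gt_eqF // ltr_wpDr.
have [||||u hu eu] := IH (k - alpha i) (F i x) (c + j); first exact: Np_F.
- by rewrite !(coefB k (alpha i)) !coef_alpha !eqxx (gtn_eqF (ltnSn i)) (ltn_eqF (ltnSn i)) /= ?mulr0n ?mulr1n; move: hlt hm; move: (k`_i : int) (k`_i.+1 : int) => a b; lia.
- by rewrite !(coefB k (alpha i)) !coef_alpha !eqxx (ltn_eqF (ltnSn i)) /= ?mulr0n ?mulr1n; move: hlt hm; move: (k`_i : int) (k`_i.+1 : int) => a b; lia.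
- by rewrite addr_ge0 // ltW.
have hEu : Npsi k (E i u) by apply: Np_eq (Np_E i hu) _ _; rewrite ?subrK.
exists ((j + c)^-1 *: (x - E i u)); first by apply/Np_Z/Np_D => //; rewrite -scaleN1r; apply: Np_Z.
have e1 : F i (E i x) = E i (F i (E i u)) + (c + j) *: E i u + j *: x.
  by rewrite (EFwt i (Np_wt hx)) -/j -eu (linearD (E i)) (linearZ_LR (E i)).
have e2 : F i (E i (E i u)) = E i (F i (E i u)) + j *: E i u.
  by rewrite (EFwt i (Np_wt hEu)) -/j.
have e3 : F i (E i (x - E i u)) = j *: x + c *: E i u.
  rewrite (linearB (E i)) (linearB (F i)) /= e1 e2 scalerDl.
  move: (E i u) => b; move: (E i (F i b)) => a.
  by apply/eqP; rewrite subr_eq [eqbRHS](AC (2*2) ((3*(2*4))*1)).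
rewrite (linearZ_LR (E i)) (linearZ_LR (F i)) e3 scalerA [c * _]mulrC -scalerA -scalerDr scalerBr.
by rewrite addrACA subrr addr0 -scalerDl scalerA mulVf // scale1r.
Qed.

Variable S' : {poly int} -> V -> Prop.
Hypothesis SS' : forall k x l, S k x -> dominant (k + wL l) -> S' (k + wL l) (Psi l x).

(** Away from dominant weights the vector is [F (E y)], and [E y] has smaller height. At a dominant
    weight [F] is pulled out of the letter: one term again has smaller height, the other contains
    one [F] less. *)
Lemma Np_Fsp k x : Npsi k x -> Fsp S' k x.
Proof.
have [m hm] : exists m : nat, hgt k < m%:Z.
  by exists `|hgt k|.+1%N; apply: le_lt_trans (ler_norm _) _; rewrite -abszE ltz_nat.
elim: m k x hm => [|m IH] k x hm hx.
  have [[i hi]|H] := pselect (exists i, k`_i < 0).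
    by rewrite (Nneg hi (Np_wt hx i)); apply: Fsp_0.
  suff : 0 <= hgt k by rewrite leNgt hm.
  by apply: hgt_ge0 => i; rewrite leNgt; apply/negP => hi; apply: H; exists i.
have [[i hi]|H] := pselect (exists i, k`_i < k`_i.+1).
  have [p hp] : exists p : nat, k`_i < p%:Z.
    by exists (absz (k`_i)).+1; apply: le_lt_trans (ler_norm _) _; rewrite -abszE ltz_nat.
  have [y hy ey] := Np_solve hx hi hp (lexx 0).
  rewrite scale0r addr0 in ey; rewrite -ey.
  apply: Fsp_eq (Fsp_F i (IH (k + alpha i) (E i y) _ (Np_E i hy))) _ _ => //; last by rewrite addrK.
  by rewrite hgtD hgt_alpha; move: hm; lia.
have dom : dominant k by move=> i; rewrite leNgt; apply/negP => hi; apply: H; exists i.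
clear H; elim: hx dom hm => {k x} [l k x hx|k|k x y _ h1 _ h2|k c x _ h] dom hm.
- elim: hx l dom hm => {k x} [k x hx|k|k x y _ h1 _ h2|k c x _ h|k i x hx h] l dom hm.
  + exact/Fsp_seed/SS'.
  + by rewrite linear0; apply: Fsp_0.
  + by rewrite linearD; apply: Fsp_D; auto.
  + by rewrite linearZ_LR; apply: Fsp_Z; auto.
  have -> : Psi l (F i x) = F i (Psi l x) + (- Fc i l) *: Psi (Fl i l) x.
    by rewrite FPsi scaleNr addrK.
  apply: Fsp_D.
    apply: Fsp_eq (Fsp_F i (IH (k + wL l) (Psi l x) _ (Np_psi l hx))) _ _ => //; last by rewrite addrAC.
    by move: hm; rewrite !hgtD hgtN hgt_alpha; lia.
  have [-> | c0] := eqVneq (Fc i l) 0; first by rewrite oppr0 scale0r; apply: Fsp_0.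
  have e : k + wL (Fl i l) = k - alpha i + wL l by rewrite wFl // addrA addrAC.
  by apply/Fsp_Z/(Fsp_eq (h (Fl i l) _ _)); rewrite ?e.
- exact: Fsp_0.
- by apply: Fsp_D; auto.
- by apply: Fsp_Z; auto.
Qed.
End Letters.
End Straightening.

(** * Polarization operators *)

Section FockOps.
Variable n : nat.
Local Notation I := 'I_n.+1.
Implicit Types (phi : Fck n) (m : Occ n) (v w : I).

(** The canonical commutation relation; colour 0 acts as the identity, hence the condition on
    [a]. *)
Lemma dd_yy a v b w phi m : dd a v (yy b w phi) m =
  yy b w (dd a v phi) m + ([&& a == b, v == w & a != 0%N])%:R * phi m.
Proof.
rewrite /dd /yy; case: (a =P 0%N) => [-> | a0]; first by rewrite !andbF mul0r addr0.
case: (b =P 0%N) => [-> | b0]; first by rewrite (introF eqP a0) mul0r addr0.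
rewrite andbT -xpair_eqE; set x := (a, v); set y := (b, w).
case: (x =P y) => [-> | xy].
  rewrite {1}/oadd eqxx orem_oadd natrD mulrDl; congr (_ + _).
  (* If [m y] is zero the truncated subtraction in [orem] loses a unit, but the factor in front then
     vanishes. *)
  have [-> | my] := posnP (m y); first by rewrite !mul0r.
  congr (_ * phi _); apply: funext => z; rewrite /oadd /orem.
  by case: (z =P y) => [-> | _]; rewrite ?subn0 ?addn0 // subnK.
rewrite mul0r addr0 {1}/oadd; have /negPf -> : y != x by apply/eqP => e; apply: xy.
rewrite addn0; congr (_ * phi _); apply: funext => z; rewrite /oadd /orem.
by case: (z =P x) => [-> | _]; case: eqP => // _; rewrite ?addn0 ?subn0.
Qed.

Lemma dd_dd a v b w phi m : dd a v (dd b w phi) m = dd b w (dd a v phi) m.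
Proof.
rewrite /dd; case: (a =P 0%N) => // _; case: (b =P 0%N) => // _; congr (phi _).
by apply: funext => z; rewrite /oadd addnAC.
Qed.

Lemma yy_yy a v b w phi m : yy a v (yy b w phi) m = yy b w (yy a v phi) m.
Proof.
rewrite /yy; case: (a =P 0%N) => // _; case: (b =P 0%N) => // _.
set x := (a, v); set y := (b, w).
rewrite mulrA [RHS]mulrA; congr (_ * phi _); last first.
  by apply: funext => z; rewrite /orem subnAC.
rewrite /orem; case: (x =P y) => [e | xy]; first by rewrite e eqxx.
have yx : (y == x) = false by rewrite eq_sym; apply/eqP.
by rewrite yx !subn0 mulrC.
Qed.

Lemma ddD a v phi psi m : dd a v (fun m => phi m + psi m) m = dd a v phi m + dd a v psi m.
Proof. by rewrite /dd; case: ifP. Qed.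
Lemma ddZ a v c phi m : dd a v (fun m => c * phi m) m = c * dd a v phi m.
Proof. by rewrite /dd; case: ifP. Qed.
Lemma yyD b v phi psi m : yy b v (fun m => phi m + psi m) m = yy b v phi m + yy b v psi m.
Proof. by rewrite /yy; case: ifP => // _; rewrite mulrDr. Qed.
Lemma yyZ b v c phi m : yy b v (fun m => c * phi m) m = c * yy b v phi m.
Proof. by rewrite /yy; case: ifP => // _; rewrite mulrCA. Qed.
Lemma dd_sum a v (J : Type) (s : seq J) (f : J -> Fck n) m :
  dd a v (fun m => \sum_(j <- s) f j m) m = \sum_(j <- s) dd a v (f j) m.
Proof. by rewrite /dd; case: ifP. Qed.
Lemma yy_sum b v (J : Type) (s : seq J) (f : J -> Fck n) m :
  yy b v (fun m => \sum_(j <- s) f j m) m = \sum_(j <- s) yy b v (f j) m.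
Proof. by rewrite /yy; case: ifP => // _; rewrite mulr_sumr. Qed.
Lemma ddE a v phi psi m : (forall m, phi m = psi m) -> dd a v phi m = dd a v psi m.
Proof. by move=> e; rewrite /dd !e. Qed.
Lemma yyE b v phi psi m : (forall m, phi m = psi m) -> yy b v phi m = yy b v psi m.
Proof. by move=> e; rewrite /yy !e. Qed.

(* [TT i j] recolours one box from [i] to [j] in all possible ways. *)
Definition TT (i j : nat) (phi : Fck n) : Fck n := fun m => \sum_(v : I) yy j v (dd i v phi) m.

Lemma sum_pick (v : I) (f : I -> rat) : \sum_w (w == v)%:R * f w = f v.
Proof.
rewrite (bigD1 v) //= eqxx mul1r big1 ?addr0 // => w /negPf ->; exact: mul0r.
Qed.

Lemma TT_yy i j b v phi m : i != 0%N ->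
  TT i j (yy b v phi) m = yy b v (TT i j phi) m + (b == i)%:R * yy j v phi m.
Proof.
move=> i0; rewrite /TT yy_sum -(sum_pick v (fun w => (b == i)%:R * yy j w phi m)) -big_split /=.
apply: eq_bigr => w _.
rewrite (@yyE j w _ (fun m => yy b v (dd i w phi) m + ([&& i == b, w == v & i != 0%N])%:R * phi m)); last first.
  exact: dd_yy.
rewrite yyD yyZ; congr (_ + _); first exact: yy_yy.
by rewrite i0 andbT eq_sym; case: (b == i); case: (w == v); rewrite ?mul0r ?mul1r // mulr0.
Qed.

Lemma TT_dd i j a v phi m : i != 0%N -> j != 0%N ->
  TT i j (dd a v phi) m = dd a v (TT i j phi) m - (a == j)%:R * dd i v phi m.
Proof.
move=> i0 j0; rewrite /TT dd_sum -(sum_pick v (fun w => (a == j)%:R * dd i w phi m)) -sumrB.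
apply: eq_bigr => w _; rewrite dd_yy.
rewrite -[yy j w (dd a v _) m](@yyE j w (dd i w (dd a v phi))); last by move=> m'; rewrite dd_dd.
rewrite eq_sym [v == w]eq_sym; have [e | _] := eqVneq j a; last first.
  by rewrite /= !mul0r mulr0 addr0 subr0.
by rewrite -e j0 /= andbT mul1r; case: (w == v); rewrite ?mul1r ?addrK // !mul0r addr0 subr0.
Qed.

(** The bracket of [gl]; [EFv], [EFvne] and [NFv] are its special cases. *)
Lemma TT_TT i j k l phi m : i != 0%N -> j != 0%N -> k != 0%N ->
  TT i j (TT k l phi) m =
  TT k l (TT i j phi) m + (l == i)%:R * TT k j phi m - (k == j)%:R * TT i l phi m.
Proof.
move=> i0 j0 k0; have e : TT k l phi = fun m => \sum_v yy l v (dd k v phi) m by [].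
transitivity (\sum_v TT i j (yy l v (dd k v phi)) m).
  rewrite {1}e /TT exchange_big /=; apply: eq_bigr => v _.
  by rewrite -yy_sum; apply: yyE => m'; rewrite dd_sum.
rewrite /TT !mulr_sumr -big_split -sumrB /=; apply: eq_bigr => v _.
rewrite -/(TT i j _ m) TT_yy // addrAC; congr (_ + _).
rewrite (@yyE l v (TT i j (dd k v phi)) (fun m => dd k v (TT i j phi) m + (- (k == j)%:R) * dd i v phi m)).
  by rewrite yyD yyZ mulNr.
by move=> m'; rewrite TT_dd // mulNr.
Qed.

Lemma TT_diag i phi m : i != 0%N -> TT i i phi m = (\sum_v m (i, v))%:R * phi m.
Proof.
move=> i0; rewrite natr_sum mulr_suml; apply: eq_bigr => v _.
rewrite /yy /dd (negPf i0); have [-> | mv] := posnP (m (i, v)); first by rewrite !mul0r.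
congr (_ * phi _); apply: funext => z; rewrite /oadd /orem.
by case: eqP => [-> | _]; rewrite ?subn0 ?addn0 // subnK.
Qed.

Lemma TTD i j phi psi m : TT i j (fun m => phi m + psi m) m = TT i j phi m + TT i j psi m.
Proof.
rewrite -big_split; apply: eq_bigr => v _ /=; rewrite -yyD.
by apply: yyE => m'; rewrite ddD.
Qed.
Lemma TTZ i j c phi m : TT i j (fun m => c * phi m) m = c * TT i j phi m.
Proof.
rewrite mulr_sumr; apply: eq_bigr => v _ /=; rewrite -yyZ.
by apply: yyE => m'; rewrite ddZ.
Qed.
Lemma TTE i j phi psi m : (forall m, phi m = psi m) -> TT i j phi m = TT i j psi m.
Proof. by move=> e; apply: eq_bigr => v _; apply: yyE => m'; apply: ddE. Qed.

Lemma vacE z m : (0 < m z)%N -> vac (n := n) m = 0.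
Proof.
by move=> h; rewrite /vac; case: asboolP => // /(_ z) e; rewrite e in h.
Qed.

Lemma dd_vac a v m : a != 0%N -> dd a v (vac (n := n)) m = 0.
Proof.
by move=> a0; rewrite /dd (negPf a0) (@vacE (a, v)) // /oadd eqxx addn1.
Qed.

Lemma yy0 b v m : yy b v (fun _ : Occ n => 0) m = 0.
Proof. by rewrite /yy; case: ifP => //; rewrite mulr0. Qed.

Lemma TT_vac i j m : i != 0%N -> TT i j (vac (n := n)) m = 0.
Proof.
move=> i0; apply: big1 => v _; rewrite -[RHS](yy0 j v m).
by apply: yyE => m'; apply: dd_vac.
Qed.
End FockOps.

(** * The [gl]-module of word vectors *)

Section VecModel.
Variable n : nat.
Local Notation I := 'I_n.+1.
(** The list of letters is kept with the latest one at the head, so that appending a step is a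
    [cons]. *)
Definition V : Type := seq I -> Occ n -> rat^o.
HB.instance Definition _ := GRing.Lmodule.on V.

Definition TV (i j : nat) (x : V) : V := fun g => TT i j (x g).
Lemma TV_linear i j : linear (TV i j).
Proof.
move=> c x y; apply: funext => g; apply: funext => m; rewrite /TV.
rewrite -[RHS]/(c * TT i j (x g) m + TT i j (y g) m).
rewrite -TTZ -TTD; exact: TTE.
Qed.
HB.instance Definition _ i j := GRing.isLinear.Build rat V V *:%R (TV i j) (@TV_linear i j).

(** A step uses one letter twice. [PsM] takes it off the list and [PsP] leaves it there, so that
    each half step has its own simple commutation rule with [gl]. *)
Definition PsM (a : nat) (x : V) : V := fun g => if g is v :: g' then dd a v (x g') else fun=> 0.
Definition PsP (b : nat) (x : V) : V := fun g => if g is v :: g' then yy b v (x g) else fun=> 0.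
Lemma PsM_linear a : linear (PsM a).
Proof.
move=> c x y; apply: funext => -[|v g]; apply: funext => m; last first.
  rewrite -[RHS]/(c * dd a v (x g) m + dd a v (y g) m).
  by rewrite -ddZ -ddD; apply: ddE.
by rewrite -[RHS]/(c * 0 + 0) mulr0 addr0.
Qed.
HB.instance Definition _ a := GRing.isLinear.Build rat V V *:%R (PsM a) (@PsM_linear a).
Lemma PsP_linear b : linear (PsP b).
Proof.
move=> c x y; apply: funext => -[|v g]; apply: funext => m; last first.
  rewrite -[RHS]/(c * yy b v (x (v :: g)) m + yy b v (y (v :: g)) m).
  by rewrite -yyZ -yyD; apply: yyE.
by rewrite -[RHS]/(c * 0 + 0) mulr0 addr0.
Qed.
HB.instance Definition _ b := GRing.isLinear.Build rat V V *:%R (PsP b) (@PsP_linear b).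

Definition Ev (i : nat) : {linear V -> V} := TV i.+2 i.+1.
Definition Fv (i : nat) : {linear V -> V} := TV i.+1 i.+2.
Definition Nv (i : nat) : {linear V -> V} := TV i.+1 i.+1.

Lemma TV_TV i j k l x : TV i.+1 j.+1 (TV k.+1 l x) =
  TV k.+1 l (TV i.+1 j.+1 x) + (l == i.+1)%:R *: TV k.+1 j.+1 x - (k == j)%:R *: TV i.+1 l x.
Proof. by apply: funext => g; apply: funext => m; rewrite /TV TT_TT. Qed.

Lemma EFv i x : Ev i (Fv i x) = Fv i (Ev i x) + Nv i x - Nv i.+1 x.
Proof. by rewrite /= TV_TV !eqxx !scale1r. Qed.
Lemma EFvne i j x : i != j -> Ev i (Fv j x) = Fv j (Ev i x).
Proof.
move=> ij; rewrite /= TV_TV !eqSS [j == i]eq_sym (negPf ij).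
by rewrite !scale0r addr0 subr0.
Qed.
Lemma NFv k i x : Nv k (Fv i x) = Fv i (Nv k x) - ((alpha i)`_k)%:~R *: Fv i x.
Proof.
rewrite /= TV_TV coef_alpha rmorphB /= scalerBl opprB addrA !eqSS [i == k]eq_sym.
case: (k =P i.+1) => [-> | h1]; last first.
  rewrite eq_sym (introF eqP h1) !scale0r !addr0.
  by case: eqP => [-> | _]; rewrite ?mulr0n ?mulr1n ?scale0r.
by rewrite eqxx (gtn_eqF (ltnSn i)) !scale0r.
Qed.
(** [Nv k] multiplies every coefficient by a natural number, the content of a row. *)
Lemma Nneg k (c : int) (x : V) : c < 0 -> Nv k x = c%:~R *: x -> x = 0.
Proof.
move=> hc e; apply: funext => g; apply: funext => m; have := congr1 (fun f : V => f g m) e.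
rewrite /= /TV TT_diag // -[(_ *: _) g m]/(c%:~R * x g m) => /eqP.
rewrite -subr_eq0 -mulrBl mulf_eq0 => /orP [|/eqP //].
rewrite subr_eq0 pmulrn eqr_int; move: hc; lia.
Qed.

Definition wP (b : nat) : {poly int} := if b is b'.+1 then 'X^b' else 0.

Lemma wP_alpha i : wP i.+2 = wP i.+1 - alpha i.
Proof. by rewrite /wP /alpha opprB addrC subrK. Qed.

Lemma TV_PsP i j b x : TV i.+1 j (PsP b x) = PsP b (TV i.+1 j x) + (b == i.+1)%:R *: PsP j x.
Proof.
apply: funext => -[|v g]; apply: funext => m.
  rewrite /TV /= -[RHS]/(0 + _ * 0) mulr0 addr0.
  by apply: big1 => v _; rewrite -[RHS](yy0 j v m); apply: yyE => m'.
by rewrite /TV /= TT_yy.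
Qed.
Lemma TV_PsM i j a x : TV i.+1 j.+1 (PsM a x) =
  PsM a (TV i.+1 j.+1 x) + (- (a == j.+1)%:R) *: PsM i.+1 x.
Proof.
apply: funext => -[|v g]; apply: funext => m.
  rewrite /TV /= -[RHS]/(0 + _ * 0) mulr0 addr0.
  by apply: big1 => v _; rewrite -[RHS](yy0 j.+1 v m); apply: yyE => m'.
by rewrite /TV /= TT_dd // -mulNr.
Qed.

Lemma coef_wP b k : (wP b)`_k = (b == k.+1)%:R.
Proof. by case: b => [|b] /=; rewrite ?coef0 // coefXn eqSS eq_sym. Qed.

Section Half.
Variable S S' : {poly int} -> V -> Prop.
Hypothesis Swt : forall k x, S k x -> wt Nv k x.
Hypothesis SE : Estable Ev S (Fsp Fv S).

Lemma PsP_Fsp : (forall k x b, S k x -> dominant (k + wP b) -> S' (k + wP b) (PsP b x)) ->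
  forall k x b, Fsp Fv S k x -> Fsp Fv S' (k + wP b) (PsP b x).
Proof.
move=> H k x b hx.
apply: (@Np_Fsp V Ev Fv Nv EFv EFvne NFv Nneg nat (fun b => [the {linear V -> V} of PsP b]) wP
  (fun i b => (b == i.+1)%:R) (fun i b => (b == i.+2)%:R) (fun i _ => i.+2) (fun i _ => i.+1)
  _ _ _ _ _ S Swt SE S' H); last exact: Np_psi.
- by move=> i l y; rewrite /= TV_PsP.
- by move=> i l y; rewrite /= TV_PsP.
- by move=> j l y; rewrite /= TV_PsP coef_wP; case: eqP => [->|_]; rewrite ?scale0r ?mulr0z // .
- by move=> i l; case: (l =P i.+1) => [-> _ | _]; rewrite ?eqxx // wP_alpha.
- by move=> i l; case: (l =P i.+2) => [-> _ | _]; rewrite ?eqxx // wP_alpha subrK.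
Qed.

Lemma PsM_Fsp : (forall k x a, S k x -> dominant (k - wP a) -> S' (k - wP a) (PsM a x)) ->
  forall k x a, Fsp Fv S k x -> Fsp Fv S' (k - wP a) (PsM a x).
Proof.
move=> H k x a hx.
apply: (@Np_Fsp V Ev Fv Nv EFv EFvne NFv Nneg nat (fun b => [the {linear V -> V} of PsM b]) (fun a => - wP a)
  (fun i b => - (b == i.+2)%:R) (fun i b => - (b == i.+1)%:R) (fun i _ => i.+1) (fun i _ => i.+2)
  _ _ _ _ _ S Swt SE S' H); last exact: Np_psi.
- by move=> i l y; rewrite /= TV_PsM.
- by move=> i l y; rewrite /= TV_PsM.
- move=> j l y; rewrite /= TV_PsM coefN coef_wP rmorphN /=.
  by case: eqP => [->|_]; rewrite ?oppr0 ?scale0r ?mulr0z.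
- by move=> i l; case: (l =P i.+2) => [-> _ | _]; rewrite ?oppr0 ?eqxx // wP_alpha opprB addrAC subrr add0r.
- by move=> i l; case: (l =P i.+1) => [-> _ | _]; rewrite ?oppr0 ?eqxx // wP_alpha opprB addrC.
Qed.
End Half.

Definition pw (al : seq nat) : {poly int} := Poly [seq (x%:Z)%R | x <- al].

Lemma coef_pw al k : (pw al)`_k = (nth 0%N al k)%:Z.
Proof.
rewrite coef_Poly; have [h | h] := ltnP k (size al); first by rewrite (nth_map 0%N).
by rewrite !nth_default ?size_map.
Qed.

Lemma pw_nil : pw [::] = 0. Proof. by []. Qed.

Lemma pw_incr al i : pw (incr_nth al i) = pw al + 'X^i.
Proof.
apply/polyP => k; rewrite coefD !coef_pw coefXn nth_incr_nth eq_sym addnC PoszD.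
by case: (k == i).
Qed.

Lemma pw_adbox be b ga : adbox be b = Some ga -> pw ga = pw be + wP b.
Proof.
case: b => [[<-]|b] /=; first by rewrite addr0.
by case: ifP => // _ [<-]; exact: pw_incr.
Qed.

Lemma sorted_geqP (l : seq nat) : reflect (forall i, nth 0 l i.+1 <= nth 0 l i)%N (sorted geq l).
Proof.
apply: (iffP (sortedP 0%N)) => H i; last by move=> _; apply: H.
have [h | h] := ltnP i.+1 (size l); first exact: H.
by rewrite nth_default.
Qed.

Lemma is_partP l : is_part l <->
  (forall i, nth 0 l i.+1 <= nth 0 l i)%N /\ (forall i, (i < size l)%N -> (0 < nth 0 l i)%N).
Proof.
rewrite /is_part; split=> [/andP [/sorted_geqP h1 /(all_nthP 0%N) h2] // | [h1 h2]].
by apply/andP; split; [apply/sorted_geqP | apply/(all_nthP 0%N)].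
Qed.

Lemma adbox_dom be b : is_part be -> dominant (pw be + wP b) -> exists ga, adbox be b = Some ga.
Proof.
case: b => [|b] pb; first by exists be.
rewrite /wP -pw_incr /adbox => dom; exists (incr_nth be b).
have dom' k : (nth 0 (incr_nth be b) k.+1 <= nth 0 (incr_nth be b) k)%N.
  by have := dom k; rewrite !coef_pw lez_nat.
(* Past the end [incr_nth] would insert rows of length zero above the new box; dominance forbids
   this. *)
have hb : (b <= size be)%N.
  rewrite leqNgt; apply/negP => h; case: b dom dom' h => // b dom dom' h.
  have := dom' b; rewrite nth_incr nth_incr_nth (gtn_eqF (ltnSn b)) add0n.
  by rewrite [X in (_ <= X)%N]nth_default.
rewrite ifT //; apply/is_partP; split=> // k; have /is_partP [h1 h2] := pb.
rewrite size_incr_nth; case: (ltnP b (size be)) => hi hk.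
  by rewrite nth_incr_nth; apply/ltn_addl/h2.
rewrite nth_incr_nth; have [_ // | kb] := eqVneq b k.
by rewrite add0n h2 //; move: kb hk hb hi; lia.
Qed.

Lemma set_nth_incr l i : (i < size l)%N -> (0 < nth 0 l i)%N ->
  incr_nth (set_nth 0%N l i (nth 0 l i).-1) i = l.
Proof.
move=> h0 h1; have sl : size (set_nth 0%N l i (nth 0%N l i).-1) = size l.
  by rewrite size_set_nth; apply/maxn_idPr.
apply: (@eq_from_nth _ 0%N); first by rewrite size_incr_nth sl h0.
move=> k _; rewrite nth_incr_nth nth_set_nth /= eq_sym; case: (k =P i) => [-> | _] //.
by rewrite add1n prednK.
Qed.

Lemma pw_strip0 l : pw (strip0 l) = pw l.
Proof.
apply/polyP => k; rewrite !coef_pw; congr Posz.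
elim/last_ind: l => // l x IH; have [-> | x0] := eqVneq x 0%N; last by rewrite strip0_rcons.
rewrite strip0_rcons0 IH nth_rcons; case: ltngtP => // h; rewrite nth_default //.
  exact: ltnW.
by rewrite h.
Qed.

Lemma strip0_all l : (forall i, nth 0 l i.+1 <= nth 0 l i)%N -> is_part (strip0 l).
Proof.
elim/last_ind: l => // l x IH H; have [x0 | x0] := eqVneq x 0%N.
  rewrite x0 strip0_rcons0; apply: IH => i.
  have := H i; rewrite x0 !nth_rcons.
  case: (ltnP i.+1 (size l)) => h; first by rewrite (ltnW h).
  by move=> _; rewrite [X in (X <= _)%N]nth_default.
rewrite strip0_rcons //; apply/is_partP; split=> // i.
rewrite size_rcons ltnS => hi.
have mono d k : (nth 0 (rcons l x) (k + d) <= nth 0 (rcons l x) k)%N.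
  by elim: d => [|d IHd]; rewrite ?addn0 // addnS; apply: leq_trans (H _) IHd.
apply: leq_trans (mono (size l - i)%N i); rewrite subnKC // nth_rcons ltnn eqxx.
by rewrite lt0n.
Qed.

Lemma rmbox_dom al a : is_part al -> dominant (pw al - wP a) ->
  exists2 be, rmbox al a = Some be & pw be = pw al - wP a.
Proof.
case: a => [|a] pal dom; first by exists al => //; rewrite subr0.
have [h1 h2] := (is_partP al).1 pal.
have ha : (a < size al)%N.
  rewrite ltnNge; apply/negP => h.
  have e1 : nth 0%N al a = 0%N by rewrite nth_default.
  have e2 : nth 0%N al a.+1 = 0%N by rewrite nth_default // ltnW.
  have := dom a; rewrite !coefB !coef_pw !coef_wP e1 e2 eqxx.
  by rewrite (ltn_eqF (ltnSn _)).
have e : pw (set_nth 0%N al a (nth 0 al a).-1) = pw al - wP a.+1.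
  by have := congr1 pw (set_nth_incr ha (h2 _ ha)); rewrite pw_incr => <-; rewrite addrK.
exists (strip0 (set_nth 0%N al a (nth 0 al a).-1)); last by rewrite pw_strip0.
rewrite /rmbox ha strip0_all // => i; rewrite -lez_nat -!coef_pw e; exact: dom.
Qed.
End VecModel.

(** * Straightening of word vectors with a prescribed beginning *)

Section Words.
Variable n : nat.
Local Notation I := 'I_n.+1.
Local Notation word := (seq (nat * nat)).
Local Notation V := (V n).
Local Notation Ev := (@Ev n).
Local Notation Fv := (@Fv n).
Local Notation Nv := (@Nv n).

Definition vacV : V := fun g => if g is [::] then @vac n else fun=> 0.
Definition pstep (x : V) (ab : nat * nat) : V := PsP ab.2 (PsM ab.1 x).
Definition uext (x : V) (w : word) : V := foldl pstep x w.
Definition uvec (w : word) : V := uext vacV w.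

Lemma uvec_rcons w ab : uvec (rcons w ab) = pstep (uvec w) ab.
Proof. by rewrite /uvec /uext -cats1 foldl_cat. Qed.

Lemma uvec_cat w v : uvec (w ++ v) = uext (uvec w) v.
Proof. by rewrite /uvec /uext foldl_cat. Qed.

Lemma uext_Uf (w : word) (g g0 : seq I) x : size w = size g -> uext x w (rev g ++ g0) = Uf (x g0) w g.
Proof.
elim: w g g0 x => [|[a b] w IH] [|v g] g0 x //= [sw].
by rewrite rev_cons cat_rcons IH.
Qed.

Lemma uvec_Uf (w : word) g : size w = size g -> uvec w (rev g) = Uf (@vac n) w g.
Proof. by move=> h; have := @uext_Uf w g [::] vacV h; rewrite cats0. Qed.

Definition wl (ab : nat * nat) : {poly int} := wP ab.2 - wP ab.1.
Definition wtw (w : word) : {poly int} := \sum_(ab <- w) wl ab.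
Lemma wtw_rcons w ab : wtw (rcons w ab) = wtw w + wl ab.
Proof. by rewrite /wtw -cats1 big_cat big_seq1. Qed.
Lemma wtw_cat w v : wtw (w ++ v) = wtw w + wtw v.
Proof. by rewrite /wtw big_cat. Qed.
Lemma wtw_cons ab w : wtw (ab :: w) = wl ab + wtw w.
Proof. by rewrite /wtw big_cons. Qed.

Lemma wt_PsP k b x : wt Nv k x -> wt Nv (k + wP b) (PsP b x).
Proof.
move=> hx j; rewrite /= TV_PsP -/(Nv j x) hx linearZ_LR coefD rmorphD scalerDl coef_wP.
by case: eqP => [-> |_]; rewrite ?mulr0z ?scale0r.
Qed.
Lemma wt_PsM k a x : wt Nv k x -> wt Nv (k - wP a) (PsM a x).
Proof.
move=> hx j; rewrite /= TV_PsM -/(Nv j x) hx linearZ_LR coefB rmorphB scalerBl coef_wP scaleNr.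
by case: eqP => [-> |_]; rewrite ?mulr0z ?scale0r.
Qed.

Lemma TV_vac i j : TV i.+1 j vacV = 0.
Proof.
apply: funext => -[|v g]; apply: funext => m; rewrite /TV /=; first exact: TT_vac.
by apply: big1 => w _; rewrite -[RHS](yy0 j w m); apply: yyE => m'.
Qed.

Lemma uvec_wt w : wt Nv (wtw w) (uvec w).
Proof.
elim/last_ind: w => [|w ab IH].
  by move=> i; rewrite /wtw big_nil coef0 mulr0z scale0r /= TV_vac.
rewrite wtw_rcons uvec_rcons /wl addrA addrAC; exact/wt_PsP/wt_PsM.
Qed.

Lemma kend_rcons al t ab : kend al (rcons t ab) =
  if kend al t is Some x then kend x [:: ab] else None.
Proof. by elim: t al => [|[a b] t IH] al //=; case: (rmbox al a) => // be; case: (adbox be b). Qed.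

Lemma kend_cat al t v : kend al (t ++ v) = if kend al t is Some x then kend x v else None.
Proof. by elim: t al => [|[a b] t IH] al //=; case: (rmbox al a) => // be; case: (adbox be b). Qed.

Lemma kend_part al t nu : is_part al -> kend al t = Some nu -> is_part nu /\ pw nu = pw al + wtw t.
Proof.
elim: t al => [|[a b] t IH] al pal.
  by case=> <-; rewrite /wtw big_nil addr0.
move=> h; have [be [ga [ea eb ek ab [pb pg]]]] := kend_cons h pal.
have [pn ->] := IH _ pg ek; split=> //.
rewrite (pw_adbox eb) (pw_adbox ab) wtw_cons /wl /= !addrA; congr (_ + _).
by rewrite [_ + wP a + _]addrAC addrK.
Qed.

Lemma kend0_part t nu : kend [::] t = Some nu -> is_part nu /\ pw nu = wtw t.
Proof. by move=> h; have [p ->] := @kend_part [::] t nu isT h; rewrite pw_nil add0r. Qed.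

(* Seeds attached to a set of tableaux starting at the empty partition. *)
Definition SW (W : word -> Prop) (k : {poly int}) (x : V) : Prop :=
  exists t al, [/\ W t, kend [::] t = Some al, k = pw al & x = uvec t].

Lemma SW_wt W k x : SW W k x -> wt Nv k x.
Proof. by move=> [t [al [_ /kend0_part [_ ->] -> ->]]]; apply: uvec_wt. Qed.

(** Straightening must not disturb the first steps, so a set of beginnings is extended one step at a
    time. *)
Definition extW (W : word -> Prop) (t : word) :=
  exists t0 ab, [/\ W t0, t = rcons t0 ab & kend [::] t != None].

Section Ext.
Variable W : word -> Prop.
Hypothesis WE : Estable Ev (SW W) (Fsp Fv (SW W)).

(** Seeds in the middle of a step: removal and addition transform differently under [gl] and are
    straightened separately. *)
Let SM (k : {poly int}) (x : V) : Prop :=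
  exists t al a be, [/\ W t, kend [::] t = Some al, rmbox al a = Some be, k = pw be & x = PsM a (uvec t)].

Lemma SM_Fsp k x a : Fsp Fv (SW W) k x -> Fsp Fv SM (k - wP a) (PsM a x).
Proof.
apply: PsM_Fsp => //; first exact: SW_wt.
move=> {}k {}x {}a [t [al [hW hk -> ->]]] dom.
have [pal _] := kend0_part hk.
by have [be e1 e2] := rmbox_dom pal dom; exists t, al, a, be; rewrite e2.
Qed.

Lemma SM_wt k x : SM k x -> wt Nv k x.
Proof.
move=> [t [al [a [be [hW hk ha -> ->]]]]]; have [pal e] := kend0_part hk.
have [pb ab] := rmbox_ad pal ha.
have -> : pw be = wtw t - wP a by rewrite -e (pw_adbox ab) addrK.
exact/wt_PsM/uvec_wt.
Qed.

Lemma SM_E : Estable Ev SM (Fsp Fv SM).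
Proof.
move=> k x i [t [al [a [be [hW hk ha -> ->]]]]]; have [pal e] := kend0_part hk.
have [pb ab] := rmbox_ad pal ha; have eb : pw be = pw al - wP a by rewrite (pw_adbox ab) addrK.
have hS : SW W (pw al) (uvec t) by exists t, al.
rewrite /= TV_PsM; apply: Fsp_D.
  by apply: Fsp_eq (SM_Fsp a (WE i hS)) _ _ => //; rewrite eb addrAC.
case: (a =P i.+1) => [e1|_]; last by rewrite oppr0 scale0r; apply: Fsp_0.
apply/Fsp_Z/(Fsp_eq (SM_Fsp i.+2 (Fsp_seed _ hS))) => //.
by rewrite eb e1 wP_alpha opprB addrCA addrC.
Qed.

Lemma extW_Fsp k x a b : Fsp Fv (SW W) k x -> Fsp Fv (SW (extW W)) (k - wP a + wP b) (pstep x (a, b)).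
Proof.
move=> h; apply: (@PsP_Fsp n SM) (SM_Fsp a h); [exact: SM_wt | exact: SM_E|].
move=> {h}k {}x {}b [t [al [a0 [be [hW hk ha -> ->]]]]] dom.
have [pal e] := kend0_part hk; have [pb ab] := rmbox_ad pal ha.
have [ga hb] := adbox_dom pb dom.
have ek : kend [::] (rcons t (a0, b)) = Some ga by rewrite kend_rcons hk /= ha hb.
exists (rcons t (a0, b)), ga; split=> //; last by rewrite uvec_rcons.
- by exists t, (a0, b); rewrite ek.
- by rewrite (pw_adbox hb).
Qed.

Lemma extW_E : Estable Ev (SW (extW W)) (Fsp Fv (SW (extW W))).
Proof.
move=> k x i [t' [al' [[t [[a b] [hW et _]] hk -> ->]]]].
move: hk; rewrite {t'}et kend_rcons; case hk: (kend [::] t) => [al|] // hab.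
have [pal _] := kend0_part hk.
have hS : Fsp Fv (SW W) (pw al) (uvec t) by apply: Fsp_seed; exists t, al.
have hE : Fsp Fv (SW W) (pw al + alpha i) (Ev i (uvec t)) by apply: WE; exists t, al.
have [_ ->] := kend_part pal hab.
rewrite uvec_rcons /pstep /= TV_PsP TV_PsM linearD linearZ_LR /= wtw_cons /wtw big_nil addr0 /wl /=.
apply: Fsp_D; first apply: Fsp_D.
- by apply: Fsp_eq (extW_Fsp a b hE) _ _ => //; ring.
- case: (a =P i.+1) => [e1|_]; last by rewrite oppr0 scale0r; apply: Fsp_0.
  by apply/Fsp_Z/(Fsp_eq (extW_Fsp i.+2 b hS)) => //; rewrite e1 wP_alpha; ring.
- case: (b =P i.+2) => [e1|_]; last by rewrite scale0r; apply: Fsp_0.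
  by apply/Fsp_Z/(Fsp_eq (extW_Fsp a i.+1 hS)) => //; rewrite e1 wP_alpha; ring.
Qed.
End Ext.

Fixpoint extWn (W : word -> Prop) (s : nat) : word -> Prop :=
  if s is s'.+1 then extWn (extW W) s' else W.

Lemma extWn_spec W s t : extWn W s t -> exists t0 v, [/\ W t0, size v = s & t = t0 ++ v].
Proof.
elim: s W t => [|s IH] W t /=; first by move=> h; exists t, [::]; rewrite cats0.
move=> /IH [t0 [v [[t1 [ab [h1 -> _]]] sv ->]]]; exists t1, (ab :: v).
by rewrite /= sv cat_rcons.
Qed.

Lemma extWn_kend W s t : (0 < s)%N -> extWn W s t -> kend [::] t != None.
Proof.
case: s => // s _; elim: s W t => [|s IH] W t /=; first by move=> [t0 [ab []]].
exact: IH.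
Qed.

(** An arbitrary suffix is thereby rewritten without leaving the tableaux that begin in [W]. *)
Lemma extWn_Fsp W s v k x : Estable Ev (SW W) (Fsp Fv (SW W)) -> size v = s ->
  Fsp Fv (SW W) k x -> Fsp Fv (SW (extWn W s)) (k + wtw v) (uext x v).
Proof.
elim: s W v k x => [|s IH] W [|[a b] v] k x //= WE.
  by move=> _; rewrite /wtw big_nil addr0.
move=> [sv] hx; rewrite wtw_cons addrA; apply: IH => //; first exact: extW_E.
by apply: Fsp_eq (extW_Fsp WE a b hx) _ _ => //; rewrite /wl addrA addrAC.
Qed.

Definition Tab (r : nat) (t : word) : Prop := size t = r /\ kend [::] t != None.

Lemma SW_mono (W W' : word -> Prop) : (forall t, W t -> W' t) ->
  forall k x, Fsp Fv (SW W) k x -> Fsp Fv (SW W') k x.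
Proof.
move=> H k x h; apply: (@Fsp_sub _ Fv (SW W) (SW W') (fun _ => True)) h _ => //.
by move=> {}k {}x _ [t [al [h1 h2 h3 h4]]]; exists t, al; split; auto.
Qed.

Lemma uvec_Fsp w : Fsp Fv (SW (Tab (size w))) (wtw w) (uvec w).
Proof.
have E0 : Estable Ev (SW (fun t => t = [::])) (Fsp Fv (SW (fun t => t = [::]))).
  by move=> k x i [t [al [-> _ _ ->]]]; rewrite /= TV_vac; apply: Fsp_0.
have h0 : Fsp Fv (SW (fun t => t = [::])) 0 vacV by apply: Fsp_seed; exists [::], [::].
have := extWn_Fsp E0 (erefl (size w)) h0; rewrite add0r; apply: SW_mono => t ht.
have [t0 [v [e1 e2 e3]]] := extWn_spec ht; rewrite e3 e1 /=; split=> //.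
have [s0 | s0] := posnP (size w).
  by move: e2; rewrite s0 => /size0nil ->.
by have := extWn_kend s0 ht; rewrite e3 e1.
Qed.

Lemma Tab_E r : Estable Ev (SW (Tab r)) (Fsp Fv (SW (Tab r))).
Proof.
elim: r => [|r IH].
  by move=> k x i [t [al [[/size0nil -> _] _ _ ->]]]; rewrite /= TV_vac; apply: Fsp_0.
have h := extW_E IH.
have H t : extW (Tab r) t <-> Tab r.+1 t.
  split; first by move=> [t0 [ab [[<- _] -> k0]]]; rewrite /Tab size_rcons.
  case/lastP: t => [[]|t ab] //; rewrite /Tab size_rcons => -[[st] hk].
  exists t, ab; split=> //; split=> //.
  by move: hk; rewrite kend_rcons; case: (kend _ t).
move=> k x i [t [al [h1 h2 h3 h4]]]; apply: (@SW_mono (extW (Tab r))); first by move=> t' /H.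
by apply: h; exists t, al; split=> //; apply/H.
Qed.

(** [E] raises weights, so it sends a seed of [W] into weights of [D], where by [Fsp_sub] only seeds
    of weight in [D] contribute. *)
Lemma restrict_E r (D : {poly int} -> Prop) (W : word -> Prop) :
  (forall k i, D k -> D (k + alpha i)) ->
  (forall t, W t -> Tab r t) ->
  (forall t al, Tab r t -> kend [::] t = Some al -> D (pw al) -> W t) ->
  (forall t al i, W t -> kend [::] t = Some al -> D (pw al + alpha i)) ->
  Estable Ev (SW W) (Fsp Fv (SW W)).
Proof.
move=> HD W1 W2 W3 k x i [t [al [h1 h2 -> ->]]].
have hE : Fsp Fv (SW (Tab r)) (pw al + alpha i) (Ev i (uvec t)).
  by apply: Tab_E; exists t, al; split=> //; apply: W1.
apply: (Fsp_sub HD) hE (W3 _ _ _ h1 h2) => {}k {}x dk [t' [al' [e1 e2 e3 e4]]].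
by exists t', al'; split=> //; apply: W2 e1 e2 _; rewrite -e3.
Qed.
End Words.

(** * The contravariant pairing of words *)

Section Kernel.
Variable n : nat.
Local Notation I := 'I_n.+1.
Local Notation word := (seq (nat * nat)).
Local Notation V := (V n).
Local Notation Fck := (Fck n).
Local Notation Ev := (@Ev n).
Local Notation Fv := (@Fv n).
Local Notation Nv := (@Nv n).
Local Notation uvec := (@uvec n).
Local Notation o0 := ((fun _ => 0%N) : Occ n).

Lemma Dop_E a b v (phi psi : Fck) m : (forall m, phi m = psi m) -> Dop a b v phi m = Dop a b v psi m.
Proof. by move=> e; apply: yyE => m'; apply: ddE. Qed.
Lemma DopD a b v (phi psi : Fck) m :
  Dop a b v (fun m => phi m + psi m) m = Dop a b v phi m + Dop a b v psi m.
Proof. by rewrite /Dop -yyD; apply: yyE => m'; rewrite ddD. Qed.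
Lemma DopZ a b v c (phi : Fck) m : Dop a b v (fun m => c * phi m) m = c * Dop a b v phi m.
Proof. by rewrite /Dop -yyZ; apply: yyE => m'; rewrite ddZ. Qed.
Lemma Dop_sum a b v (J : Type) (s : seq J) (phi : J -> Fck) m :
  Dop a b v (fun m => \sum_(j <- s) phi j m) m = \sum_(j <- s) Dop a b v (phi j) m.
Proof. by rewrite /Dop -yy_sum; apply: yyE => m'; rewrite dd_sum. Qed.

Lemma Dop_TT i j a b v (phi : Fck) m : i != 0%N -> j != 0%N ->
  Dop b a v (TT i j phi) m = TT i j (Dop b a v phi) m
    + ((b == j)%:R * Dop i a v phi m - (a == i)%:R * Dop b j v phi m).
Proof.
move=> i0 j0; rewrite /Dop TT_yy //.
rewrite [in X in _ = yy _ _ X _ + _ + _](_ : TT i j (dd b v phi) =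
  fun m => dd b v (TT i j phi) m + (- (b == j)%:R) * dd i v phi m); last first.
  by apply: funext => m'; rewrite TT_dd // mulNr.
by rewrite yyD yyZ mulNr; ring.
Qed.

Lemma Lf_E q f (phi psi : Fck) m : (forall m, phi m = psi m) -> Lf q f phi m = Lf q f psi m.
Proof.
by elim: q f m => [|[a b] q IH] [|v f] m e //=; apply: Dop_E => m'; apply: IH.
Qed.
Lemma LfD q f (phi psi : Fck) m :
  Lf q f (fun m => phi m + psi m) m = Lf q f phi m + Lf q f psi m.
Proof.
elim: q f m => [|[a b] q IH] [|v f] m //=; rewrite -DopD.
by apply: Dop_E => m'; apply: IH.
Qed.
Lemma LfZ q f c (phi : Fck) m : Lf q f (fun m => c * phi m) m = c * Lf q f phi m.
Proof.
elim: q f m => [|[a b] q IH] [|v f] m //=; rewrite -DopZ.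
by apply: Dop_E => m'; apply: IH.
Qed.

(** The derivation by which a recolouring acts on the letters of [q]: every half step is altered in
    turn, with a sign for removals. *)
Fixpoint modl (i j : nat) (q : word) : seq (rat * word) :=
  if q is (a, b) :: t then
    [:: ((b == j)%:R, (a, i) :: t); (- (a == i)%:R, (j, b) :: t)] ++
    [seq (p.1, (a, b) :: p.2) | p <- modl i j t]
  else [::].

Lemma Lf_TT i j q f (psi : Fck) m : i != 0%N -> j != 0%N -> size q = size f ->
  Lf q f (TT i j psi) m = TT i j (Lf q f psi) m + \sum_(p <- modl i j q) p.1 * Lf p.2 f psi m.
Proof.
move=> i0 j0; elim: q f m => [|[a b] q IH] [|v f] m //=; first by rewrite big_nil addr0.
move=> [sq]; rewrite (@Dop_E _ _ _ _ (fun m => TT i j (Lf q f psi) m +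
  \sum_(p <- modl i j q) p.1 * Lf p.2 f psi m)); last by move=> m'; apply: IH.
rewrite DopD Dop_TT // !big_cons big_map /= mulNr -!addrA; congr (_ + (_ + (_ + _))).
by rewrite Dop_sum; apply: eq_bigr => p _; rewrite DopZ.
Qed.

Lemma modl_spec i q p : p \in modl i.+1 i.+2 q -> p.1 != 0 ->
  size p.2 = size q /\ wtw p.2 = wtw q + alpha i.
Proof.
elim: q p => [|[a b] q IH] p //=; rewrite !inE => /or3P [/eqP -> | /eqP -> | /mapP [p' hp ->]] /=.
- case: (b =P i.+2) => [-> _ | _]; last by rewrite eqxx.
  by split=> //; rewrite !wtw_cons /wl /alpha /=; ring.
- case: (a =P i.+1) => [-> _ | _]; last by rewrite oppr0 eqxx.
  by split=> //; rewrite !wtw_cons /wl /alpha /=; ring.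
move=> h; have [-> e] := IH _ hp h; split=> //.
by rewrite !wtw_cons e addrA.
Qed.

Lemma sum_modl k q f (psi : Fck) m : \sum_(p <- modl k.+1 k.+1 q) p.1 * Lf p.2 f psi m =
  ((wtw q)`_k)%:~R * Lf q f psi m.
Proof.
elim: q f m => [|[a b] q IH] f m; first by rewrite /wtw !big_nil coef0 mulr0z mul0r.
rewrite /= !big_cons big_map /= wtw_cons coefD rmorphD /= /wl coefB !coef_wP /=.
have e1 : (b == k.+1)%:R * Lf ((a, k.+1) :: q) f psi m = (b == k.+1)%:R * Lf ((a, b) :: q) f psi m.
  by case: (b =P k.+1) => [-> | _]; rewrite ?mul0r.
have e2 : (a == k.+1)%:R * Lf ((k.+1, b) :: q) f psi m = (a == k.+1)%:R * Lf ((a, b) :: q) f psi m.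
  by case: (a =P k.+1) => [-> | _]; rewrite ?mul0r.
rewrite mulNr e1 e2 mulrDl addrA rmorphB mulrBl; congr (_ - _ + _); try by case: (_ == _).
case: f {e1 e2} => [|v f] /=.
  have nil w : Lf w [::] psi = psi by case: w => [|[]].
  by rewrite -[psi m in RHS]/(psi m) -{2}(nil q) -IH; apply: eq_bigr => p _; rewrite nil.
rewrite -DopZ (@Dop_E _ _ _ _ (fun m => \sum_(p <- modl k.+1 k.+1 q) p.1 * Lf p.2 f psi m)).
  by rewrite Dop_sum; apply: eq_bigr => p _; rewrite DopZ.
by move=> m'; rewrite IH.
Qed.

(** The list is reversed because vectors keep their latest letter first; evaluation at the zero
    occupation pairs with the vacuum. *)
Definition KK (q : word) (x : V) (f g : seq I) : rat := Lf q f (x (rev g)) o0.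

Lemma KKD q x y f g : KK q (x + y) f g = KK q x f g + KK q y f g.
Proof. exact: LfD. Qed.
Lemma KKZ q c x f g : KK q (c *: x) f g = c * KK q x f g.
Proof. exact: LfZ. Qed.
Lemma KK0 q f g : KK q 0 f g = 0.
Proof. by have := KKZ q 0 0 f g; rewrite scale0r mul0r. Qed.

Lemma TT_o0 i j (phi : Fck) : j != 0%N -> TT i j phi o0 = 0.
Proof. by move=> j0; apply: big1 => v _; rewrite /yy (negPf j0) mul0r. Qed.

(** Evaluation at zero kills anything beginning with a creation, so only the derivation on [q]
    remains; by [modl_spec] its words have a weight higher by a root. *)
Lemma KK_F q i x f g : size q = size f ->
  KK q (Fv i x) f g = \sum_(p <- modl i.+1 i.+2 q) p.1 * KK p.2 x f g.
Proof. by move=> sq; rewrite /KK /= Lf_TT // TT_o0 // add0r. Qed.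

(** A number operator may be evaluated on either argument, so words of different weight are
    orthogonal. *)
Lemma KK_wt q w f g : size q = size f -> wtw q != wtw w -> KK q (uvec w) f g = 0.
Proof.
move=> sq h; have [k hk] : exists k, (wtw q)`_k != (wtw w)`_k.
  have [//|H] := pselect (exists k, (wtw q)`_k != (wtw w)`_k).
  by case/eqP: h; apply/polyP => k; apply/eqP/negPn/negP => hk; apply: H; exists k.
have e1 : KK q (Nv k (uvec w)) f g = ((wtw q)`_k)%:~R * KK q (uvec w) f g.
  by rewrite /KK /= Lf_TT // TT_o0 // add0r sum_modl.
have e2 : KK q (Nv k (uvec w)) f g = ((wtw w)`_k)%:~R * KK q (uvec w) f g.
  by rewrite uvec_wt KKZ.
apply/eqP; have := e1; rewrite e2 => /eqP; rewrite eq_sym -subr_eq0 -mulrBl mulf_eq0 subr_eq0 eqr_int.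
by rewrite (negPf hk).
Qed.

Definition op := (bool * (nat * I))%type.
Definition ap (o : op) (phi : Fck) : Fck := if o.1 then yy o.2.1 o.2.2 phi else dd o.2.1 o.2.2 phi.
Definition run (os : seq op) (phi : Fck) : Fck := foldr ap phi os.
Definition dag (o : op) : op := (~~ o.1, o.2).
Definition vev (os : seq op) : rat := run os (@vac n) o0.

Lemma run_cat os os' phi : run (os ++ os') phi = run os (run os' phi).
Proof. by rewrite /run foldr_cat. Qed.
Lemma run_E os (phi psi : Fck) m : (forall m, phi m = psi m) -> run os phi m = run os psi m.
Proof.
move=> e; elim: os m => //= o os IH m; rewrite /ap; case: ifP => _; [exact: yyE | exact: ddE].
Qed.
Lemma ap_sum o (J : Type) (s : seq J) (phi : J -> Fck) m :
  ap o (fun m => \sum_(j <- s) phi j m) m = \sum_(j <- s) ap o (phi j) m.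
Proof. by rewrite /ap; case: ifP => _; [apply: yy_sum | apply: dd_sum]. Qed.
Lemma apD o (phi psi : Fck) m : ap o (fun m => phi m + psi m) m = ap o phi m + ap o psi m.
Proof. by rewrite /ap; case: ifP => _; [apply: yyD | apply: ddD]. Qed.
Lemma ap_E o (phi psi : Fck) m : (forall m, phi m = psi m) -> ap o phi m = ap o psi m.
Proof. by move=> e; rewrite /ap; case: ifP => _; [apply: yyE | apply: ddE]. Qed.

(* Wick contraction: all ways of deleting one operator of the list equal to [o]. *)
Fixpoint contr (o : op) (os : seq op) : seq (seq op) :=
  if os is o' :: os' then
    (if o' == o then [:: os'] else [::]) ++ [seq o' :: s | s <- contr o os']
  else [::].

Lemma run_dd x os (phi : Fck) m : x.1 != 0%N ->
  dd x.1 x.2 (run os phi) m = run os (dd x.1 x.2 phi) m + \sum_(s <- contr (true, x) os) run s phi m.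
Proof.
move=> x0; elim: os m => [|o os IH] m; first by rewrite big_nil addr0.
rewrite /= big_cat big_map /=.
have e : ap o (dd x.1 x.2 (run os phi)) m = ap o (run os (dd x.1 x.2 phi)) m +
   \sum_(s <- contr (true, x) os) ap o (run s phi) m.
  by rewrite -ap_sum -apD; apply: ap_E.
transitivity (ap o (dd x.1 x.2 (run os phi)) m + (o == (true, x))%:R * run os phi m); last first.
  rewrite e; case: eqP => _; rewrite ?big_seq1 ?big_nil ?mul1r ?mul0r; ring.
case: o {e} => [[] y]; rewrite /ap /=.
  rewrite dd_yy; congr (_ + _ * _); congr (_%:R).
  by rewrite x0 andbT xpair_eqE /= -xpair_eqE -!surjective_pairing eq_sym.
by rewrite dd_dd ?xpair_eqE /= mul0r addr0.
Qed.

Lemma run_yy x os (phi : Fck) m : x.1 != 0%N ->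
  run os (yy x.1 x.2 phi) m = yy x.1 x.2 (run os phi) m + \sum_(s <- contr (false, x) os) run s phi m.
Proof.
move=> x0; elim: os m => [|o os IH] m; first by rewrite big_nil addr0.
rewrite /= big_cat big_map /=.
have e : ap o (run os (yy x.1 x.2 phi)) m = ap o (yy x.1 x.2 (run os phi)) m +
   \sum_(s <- contr (false, x) os) ap o (run s phi) m.
  by rewrite -ap_sum -apD; apply: ap_E.
rewrite {}e; have -> : ap o (yy x.1 x.2 (run os phi)) m =
  yy x.1 x.2 (ap o (run os phi)) m + (o == (false, x))%:R * run os phi m; last first.
  case: eqP => _; rewrite ?big_seq1 ?big_nil ?mul1r ?mul0r; ring.
case: o => [[] y]; rewrite /ap /=.
  by rewrite yy_yy ?xpair_eqE /= mul0r addr0.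
rewrite dd_yy; congr (_ + _ * _); congr (_%:R).
have -> : ((false, y) == (false, x)) = (y.1 == x.1) && (y.2 == x.2).
  by rewrite xpair_eqE /=; case: (y) (x) => [? ?] [? ?]; rewrite xpair_eqE.
by case: (y.1 =P x.1) => // ->; rewrite x0 andbT.
Qed.

Lemma contr_size o os s : s \in contr o os -> size os = (size s).+1.
Proof.
elim: os s => //= o' os IH s; rewrite mem_cat => /orP [|/mapP [s' /IH -> ->] //].
by case: ifP => //; rewrite inE => _ /eqP ->.
Qed.

Lemma contr_cat o os os' : contr o (os ++ os') =
  [seq s ++ os' | s <- contr o os] ++ [seq os ++ s | s <- contr o os'].
Proof.
elim: os => [|o' os IH] /=; first by rewrite map_id_in.
rewrite IH !map_cat -!map_comp -catA; congr (_ ++ _); first by case: ifP.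
Qed.

Lemma dagK : involutive dag. Proof. by case=> [[] x]. Qed.

Lemma contr_rev o os : perm_eq (contr (dag o) (rev (map dag os))) [seq rev (map dag s) | s <- contr o os].
Proof.
elim: os => //= o' os IH; rewrite rev_cons -cats1 contr_cat /= cats0 map_cat -map_comp.
rewrite (inj_eq (inv_inj dagK)) perm_catC perm_cat //.
  by case: ifP => // _ /=; rewrite cats0.
rewrite [X in perm_eq _ X](_ : _ = [seq s ++ [:: dag o'] | s <- [seq rev (map dag s) | s <- contr o os]]).
  exact: perm_map.
by rewrite -!map_comp; apply: eq_map => s /=; rewrite rev_cons cats1.
Qed.

Lemma run0 os m : run os (fun _ => 0) m = 0.
Proof.
elim: os m => //= o os IH m; rewrite (@ap_E _ _ (fun _ => 0)) //.
by rewrite /ap; case: ifP => _; [apply: yy0 | rewrite /dd; case: ifP].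
Qed.

(** Induction on the length. An outermost creation gives zero, as does its adjoint next to the
    vacuum. An outermost annihilation is contracted with every matching creation, and by [contr_rev]
    the adjoint product has the same contractions. *)
Lemma vev_dag os : vev os = vev (rev (map dag os)).
Proof.
have [k] := ubnP (size os); elim: k os => // k IH [|[c [a v]] os] //=; rewrite ltnS => sk.
rewrite rev_cons -cats1 {2}/vev run_cat /=.
have [a0 | a0] := eqVneq a 0%N.
  rewrite a0; case: c; rewrite /vev /= /ap /= /yy /dd /=.
    by rewrite -/(vev os) IH // ltnW.
  by rewrite -/(vev os) IH // ltnW.
case: c; rewrite /ap /=.
  rewrite (@run_E _ _ (fun _ => 0)) ?run0; last by move=> m; apply: dd_vac.
  by rewrite /vev /= /ap /= /yy (negPf a0) mul0r.
have -> : vev ((false, (a, v)) :: os) = dd a v (run os (@vac n)) o0 by [].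
rewrite (@run_dd (a, v)) // (@run_yy (a, v)) //= {1}/yy (negPf a0) mul0r add0r.
rewrite (@run_E _ _ (fun _ => 0)) ?run0 ?add0r; last by move=> m; apply: dd_vac.
have p := contr_rev (true, (a, v)) os; rewrite /dag /= in p.
rewrite (perm_big _ p) /= big_map; apply: eq_big_seq => s hs.
by apply: IH; rewrite /= (contr_size hs) in sk; apply: ltnW.
Qed.

Fixpoint opsL (q : word) (f : seq I) : seq op :=
  match q, f with
  | (a, b) :: q', v :: f' => [:: (true, (a, v)); (false, (b, v))] ++ opsL q' f'
  | _, _ => [::]
  end.

Lemma Lf_run q f phi : Lf q f phi = run (opsL q f) phi.
Proof. by elim: q f => [|[a b] q IH] [|v f] //=; rewrite /Dop IH. Qed.
Lemma Uf_run w g phi : Uf phi w g = run (rev (map dag (opsL w g))) phi.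
Proof.
elim: w g phi => [|[a b] w IH] [|v g] phi //=.
by rewrite IH !rev_cons -!cats1 -catA run_cat.
Qed.

Lemma KK_sym q w f g : size q = size f -> size w = size g ->
  KK q (uvec w) f g = KK w (uvec q) g f.
Proof.
move=> sq sw; rewrite /KK !uvec_Uf // !Lf_run !Uf_run -!run_cat -/(vev _) -/(vev _) vev_dag.
by rewrite map_cat rev_cat map_rev revK (mapK dagK).
Qed.
End Kernel.

Lemma pw_inj al be : is_part al -> is_part be -> pw al = pw be -> al = be.
Proof.
move=> /is_partP [_ h1] /is_partP [_ h2] e.
have E i : nth 0%N al i = nth 0%N be i.
  by have := congr1 (fun p : {poly int} => p`_i) e; rewrite !coef_pw => -[].
apply: (@eq_from_nth _ 0%N) => // ; apply/eqP; rewrite eqn_leq; apply/andP; split.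
  by rewrite leqNgt; apply/negP => h; have := h1 _ h; rewrite E nth_default.
by rewrite leqNgt; apply/negP => h; have := h2 _ h; rewrite -E nth_default.
Qed.

(** * Two-sided straightening inside a space of kernels *)

Section WordSpan.
Variable n : nat.
Local Notation I := 'I_n.+1.
Local Notation word := (seq (nat * nat)).
Local Notation V := (V n).
Local Notation Ev := (@Ev n).
Local Notation Fv := (@Fv n).
Local Notation Nv := (@Nv n).
Local Notation uvec := (@uvec n).
Local Notation Ker := (seq I -> seq I -> rat).

Inductive Wsp (r : nat) : V -> Prop :=
| Wsp_w w : size w = r -> Wsp r (uvec w)
| Wsp_0 : Wsp r 0
| Wsp_D x y : Wsp r x -> Wsp r y -> Wsp r (x + y)
| Wsp_Z c x : Wsp r x -> Wsp r (c *: x).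

Lemma pstep_0 ab : pstep (0 : V) ab = 0.
Proof. by rewrite /pstep !linear0. Qed.
Lemma pstep_D x y ab : pstep (x + y : V) ab = pstep x ab + pstep y ab.
Proof. by rewrite /pstep !linearD. Qed.
Lemma pstep_Z c x ab : pstep (c *: x : V) ab = c *: pstep x ab.
Proof. by rewrite /pstep !linearZ_LR. Qed.

Lemma Wsp_pstep r x ab : Wsp r x -> Wsp r.+1 (pstep x ab).
Proof.
elim=> {x} [w sw||x y _ h1 _ h2|c x _ h].
- by rewrite -uvec_rcons; apply: Wsp_w; rewrite size_rcons sw.
- by rewrite pstep_0; apply: Wsp_0.
- by rewrite pstep_D; apply: Wsp_D.
- by rewrite pstep_Z; apply: Wsp_Z.
Qed.

Lemma Wsp_TV i j r x : Wsp r x -> Wsp r (TV i.+1 j.+1 x).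
Proof.
elim=> {x} [w <-||x y _ h1 _ h2|c x _ h]; first last.
- by rewrite linearZ_LR; apply: Wsp_Z.
- by rewrite linearD; apply: Wsp_D.
- by rewrite linear0; apply: Wsp_0.
elim/last_ind: w => [|w [a b] IH]; first by rewrite TV_vac; apply: Wsp_0.
rewrite uvec_rcons /pstep /= TV_PsP TV_PsM linearD linearZ_LR /= size_rcons.
have hw : Wsp (size w) (uvec w) by apply: Wsp_w.
apply: Wsp_D; first apply: Wsp_D.
- exact: (Wsp_pstep (a, b) IH).
- exact/Wsp_Z/(Wsp_pstep (i.+1, b) hw).
- exact/Wsp_Z/(Wsp_pstep (a, j.+1) hw).
Qed.

Lemma Fsp_Wsp r (W : word -> Prop) k x : (forall t, W t -> size t = r) -> Fsp Fv (SW W) k x -> Wsp r x.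
Proof.
move=> H; elim=> {k x} [k x [t [al [hW _ _ ->]]]|k|k x y _ h1 _ h2|k c x _ h|k i x _ h].
- exact/Wsp_w/H.
- exact: Wsp_0.
- exact: Wsp_D.
- exact: Wsp_Z.
- exact: Wsp_TV.
Qed.

Section KerSpace.
Variables (r : nat) (J : Ker -> Prop).
(** The last clause allows exchanging kernels that agree on words of length [r], the only ones on
    which a diagram acts. *)
Definition kspace := [/\ J (fun _ _ => 0), forall K K', J K -> J K' -> J (fun f g => K f g + K' f g),
  forall c K, J K -> J (fun f g => c * K f g) &
  forall K K', (forall f g, size f = r -> size g = r -> K f g = K' f g) -> J K -> J K'].
Hypothesis HJ : kspace.

Lemma J_lin q x : size q = r -> (forall w, size w = r -> J (KK q (uvec w))) -> Wsp r x -> J (KK q x).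
Proof.
have [J0 JD JZ Je] := HJ; move=> sq H; elim=> {x} [w /H //||x y _ h1 _ h2|c x _ h].
- by apply: Je J0 => f g _ _; rewrite KK0.
- by apply: Je (JD _ _ h1 h2) => f g _ _; rewrite KKD.
- by apply: Je (JZ c _ h) => f g _ _; rewrite KKZ.
Qed.

Lemma J_sum (T : eqType) (l : seq (rat * T)) (K : T -> Ker) :
  (forall p, p \in l -> p.1 != 0 -> J (K p.2)) -> J (fun f g => \sum_(p <- l) p.1 * K p.2 f g).
Proof.
have [J0 JD JZ Je] := HJ; elim: l => [|p l IH] H.
  by apply: Je J0 => f g _ _; rewrite big_nil.
have h1 : J (fun f g => p.1 * K p.2 f g).
  have [p0 | p0] := eqVneq p.1 0; first by apply: Je J0 => f g _ _; rewrite p0 mul0r.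
  by apply/JZ/H => //; rewrite mem_head.
have h2 : J (fun f g => \sum_(p <- l) p.1 * K p.2 f g).
  by apply: IH => p' hp'; apply: H; rewrite inE hp' orbT.
by apply: Je (JD _ _ h1 h2) => f g _ _; rewrite big_cons.
Qed.

(** Each [F] on the right moves to the left word and raises its weight, so only seeds and words of
    higher left weight remain to be treated. *)
Lemma J_step q (W : word -> Prop) k x : size q = r -> (forall t, W t -> size t = r) ->
  (forall t al, W t -> kend [::] t = Some al -> J (KK q (uvec t))) ->
  (forall q' i w, size q' = r -> wtw q' = wtw q + alpha i -> size w = r -> J (KK q' (uvec w))) ->
  Fsp Fv (SW W) k x -> J (KK q x).
Proof.
have [J0 JD JZ Je] := HJ; move=> sq sW hs hq.
elim=> {k x} [k x [t [al [hW hk _ ->]]]|k|k x y _ h1 _ h2|k c x _ h|k i x hx h].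
- exact: hs hk.
- by apply: Je J0 => f g _ _; rewrite KK0.
- by apply: Je (JD _ _ h1 h2) => f g _ _; rewrite KKD.
- by apply: Je (JZ c _ h) => f g _ _; rewrite KKZ.
apply: (Je (fun f g => \sum_(p <- modl i.+1 i.+2 q) p.1 * KK p.2 x f g)).
  by move=> f g sf sg; rewrite KK_F // sq.
apply: (@J_sum _ _ (fun q' => KK q' x)) => p hp p0; have [s2 w2] := modl_spec hp p0.
apply: J_lin; rewrite ?s2 //; last exact: Fsp_Wsp hx.
by move=> w sw; apply: (hq p.2 i) => //; rewrite s2.
Qed.
End KerSpace.

(** Induction on the height of the left weight. The right word is straightened, then the left one
    after transposing by [KK_sym]; all lowering terms fall under the induction, and orthogonality
    leaves pairs of tableaux of equal shape. *)
Lemma J_all r (D : {poly int} -> Prop) (J : Ker -> Prop) : kspace r J ->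
  (forall k i, D k -> D (k + alpha i)) ->
  (forall t t' al, Tab r t -> Tab r t' -> kend [::] t = Some al -> kend [::] t' = Some al ->
    D (pw al) -> J (KK t (uvec t'))) ->
  forall q w, size q = r -> size w = r -> D (wtw q) -> J (KK q (uvec w)).
Proof.
move=> HJ HD HS q w; have [J0 JD JZ Je] := HJ.
have [m hm] : exists m : nat, hgt (wtw q) < m%:Z.
  by exists `|hgt (wtw q)|.+1%N; apply: le_lt_trans (ler_norm _) _; rewrite -abszE ltz_nat.
have Z q' w' : size q' = r -> wtw q' != wtw w' -> J (KK q' (uvec w')).
  by move=> sq' h; apply: Je J0 => f g sf sg; rewrite KK_wt // sq'.
have Z' q' w' : size q' = r -> wtw q' != wtw w' -> J (fun f g => KK q' (uvec w') g f).
  by move=> sq' h; apply: Je J0 => f g sf sg; rewrite KK_wt // sq'.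
have HJ' : kspace r (fun K => J (fun f g => K g f)).
  split=> //; [by move=> K K' h1 h2; apply: JD h1 h2 | by move=> c K h; apply: JZ c _ h|].
  by move=> K K' e h; apply: Je h => f g sf sg; apply: e.
elim: m q w hm => [|m IH] q w hm sq sw dq.
  have [[i hi]|H] := pselect (exists i, (wtw q)`_i < 0); last first.
    suff : 0 <= hgt (wtw q) by rewrite leNgt hm.
    by apply: hgt_ge0 => i; rewrite leNgt; apply/negP => hi; apply: H; exists i.
  have [e | ne] := eqVneq (wtw q) (wtw w); last exact: Z.
  have -> : uvec w = 0 by apply: (Nneg hi); rewrite e; apply: uvec_wt.
  by apply: Je J0 => f g _ _; rewrite KK0.
have hi q' i : wtw q' = wtw q + alpha i -> hgt (wtw q') < m.
  by move=> ->; rewrite hgtD hgt_alpha; move: hm; lia.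
have hw := uvec_Fsp n w; rewrite sw in hw.
apply: (@J_step r J HJ q (Tab r) _ _ sq _ _ _ hw); first by move=> t [].
  move=> t al tt hk; have [_ et] := kend0_part hk.
  have [e | ne] := eqVneq (wtw q) (wtw t); last exact: Z.
  have st := tt.1.
  apply: (Je (fun f g => KK t (uvec q) g f)).
    by move=> f g sf sg; rewrite KK_sym // ?st ?sq.
  have hq := uvec_Fsp n q; rewrite sq in hq.
  apply: (@J_step r _ HJ' t (Tab r) _ _ st _ _ _ hq); first by move=> t' [].
    move=> t' al' tt' hk'; have [_ et'] := kend0_part hk'.
    have [e' | ne] := eqVneq (wtw t) (wtw t'); last exact: Z'.
    apply: (Je (KK t' (uvec t))).
      by move=> f g sf sg; rewrite KK_sym // ?tt'.1 ?st.
    have eal : al' = al.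
      have : pw al' = pw al by rewrite et' et e'.
      by apply: pw_inj; [have [] := kend0_part hk' | have [] := kend0_part hk].
    by apply: (HS t' t al tt' tt) => //; [rewrite hk' eal | rewrite et -e].
  move=> q' i w' sq' wq' sw'.
  have [e' | ne] := eqVneq (wtw q') (wtw w'); last exact: Z'.
  apply: (Je (KK w' (uvec q'))).
    by move=> f g sf sg; rewrite KK_sym // ?sq' ?sw'.
  apply: IH => //; rewrite -e'; first by apply: (hi _ i); rewrite wq' e.
  by rewrite wq' -e; apply: HD.
move=> q' i w' sq' wq' sw'; apply: IH => //; first exact: (hi _ i).
by rewrite wq'; apply: HD.
Qed.
End WordSpan.

(** * Dominance order on weights *)

Definition pc (k : {poly int}) (a : nat) : int := \sum_(i < a) k`_i.
(** The order of [gdom] extended from partitions to arbitrary weights, as needed for words that are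
    not tableaux. *)
Definition domw (be : seq nat) (k : {poly int}) : Prop :=
  k.[1] < (sumn be)%:Z \/
  [/\ k.[1] = (sumn be)%:Z, forall a, (psum be a)%:Z <= pc k a & k != pw be].

Lemma psum_sum l a : psum l a = (\sum_(i < a) nth 0 l i)%N.
Proof.
elim: a => [|a IH]; first by rewrite big_ord0 /psum take0.
by rewrite big_ord_recr /= -IH psumS.
Qed.

Lemma psum_over l a : (size l <= a)%N -> psum l a = sumn l.
Proof. by move=> h; rewrite /psum take_oversize. Qed.

Lemma pc_pw al a : pc (pw al) a = (psum al a)%:Z.
Proof.
rewrite /pc; elim: a => [|a IH]; first by rewrite big_ord0 /psum take0.
by rewrite big_ord_recr /= IH psumS coef_pw PoszD.
Qed.

Lemma pw1 al : (pw al).[1] = (sumn al)%:Z.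
Proof.
rewrite /pw; elim: al => [|x al IH]; first by rewrite horner0.
by rewrite /= horner_cons IH mulr1 addrC PoszD.
Qed.

Lemma pc_alpha i a : pc (alpha i) a = (a == i.+1)%:R.
Proof.
rewrite /pc; elim: a => [|a IH]; first by rewrite big_ord0.
rewrite big_ord_recr /= IH coef_alpha eqSS; case: (a =P i.+1) => [-> | _]; last by rewrite add0r subr0.
by rewrite (gtn_eqF (ltnSn i)) add0r subrr.
Qed.

Lemma pcD k l a : pc (k + l) a = pc k a + pc l a.
Proof. by rewrite /pc -big_split; apply: eq_bigr => i _; rewrite coefD. Qed.

Lemma domw_up be k i : domw be k -> domw be (k + alpha i).
Proof.
have a1 : (alpha i).[1] = 0 by rewrite /alpha hornerD hornerN !hornerXn !expr1n subrr.
case=> [h | [h1 h2 h3]]; first by left; rewrite hornerD a1 addr0.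
right; rewrite hornerD a1 addr0; split=> //.
  by move=> a; rewrite pcD pc_alpha (le_trans (h2 a)) // lerDl ler0n.
apply/eqP => e; have := h2 i.+1.
have := congr1 (fun p => pc p i.+1) e; rewrite pcD pc_alpha pc_pw eqxx /= => <-.
by rewrite gerDl ler10.
Qed.

(** The weight of [be] is itself excluded, but a single root suffices to enter: this is why a
    lowering operator moved onto a word of weight [be] gives an element of the ideal. *)
Lemma domw_alpha be i : domw be (pw be + alpha i).
Proof.
have a1 : (alpha i).[1] = 0 by rewrite /alpha hornerD hornerN !hornerXn !expr1n subrr.
right; rewrite hornerD a1 addr0 pw1; split=> //.
  by move=> a; rewrite pcD pc_alpha pc_pw lerDl ler0n.
apply/eqP => /(congr1 (fun p => pc p i.+1)); rewrite pcD pc_alpha eqxx => /eqP.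
by rewrite -subr_eq0 addrC addKr oner_eq0.
Qed.

Lemma gdomP al be : is_part al -> is_part be -> gdom al be <-> domw be (pw al).
Proof.
move=> pa pb; rewrite /gdom /domi /domw pw1 ltz_nat.
have ne : (al != be) = (pw al != pw be).
  by congr negb; apply/eqP/eqP => [-> // | ]; apply: pw_inj.
have [lt | ge] := ltnP (sumn al) (sumn be).
  rewrite /=; split=> [_ | _]; first by left.
  by apply/eqP => e; rewrite e ltnn in lt.
rewrite /= -ne; split.
  case/andP => /andP [/eqP h1 /allP h2] h3; right; split=> //; first by rewrite h1.
  move=> a; rewrite pc_pw lez_nat.
  have [-> | a0] := posnP a; first by rewrite /psum !take0.
  have [h | h] := leqP a (maxn (size al) (size be)).
    by apply: h2; rewrite mem_iota a0 add1n ltnS.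
  by rewrite !psum_over ?h1 // ltnW //; apply: leq_ltn_trans h; rewrite ?leq_maxl ?leq_maxr.
case=> [// | [[h1] h2 h3]]; rewrite h1 eqxx h3 andbT /=.
by apply/allP => a _; have := h2 a; rewrite pc_pw lez_nat.
Qed.

(** * The cellular basis as kernels *)

Section SpanP.
Variable r : nat.
Implicit Types S : alg r -> Prop.

Lemma spanP_in S v : S v -> spanP r S v.
Proof.
move=> h; exists [:: v], [:: 1]; split; first by move=> u; rewrite inE => /eqP ->.
by rewrite big_ord_recl big_ord0 addr0 /=; apply/ffunP => d; rewrite ffunE mul1r.
Qed.
Lemma scl_add c (v w : alg r) : scl c (v + w) = scl c v + scl c w.
Proof. by apply/ffunP => d; rewrite !ffunE mulrDr. Qed.
Lemma scl_scl c d (v : alg r) : scl c (scl d v) = scl (c * d) v.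
Proof. by apply/ffunP => e; rewrite !ffunE mulrA. Qed.
Lemma scl0 c : scl c (0 : alg r) = 0.
Proof. by apply/ffunP => e; rewrite !ffunE mulr0. Qed.
Lemma scl1 (v : alg r) : scl 1 v = v.
Proof. by apply/ffunP => e; rewrite !ffunE mul1r. Qed.
Lemma sclN1 (v : alg r) : scl (-1) v = - v.
Proof. by apply/ffunP => e; rewrite !ffunE mulN1r. Qed.

Lemma spanP_Z S c v : spanP r S v -> spanP r S (scl c v).
Proof.
(* A coefficient list may have any length, missing entries counting as 0; it is brought to the
   length of [L] so that [nth_map] applies. *)
move=> [L [d [hL ->]]]; exists L, [seq c * x | x <- take (size L) (d ++ nseq (size L) 0)]; split=> //.
rewrite (big_morph (scl c) (scl_add c) (scl0 c)); apply: eq_bigr => i _.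
rewrite scl_scl; congr (scl _ _).
rewrite (nth_map 0) ?nth_take ?nth_cat //.
  by case: ltnP => // h; rewrite nth_nseq nth_default // if_same.
by rewrite size_takel // size_cat size_nseq leq_addl.
Qed.

Lemma spanP_D S v w : spanP r S v -> spanP r S w -> spanP r S (v + w).
Proof.
move=> [L1 [c1 [h1 ->]]] [L2 [c2 [h2 ->]]].
(* [mkseq] cuts or pads [c1] to the length of [L1], so that [c2] starts at the right place. *)
exists (L1 ++ L2), (mkseq (nth 0 c1) (size L1) ++ c2); split.
  by move=> u; rewrite mem_cat => /orP [/h1 | /h2].
rewrite size_cat big_split_ord /=; congr (_ + _); apply: eq_bigr => i _.
  by rewrite !nth_cat size_mkseq ltn_ord nth_mkseq.
by rewrite !nth_cat size_mkseq ltnNge leq_addr /= addKn.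
Qed.

Lemma spanP_0 S : spanP r S 0.
Proof. by exists [::], [::]; split=> //; rewrite big_ord0. Qed.

Lemma spanP_ind S (P : alg r -> Prop) : P 0 -> (forall v w, P v -> P w -> P (v + w)) ->
  (forall c v, P v -> P (scl c v)) -> (forall v, S v -> P v) -> forall v, spanP r S v -> P v.
Proof.
move=> P0 PD PZ PS v [L [c [h ->]]]; elim/big_ind: _ => // i _.
by apply/PZ/PS/h/mem_nth.
Qed.

Lemma spanP_sub S S' : (forall v, S v -> spanP r S' v) -> forall v, spanP r S v -> spanP r S' v.
Proof.
move=> H; apply: spanP_ind => //; [exact: spanP_0 | exact: spanP_D | move=> c v; exact: spanP_Z].
Qed.

Lemma spanP_sum S (T : eqType) (l : seq T) (F : T -> alg r) :
  (forall t, t \in l -> spanP r S (F t)) -> spanP r S (\sum_(t <- l) F t).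
Proof.
move=> H; rewrite big_seq; elim/big_ind: _ => //; [exact: spanP_0 | exact: spanP_D].
Qed.

Lemma spanP_N S v : spanP r S v -> spanP r S (- v).
Proof. by rewrite -sclN1; apply: spanP_Z. Qed.
End SpanP.

Section Rep.
Variables (n r : nat).
Local Notation I := 'I_n.+1.
Hypothesis hn : (r + r <= n.+1)%N.
Variable S : alg r -> Prop.
Hypothesis Sgood : forall v, S v -> good v.

Lemma goodD (a b : alg r) : good a -> good b -> good (a + b).
Proof. by move=> h1 h2 d hd; rewrite ffunE h1 // h2 // addr0. Qed.
Lemma goodZ c (a : alg r) : good a -> good (scl c a).
Proof. by move=> h1 d hd; rewrite ffunE h1 // mulr0. Qed.
Lemma good0 : good (0 : alg r).
Proof. by move=> d hd; rewrite ffunE. Qed.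
Lemma goodN (a : alg r) : good a -> good (- a).
Proof. by move=> h1 d hd; rewrite ffunE h1 // oppr0. Qed.

Lemma good_span a : spanP r S a -> good a.
Proof.
apply: spanP_ind => //; [exact: good0 | exact: goodD | move=> c v; exact: goodZ].
Qed.

(** Membership in a span expressed through kernels, so that it makes sense for words that are not
    tableaux; [repK_mem] returns to the algebra by faithfulness. *)
Definition repK (K : seq I -> seq I -> rat) : Prop :=
  exists2 a, spanP r S a & forall f g, size f = r -> size g = r -> rho a f g = K f g.

Lemma repK_kspace : kspace r repK.
Proof.
split.
- by exists 0; [apply: spanP_0 | move=> f g _ _; rewrite rho0].
- move=> K K' [a ha ea] [b hb eb]; exists (a + b); first exact: spanP_D.
  by move=> f g sf sg; rewrite rhoD ea ?eb.
- move=> c K [a ha ea]; exists (scl c a); first exact: spanP_Z.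
  by move=> f g sf sg; rewrite rho_scl ea.
- by move=> K K' e [a ha ea]; exists a => // f g sf sg; rewrite ea ?e.
Qed.

Lemma rho_eq (a b : alg r) : good a -> good b ->
  (forall f g : seq I, size f = r -> size g = r -> rho a f g = rho b f g) -> a = b.
Proof.
move=> ga gb e; apply/eqP; rewrite -subr_eq0; apply/eqP/(rho_inj hn); first exact/goodD/goodN.
by move=> f g sf sg; rewrite rhoD rhoN e // subrr.
Qed.

Lemma repK_mem a : good a -> repK (rho a) -> spanP r S a.
Proof.
move=> ga [b hb eb]; have gb := good_span hb.
by rewrite (@rho_eq a b) // => f g sf sg; rewrite eb.
Qed.
End Rep.

Lemma repK_sub n r (S S' : alg r -> Prop) K : (forall v, S v -> spanP r S' v) ->
  @repK n r S K -> repK S' K.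
Proof. by move=> H [a ha ea]; exists a => //; apply: spanP_sub H _ ha. Qed.

Lemma aone_good r : good (aone r).
Proof. exact/good_bas/dgrel_isdg. Qed.
Lemma aprod_good r (c : rat) l : good (aprod (r := r) c l).
Proof. by case: l => [|a l]; [apply: aone_good | move=> d hd; apply: amul_isdg]. Qed.

(** * Completeness of the finite enumerations *)

Lemma mem_seqs s B t : (t \in seqs s B) = (size t == s) && all (fun ab => (ab.1 < B)%N && (ab.2 < B)%N) t.
Proof.
elim: s t => [|s IH] t /=; first by rewrite inE; case: t.
apply/allpairsP/idP => [[[x y] /= [hx hy ->]] | ].
  move: hy; rewrite IH /= eqSS => /andP [-> ->]; rewrite andbT.
  by move: hx => /allpairsP [[i j] /= [hi hj ->]]; move: hi hj; rewrite !mem_iota !add0n /= => -> ->.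
case: t => [|[i j] t] //= /and3P [st /andP [hi hj] ht].
exists ((i, j), t); split=> //=; last by rewrite IH ht andbT.
by apply/allpairsP; exists (i, j); rewrite !mem_iota.
Qed.

Lemma size_part al : is_part al -> (size al <= sumn al)%N.
Proof.
move=> /andP [_]; elim: al => //= x al IH /andP [h1 /IH h2].
by rewrite -add1n leq_add.
Qed.

(** A row index is at most one more than the number of rows, which is at most the number of boxes;
    so the bounded lists of letters miss no tableau. *)
Lemma kend_letters al t nu : is_part al -> kend al t = Some nu ->
  all (fun ab => (ab.1 <= sumn al + size t)%N && (ab.2 <= sumn al + size t)%N) t.
Proof.
elim: t al => // -[a b] t IH al pal h; have [be [ga [ea eb ek ab [pb pg]]]] := kend_cons h pal.
have sga := size_adbox eb; have sal := size_adbox ab.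
have h1 : (a <= size al)%N by move: ea; case: (a) => //= a'; case: ltnP.
have h2 : (b <= (size be).+1)%N.
  move: eb; case: (b) => //= b'; case: ifP => // /andP [h0 h3] _.
  rewrite ltnS leqNgt; apply/negP => hh; have := allP h3 0%N.
  rewrite ltnn => H; suff : false by []. apply: H.
  have -> : 0%N = nth 0%N (incr_nth be b') (size be).
    by rewrite nth_incr_nth nth_default // addn0 (gtn_eqF hh).
  by apply: mem_nth; rewrite size_incr_nth; case: (ltnP b' (size be)) => h5 //=; lia.
have h3 := size_part pal; have h4 := size_part pb.
rewrite /=; apply/andP; split.
  by apply/andP; split; move: sal; case: (a != 0)%N; lia.
apply: sub_all (IH _ pg ek) => -[c d] /= /andP [hc hd].
apply/andP; move: sga sal; case: (a != 0)%N; case: (b != 0)%N => /=; lia.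
Qed.

Lemma mem_stdl lam nu s t : is_part lam ->
  (t \in stdl lam nu s) = (size t == s) && (kend lam t == Some nu).
Proof.
move=> pl; rewrite mem_filter andbC mem_seqs; case: eqP => //= st.
case: eqP => [hk | _]; last by rewrite andbF.
rewrite andbT; apply: sub_all (kend_letters pl hk) => -[a b] /=; rewrite st; lia.
Qed.

Lemma mem_alltab r t : (t \in alltab r) = (size t == r) && (kend [::] t != None).
Proof.
rewrite mem_filter andbC mem_seqs; case: eqP => //= st.
case hk: (kend [::] t) => [nu|] //=; last by rewrite andbF.
rewrite andbT; apply: sub_all (@kend_letters [::] _ _ isT hk) => -[a b] /=; rewrite st; lia.
Qed.

Lemma is_part_rcons l x : is_part (rcons l x) -> is_part l /\ (0 < x)%N.
Proof.
rewrite /is_part all_rcons => /andP [h /andP [h1 h2]]; rewrite h2 andbT h1; split=> //.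
case: l h {h2} => //= y l; rewrite rcons_path => /andP [] //.
Qed.

Lemma incr_rcons l j : incr_nth (rcons l j) (size l) = rcons l j.+1.
Proof. by elim: l => //= x l ->. Qed.

Lemma is_part_rcons_le l x y : is_part (rcons l x) -> (0 < y <= x)%N -> is_part (rcons l y).
Proof.
move=> /is_partP [h1 h2] hy; apply/is_partP; rewrite size_rcons in h2 *; split=> i.
  have := h1 i; rewrite !nth_rcons; case: (ltngtP i.+1 (size l)) => h; case: (ltngtP i (size l)) => h'; lia.
move: hy => /andP [y0 _] hi; have := h2 i; rewrite !size_rcons in hi *; rewrite !nth_rcons.
by case: (ltngtP i (size l)) => h H //; [apply: H | move: hi h; rewrite ltnS; lia].
Qed.

Lemma tlam_rcons l x : tlam (rcons l x) = tlam l ++ nseq x (0%N, (size l).+1).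
Proof.
rewrite /tlam size_rcons -{1}addn1 iotaD map_cat flatten_cat /= add0n cats0 nth_rcons ltnn eqxx.
congr (flatten _ ++ _); apply/eq_in_map => i; rewrite mem_iota /= add0n => hi.
by rewrite nth_rcons hi.
Qed.

Lemma kend_tlam lam : is_part lam -> kend [::] (tlam lam) = Some lam.
Proof.
elim/last_ind: lam => // l x IH hl; have [pl x0] := is_part_rcons hl.
rewrite tlam_rcons kend_cat IH //.
suff H j : (0 < j <= x)%N -> kend l (nseq j (0%N, (size l).+1)) = Some (rcons l j) by apply: H; rewrite x0 /=.
case: j => // j; elim: j => [|j IHj] hj.
  have -> : nseq 1 (0%N, (size l).+1) = [:: (0%N, (size l).+1)] by [].
  rewrite /= /adbox.
  have -> : incr_nth l (size l) = rcons l 1 by elim: (l) => //= ? ? ->.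
  by rewrite (is_part_rcons_le hl).
rewrite -addn1 nseqD cats1 kend_rcons IHj; last by lia.
by rewrite /= /adbox incr_rcons addn1 (is_part_rcons_le hl).
Qed.

Lemma size_tlam lam : size (tlam lam) = sumn lam.
Proof.
by elim/last_ind: lam => // l x IH; rewrite tlam_rcons size_cat size_nseq IH sumn_rcons.
Qed.

Lemma rwf_rcons j l x : rwf j (rcons l x) = rwf j l ++ nseq x (j + size l)%N.
Proof.
by elim: l j => [|y l IH] j /=; rewrite ?cats0 ?addn0 // IH catA addSnnS.
Qed.

Lemma tlam_rw lam : tlam lam = [seq (0%N, c) | c <- rw lam].
Proof.
by elim/last_ind: lam => // l x IH; rewrite tlam_rcons /rw rwf_rcons map_cat IH map_nseq.
Qed.

(** * [u_t] as a pairing with the superstandard word *)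

Section SuperstandardWord.
Variables (n r : nat) (nu : seq nat).
Local Notation I := 'I_n.+1.
Local Notation q := (n.+1%:R : rat).
Local Notation uvec := (@uvec n).
Local Notation Fv := (@Fv n).
Local Notation Ev := (@Ev n).
Local Notation o0 := ((fun _ => 0%N) : Occ n).
Hypothesis pnu : is_part nu.
Hypothesis knu : (sumn nu <= r)%N.

(** Pairing with this word builds the rows of [nu] from the first [|nu|] letters and ignores the
    others, which is the evaluation point of [rho_uT]. *)
Definition w0 : seq (nat * nat) := tlam nu ++ nseq (r - sumn nu) (0, 0)%N.

Lemma size_w0 : size w0 = r.
Proof. by rewrite size_cat size_tlam size_nseq subnKC. Qed.

Lemma wtw_w0 : wtw w0 = pw nu.
Proof.
have [_ ->] := kend0_part (kend_tlam pnu); rewrite wtw_cat [X in _ + X](_ : _ = 0) ?addr0 //.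
by rewrite /wtw big_nseq; elim: (r - _)%N => //= j ->; rewrite addr0 /wl subrr.
Qed.

Lemma Lf_w0 (f : seq I) (psi : Fck n) : size f = r -> Lf w0 f psi o0 = psi (occ (zip (rw nu) (take (sumn nu) f))).
Proof.
have H (R : seq nat) j (g : seq I) (m : Occ n) : all (fun c => c != 0%N) R -> size g = (size R + j)%N ->
    Lf ([seq (0%N, c) | c <- R] ++ nseq j (0, 0)%N) g psi m =
    psi (fun z => m z + count_mem z (zip R (take (size R) g)))%N.
  elim: R g m => [|c R IH] g m /=.
    move=> _ _; transitivity (psi m); last by congr psi; apply/funext => z; rewrite take0 addn0.
    by elim: j g m => [|j IHj] [|v g] m //=; rewrite /Dop /yy /= /dd /= IHj.
  case: g => [|v g] //= /andP [c0 hR] [sg]; rewrite /Dop /yy /= /dd (negPf c0) IH //.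
  congr psi; apply/funext => z; rewrite /oadd /= -addnA eq_sym; congr (_ + (_ + _))%N.
move=> sf; rewrite /w0 tlam_rw H ?sf ?size_rw ?subnKC //.
by apply/allP => c /rwf_ge; rewrite lt0n.
Qed.

Lemma KK_w0 (x : V n) (f g : seq I) : size f = r -> KK w0 x f g = x (rev g) (occ (zip (rw nu) (take (sumn nu) f))).
Proof. exact: Lf_w0. Qed.

Lemma rho_uT_w0 t f g : kend [::] t = Some nu -> size t = r -> size f = r -> size g = r ->
  rho (uT r q t) f g = KK w0 (uvec t) f g.
Proof.
by move=> hk st sf sg; rewrite KK_w0 // uvec_Uf ?st ?sg // (rho_uT hk).
Qed.

(** By [J_all] it suffices to treat pairs of tableaux of a common shape above [nu], whose kernels
    are those of the generators [d_t u_t']. *)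
Lemma repPgt p w : size p = r -> size w = r -> domw nu (wtw p) ->
  @repK n r (fun v => v \in Pgt r q nu) (KK p (uvec w)).
Proof.
apply: (@J_all n r (domw nu) (repK (fun v => v \in Pgt r q nu))) p w.
- exact: repK_kspace.
- by move=> k i; apply: domw_up.
move=> t t' al [st h1] [st' h2] e1 e2 hD; have [pal _] := kend0_part e1.
exists (amul q (dT r q t) (uT r q t')).
  apply: spanP_in; apply/allpairsPdep; exists t, t'; split=> //; first by rewrite mem_alltab st eqxx.
  rewrite mem_filter mem_alltab st' eqxx h2 andbT /shp e1 e2 /= eqxx /=.
  have G : gdom al nu by apply/(gdomP pal pnu).
  by rewrite G.
by move=> f g sf sg; rewrite (rho_dT_uT e1 e2) // /KK uvec_Uf // st'.
Qed.

(** Lowering operators turn [w0] into words of weight above [nu], which [repPgt] handles; of the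
    seeds only those of shape [nu] are not orthogonal to [w0]. *)
Lemma repUw (S : alg r -> Prop) (W : seq (nat * nat) -> Prop) k x :
  (forall v, v \in Pgt r q nu -> S v) -> (forall t, W t -> Tab r t) ->
  (forall t, W t -> kend [::] t = Some nu -> S (uT r q t)) ->
  Fsp Fv (SW W) k x -> @repK n r S (KK w0 x).
Proof.
move=> S1 W1 S2; have HJ := @repK_kspace n r S; have [J0 _ _ Je] := HJ.
apply: (J_step HJ) => //; first exact: size_w0.
- by move=> t /W1 [].
- move=> t al hW hk; have [st _] := W1 _ hW; have [pal et] := kend0_part hk.
  have [e | ne] := eqVneq (wtw w0) (wtw t).
    have e' : al = nu by apply: pw_inj => //; rewrite et -e wtw_w0.
    exists (uT r q t); first by apply/spanP_in/S2 => //; rewrite hk e'.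
    by move=> f g sf sg; rewrite rho_uT_w0 // hk e'.
  by apply: Je J0 => f g sf sg; rewrite KK_wt // sf size_w0.
move=> q' i w sq' wq' sw; apply: (@repK_sub n r (fun v => v \in Pgt r q nu)).
  by move=> v /S1; apply: spanP_in.
by apply: repPgt => //; rewrite wq' wtw_w0; apply: domw_alpha.
Qed.
End SuperstandardWord.

(** * Tableaux whose first part ends at or above [lam] *)

Section Prefix.
Variables (n s : nat) (lam nu : seq nat).
Local Notation m := (sumn lam).
Local Notation r := (m + s)%N.
Local Notation q := (n.+1%:R : rat).
Local Notation Fv := (@Fv n).
Local Notation Ev := (@Ev n).
Hypothesis plam : is_part lam.
Hypothesis pnu : is_part nu.
Hypothesis knu : (sumn nu <= r)%N.

Definition WB0 (t : seq (nat * nat)) : Prop := Tab m t /\ gdom (shp t) lam.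
(** A single tableau of shape [lam] may be added without losing stability under [E], since raising
    it leads strictly above [lam]. *)
Definition WA0 (t : seq (nat * nat)) : Prop := WB0 t \/ t = tlam lam.

Lemma Tab_tlam : Tab m (tlam lam).
Proof. by split; [rewrite size_tlam | rewrite kend_tlam]. Qed.

Lemma WB0_E : Estable Ev (SW WB0) (Fsp Fv (SW WB0)).
Proof.
apply: (@restrict_E n m (domw lam)); first exact: domw_up.
- by move=> t [].
- move=> t al h1 h2 h3; split=> //; have [pal _] := kend0_part h2.
  by rewrite /shp h2; apply/gdomP.
move=> t al i [h1 h2] h3; apply: domw_up; have [pal _] := kend0_part h3.
by move: h2; rewrite /shp h3; apply: (iffLR (gdomP _ _)).
Qed.

Lemma WA0_E : Estable Ev (SW WA0) (Fsp Fv (SW WA0)).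
Proof.
apply: (@restrict_E n m (domw lam)); first exact: domw_up.
- by move=> t [[]|->] //; apply: Tab_tlam.
- move=> t al h1 h2 h3; left; split=> //; have [pal _] := kend0_part h2.
  by rewrite /shp h2; apply/gdomP.
move=> t al i [[h1 h2] h3 | -> ].
  apply: domw_up; have [pal _] := kend0_part h3.
  by move: h2; rewrite /shp h3; apply: (iffLR (gdomP _ _)).
by rewrite kend_tlam // => -[<-]; apply: domw_alpha.
Qed.

Definition Bgen (v : alg r) : Prop := v \in Pgt r q nu ++ Dgt r q lam nu s.
Definition Agen (v : alg r) : Prop := v \in Pgt r q nu ++ Dlam r q lam nu s ++ Dgt r q lam nu s.

Lemma extWn_Tab W t : (forall t0, W t0 -> Tab m t0) -> extWn W s t -> Tab r t.
Proof.
move=> HW ht; have [t0 [v [h1 h2 e]]] := extWn_spec ht; have [s0 k0] := HW _ h1.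
split; first by rewrite e size_cat s0 h2.
have [e0 | s1] := posnP s; last exact: extWn_kend ht.
by move: h2; rewrite e0 e => /size0nil ->; rewrite cats0.
Qed.

Lemma mem_Dgt t : size t = r -> kend [::] t = Some nu -> gdom (shp (take m t)) lam ->
  uT r q t \in Dgt r q lam nu s.
Proof.
move=> st hk hd; apply: map_f; rewrite mem_filter mem_stdl // st eqxx hk eqxx !andbT.
by rewrite /tat addnK.
Qed.

Lemma mem_Dlam v : size v = s -> kend lam v = Some nu -> uT r q (tlam lam ++ v) \in Dlam r q lam nu s.
Proof.
move=> sv hk; apply: map_f; rewrite mem_filter mem_stdl // kend_cat kend_tlam // hk eqxx.
by rewrite addnK take_size_cat ?size_tlam // size_cat size_tlam sv !eqxx.
Qed.

(** The suffix [v] is any word of length [s]: the error terms of a transposition need this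
    freedom. *)
Lemma repB k x v : size v = s -> Fsp Fv (SW WB0) k x -> @repK n r Bgen (KK (w0 r nu) (uext x v)).
Proof.
move=> sv hx; apply: (repUw pnu knu _ _ _ (extWn_Fsp WB0_E sv hx)).
- by move=> u hu; rewrite /Bgen mem_cat hu.
- by move=> t; apply: extWn_Tab => t0 [].
move=> t ht hk; have [st _] : Tab r t by apply: extWn_Tab ht => t0 [].
have [t0 [v' [[[h1 h3] h4] h2 e]]] := extWn_spec ht.
by rewrite /Bgen mem_cat mem_Dgt ?orbT // e take_size_cat.
Qed.

Lemma repA k x v : size v = s -> Fsp Fv (SW WA0) k x -> @repK n r Agen (KK (w0 r nu) (uext x v)).
Proof.
move=> sv hx; apply: (repUw pnu knu _ _ _ (extWn_Fsp WA0_E sv hx)).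
- by move=> u hu; rewrite /Agen mem_cat hu.
- by move=> t; apply: extWn_Tab => t0 [[]|->] //; apply: Tab_tlam.
move=> t ht hk; have [st _] : Tab r t by apply: extWn_Tab ht => t0 [[]|->] //; apply: Tab_tlam.
have [t0 [v' [[[[h1 h3] h4]|h1] h2 e]]] := extWn_spec ht.
  by rewrite /Agen !mem_cat mem_Dgt ?orbT // e take_size_cat.
by rewrite /Agen !mem_cat e h1 mem_Dlam ?orbT //; move: hk; rewrite e h1 kend_cat kend_tlam.
Qed.

Lemma Fsp_WB0 t : WB0 t -> Fsp Fv (SW WB0) (pw (shp t)) (@uvec n t).
Proof.
move=> h; apply: Fsp_seed; exists t, (shp t); split=> //.
by have [[_]] := h; rewrite /shp; case: (kend _ t).
Qed.

Lemma Fsp_tlam : Fsp Fv (SW WA0) (pw lam) (@uvec n (tlam lam)).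
Proof. by apply: Fsp_seed; exists (tlam lam), lam; split; rewrite ?kend_tlam //; right. Qed.
End Prefix.

(** * Interchanging integral steps *)

Section Swap.
Variable n : nat.
Local Notation I := 'I_n.+1.
Local Notation word := (seq (nat * nat)).
Local Notation uvec := (@uvec n).
Implicit Types (phi psi : Fck n) (g : seq I) (w : word).

Lemma Uf_cat phi w1 w2 g1 g2 : size w1 = size g1 ->
  Uf phi (w1 ++ w2) (g1 ++ g2) = Uf (Uf phi w1 g1) w2 g2.
Proof. by elim: w1 g1 phi => [|[a b] w1 IH] [|v g1] phi //= [/IH]. Qed.

Lemma UfD phi psi w g : Uf (fun m => phi m + psi m) w g = (fun m => Uf phi w g m + Uf psi w g m).
Proof.
elim: w g phi psi => [|[a b] w IH] [|v g] phi psi //=; rewrite -IH; congr (Uf _ _ _).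
by apply/funext => m; rewrite DopD.
Qed.
Lemma UfZ c phi w g : Uf (fun m => c * phi m) w g = (fun m => c * Uf phi w g m).
Proof.
elim: w g phi => [|[a b] w IH] [|v g] phi //=; rewrite -IH; congr (Uf _ _ _).
by apply/funext => m; rewrite DopZ.
Qed.

(** A colour absent from the earlier steps. Creating it and removing it in the next step forces the
    two labels to agree. *)
Definition fresh (c : nat) (w : word) := all (fun ab => (ab.1 != c) && (ab.2 != c)) w.

Lemma dd_fresh c w g v m : c != 0%N -> fresh c w -> dd c v (Uf (@vac n) w g) m = 0.
Proof.
move=> c0; have : forall v m, dd c v (@vac n) m = 0 by move=> *; apply: dd_vac.
elim: w g (@vac n) v m => [|[a b] w IH] [|u g] phi v m H //=.
case/andP => /andP [_ bc] fw; apply: IH fw => {}v {}m.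
rewrite /Dop dd_yy (eq_sym c b) (negPf bc) mul0r addr0.
have -> : dd c v (dd a u phi) = (fun=> 0).
  by apply/funext => m'; rewrite dd_dd /dd; case: ifP => _; apply: H.
exact: yy0.
Qed.

(** The commutator of two steps is [v == v'] times one merged step; as nothing else carries the
    colour [c], that is the product of a step ending in [c] and a step starting from [c]. *)
Lemma Dop_swap c phi (p p' : nat * nat) (v v' : I) : c != 0%N ->
  (forall v m, dd c v phi m = 0) -> p.2 != c -> p'.2 != c -> p.1 != c -> p'.1 != c ->
  Dop p'.1 p'.2 v (Dop p.1 p.2 v' phi) = (fun m => Dop p.1 p.2 v' (Dop p'.1 p'.2 v phi) m +
   (((p'.1 == p.2) && (p.2 != 0%N))%:R * Dop c p'.2 v' (Dop p.1 c v phi) m +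
    (- ((p.1 == p'.2) && (p'.2 != 0%N))%:R) * Dop c p.2 v' (Dop p'.1 c v phi) m)).
Proof.
move=> c0 fr h1 h2 h3 h4; apply/funext => m.
have H a b : Dop c b v' (Dop a c v phi) = (fun m => (v == v')%:R * yy b v' (dd a v phi) m).
  apply/funext => m'; rewrite /Dop -yyZ; apply: yyE => m2; rewrite dd_yy eqxx c0 andbT /= eq_sym.
  rewrite (_ : dd c v' (dd a v phi) = fun=> 0) ?yy0 ?add0r //.
  by apply/funext => m3; rewrite dd_dd /dd; case: ifP => _; apply: fr.
rewrite !H /Dop.
under [in X in X = _]yyE => m' do rewrite dd_yy.
under [in X in _ = X + _]yyE => m' do rewrite dd_yy.
rewrite !yyD !yyZ yy_yy.
rewrite (_ : dd p'.1 v (dd p.1 v' phi) = dd p.1 v' (dd p'.1 v phi)); last first.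
  by apply/funext => m'; rewrite dd_dd.
rewrite -!addrA; congr (_ + _).
have [<- | ne] := eqVneq v v'; rewrite /= ?andbF ?andbT ?mul0r ?mulr0 ?addr0 // !mul1r.
have -> : (p'.1 == p.2) && (p'.1 != 0%N) = (p'.1 == p.2) && (p.2 != 0%N).
  by case: eqP => // ->.
have -> : (p.1 == p'.2) && (p.1 != 0%N) = (p.1 == p'.2) && (p'.2 != 0%N).
  by case: eqP => // ->.
ring.
Qed.

Lemma fresh_exists w : exists2 c, c != 0%N & fresh c w.
Proof.
exists (sumn [seq ab.1 + ab.2 | ab <- w] + 1)%N; first by rewrite addn1.
rewrite /fresh; apply/allP => ab h; have : (ab.1 + ab.2 <= sumn [seq ab.1 + ab.2 | ab <- w])%N.
  elim: w h => //= x w IH; rewrite inE => /orP [/eqP -> | /IH h]; first exact: leq_addr.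
  exact: leq_trans h (leq_addl _ _).
by move=> hh; apply/andP; split; apply/eqP; lia.
Qed.

(** The colour and the coefficients are chosen before the labels, so the error terms are again
    vectors of fixed words. *)
Lemma swap_gen w1 p p' w2 : exists c e e', forall g1 (v v' : I) g2, size w1 = size g1 -> size w2 = size g2 ->
  uvec (w1 ++ p :: p' :: w2) (rev (g1 ++ v' :: v :: g2)) =
  uvec (w1 ++ p' :: p :: w2) (rev (g1 ++ v :: v' :: g2)) +
  (e *: uvec (w1 ++ (p.1, c) :: (c, p'.2) :: w2) (rev (g1 ++ v :: v' :: g2)) +
   e' *: uvec (w1 ++ (p'.1, c) :: (c, p.2) :: w2) (rev (g1 ++ v :: v' :: g2))).
Proof.
have [c c0 hc] := fresh_exists (p :: p' :: w1); move: hc => /= /and3P [/andP [h1 h2] /andP [h3 h4] hc].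
exists c, ((p'.1 == p.2) && (p.2 != 0%N))%:R, (- ((p.1 == p'.2) && (p'.2 != 0%N))%:R) => g1 v v' g2 s1 s2.
rewrite !uvec_Uf ?size_cat /= ?s1 ?s2 //; rewrite !Uf_cat //.
case: p p' h1 h2 h3 h4 => [a b] [a' b'] /= h1 h2 h3 h4.
have := @Dop_swap c (Uf (@vac n) w1 g1) (a, b) (a', b') v v' c0 (fun v m => dd_fresh g1 v m c0 hc) h2 h4 h1 h3.
by move=> /= ->; rewrite UfD UfD !UfZ.
Qed.

Lemma swap_ne w1 p p' w2 g1 (v v' : I) g2 : size w1 = size g1 -> size w2 = size g2 -> v != v' ->
  uvec (w1 ++ p :: p' :: w2) (rev (g1 ++ v' :: v :: g2)) =
  uvec (w1 ++ p' :: p :: w2) (rev (g1 ++ v :: v' :: g2)).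
Proof.
move=> s1 s2 ne; have ne' : (v' == v) = false by rewrite eq_sym (negPf ne).
rewrite !uvec_Uf ?size_cat /= ?s1 ?s2 //; rewrite !Uf_cat //.
case: p p' => [a b] [a' b'] /=; congr (Uf _ _ _); apply/funext => m; rewrite /Dop.
under [in X in X = _]yyE => m' do rewrite dd_yy (negPf ne) andbF mul0r addr0.
under [in X in _ = X]yyE => m' do rewrite dd_yy ne' andbF mul0r addr0.
rewrite yy_yy; apply: yyE => m1; apply: yyE => m2; exact: dd_dd.
Qed.

Definition gswap (j : nat) (g : seq I) : seq I :=
  take j g ++ nth ord0 g j.+1 :: nth ord0 g j :: drop j.+2 g.

Lemma split2 j g : (j.+1 < size g)%N -> g = take j g ++ nth ord0 g j :: nth ord0 g j.+1 :: drop j.+2 g.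
Proof. by move=> h; rewrite -!drop_nth ?cat_take_drop // ltnW. Qed.

Lemma split2w j w : (j.+1 < size w)%N ->
  w = take j w ++ nth (0, 0)%N w j :: nth (0, 0)%N w j.+1 :: drop j.+2 w.
Proof. by move=> h; rewrite -!drop_nth ?cat_take_drop // ltnW. Qed.

Lemma size_gswap j g : (j.+1 < size g)%N -> size (gswap j g) = size g.
Proof. by move=> h; rewrite {2}(split2 h) !size_cat. Qed.

(** Right multiplication by an adjacent transposition, seen on kernels. *)
Definition swK (j : nat) (K : seq I -> seq I -> rat) : seq I -> seq I -> rat :=
  fun f g => K f (gswap j g).

Lemma swK_rep r j (S : alg r -> Prop) a : (j.+1 < r)%N -> (forall v, S v -> repK S (swK j (@rho n r v))) ->
  spanP r S a -> repK S (swK j (rho a)).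
Proof.
move=> hj H; have [J0 JD JZ Je] := @repK_kspace n r S.
apply: (@spanP_ind r S (fun a => repK S (swK j (rho a)))) => //.
- by apply: Je J0 => f g _ _; rewrite /swK rho0.
- by move=> v w h1 h2; apply: Je (JD _ _ h1 h2) => f g _ _; rewrite /swK rhoD.
- by move=> c v h1; apply: Je (JZ c _ h1) => f g _ _; rewrite /swK rho_scl.
Qed.

Lemma swK_KK r j q w (S : alg r -> Prop) : (j.+1 < r)%N -> size w = r ->
  (forall x y, repK S (KK q (uvec (take j w ++ x :: y :: drop j.+2 w)))) ->
  repK S (swK j (KK q (uvec w))).
Proof.
move=> hj sw H; have [J0 JD JZ Je] := @repK_kspace n r S.
have sz g : size g = r -> size (take j w) = size (take j g) /\ size (drop j.+2 w) = size (drop j.+2 g).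
  by move=> sg; rewrite !size_take !size_drop sw sg.
have [c [e [e' E]]] := swap_gen (take j w) (nth (0, 0)%N w j) (nth (0, 0)%N w j.+1) (drop j.+2 w).
rewrite {1}[w](@split2w j) ?sw //; move: E; move: (nth _ w j) (nth _ w j.+1) => p p' E.
apply: Je (JD _ _ (H p' p) (JD _ _ (JZ e _ (H (p.1, c) (c, p'.2))) (JZ e' _ (H (p'.1, c) (c, p.2))))) => f g sf sg.
have [s1 s2] := sz g sg; rewrite /swK /gswap /KK E // -(@split2 j) ?sg //.
by rewrite LfD LfD !LfZ.
Qed.
End Swap.

(** * Stability of the defining spaces under exchange of letters *)

Section Stable.
Variables (n s : nat) (lam nu : seq nat).
Local Notation m := (sumn lam).
Local Notation r := (m + s)%N.
Local Notation q := (n.+1%:R : rat).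
Local Notation uvec := (@uvec n).
Hypothesis plam : is_part lam.
Hypothesis pnu : is_part nu.
Hypothesis knu : (sumn nu <= r)%N.
Let S0 (v : alg r) : Prop := v \in Pgt r q nu.
Local Notation Bg := (@Bgen n s lam nu).
Local Notation Ag := (@Agen n s lam nu).

(** All error terms keep the left word, whose weight is above [nu]; the right word is arbitrary in
    [repPgt]. *)
Lemma sw_Pgt j v : (j.+1 < r)%N -> S0 v -> @repK n r S0 (swK j (rho v)).
Proof.
move=> hj /allpairsPdep [t [t' []]]; rewrite mem_alltab mem_filter mem_alltab.
move=> /andP [/eqP st h1] /and3P [/andP [/eqP sh hg] /eqP st' h2] ->.
have [al e1] : exists al, kend [::] t = Some al by case: (kend _ t) h1 => [al|] // _; exists al.
have [al' e2] : exists al, kend [::] t' = Some al by case: (kend _ t') h2 => [al'|] // _; exists al'.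
have e3 : al' = al by move: sh; rewrite /shp e1 e2.
have [pal wal] := kend0_part e1.
have [J0 JD JZ Je] := @repK_kspace n r S0.
apply: (Je (swK j (KK t (uvec t')))).
  move=> f g sf sg; rewrite /swK (rho_dT_uT e1) ?e2 ?e3 ?size_gswap ?sg //.
  by rewrite /KK uvec_Uf // size_gswap ?sg ?st'.
apply: swK_KK => // x y; apply: repPgt => //.
  by rewrite size_cat /= size_take size_drop st' (ltnW hj); lia.
by rewrite -wal; apply/gdomP => //; move: hg; rewrite /shp e1.
Qed.

Lemma Pgt_Bgen v : S0 v -> spanP r Bg v.
Proof. by move=> h; apply: spanP_in; rewrite /Bgen mem_cat h. Qed.
Lemma Pgt_Agen v : S0 v -> spanP r Ag v.
Proof. by move=> h; apply: spanP_in; rewrite /Agen !mem_cat h. Qed.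

(** Since [m <= j], the exchange leaves the first [m] steps alone and only the suffix becomes an
    arbitrary word. *)
Lemma sw_word (S : alg r -> Prop) (W : seq (nat * nat) -> Prop) j t : (m <= j)%N -> (j.+1 < r)%N ->
  (forall t v, W t -> size v = s -> @repK n r S (KK (w0 r nu) (uext (uvec t) v))) ->
  W (take m t) -> size t = r -> kend [::] t = Some nu ->
  @repK n r S (swK j (rho (uT r q t))).
Proof.
move=> mj hj HW wt st hk; have [J0 JD JZ Je] := @repK_kspace n r S.
apply: (Je (swK j (KK (w0 r nu) (uvec t)))).
  by move=> f g sf sg; rewrite /swK -(rho_uT_w0 knu hk) ?size_gswap ?sg.
apply: swK_KK => // x y.
have -> : take j t ++ x :: y :: drop j.+2 t = take m t ++ (drop m (take j t) ++ x :: y :: drop j.+2 t).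
  by rewrite catA -(take_takel t mj) cat_take_drop.
rewrite uvec_cat; apply: HW => //.
by rewrite size_cat /= !size_drop size_take st (ltnW hj); lia.
Qed.

Lemma WB0_rep t v : @WB0 lam t -> size v = s -> @repK n r Bg (KK (w0 r nu) (uext (uvec t) v)).
Proof. by move=> ht sv; apply: (repB plam pnu knu sv (@Fsp_WB0 n lam t ht)). Qed.
Lemma WA0_rep t v : @WA0 lam t -> size v = s -> @repK n r Ag (KK (w0 r nu) (uext (uvec t) v)).
Proof.
case=> [ht | ->] sv; last exact: (repA plam pnu knu sv (@Fsp_tlam n lam plam)).
apply: (repA plam pnu knu sv (k := pw (shp t))).
by apply: (SW_mono (W := @WB0 lam)); [move=> t' h; left | apply: Fsp_WB0].
Qed.

Lemma mem_DgtP v : v \in Dgt r q lam nu s -> exists t,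
  [/\ v = uT r q t, size t = r, kend [::] t = Some nu & @WB0 lam (take m t)].
Proof.
move=> /mapP [t]; rewrite mem_filter mem_stdl // /tat addnK => /and3P [h1 /eqP st /eqP hk] ->.
exists t; split=> //; split=> //; split; first by rewrite size_takel ?st ?leq_addr.
by move: hk; rewrite -{1}(cat_take_drop m t) kend_cat; case: (kend _ _).
Qed.

Lemma mem_DlamP v : v \in Dlam r q lam nu s -> exists t,
  [/\ v = uT r q (tlam lam ++ t), size t = s & kend lam t = Some nu].
Proof.
move=> /mapP [t]; rewrite mem_filter mem_stdl // addnK => /and3P [/eqP h1 /eqP st /eqP hk] ->.
exists (drop m t); split; first by rewrite -h1 cat_take_drop.
  by rewrite size_drop st addKn.
by move: hk; rewrite -{1}(cat_take_drop m t) kend_cat h1 kend_tlam.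
Qed.

Lemma sw_B j v : (m <= j)%N -> (j.+1 < r)%N -> spanP r Bg v -> @repK n r Bg (swK j (rho v)).
Proof.
move=> mj hj; apply: swK_rep => // {}v; rewrite {1}/Bgen mem_cat => /orP [h|].
  exact: repK_sub Pgt_Bgen (sw_Pgt hj h).
by move=> /mem_DgtP [t [-> st hk ht]]; apply: (@sw_word Bg (@WB0 lam)) => //; apply: WB0_rep.
Qed.

Lemma sw_A j v : (m <= j)%N -> (j.+1 < r)%N -> spanP r Ag v -> @repK n r Ag (swK j (rho v)).
Proof.
move=> mj hj; apply: swK_rep => // {}v; rewrite {1}/Agen !mem_cat => /or3P [h||].
- exact: repK_sub Pgt_Agen (sw_Pgt hj h).
- move=> /mem_DlamP [t [-> st hk]]; apply: (@sw_word Ag (@WA0 lam)) => //.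
  + exact: WA0_rep.
  + by right; rewrite take_size_cat // size_tlam.
  + by rewrite size_cat size_tlam st.
  + by rewrite kend_cat kend_tlam.
by move=> /mem_DgtP [t [-> st hk ht]]; apply: (@sw_word Ag (@WA0 lam)) => //; [apply: WA0_rep | left].
Qed.
End Stable.

Section AmulLin.
Variables (r : nat) (c : rat).
Implicit Types a b : alg r.
Lemma amulDl a a' b : amul c (a + a') b = amul c a b + amul c a' b.
Proof.
apply/ffunP => d; rewrite !ffunE -big_split; apply: eq_bigr => x _; rewrite -big_split.
by apply: eq_bigr => y _; rewrite !ffunE !mulrDl.
Qed.
Lemma amulZl k a b : amul c (scl k a) b = scl k (amul c a b).
Proof.
apply/ffunP => d; rewrite !ffunE mulr_sumr; apply: eq_bigr => x _; rewrite mulr_sumr.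
by apply: eq_bigr => y _; rewrite !ffunE -!mulrA.
Qed.
Lemma amulZr k a b : amul c a (scl k b) = scl k (amul c a b).
Proof.
apply/ffunP => d; rewrite !ffunE mulr_sumr; apply: eq_bigr => x _; rewrite mulr_sumr.
by apply: eq_bigr => y _; rewrite !ffunE mulrCA -!mulrA.
Qed.
Lemma amul0l b : amul c 0 b = 0.
Proof. by rewrite -[0 in LHS](@scl0 r 0) amulZl; apply/ffunP => d; rewrite !ffunE mul0r. Qed.
Lemma amul_suml (T : Type) (l : seq T) (F : T -> alg r) b :
  amul c (\sum_(t <- l) F t) b = \sum_(t <- l) amul c (F t) b.
Proof. exact: (big_morph (fun a => amul c a b) (fun a a' => amulDl a a' b) (amul0l b)). Qed.
Lemma amulNl a b : amul c (- a) b = - amul c a b.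
Proof. by rewrite -!sclN1 amulZl. Qed.
Lemma amulBl a a' b : amul c (a - a') b = amul c a b - amul c a' b.
Proof. by rewrite amulDl amulNl. Qed.
Lemma amul_good a b : good (amul c a b).
Proof. by move=> d; apply: amul_isdg. Qed.
Lemma amul_bas (x y : dg r) : amul c (bas x) (bas y) = scl (c ^+ midc x y) (bas (Defs.comp x y)).
Proof.
apply/ffunP => d; rewrite !ffunE (bigD1 x) //= [X in _ + X]big1 ?addr0; last first.
  by move=> x' /negPf nx; rewrite big1 // => y' _; rewrite ffunE nx !mul0r.
rewrite (bigD1 y) //= [X in _ + X]big1 ?addr0; last first.
  by move=> y' /negPf ny; rewrite !ffunE ny mulr0 mul0r.
by rewrite !ffunE !eqxx !mul1r eq_sym; case: eqP => _; rewrite ?mulr1 ?mulr0.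
Qed.
End AmulLin.

Section Assoc.
Variables (n r : nat).
Local Notation q := (n.+1%:R : rat).
Hypothesis hn : (r + r <= n.+1)%N.
(** Inherited from the product of kernels by faithfulness, instead of comparing components in a
    stack of three diagrams. *)
Lemma amulA (a b c : alg r) : amul q (amul q a b) c = amul q a (amul q b c).
Proof.
apply: (rho_eq hn); try exact: amul_good.
move=> f g sf sg; rewrite !rho_amul //.
under eq_big_seq => h do (rewrite mem_alls => /eqP sh; rewrite rho_amul // mulr_suml).
under [RHS]eq_big_seq => h do (rewrite mem_alls => /eqP sh; rewrite rho_amul // mulr_sumr).
rewrite exchange_big; apply: eq_bigr => h _; apply: eq_bigr => h' _; by rewrite mulrA.
Qed.
End Assoc.

(** * The subalgebra on the last [s] vertices *)

Section Embed.
Variables (n m s : nat).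
Local Notation r := (m + s)%N.
Local Notation I := 'I_n.+1.
Local Notation q := (n.+1%:R : rat).

Lemma emvP (f g : seq I) a a' : size f = r -> emv r s a = Some a' -> (a < r + r)%N ->
  (a' < s + s)%N /\ vals f g a = vals (drop m f) (drop m g) a'.
Proof.
move=> sf; rewrite /emv addnK; have sd : size (drop m f) = s by rewrite size_drop sf addKn.
have [h1 | h1] := ltnP a r.
  have [// | h2] := ltnP a m; case=> <- _; split; first lia.
  rewrite (@valsl n r) // (@valsl n s) //; last lia.
  by rewrite nth_drop subnKC.
have [// | h2] := ltnP (a - r) m; case=> <- h3; split; first lia.
by rewrite -{1}(subnKC h1) (@valsr n r) // (@valsr n s) // nth_drop subnKC.
Qed.

Lemma rho_embd (e : dg s) (f g : seq I) : size f = r -> size g = r ->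
  rho (bas (embd r s e)) f g = (take m f == take m g)%:R * rho (bas e) (drop m f) (drop m g).
Proof.
move=> sf sg; rewrite [rho (bas e) _ _]rho_bas -natrM mulnb; apply: rho_dgrel; apply: (iffP andP).
  move=> [/eqP h1 /cstP h2] a b /orP [/andP [ha /eqP hb] |].
    rewrite addnK in ha; rewrite hb [in RHS]addnC (@valsl n r) //; last lia.
    by rewrite (@valsr n r) // -(nth_take _ ha f) h1 nth_take.
  case ea: (emv r s a) => [a'|] //; case eb: (emv r s b) => [b'|] // /eqP.
  have [ha ->] := emvP g sf ea (ltn_ord a); have [hb ->] := emvP g sf eb (ltn_ord b).
  have -> : a' = Ordinal ha by []. have -> : b' = Ordinal hb by [].
  by rewrite !nap_ord => /val_inj; apply: h2.
move=> H; split.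
  apply/eqP; apply: (@eq_from_nth _ ord0); rewrite !size_takel ?sf ?sg ?leq_addr // => i hi.
  rewrite !nth_take //.
  have h1 : (i < r + r)%N by lia. have h2 : (i + r < r + r)%N by lia.
  have := H (Ordinal h1) (Ordinal h2); rewrite /= addnK hi eqxx => /(_ isT).
  by rewrite (@valsl n r) 1?addnC ?(@valsr n r) //; lia.
apply/cstP => a b eab.
have L (c : 'I_(s + s)) : exists2 d : 'I_(r + r), emv r s d = Some (val c) & True.
  have [h | h] := ltnP c s.
    have hd : (m + c < r + r)%N by lia.
    exists (Ordinal hd) => //=; rewrite /emv addnK ltn_add2l h ltnNge leq_addr /=.
    by rewrite addKn.
  have hd : (r + (m + (c - s)) < r + r)%N by have := ltn_ord c; lia.
  exists (Ordinal hd) => //=; rewrite /emv addnK ltnNge leq_addr /= !addKn ltnNge leq_addr /=.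
  by rewrite ?addKn subnKC.
have [a1 ea _] := L a; have [b1 eb _] := L b.
have [_ <-] := emvP g sf ea (ltn_ord a1); have [_ <-] := emvP g sf eb (ltn_ord b1).
by apply: H; rewrite ea eb !nap_ord eab eqxx orbT.
Qed.

Lemma sum_take (F : seq I -> rat) (f : seq I) : size f = r ->
  \sum_(h <- alls n r) (take m f == take m h)%:R * F h = \sum_(h <- alls n s) F (take m f ++ h).
Proof.
move=> sf; have st : size (take m f) = m by rewrite size_takel // sf leq_addr.
rewrite -(big_map (cat (take m f)) xpredT F).
transitivity (\sum_(h <- [seq h <- alls n r | take m f == take m h]) F h).
  rewrite big_filter [RHS]big_mkcond; apply: eq_bigr => h _.
  by case: ifP; rewrite ?mul1r ?mul0r.
apply: perm_big; apply: uniq_perm; first exact/filter_uniq/uniq_alls.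
  by rewrite map_inj_uniq ?uniq_alls // => x y /eqP; rewrite eqseq_cat // eqxx => /eqP.
move=> h; rewrite mem_filter mem_alls; apply/andP/mapP => [[/eqP e /eqP sh] | [h' + ->]].
  by exists (drop m h); rewrite ?mem_alls ?size_drop ?sh ?addKn // e cat_take_drop.
by rewrite mem_alls => /eqP sh'; rewrite take_size_cat // size_cat st sh'.
Qed.

Lemma rho_bas_dg (x y : dg s) : (r + r <= n.+1)%N ->
  amul q (bas (embd r s x)) (bas (embd r s y)) = scl (q ^+ midc x y) (bas (embd r s (Defs.comp x y))).
Proof.
move=> hn; apply: (rho_eq hn); [exact: amul_good | exact/goodZ/good_bas/dgrel_isdg |].
move=> f g sf sg; rewrite [LHS](rho_amul _ _ sf sg) [RHS]rho_scl [X in _ = _ * X](rho_embd _ sf sg).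
have sd (h : seq I) : size h = r -> size (drop m h) = s by move=> sh; rewrite size_drop sh addKn.
have st : size (take m f) = m by rewrite size_takel // sf leq_addr.
transitivity (\sum_(h <- alls n r) (take m f == take m h)%:R * (rho (bas x) (drop m f) (drop m h) *
   ((take m h == take m g)%:R * rho (bas y) (drop m h) (drop m g)))).
  apply: eq_big_seq => h; rewrite mem_alls => /eqP sh.
  rewrite [X in X * _ = _](rho_embd x sf sh).
  rewrite [X in _ * X = _](rho_embd y sh sg).
  by rewrite -mulrA.
rewrite sum_take // mulrCA -[X in _ = _ * X]rho_scl -amul_bas [X in _ = _ * X](rho_amul _ _ (sd f sf) (sd g sg)) mulr_sumr.
by apply: eq_bigr => h _; rewrite take_size_cat // drop_size_cat // mulrCA.
Qed.

(* [ptw h] is the right action of a place permutation [h] on the last [s] letters. *)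
Definition ptw (p : nat -> nat) (g : seq I) : seq I := take m g ++ mkseq (fun a => nth ord0 (drop m g) (p a)) s.

Lemma pap_lt (h : 'S_s) a : (a < s)%N -> (pap s h a < s)%N.
Proof. by move=> ha; rewrite /pap -[a]/(val (Ordinal ha)) osub_ord; apply: ltn_ord. Qed.

Lemma pap_ord (h : 'S_s) (i : 'I_s) : pap s h i = h i.
Proof. by rewrite /pap osub_ord. Qed.

Lemma rho_map (P : nat -> nat -> bool) (p : nat -> nat) (f g : seq I) : size f = s -> size g = s ->
  (forall a, (a < s)%N -> (p a < s)%N) -> (forall a b, P a b = (a < s)%N && (b == s + p a)%N) ->
  rho (bas (dgrel s P)) f g = (f == mkseq (fun a => nth ord0 g (p a)) s)%:R.
Proof.
move=> sf sg hp HP; rewrite (@rho_part n s P predT p) //; congr (_ %:R); congr nat_of_bool.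
rewrite -(@nth_all_eq n s) ?size_mkseq //; apply: eq_in_all => a; rewrite mem_iota /= => ha.
by rewrite nth_mkseq.
Qed.

Lemma rho_permd (h : 'S_s) (f g : seq I) : size f = r -> size g = r ->
  rho (permd r s h) f g = (f == ptw (pap s h) g)%:R.
Proof.
move=> sf sg; rewrite (rho_embd _ sf sg) (@rho_map _ (pap s h)) ?size_drop ?sf ?sg ?addKn //; last exact: pap_lt.
rewrite -natrM mulnb -eqseq_cat ?cat_take_drop // !size_takel ?sf ?sg ?leq_addr //.
Qed.

Lemma size_ptw p g : size g = r -> size (ptw p g) = r.
Proof. by move=> sg; rewrite size_cat size_mkseq size_takel // sg leq_addr. Qed.

Lemma rho_amul_permd (a : alg r) (h : 'S_s) (f g : seq I) : size f = r -> size g = r ->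
  rho (amul q a (permd r s h)) f g = rho a f (ptw (pap s h) g).
Proof.
move=> sf sg; rewrite rho_amul // -[RHS](@sum_delta n r (ptw (pap s h) g) (rho a f)) ?size_ptw //.
by apply: eq_big_seq => h'; rewrite mem_alls => /eqP sh; rewrite rho_permd // mulrC eq_sym.
Qed.

Lemma drop_ptw p g : size g = r -> drop m (ptw p g) = mkseq (fun a => nth ord0 (drop m g) (p a)) s.
Proof. by move=> sg; rewrite drop_size_cat // size_takel // sg leq_addr. Qed.
Lemma take_ptw p g : size g = r -> take m (ptw p g) = take m g.
Proof. by move=> sg; rewrite take_size_cat // size_takel // sg leq_addr. Qed.

Lemma ptw1 g : size g = r -> ptw (pap s 1%g) g = g.
Proof.
move=> sg; rewrite -[RHS](cat_take_drop m); congr (_ ++ _).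
have sd : size (drop m g) = s by rewrite size_drop sg addKn.
apply: (@eq_from_nth _ ord0); rewrite size_mkseq ?sd // => i hi; rewrite nth_mkseq //.
by rewrite -[i]/(val (Ordinal hi)) pap_ord perm1.
Qed.

Lemma ptwM (h h' : 'S_s) g : size g = r -> ptw (pap s h) (ptw (pap s h') g) = ptw (pap s (h * h')%g) g.
Proof.
move=> sg; rewrite {1}/ptw take_ptw // drop_ptw //; congr (_ ++ _).
apply: (@eq_from_nth _ ord0); rewrite !size_mkseq // => i hi; rewrite !nth_mkseq ?pap_lt //.
by rewrite -[i]/(val (Ordinal hi)) !pap_ord permM.
Qed.

Lemma permdM (h h' : 'S_s) : (r + r <= n.+1)%N -> amul q (permd r s h) (permd r s h') = permd r s (h * h')%g.
Proof.
move=> hn; apply: (rho_eq hn); [exact: amul_good | exact/good_bas/dgrel_isdg |].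
move=> f g sf sg; rewrite [LHS](rho_amul_permd _ _ sf sg) [LHS](rho_permd _ sf (size_ptw _ sg)).
by rewrite [RHS](rho_permd _ sf sg) ptwM.
Qed.

Lemma amul_permd1 (a : alg r) : (r + r <= n.+1)%N -> good a -> amul q a (permd r s 1%g) = a.
Proof.
move=> hn ga; apply: (rho_eq hn) => //; first exact: amul_good.
by move=> f g sf sg; rewrite [LHS](rho_amul_permd _ _ sf sg) ptw1.
Qed.

Lemma ptw_tperm (i j : 'I_s) g : size g = r -> val j = i.+1 -> ptw (pap s (tperm i j)) g = gswap (m + i) g.
Proof.
move=> sg ij; have ij' : nat_of_ord j = i.+1 := ij; have hj := ltn_ord j; have hi := ltn_ord i.
apply: (@eq_from_nth _ ord0); first by rewrite (size_ptw _ sg) size_gswap ?sg //; lia.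
rewrite size_ptw // => a ha; rewrite /ptw /gswap !nth_cat !size_takel ?sg; try lia.
have [am | am] := ltnP a m.
  by rewrite ifT ?nth_take //; lia.
have ham : (a - m < s)%N by lia.
rewrite nth_mkseq // -[(a - m)%N]/(val (Ordinal ham)) pap_ord permE /= nth_drop.
case: (ltngtP a (m + i)) => h.
- rewrite nth_take //; case: eqP => [/(congr1 val) /= e|_]; first lia.
  by case: eqP => [/(congr1 val) /= e|_] /=; [lia | rewrite subnKC].
- case: eqP => [/(congr1 val) /= e|_]; first lia.
  case: eqP => [/(congr1 val) /= e|ne] /=.
    by rewrite (_ : a - (m + i) = 1)%N //; lia.
  have : a <> (m + j)%N by move=> e; apply: ne; apply: val_inj => /=; lia.
  move=> e2; rewrite (_ : a - (m + i) = (a - (m + i) - 2).+2)%N /=; last lia.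
  by rewrite nth_drop; congr nth; lia.
case: eqP => [_|ne]; last by case: ne; apply: val_inj => /=; lia.
by rewrite h subnn /= ij addnS.
Qed.
End Embed.

(** * Young subgroups and adjacent transpositions *)

Lemma blk_mono mu i j : (i <= j)%N -> (blk mu i <= blk mu j)%N.
Proof. by move=> h; apply: sub_count => c /= h2; apply: leq_trans h2 h. Qed.

Lemma count_lt (T : eqType) (a b : pred T) l c : (forall x, a x -> b x) -> c \in l -> b c -> ~~ a c ->
  (count a l < count b l)%N.
Proof.
move=> H + bc ac; elim: l => //= x l IH; rewrite inE => /orP [/eqP <- | /IH h].
  by rewrite bc (negPf ac) add0n add1n ltnS; apply: sub_count.
by case ax: (a x); rewrite ?(H _ ax) ?ltn_add2l // (leq_trans h) // leq_addl.
Qed.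

(** A partial sum of [mu] equal to [i+1] would separate the positions [i] and [i+1] into different
    blocks. *)
Lemma blk_allowed mu s i : (i.+1 < s)%N -> blk mu i = blk mu i.+1 -> allowed mu s i.+1.
Proof.
move=> hi e; rewrite /allowed hi /=; apply/mapP => -[c hc ec]; move: e => /eqP; apply/negP.
rewrite neq_ltn; apply/orP; left; rewrite /blk.
have hc' : c \in iota 1 (size mu) by move: hc; rewrite !mem_iota; lia.
by apply: (count_lt (c := c)) => //; [move=> x /leq_trans -> | rewrite -ec | rewrite -ec ltnn].
Qed.

(* Sorting by adjacent transpositions inside the blocks, with [\sum_i i * x i] as a measure. *)
Lemma young_ind s mu (P : 'S_s -> Prop) : P 1%g ->
  (forall (i j : 'I_s) x, val j = i.+1 -> allowed mu s i.+1 -> P x -> P (tperm i j * x)%g) ->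
  forall x, young s mu x -> P x.
Proof.
move=> P1 PS x hx.
pose M (x : 'S_s) := (\sum_(i < s) i * x i)%N.
have Mb y : (M y <= s * (s * s))%N.
  apply: (@leq_trans (\sum_(i < s) s * s)); last by rewrite sum_nat_const card_ord.
  by apply: leq_sum => i _; apply: leq_mul; apply: ltnW.
have [k hk] := ubnP (s * (s * s) - M x); elim: k x hk hx => // k IH x hk hx.
have [[i [j [ij ni]]]|H] := pselect (exists i j : 'I_s, val j = i.+1 /\ (x j < x i)%N); last first.
  suff -> : x = 1%g by [].
  have mono (i j : 'I_s) : (i <= j)%N -> (x i <= x j)%N.
    case: j => j hj /=; elim: j hj => [|j IHj] hj hij.
      by have -> : i = Ordinal hj by apply: val_inj => /=; lia.
    have [e|hij'] := eqVneq (val i) j.+1; first by have -> : i = Ordinal hj by apply: val_inj.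
    have hj' := ltnW hj; apply: leq_trans (IHj hj' _) _; first by move: hij'; rewrite /=; lia.
    by rewrite leqNgt; apply/negP => hh; apply: H; exists (Ordinal hj'), (Ordinal hj).
  apply/permP => i; rewrite perm1; apply: val_inj.
  have inj (a b : 'I_s) : (a < b)%N -> (x a < x b)%N.
    move=> ab; rewrite ltn_neqAle mono ?(ltnW ab) // andbT.
    by apply/eqP => /val_inj /perm_inj e; rewrite e ltnn in ab.
  have lo (a : 'I_s) : (a <= x a)%N.
    case: a => a ha; elim: a ha => // a IHa ha /=.
    by apply: leq_ltn_trans (IHa (ltnW ha)) _; apply: inj => /=.
  have hi (a : 'I_s) : (x a <= a)%N.
    have [d hd] := ubnP (s - a); elim: d a hd => // d IHd a hd.
    have [ha|ha] := ltnP a.+1 s; last by have := ltn_ord (x a); lia.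
    have := @inj a (Ordinal ha) (ltnSn a); have := IHd (Ordinal ha); rewrite /= => h1 h2.
    by have := h1 _; lia.
  by apply/eqP; rewrite eqn_leq lo hi.
have ij' : nat_of_ord j = i.+1 := ij.
have hb k' : blk mu (x k') = blk mu k' by apply/eqP; move/forallP: hx.
have eb : blk mu i = blk mu i.+1.
  apply/eqP; rewrite eqn_leq blk_mono // -ij' -(hb i) -(hb j) blk_mono //; exact: ltnW.
have al : allowed mu s i.+1 by apply: blk_allowed => //; rewrite -ij'.
have nij : i != j by apply/eqP => e; rewrite -e in ij'; lia.
rewrite -[x](mulKg (tperm i j)) tpermV; apply: PS => //; apply: IH; last first.
  apply/forallP => k'; rewrite permM hb; case: tpermP => [->|->|_ _] //; rewrite ij' ?eb //.
have e1 (y : 'S_s) : M y = (i * y i + (j * y j + \sum_(k < s | (k != i) && (k != j)) k * y k))%N.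
  by rewrite /M (bigD1 i) //= (bigD1 j) //= eq_sym.
have : (M x < M (tperm i j * x)%g)%N.
  rewrite !e1 !permM tpermL tpermR.
  rewrite [X in (_ < _ + (_ + X))%N](eq_bigr (fun k : 'I_s => k * x k)%N); last first.
    by move=> k' /andP [h1 h2]; rewrite permM tpermD // eq_sym.
  rewrite ij' !mulSn !addnA ltn_add2r; lia.
move=> h; have h2 := Mb (tperm i j * x)%g; move: hk h h2; clear.
by move: (M x) (M (tperm i j * x)%g) (s * (s * s))%N => A C B; lia.
Qed.

(** With a single block, [young_ind] becomes induction over the whole symmetric group. *)
Lemma young_full s (x : 'S_s) : young s [:: s] x.
Proof.
have b0 i : (i < s)%N -> blk [:: s] i = 0%N.
  move=> h; rewrite /blk (@eq_in_count _ _ pred0) ?count_pred0 // => c; rewrite inE => /eqP ->.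
  by rewrite /psum take_oversize //= addn0 leqNgt h.
by apply/forallP => i; rewrite !b0 ?ltn_ord.
Qed.

(** * The symmetric group on the quotient and elements of the ideal *)

Section Quotient.
Variables (n s : nat) (lam nu : seq nat).
Local Notation m := (sumn lam).
Local Notation r := (m + s)%N.
Local Notation q := (n.+1%:R : rat).
Local Notation I := 'I_n.+1.
Local Notation uvec := (@uvec n).
Hypothesis hn : (r + r <= n.+1)%N.
Hypothesis plam : is_part lam.
Hypothesis pnu : is_part nu.
Hypothesis knu : (sumn nu <= r)%N.
Hypothesis s0 : (0 < s)%N.
Local Notation Bg := (@Bgen n s lam nu).
Local Notation Ag := (@Agen n s lam nu).
Local Notation ASet := (Aset r q lam nu s).
Local Notation BSet := (Bset r q lam nu s).
Local Notation ISet := (Iset r s q).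

Lemma Agen_good v : Ag v -> good v.
Proof.
rewrite /Agen !mem_cat => /or3P [/allpairsPdep [? [? [_ _ ->]]] | /mapP [? _ ->] | /mapP [? _ ->]].
- exact: amul_good.
- exact: aprod_good.
- exact: aprod_good.
Qed.
Lemma Bgen_Agen v : Bg v -> Ag v.
Proof. by rewrite /Bgen /Agen !mem_cat => /orP [] ->; rewrite ?orbT. Qed.
Lemma Bgen_good v : Bg v -> good v. Proof. by move/Bgen_Agen/Agen_good. Qed.
Lemma Aset_good v : ASet v -> good v. Proof. exact: (good_span Agen_good). Qed.

Lemma spanB_Bset v : spanP r Bg v -> BSet v.
Proof. by apply: spanP_sub => {}v h; apply: spanP_in; left. Qed.

Lemma Iset_right a (z : dg s) : ISet a -> ISet (amul q a (bas (embd r s z))).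
Proof.
apply: (@spanP_ind r _ (fun a => ISet (amul q a (bas (embd r s z))))).
- by rewrite amul0l; apply: spanP_0.
- by move=> v w h1 h2; rewrite amulDl; apply: spanP_D.
- by move=> c v h; rewrite amulZl; apply: spanP_Z.
move=> v [x [y [hx hy ->]]]; rewrite (amulA hn) [X in amul _ _ X](@rho_bas_dg n m s) // amulZr.
apply/spanP_Z/spanP_in; exists x, (Defs.comp y z); split=> //; exact: comp_isdg.
Qed.

Lemma sym_A (h : 'S_s) a : ASet a -> ASet (amul q a (permd r s h)).
Proof.
move: a; apply: (@young_ind s [:: s] (fun h => forall a, ASet a -> ASet (amul q a (permd r s h)))).
- by move=> a ha; rewrite (amul_permd1 hn) //; apply: Aset_good.
- move=> i j x ij _ hx a ha; rewrite -(permdM _ _ hn) -(amulA hn); apply: hx.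
  have hj := ltn_ord j; have ij' : nat_of_ord j = i.+1 := ij.
  apply: (repK_mem hn Agen_good); first exact: amul_good.
  have [J0 JD JZ Je] := @repK_kspace n r Ag.
  apply: Je (sw_A plam pnu knu (j := (m + i)%N) _ _ ha); [|lia|lia].
  by move=> f g sf sg; rewrite [RHS](rho_amul_permd _ _ sf sg) /swK (ptw_tperm sg ij).
exact: young_full.
Qed.

Lemma sym_B0 (h : 'S_s) a : spanP r Bg a -> spanP r Bg (amul q a (permd r s h)).
Proof.
move: a; apply: (@young_ind s [:: s] (fun h => forall a, spanP r Bg a -> spanP r Bg (amul q a (permd r s h)))).
- by move=> a ha; rewrite (amul_permd1 hn) //; apply: good_span Bgen_good _ ha.
- move=> i j x ij _ hx a ha; rewrite -(permdM _ _ hn) -(amulA hn); apply: hx.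
  have hj := ltn_ord j; have ij' : nat_of_ord j = i.+1 := ij.
  apply: (repK_mem hn Bgen_good); first exact: amul_good.
  have [J0 JD JZ Je] := @repK_kspace n r Bg.
  apply: Je (sw_B plam pnu knu (j := (m + i)%N) _ _ ha); [|lia|lia].
  by move=> f g sf sg; rewrite [RHS](rho_amul_permd _ _ sf sg) /swK (ptw_tperm sg ij).
exact: young_full.
Qed.

Lemma sym_B (h : 'S_s) a : BSet a -> BSet (amul q a (permd r s h)).
Proof.
apply: (@spanP_ind r _ (fun a => BSet (amul q a (permd r s h)))).
- by rewrite amul0l; apply: spanP_0.
- by move=> v w h1 h2; rewrite amulDl; apply: spanP_D.
- by move=> c v hc; rewrite amulZl; apply: spanP_Z.
move=> v [hv | [w [b [hw hb ->]]]]; first by apply/spanB_Bset/sym_B0/spanP_in.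
apply: spanP_in; right; exists w, (amul q b (permd r s h)); split=> //; first exact: Iset_right.
exact: amulA.
Qed.

(* [lastK i j] is the kernel of the diagram joining [i] and [j] both at the top and at the bottom
   and leaving [j] otherwise free; for [i <> j] this is the idempotent "[i] and [j] carry equal labels",
   and for [i = j] it is [p_j]. *)
Definition lastK (i j : nat) (f g : seq I) : rat :=
  [&& nth ord0 f (m + i) == nth ord0 f (m + j), nth ord0 g (m + i) == nth ord0 g (m + j) &
    all (fun a => (a != (m + j)%N) ==> (nth ord0 f a == nth ord0 g a)) (iota 0 r)]%:R.

Lemma lastK_I i j : (i < s)%N -> (j < s)%N ->
  @repK n r (fun v => exists x y : dg s, [/\ isdg x, isdg y &
           v = amul q (amul q (bas (embd r s x)) (pg r r)) (bas (embd r s y))]) (lastK i j).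
Proof.
move=> hi hj.
(* [t] exchanges [j] with the last position, the one cut by [p_r]; [P] and [Q] are this
   transposition with [i] and [j] also joined on the outer side. *)
pose t a := if a == j then s.-1 else if a == s.-1 then j else a.
have ts a : (a < s)%N -> (t a < s)%N by rewrite /t; case: eqP; [lia | case: eqP; lia].
have tt a : t (t a) = a.
  by rewrite /t; case: (eqVneq a j) => [->|h1]; [rewrite eqxx; case: eqP | case: (eqVneq a s.-1) => [->|h2]; rewrite ?eqxx ?(negPf h1) ?(negPf h2)].
pose c (f : seq I) := nth ord0 f (m + i) == nth ord0 f (m + j).
pose P a b := ((a < s) && (b == s + t a) || (a == i) && (b == j))%N.
pose Q a b := ((a < s) && (b == s + t a) || (a == s + i) && (b == s + j))%N.
have hs (F G : seq I) : size F = s -> size G = s -> reflect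
    (forall a, (a < s)%N -> nth ord0 F a = nth ord0 G (t a)) (F == mkseq (fun a => nth ord0 G (t a)) s).
  move=> sF sG; apply: (iffP eqP) => [-> a ha | H]; first by rewrite nth_mkseq.
  by apply: (@eq_from_nth _ ord0); rewrite ?size_mkseq // sF => a ha; rewrite nth_mkseq // H.
have X (F G : seq I) : size F = s -> size G = s -> rho (bas (dgrel s P)) F G =
    ((F == mkseq (fun a => nth ord0 G (t a)) s) && (nth ord0 F i == nth ord0 F j))%:R.
  move=> sF sG; apply: rho_dgrel; apply: (iffP andP).
    move=> [/(hs _ _ sF sG) h1 /eqP h2] a b /orP [/andP [ha /eqP ->] | /andP [/eqP -> /eqP ->]].
      by rewrite (@valsl n s) // (@valsr n s) // h1.
    by rewrite !(@valsl n s).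
  move=> H; split.
    apply/hs => // a ha; have h1 : (a < s + s)%N by lia. have h2 : (s + t a < s + s)%N by have := ts a ha; lia.
    have := H (Ordinal h1) (Ordinal h2); rewrite /P /= ha eqxx => /(_ isT).
    by rewrite (@valsl n s) // (@valsr n s).
  have h1 : (i < s + s)%N by lia. have h2 : (j < s + s)%N by lia.
  have := H (Ordinal h1) (Ordinal h2); rewrite /P /= !eqxx orbT => /(_ isT).
  by rewrite !(@valsl n s) // => ->.
have Y (F G : seq I) : size F = s -> size G = s -> rho (bas (dgrel s Q)) F G =
    ((F == mkseq (fun a => nth ord0 G (t a)) s) && (nth ord0 G i == nth ord0 G j))%:R.
  move=> sF sG; apply: rho_dgrel; apply: (iffP andP).
    move=> [/(hs _ _ sF sG) h1 /eqP h2] a b /orP [/andP [ha /eqP ->] | /andP [/eqP -> /eqP ->]].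
      by rewrite (@valsl n s) // (@valsr n s) // h1.
    by rewrite !(@valsr n s).
  move=> H; split.
    apply/hs => // a ha; have h1 : (a < s + s)%N by lia. have h2 : (s + t a < s + s)%N by have := ts a ha; lia.
    have := H (Ordinal h1) (Ordinal h2); rewrite /Q /= ha eqxx => /(_ isT).
    by rewrite (@valsl n s) // (@valsr n s).
  have h1 : (s + i < s + s)%N by lia. have h2 : (s + j < s + s)%N by lia.
  have := H (Ordinal h1) (Ordinal h2); rewrite /Q /= !eqxx orbT => /(_ isT).
  by rewrite !(@valsr n s) // => ->.
have sd (h : seq I) : size h = r -> size (drop m h) = s by move=> sh; rewrite size_drop sh addKn.
have sk (h : seq I) : size h = r -> size (take m h) = m by move=> sh; rewrite size_takel // sh leq_addr.
pose T (f : seq I) := ptw m s t f.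
have TT (f : seq I) : size f = r -> T (T f) = f.
  move=> sf; rewrite /T {1}/ptw take_ptw // drop_ptw // -[RHS](cat_take_drop m); congr (_ ++ _).
  apply: (@eq_from_nth _ ord0); rewrite size_mkseq ?sd // => a ha; rewrite !nth_mkseq ?ts //.
  by rewrite tt.
have sT (f : seq I) : size f = r -> size (T f) = r by move=> sf; apply: size_ptw.
have XE (f h : seq I) : size f = r -> size h = r -> rho (bas (embd r s (dgrel s P))) f h = (T f == h)%:R * (c f)%:R.
  move=> sf sh; rewrite [LHS](rho_embd _ sf sh) X ?sd // -!natrM !mulnb; congr (_ %:R); congr nat_of_bool.
  rewrite andbA -eqseq_cat ?sk // cat_take_drop /c !nth_drop; congr (_ && _).
  by apply/eqP/eqP => e; [rewrite e; exact: TT | rewrite -e; exact: (esym (TT _ sf))].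
have YE (h g : seq I) : size h = r -> size g = r -> rho (bas (embd r s (dgrel s Q))) h g = (T g == h)%:R * (c g)%:R.
  move=> sf sh; rewrite [LHS](rho_embd _ sf sh) Y ?sd // -!natrM !mulnb; congr (_ %:R); congr nat_of_bool.
  by rewrite andbA -eqseq_cat ?sk // cat_take_drop /c !nth_drop eq_sym.
exists (amul q (amul q (bas (embd r s (dgrel s P))) (pg r r)) (bas (embd r s (dgrel s Q)))).
  by apply: spanP_in; exists (dgrel s P), (dgrel s Q); split=> //; apply: dgrel_isdg.
move=> f g sf sg; rewrite [LHS](rho_amul _ _ sf sg).
transitivity (\sum_(h <- alls n r) (T g == h)%:R * ((c f)%:R * (c g)%:R * rho (pg r r) (T f) h)).
  apply: eq_big_seq => h; rewrite mem_alls => /eqP sh; rewrite [X in _ * X](YE _ _ sh sg).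
  rewrite [X in X * _](rho_amul _ _ sf sh).
  rewrite (_ : (\sum_(k <- _) _) = (c f)%:R * rho (pg r r) (T f) h); first by ring.
  rewrite -(@sum_delta n r (T f) (fun k => (c f)%:R * rho (pg r r) k h)) ?sT //.
  apply: eq_big_seq => k; rewrite mem_alls => /eqP sk'; rewrite [X in X * _](XE _ _ sf sk'); ring.
rewrite sum_delta ?sT // /lastK.
have -> : rho (pg r r) (T f) (T g) = (all (fun a => (a != r.-1) ==> (nth ord0 (T f) a == nth ord0 (T g) a)) (iota 0 r))%:R.
  by apply: (@rho_part n r _ (fun a => a != r.-1) id) => //; [exact: sT | move=> a b; rewrite (addnC r a) andbA].
rewrite -!natrM !mulnb -/(c f) -/(c g) -andbA; congr (_ %:R); congr nat_of_bool; congr [&& _, _ & _].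
have nT (F : seq I) a : size F = r -> (a < r)%N ->
    nth ord0 (T F) a = nth ord0 F (if (a < m)%N then a else m + t (a - m))%N.
  move=> sF ha; rewrite /T /ptw nth_cat sk //; case: ltnP => h; first by rewrite nth_take.
  by rewrite nth_mkseq ?nth_drop //; lia.
have h1 : (if (m + j < m)%N then m + j else m + t (m + j - m))%N = r.-1.
  by rewrite ltnNge leq_addr /= addKn /t eqxx; lia.
apply/allP/allP => H a; rewrite mem_iota /= => ha; apply/implyP => na.
  have := H (if (a < m)%N then a else m + t (a - m))%N; rewrite mem_iota /=.
  have tm : (~~ (a < m)%N -> t (a - m) < s)%N by move=> h; apply: ts; lia.
  have E : (if (if (a < m)%N then a else m + t (a - m)) < m then (if (a < m)%N then a else m + t (a - m)) else m + t ((if (a < m)%N then a else m + t (a - m)) - m))%N = a.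
    case: (ltnP a m) => h; rewrite ?h // ltnNge leq_addr /= addKn tt; lia.
  rewrite !nT ?E //; try by move: tm; case: (ltnP a m) => h tm; [lia | have := tm isT; lia].
  move=> H2; apply: (implyP (H2 _)).
    by move: tm; case: (ltnP a m) => h tm; [lia | have := tm isT; lia].
  apply/eqP => e; case/eqP: na; rewrite -E e; case: (ltnP r.-1 m) => h; first lia.
  by rewrite /t; case: eqP => h2; [lia | rewrite ifT ?subnKC //; lia].
have := H (if (a < m)%N then a else m + t (a - m))%N; rewrite mem_iota /= !nT // => H2.
have tm : (~~ (a < m)%N -> t (a - m) < s)%N by move=> h; apply: ts; lia.
apply: (implyP (H2 _)); first by move: tm; case: (ltnP a m) => h tm; [lia | have := tm isT; lia].
apply/eqP => e; case/eqP: na; move: e; case: (ltnP a m) => h; first lia.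
by move/addnI => e; have := tt (a - m)%N; rewrite e /t eqxx; lia.
Qed.
End Quotient.

Lemma swapkE t i : (i.+1 < size t)%N ->
  swapk t i.+1 = take i t ++ nth (0, 0)%N t i.+1 :: nth (0, 0)%N t i :: drop i.+2 t.
Proof.
move=> h; have st : size (take i t) = i by rewrite size_takel //; lia.
apply: (@eq_from_nth _ (0, 0)%N).
  by rewrite /swapk !size_set_nth size_cat /= st size_drop; lia.
move=> a _; rewrite /swapk !nth_set_nth /= nth_set_nth /= nth_cat st.
case: (ltngtP a i) => hi.
- by rewrite (_ : (a == i.+1) = false) ?nth_take //; lia.
- case: (eqVneq a i.+1) => [-> | ne]; first by rewrite subSnn.
  by rewrite (_ : a - i = (a - i - 2).+2)%N /= ?nth_drop; [congr nth; lia | lia].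
by rewrite hi subnn (_ : (i == i.+1) = false) //; lia.
Qed.

(** * Removing more boxes than a row contains *)

Section Overfull.
Variables (n : nat) (i : nat).
Local Notation I := 'I_n.+1.
Hypothesis i0 : (0 < i)%N.

(** With distinct labels a box added by one step is never removed by a later one. So the boxes of
    row [i] with labels still to come, plus the [c] removals already made, stay at most [N]. *)
Lemma overfull_aux (t : seq (nat * nat)) (g : seq I) (phi : Fck n) (c N : nat) :
  (forall m, phi m != 0 -> (\sum_(v <- g) m (i, v) + c <= N)%N) -> uniq g -> size t = size g ->
  (N < c + count (fun st => st.1 == i) t)%N -> Uf phi t g = (fun=> 0).
Proof.
elim: t g phi c => [|[a b] t IH] [|v g] phi c H //=.
  move=> _ _ hN; apply/funext => m; apply/eqP/negPn/negP => /H.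
  by rewrite big_nil; lia.
move=> /andP [vg ug] [st]; rewrite addnA => hN; apply: IH hN => // m hm.
have [m' [h1 h2]] : exists m', dd a v phi m' != 0 /\ forall u, u != v -> m' (i, u) = m (i, u).
  move: hm; rewrite /Dop /yy; case: (b =P 0%N) => _; first by exists m.
  rewrite mulf_eq0 negb_or => /andP [_ h]; exists (orem (b, v) m); split=> // u uv.
  by rewrite /orem xpair_eqE (negPf uv) andbF subn0.
have hs (F : Occ n) : (forall u, u != v -> F (i, u) = m (i, u)) ->
    (\sum_(u <- g) m (i, u) = \sum_(u <- g) F (i, u))%N.
  move=> E; apply: eq_big_seq => u hu; rewrite E //; apply/eqP => e; by rewrite -e hu in vg.
move: h1; rewrite /dd; case: (a =P 0%N) => [-> | a0].
  move=> /H; rewrite big_cons (hs m') // (ltn_eqF i0) addn0; lia.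
move=> /H; rewrite big_cons (hs (oadd (a, v) m')); last first.
  by move=> u uv; rewrite /oadd xpair_eqE (negPf uv) andbF addn0 h2.
by rewrite {1}/oadd xpair_eqE eqxx andbT (eq_sym i a); lia.
Qed.
End Overfull.

Lemma uvec_overfull n lam t (g : seq 'I_n.+1) i : is_part lam -> (0 < i)%N ->
  (nth 0 lam i.-1 < count (fun st => st.1 == i) t)%N -> size g = (sumn lam + size t)%N ->
  uniq (drop (sumn lam) g) -> Uf (@vac n) (tlam lam ++ t) g = (fun=> 0).
Proof.
move=> plam i0 hc sg ug; rewrite -(cat_take_drop (sumn lam) g).
have st : size (take (sumn lam) g) = sumn lam by rewrite size_takel // sg leq_addr.
rewrite Uf_cat ?size_tlam ?st //.
apply: (@overfull_aux n i i0 t _ _ 0 (nth 0 lam i.-1)%N) => //; last by rewrite size_drop sg addKn.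
move=> m hm; rewrite addn0.
(* The vector of [t^lam] is an eigenvector of the number operator of row [i], so wherever it is
   nonzero that row holds exactly its [lam]-many boxes. *)
have E : (\sum_v m (i, v))%N = nth 0%N lam i.-1.
  have [_ ew] := kend0_part (kend_tlam plam).
  have := congr1 (fun x => x (rev (take (sumn lam) g)) m) (@uvec_wt n (tlam lam) i.-1).
  rewrite /= /Nv /TV /= (prednK i0) TT_diag ?lt0n -?ew ?coef_pw //; last by rewrite -lt0n.
  rewrite /= -[(_ *: _) _ _]/(_ * _) uvec_Uf ?size_tlam ?st // => /(mulIf hm) /eqP.
  by rewrite -pmulrn eqr_nat => /eqP.
rewrite -E big_uniq //= [X in (_ <= X)%N](bigID (mem (drop (sumn lam) g))) /=; exact: leq_addr.
Qed.

Lemma uniq_seqs k B : uniq (seqs k B).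
Proof.
elim: k => //= k IH; apply: allpairs_uniq => //; last by move=> [a b] [c d] _ _ /= [-> ->].
by apply: allpairs_uniq; rewrite ?iota_uniq // => -[a b] [c d] _ _.
Qed.

Lemma uniq_std0 lam nu s : uniq (std0 lam nu s).
Proof. by rewrite !filter_uniq // uniq_seqs. Qed.

(** * [Std^0] spans the quotient *)

Section Spanning.
Variables (n s : nat) (lam nu : seq nat).
Local Notation m := (sumn lam).
Local Notation r := (m + s)%N.
Local Notation q := (n.+1%:R : rat).
Local Notation I := 'I_n.+1.
Local Notation uvec := (@uvec n).
Hypothesis hn : (r + r <= n.+1)%N.
Hypothesis plam : is_part lam.
Hypothesis pnu : is_part nu.
Hypothesis knu : (sumn nu <= r)%N.
Hypothesis s0 : (0 < s)%N.
Local Notation ASet := (Aset r q lam nu s).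
Local Notation BSet := (Bset r q lam nu s).
Local Notation ISet := (Iset r s q).
Local Definition GI (v : alg r) : Prop := exists x y : dg s, [/\ isdg x, isdg y &
           v = amul q (amul q (bas (embd r s x)) (pg r r)) (bas (embd r s y))].

Lemma link_right K i j : (i < s)%N -> (j < s)%N -> @repK n r GI K ->
  @repK n r GI (fun f g => K f g * (nth ord0 g (m + i) == nth ord0 g (m + j))%:R).
Proof.
move=> hi hj [a ha ea].
pose P a b := ((a < s) && (b == s + a) || (a == i) && (b == j))%N.
have X (F G : seq I) : size F = s -> size G = s -> rho (bas (dgrel s P)) F G =
    ((F == G) && (nth ord0 G i == nth ord0 G j))%:R.
  move=> sF sG; apply: rho_dgrel; apply: (iffP andP).
    move=> [/eqP -> /eqP h2] x b /orP [/andP [hx /eqP ->] | /andP [/eqP -> /eqP ->]].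
      by rewrite (@valsl n s) // (@valsr n s).
    by rewrite !(@valsl n s).
  move=> H; have E : F = G.
    apply: (@eq_from_nth _ ord0); rewrite sF // => x hx.
    have h1 : (x < s + s)%N by lia. have h2 : (s + x < s + s)%N by lia.
    have := H (Ordinal h1) (Ordinal h2); rewrite /P /= hx eqxx => /(_ isT).
    by rewrite (@valsl n s) // (@valsr n s).
  split; first by rewrite E.
  have h1 : (i < s + s)%N by lia. have h2 : (j < s + s)%N by lia.
  have := H (Ordinal h1) (Ordinal h2); rewrite /P /= !eqxx orbT => /(_ isT).
  by rewrite !(@valsl n s) // E => ->.
exists (amul q a (bas (embd r s (dgrel s P)))); first exact: (Iset_right hn).
move=> f g sf sg; rewrite [LHS](rho_amul _ _ sf sg) -ea // -(@sum_delta n r g (fun h => rho a f h * _)) //.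
apply: eq_big_seq => h; rewrite mem_alls => /eqP sh; rewrite [X in _ * X](rho_embd _ sh sg).
rewrite X ?size_drop ?sh ?sg ?addKn // !nth_drop -natrM mulnb andbA.
rewrite -eqseq_cat ?size_takel ?sh ?sg ?leq_addr // !cat_take_drop (eq_sym h g).
by case: eqP => [<-|_] /=; rewrite ?mulr0 ?mul0r ?mul1r.
Qed.

(** The identity on words showing one of the coincidences listed in [es]. It is placed in the ideal
    by inclusion and exclusion, [link_right] supplying the product with one more coincidence. *)
Definition exK (es : seq (nat * nat)) (f g : seq I) : rat :=
  ((f == g) && has (fun e => nth ord0 g (m + e.1) == nth ord0 g (m + e.2)) es)%:R.

Lemma exK_I es : all (fun e => [&& e.1 < s, e.2 < s & e.1 != e.2]%N) es -> @repK n r GI (exK es).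
Proof.
have [J0 JD JZ Je] := @repK_kspace n r GI.
elim: es => [|[i j] es IH] /=; first by move=> _; apply: Je J0 => f g _ _; rewrite /exK andbF.
move=> /andP [/and3P [hi hj ij] /IH h].
apply: Je (JD _ _ (lastK_I hn plam pnu knu s0 hi hj) (JD _ _ h (JZ (-1) _ (link_right hi hj h)))) => f g sf sg.
have -> : lastK s lam i j f g = ((f == g) && (nth ord0 g (m + i) == nth ord0 g (m + j)))%:R.
  rewrite /lastK; congr (_ %:R); congr nat_of_bool; apply/and3P/andP => [[/eqP h1 /eqP h2 /allP h3] | [/eqP -> ->]].
    rewrite h2 eqxx; split=> //; apply/eqP; apply: (@eq_from_nth _ ord0); rewrite ?sf // => a ha.
    have := h3 a; rewrite mem_iota ha => /(_ isT); case: (a =P _) => /= [-> _ | _ /eqP //].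
    rewrite -h1 -h2; have := h3 (m + i)%N; rewrite mem_iota /= ltn_add2l hi eqn_add2l ij => /(_ isT)/eqP //.
  by split=> //; apply/allP => a _; rewrite eqxx implybT.
rewrite /exK /=; case: (f == g); case: (_ == nth ord0 g (m + j)); case: has => /=; ring.
Qed.

Lemma uniq_I : exists2 z, ISet z & forall f g, size f = r -> size g = r ->
  @rho n r z f g = ((f == g) && ~~ uniq (drop m g))%:R.
Proof.
pose es := [seq e <- [seq (i, j) | i <- iota 0 s, j <- iota 0 s] | e.1 != e.2].
have [z hz ez] : @repK n r GI (exK es).
  apply: exK_I; apply/allP => -[i j]; rewrite mem_filter /= => /andP [-> /allpairsP [[a b] /= [ha hb [-> ->]]]].
  by move: ha hb; rewrite !mem_iota /= => -> ->.
exists z => // f g sf sg; rewrite ez // /exK; congr ((_ && _)%:R).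
have sd : size (drop m g) = s by rewrite size_drop sg addKn.
apply/hasP/(uniqPn ord0) => [[[i j]] | [i [j [ij hj e]]]].
  rewrite mem_filter /= => /andP [ij /allpairsP [[a b] /= [ha hb [ea eb]]]] /eqP e.
  move: ha hb; rewrite !mem_iota /= -ea -eb => ha hb.
  case: (ltngtP i j) => h; last by rewrite h eqxx in ij.
    by exists i, j; split=> //; [rewrite sd; lia | rewrite !nth_drop].
  by exists j, i; split=> //; [rewrite sd; lia | rewrite !nth_drop].
rewrite sd in hj; exists (i, j); last by rewrite /= -!nth_drop e.
rewrite mem_filter /= (ltn_eqF ij); apply/allpairsP; exists (i, j); split=> //=; rewrite mem_iota; lia.
Qed.

(** Such an element is unchanged by right multiplication with the idempotent of [uniq_I], which lies
    in the ideal. *)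
Lemma Bset_uniq a : ASet a ->
  (forall f g, size f = r -> size g = r -> uniq (drop m g) -> @rho n r a f g = 0) -> BSet a.
Proof.
move=> ha H; have [z hz ez] := uniq_I.
suff -> : a = amul q a z by apply: spanP_in; right; exists a, z.
apply: (rho_eq hn); [exact: Aset_good ha | exact: amul_good | move=> f g sf sg].
rewrite [RHS](rho_amul _ _ sf sg) -[LHS](@sum_delta n r g (rho a f)) //.
apply: eq_big_seq => h; rewrite mem_alls => /eqP sh; rewrite ez // mulrC eq_sym.
case: eqP => [-> | _] /=; last by rewrite mulr0.
by case ug: (uniq _); rewrite ?mulr1 // H // !mulr0.
Qed.

Lemma Aset_uT t : size t = s -> kend lam t = Some nu -> ASet (uT r q (tlam lam ++ t)).
Proof. by move=> st hk; apply: spanP_in; rewrite !mem_cat mem_Dlam ?orbT. Qed.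

Lemma rho_uT_lam t f g : size t = s -> kend lam t = Some nu -> size f = r -> size g = r ->
  rho (uT r q (tlam lam ++ t)) f g = KK (w0 r nu) (uvec (tlam lam ++ t)) f g.
Proof.
move=> st hk sf sg; apply: rho_uT_w0 => //; first by rewrite kend_cat kend_tlam.
by rewrite size_cat size_tlam st.
Qed.

Lemma swap_B t (i j : 'I_s) : size t = s -> kend lam t = Some nu -> val j = i.+1 ->
  kend lam (swapk t i.+1) = Some nu ->
  BSet (amul q (uT r q (tlam lam ++ t)) (permd r s (tperm i j)) - uT r q (tlam lam ++ swapk t i.+1)).
Proof.
move=> st hk ij hk'; have hj := ltn_ord j; have ij' : nat_of_ord j = i.+1 := ij.
have hi : (i.+1 < size t)%N by rewrite st -ij'.
have st' : size (swapk t i.+1) = s by rewrite swapkE // size_cat /= size_drop size_takel ?st; lia.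
apply: Bset_uniq.
  by apply: spanP_D; [apply: sym_A => //; apply: Aset_uT | apply/spanP_N/Aset_uT].
move=> f g sf sg ug; rewrite rhoD rhoN [X in X - _](rho_amul_permd _ _ sf sg) (ptw_tperm sg ij).
have sg' : size (gswap (m + i) g) = r by rewrite size_gswap ?sg; lia.
rewrite !rho_uT_lam // (swapkE hi) /KK /gswap.
have hg : ((m + i).+1 < size g)%N by rewrite sg; lia.
have s1 : size (tlam lam ++ take i t) = size (take (m + i) g).
  by rewrite size_cat size_tlam !size_takel ?st ?sg; lia.
have s2 : size (drop i.+2 t) = size (drop (m + i).+2 g) by rewrite !size_drop sg st; lia.
have ne : nth ord0 g (m + i) != nth ord0 g (m + i).+1.
  by rewrite -addnS -!nth_drop nth_uniq ?size_drop ?sg ?addKn //; lia.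
have := swap_ne (nth (0, 0)%N t i) (nth (0, 0)%N t i.+1) s1 s2 ne.
by rewrite -(split2 hg) -!catA -(split2w hi) => ->; rewrite subrr.
Qed.

(** An empty step ignores its letter. Summing over that letter, which is right multiplication by an
    element of the ideal, therefore multiplies [u_t] by the number [n+1] of labels. *)
Lemma std0_zero t : size t = s -> kend lam t = Some nu -> (0, 0)%N \in t -> BSet (uT r q (tlam lam ++ t)).
Proof.
move=> st hk h0; pose j := index (0, 0)%N t; have hj : (j < s)%N by rewrite -st index_mem.
have [z hz ez] : @repK n r GI (lastK s lam j j) by apply: (lastK_I hn plam pnu knu s0 hj hj).
set u := uT _ _ _; have ku (f g : seq I) a : size f = r -> size g = r -> size a = r ->
    all (fun a' => (a' != (m + j)%N) ==> (nth ord0 a a' == nth ord0 g a')) (iota 0 r) -> rho u f a = rho u f g.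
  move=> sf sg sa /allP H; rewrite !rho_uT_lam // /KK; congr (Lf _ _ _ _).
  have ta : take (m + j) a = take (m + j) g.
    apply: (@eq_from_nth _ ord0); rewrite !size_takel ?sa ?sg; try lia.
    move=> x hx; rewrite !nth_take //; apply/eqP; have := H x; rewrite mem_iota /=.
    by rewrite (ltn_eqF hx) /=; apply; lia.
  have da : drop (m + j).+1 a = drop (m + j).+1 g.
    apply: (@eq_from_nth _ ord0); rewrite !size_drop ?sa ?sg // => x hx.
    rewrite !nth_drop; apply/eqP; have := H ((m + j).+1 + x)%N; rewrite mem_iota /=.
    by rewrite (_ : ((m + j).+1 + x == m + j) = false)%N /=; [apply; lia | lia].
  have cut (h : seq I) : size h = r -> h = take (m + j) h ++ nth ord0 h (m + j) :: drop (m + j).+1 h.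
    by move=> sh; rewrite -drop_nth ?cat_take_drop // sh; lia.
  have cw : t = take j t ++ (0, 0)%N :: drop j.+1 t.
    by rewrite -{1}(cat_take_drop j t) (drop_nth (0, 0)%N) ?st // nth_index.
  rewrite [a]cut // [g]cut // ta da cw catA.
  have s1 : size (tlam lam ++ take j t) = size (take (m + j) g).
    by rewrite size_cat size_tlam !size_takel ?sg ?st //; lia.
  have s2 : size (drop j.+1 t) = size (drop (m + j).+1 g) by rewrite !size_drop st sg; lia.
  have sz v : size ((tlam lam ++ take j t) ++ (0, 0)%N :: drop j.+1 t) = size (take (m + j) g ++ v :: drop (m + j).+1 g).
    by rewrite size_cat [RHS]size_cat s1 /= s2.
  by rewrite !uvec_Uf // !(Uf_cat _ _ _ s1).
pose c (g : seq I) := \sum_(h <- alls n r) ((all (fun a' => (a' != (m + j)%N) ==> (nth ord0 h a' == nth ord0 g a')) (iota 0 r))%:R : rat).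
have cE (f g : seq I) : size f = r -> size g = r -> rho (amul q u z) f g = c g * rho u f g.
  move=> sf sg; rewrite [LHS](rho_amul _ _ sf sg) mulr_suml; apply: eq_big_seq => h; rewrite mem_alls => /eqP sh.
  rewrite ez // /lastK !eqxx /=; case E: (all _ _); last by rewrite mulr0 mul0r.
  by rewrite mulr1 mul1r (ku f g h).
have c1 (g : seq I) : size g = r -> c g = n.+1%:R.
  move=> sg; have hj' : (m + j < size g)%N by rewrite sg; lia.
  have := @lact_pg n r (m + j).+1 (take (m + j) g) (drop (m + j).+1 g) (nth ord0 g (m + j)) (fun=> 1).
  rewrite -drop_nth // cat_take_drop size_takel ?(ltnW hj') // => /(_ erefl isT sg).
  rewrite sumr_const card_ord => <-; apply: eq_big_seq => h; rewrite mem_alls => /eqP sh; rewrite mulr1.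
  rewrite (@rho_part n r _ (fun a => a != (m + j)%N) id) //; last by move=> a b; rewrite (addnC r a) andbA.
  by congr (_ %:R); congr nat_of_bool; apply: eq_all => a; rewrite [_ == nth _ g _]eq_sym.
have uA : ASet u by apply: Aset_uT.
have -> : u = scl (n.+1%:R^-1) (amul q u z).
  apply: (rho_eq hn); [exact: Aset_good uA | exact/goodZ/amul_good | move=> f g sf sg].
  by rewrite rho_scl cE // c1 // mulrA mulVf ?mul1r // pnatr_eq0.
by apply/spanP_Z/spanP_in; right; exists u, z.
Qed.

Lemma std0_over t i : size t = s -> kend lam t = Some nu -> (0 < i)%N ->
  (nth 0 lam i.-1 < count (fun st => st.1 == i) t)%N -> BSet (uT r q (tlam lam ++ t)).
Proof.
move=> st hk i0 hc; apply: Bset_uniq; first exact: Aset_uT.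
move=> f g sf sg ug; rewrite rho_uT_lam // KK_w0 // uvec_Uf ?size_cat ?size_tlam ?st ?sg //.
by rewrite (uvec_overfull plam i0 hc) // sg st.
Qed.

Lemma mem_std0 t : (t \in std0 lam nu s) = [&& size t == s, kend lam t == Some nu, (0, 0)%N \notin t &
   all (fun i => count (fun st => st.1 == i) t <= nth 0 lam i.-1)%N (iota 1 (sumn lam + s + 2))].
Proof. by rewrite mem_filter mem_stdl // andbC -andbA. Qed.

Lemma stdl_B t : t \in stdl lam nu s -> t \notin std0 lam nu s -> BSet (uT r q (tlam lam ++ t)).
Proof.
rewrite mem_std0 mem_stdl // => /andP [/eqP st /eqP hk]; rewrite st hk !eqxx /= negb_and negbK.
case/orP => [|/allPn [i]]; first exact: std0_zero.
by rewrite mem_iota -ltnNge => /andP [i0 _]; apply: std0_over.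
Qed.

Lemma Aset_std0 a : ASet a -> exists c : seq (nat * nat) -> rat,
  BSet (a - \sum_(t <- std0 lam nu s) scl (c t) (uT r q (tlam lam ++ t))).
Proof.
pose P a := exists c : seq (nat * nat) -> rat,
  BSet (a - \sum_(t <- std0 lam nu s) scl (c t) (uT r q (tlam lam ++ t))).
have BP b : BSet b -> P b.
  move=> hb; exists (fun=> 0); rewrite big1 ?subr0 // => t _.
  by apply/ffunP => d; rewrite !ffunE mul0r.
apply: (@spanP_ind r _ P).
- by apply: BP; apply: spanP_0.
- move=> v w [c1 h1] [c2 h2]; exists (fun t => c1 t + c2 t).
  have := spanP_D h1 h2; congr (BSet _).
  rewrite [X in _ = _ - X](eq_bigr (fun t => scl (c1 t) (uT r q (tlam lam ++ t)) + scl (c2 t) (uT r q (tlam lam ++ t)))).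
    by rewrite big_split /= opprD addrACA.
  by move=> t _; apply/ffunP => d; rewrite !ffunE mulrDl.
- move=> k v [c h]; exists (fun t => k * c t).
  have := spanP_Z k h; congr (BSet _).
  rewrite scl_add -sclN1 scl_scl mulrC -scl_scl sclN1; congr (_ - _).
  by rewrite (big_morph (scl k) (scl_add k) (scl0 _ k)); apply: eq_bigr => t _; rewrite scl_scl.
move=> v; rewrite !mem_cat => /or3P [h|/(mem_DlamP plam) h|h].
- by apply/BP/spanB_Bset/spanP_in; rewrite /Bgen mem_cat h.
- have [t [-> st hk]] := h.
  have [ht | ht] := boolP (t \in std0 lam nu s).
    exists (fun t' => (t' == t)%:R); rewrite (bigD1_seq t) //=; last exact: uniq_std0.
    rewrite eqxx scl1 big1 ?addr0 ?subrr; first exact: spanP_0.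
    by move=> t' /negPf ->; apply/ffunP => d; rewrite !ffunE mul0r.
  by apply/BP/stdl_B => //; rewrite mem_stdl // st hk !eqxx.
by apply/BP/spanB_Bset/spanP_in; rewrite /Bgen mem_cat h orbT.
Qed.
End Spanning.

Section Lists.
Variable n : nat.
Local Notation I := 'I_n.+1.
Lemma sum_allsS k (F : seq I -> rat) :
  \sum_(g <- alls n k.+1) F g = \sum_(v : I) \sum_(g <- alls n k) F (v :: g).
Proof. by rewrite /= big_allpairs_dep /= big_enum. Qed.

Lemma sum_alls_cat a b (F : seq I -> rat) :
  \sum_(g <- alls n (a + b)) F g = \sum_(g1 <- alls n a) \sum_(g2 <- alls n b) F (g1 ++ g2).
Proof.
elim: a F => [|a IH] F; first by rewrite /= big_seq1.
by rewrite addSn !sum_allsS; apply: eq_bigr => v _; rewrite IH.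
Qed.
End Lists.

(** * Antisymmetrization along columns *)

Section Smear.
Variable n : nat.
Local Notation I := 'I_n.+1.
Local Notation Fck := (Fck n).
Local Notation letter := ((nat * nat) * nat)%type.
Implicit Types (phi psi : Fck).

(* A mean-zero weight on three values; the [c]-th one lives on [3c, 3c+1, 3c+2]. *)
Definition vv (c : nat) (x : I) : rat :=
  if (x : nat) == (3 * c)%N then 2%:R else
  if ((x : nat) == (3 * c).+1)%N || ((x : nat) == (3 * c).+2)%N then -1 else 0.

Lemma vv_supp c (x : I) : vv c x != 0 -> (3 * c <= x < 3 * c + 3)%N.
Proof.
rewrite /vv; case: (eqVneq (x : nat) _) => [-> _|_]; first lia.
case: (eqVneq (x : nat) _) => [-> _|_]; first lia.
by case: (eqVneq (x : nat) _) => [-> _|_]; [lia | rewrite eqxx].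
Qed.

Lemma vv_disj c c' x : vv c x != 0 -> vv c' x != 0 -> c = c'.
Proof. by move=> /vv_supp h1 /vv_supp h2; lia. Qed.

Lemma sum_vv k c : ((3 * c).+2 < n.+1)%N -> (0 < k)%N ->
  \sum_(x : I) vv c x ^+ k = 2 ^+ k + 2 * (-1) ^+ k.
Proof.
move=> hc k0; have h0 : (3 * c < n.+1)%N by lia. have h1 : ((3 * c).+1 < n.+1)%N by lia.
rewrite (eq_bigr (fun x : I => (x == Ordinal h0)%:R * 2 ^+ k + ((x == Ordinal h1)%:R * (-1) ^+ k +
    (x == Ordinal hc)%:R * (-1) ^+ k))).
  by rewrite !big_split /= !(@sum_pick n _ (fun=> _)); ring.
move=> x _; rewrite -!val_eqE /= /vv.
case: (eqVneq (x : nat) _) => [->|_].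
  by rewrite (ltn_eqF (ltnSn _)) (_ : (_ == _.+2) = false) ?mul0r ?mul1r ?addr0 //; lia.
case: (eqVneq (x : nat) _) => [->|_] /=.
  by rewrite (ltn_eqF (ltnSn _)) !mul0r mul1r addr0 add0r.
case: (eqVneq (x : nat) (3 * c).+2) => _ /=; first by rewrite !mul0r mul1r !add0r.
by rewrite !mul0r !addr0 expr0n (gtn_eqF k0).
Qed.

Lemma sum_vv1 c : ((3 * c).+2 < n.+1)%N -> \sum_(x : I) vv c x = 0.
Proof. by move=> h; have := sum_vv h (ltnSn 0); rewrite !expr1 mulrN1 subrr. Qed.

Definition wgt (cs : seq nat) (f : seq I) : rat := \prod_(p <- zip cs f) vv p.1 p.2.

Lemma wgt_cons c cs v f : wgt (c :: cs) (v :: f) = vv c v * wgt cs f.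
Proof. by rewrite /wgt /= big_cons. Qed.
Lemma wgt_cat cs cs' f f' : size cs = size f -> wgt (cs ++ cs') (f ++ f') = wgt cs f * wgt cs' f'.
Proof. by move=> h; rewrite /wgt zip_cat // big_cat. Qed.

Definition Dc (a b c : nat) phi : Fck := fun m => \sum_(x : I) vv c x * Dop a b x phi m.
Definition Uz phi (l : seq letter) : Fck := foldl (fun psi p => Dc p.1.1 p.1.2 p.2 psi) phi l.

Lemma Dc_sum (J : Type) (l : seq J) (k : J -> rat) (phi : J -> Fck) a b c :
  Dc a b c (fun m => \sum_(j <- l) k j * phi j m) = (fun m => \sum_(j <- l) k j * Dc a b c (phi j) m).
Proof.
apply/funext => m; rewrite /Dc; under eq_bigr => x _.
  rewrite Dop_sum mulr_sumr; under eq_bigr => j _ do rewrite DopZ mulrCA; over.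
by rewrite exchange_big; apply: eq_bigr => j _; rewrite mulr_sumr.
Qed.

Lemma Uz_sum (J : Type) (r : seq J) (k : J -> rat) (phi : J -> Fck) l :
  Uz (fun m => \sum_(j <- r) k j * phi j m) l = (fun m => \sum_(j <- r) k j * Uz (phi j) l m).
Proof. by elim: l phi => //= p l IH phi; rewrite Dc_sum IH. Qed.

Lemma Dc0 a b c : Dc a b c (fun=> 0) = (fun=> 0).
Proof.
have := @Dc_sum unit [::] (fun=> 0) (fun=> fun=> 0) a b c.
by rewrite (_ : (fun m : Occ n => _) = fun=> 0) => [-> |]; apply/funext => m; rewrite big_nil.
Qed.
Lemma Uz0 l : Uz (fun=> 0) l = (fun=> 0).
Proof. by elim: l => //= p l; rewrite Dc0. Qed.

Lemma Uz_Uf phi (w : seq (nat * nat)) cs m : size cs = size w ->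
  \sum_(g <- alls n (size w)) wgt cs g * Uf phi w g m = Uz phi (zip w cs) m.
Proof.
elim: w cs phi => [|[a b] w IH] [|c cs] phi //=; first by rewrite big_seq1 /wgt big_nil mul1r.
move=> [sw]; rewrite sum_allsS /=.
have -> : Dc a b c phi = fun m => \sum_(x <- index_enum I) vv c x * Dop a b x phi m by [].
rewrite Uz_sum; apply: eq_bigr => x _; rewrite -IH // mulr_sumr; apply: eq_bigr => g _.
by rewrite wgt_cons mulrA.
Qed.

Definition noc (c : nat) phi := forall a x m, a != 0%N -> vv c x != 0 -> dd a x phi m = 0.

Lemma noc_vac c : noc c (@vac n).
Proof. by move=> a x m a0 _; apply: dd_vac. Qed.

Lemma noc_Dc c a b c' phi : c != c' -> noc c phi -> noc c (Dc a b c' phi).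
Proof.
move=> cc H a' x m a0 vx; rewrite /Dc dd_sum big1 // => y _; rewrite ddZ.
have [-> | vy] := eqVneq (vv c' y) 0; first by rewrite mul0r.
have xy : (x == y) = false by apply/eqP => e; case/eqP: cc; apply: (@vv_disj c c' x) => //; rewrite e.
rewrite /Dop dd_yy xy andbF mul0r addr0 (_ : dd a' x (dd a y phi) = fun=> 0) ?yy0 ?mulr0 //.
by apply/funext => m'; rewrite dd_dd /dd; case: ifP => _; apply: H.
Qed.

(** Labels of different classes are disjoint, so a removal of class [c] needs an earlier addition of
    the same class. *)
Lemma noc_D0 c a b phi : a != 0%N -> noc c phi -> Dc a b c phi = fun=> 0.
Proof.
move=> a0 H; apply/funext => m; apply: big1 => x _.
have [-> | vx] := eqVneq (vv c x) 0; first by rewrite mul0r.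
by rewrite /Dop (_ : dd a x phi = fun=> 0) ?yy0 ?mulr0 //; apply/funext => m'; apply: H.
Qed.

Lemma Dc00 c phi : ((3 * c).+2 < n.+1)%N -> Dc 0 0 c phi = fun=> 0.
Proof.
move=> hc; apply/funext => m; rewrite /Dc /Dop /yy /dd /=.
by rewrite -mulr_suml sum_vv1 // mul0r.
Qed.

(** When each class occurs only once, a removal finds nothing to remove and an empty step sums a
    mean-zero weight; only pure additions survive. *)
Lemma Uz_bad phi l : (forall p, p \in l -> noc p.2 phi) -> uniq [seq p.2 | p <- l] ->
  (forall p, p \in l -> ((3 * p.2).+2 < n.+1)%N) ->
  has (fun p => (p.1.1 != 0%N) || (p.1.2 == 0%N)) l -> Uz phi l = fun=> 0.
Proof.
elim: l phi => // -[[a b] c] l IH phi H /= /andP [cl ul] hc.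
have hc' : forall p, p \in l -> ((3 * p.2).+2 < n.+1)%N by move=> p hp; apply: hc; rewrite inE hp orbT.
have [a0 | a0] := eqVneq a 0%N; last first.
  by rewrite (noc_D0 _ a0) ?Uz0 //; apply: (H (a, b, c)); rewrite mem_head.
have [b0 | b0] := eqVneq b 0%N.
  by rewrite a0 b0 Dc00 ?Uz0 //; apply: (hc (a, b, c)); rewrite mem_head.
rewrite a0 /= => hl; apply: IH => // p hp; apply: noc_Dc; last by apply: H; rewrite inE hp orbT.
by apply/eqP => e; case/negP: cl; apply/mapP; exists p.
Qed.

Lemma Uz_cat phi l l' : Uz phi (l ++ l') = Uz (Uz phi l) l'.
Proof. by rewrite /Uz foldl_cat. Qed.

Lemma Dc_comm b c b' c' phi : Dc 0 b c (Dc 0 b' c' phi) = Dc 0 b' c' (Dc 0 b c phi).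
Proof.
have -> : Dc 0 b' c' phi = (fun m => \sum_(x <- index_enum I) vv c' x * Dop 0 b' x phi m) by [].
have -> : Dc 0 b c phi = (fun m => \sum_(x <- index_enum I) vv c x * Dop 0 b x phi m) by [].
rewrite !Dc_sum; apply/funext => m; rewrite /Dc.
under eq_bigr => x _ do rewrite mulr_sumr.
under [RHS]eq_bigr => x _ do rewrite mulr_sumr.
rewrite exchange_big; apply: eq_bigr => x _; apply: eq_bigr => y _; rewrite mulrCA.
by rewrite /Dop /dd /= yy_yy.
Qed.

Lemma Uz_comm1 b c phi l : all (fun p => p.1.1 == 0%N) l -> Uz (Dc 0 b c phi) l = Dc 0 b c (Uz phi l).
Proof.
elim: l phi => // -[[a' b'] c'] l IH phi /= /andP [/eqP -> hl].
by rewrite Dc_comm IH.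
Qed.

Lemma Uz_comm phi l l' : all (fun p => p.1.1 == 0%N) l -> all (fun p => p.1.1 == 0%N) l' ->
  Uz (Uz phi l) l' = Uz (Uz phi l') l.
Proof.
elim: l phi => // -[[a b] c] l IH phi /= /andP [/eqP -> hl] hl'.
by rewrite IH // Uz_comm1.
Qed.

Lemma Uz_perm phi l l' : all (fun p => p.1.1 == 0%N) l -> perm_eq l l' -> Uz phi l = Uz phi l'.
Proof.
move=> h0 pe; pose P k := all (fun p : letter => p.1.1 == 0%N) k /\ Uz phi l = Uz phi k.
suff : P l' by case.
apply: (catCA_perm_ind _ pe); last by [].
move=> l1 l2 l3; rewrite /P !all_cat => -[/and3P [h1 h2 h3] ->]; split; first by rewrite h1 h2 h3.
by rewrite !Uz_cat (Uz_comm _ h1 h2).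
Qed.
End Smear.

Section Column.
Variables (n : nat) (A : nat).
Local Notation T := ('I_A.+1 * 'I_A.+1)%type.
Definition colp (X : seq T) (p : {perm T}) : bool :=
  perm_on [set x in X] p && [forall x, (p x).2 == x.2].

Lemma colp1 X : colp X 1%g.
Proof. by rewrite /colp perm_on1 /=; apply/forallP => x; rewrite perm1. Qed.

Lemma colpM X p p' : colp X p -> colp X p' -> colp X (p * p')%g.
Proof.
move=> /andP [h1 /forallP h2] /andP [h3 /forallP h4]; rewrite /colp perm_onM //=.
by apply/forallP => x; rewrite permM (eqP (h4 _)).
Qed.

Lemma colp_tperm X x y : x \in X -> y \in X -> x.2 = y.2 -> colp X (tperm x y).
Proof.
move=> hx hy e; apply/andP; split.
  apply/subsetP => z; rewrite !inE; case: tpermP => [-> //|-> //|_ _]; by rewrite eqxx.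
by apply/forallP => z; case: tpermP => [->|->|_ _]; rewrite ?e.
Qed.

Lemma colp_mem X p x : colp X p -> (p x \in X) = (x \in X).
Proof. by move=> /andP [h _]; have := perm_closed x h; rewrite !inE. Qed.

Lemma colp_col X p x : colp X p -> (p x).2 = x.2.
Proof. by move=> /andP [_ /forallP h]; apply/eqP. Qed.

(** Exchanging [x] and [y] reverses the sign but not the product, because pure additions commute. *)
Lemma colsum0 (X : seq T) (bf : T -> nat * nat) (cl : T -> nat) x y m : uniq X ->
  all (fun z => (bf z).1 == 0%N) X -> x \in X -> y \in X -> x != y -> x.2 = y.2 -> bf x = bf y ->
  \sum_(p : {perm T} | colp X p) (-1) ^+ p * Uz (@vac n) [seq (bf z, cl (p z)) | z <- X] m = 0.
Proof.
move=> uX h0 hx hy xy exy eb; set S := (\sum_(p | _) _).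
suff : S = - S by move/eqP; rewrite -addr_eq0 -mulr2n mulrn_eq0 => /eqP.
rewrite {1}/S (reindex_inj (mulgI (tperm x y))) /= /S -sumrN; apply: eq_big => [p|p _].
  apply/idP/idP => h; last by apply: colpM => //; apply: colp_tperm.
  rewrite -[p](mulKg (tperm x y)) tpermV; apply: colpM => //; exact: colp_tperm.
rewrite odd_permM odd_tperm xy /= signrN mulNr; congr (- (_ * _)).
congr (_ m); apply: Uz_perm.
  by rewrite all_map; apply/allP => z hz /=; exact: (allP h0 _ hz).
have eb' z : bf (tperm x y z) = bf z by case: tpermP => [->|->|].
rewrite (eq_map (g := (fun z => (bf z, cl (p z))) \o tperm x y)); last first.
  by move=> z /=; rewrite eb' permM.
rewrite map_comp; apply: perm_map; apply: uniq_perm => //.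
  by rewrite map_inj_uniq //; apply: perm_inj.
have tX z : (tperm x y z \in X) = (z \in X) by case: tpermP => [->|->|] //; rewrite ?hx ?hy.
move=> z; apply/mapP/idP => [[z' hz' ->] | hz]; first by rewrite tX.
by exists (tperm x y z); rewrite ?tX // tpermK.
Qed.
End Column.

Lemma horner1_ge0 (k : {poly int}) : (forall i, 0 <= k`_i) -> 0 <= k.[1].
Proof. by move=> h; rewrite horner_coef sumr_ge0 // => i _; rewrite expr1n mulr1. Qed.

Lemma horner1_eq0 (k : {poly int}) : (forall i, 0 <= k`_i) -> k.[1] = 0 -> k = 0.
Proof.
move=> h; rewrite horner_coef => /psumr_eq0P H; apply/polyP => i; rewrite coef0.
have [hi | hi] := ltnP i (size k); last by rewrite nth_default.
have := H (fun i _ => mulr_ge0 (h i) (exprn_ge0 _ ler01)) (Ordinal hi) isT.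
by rewrite /= expr1n mulr1.
Qed.

Lemma pc_eq (k l : {poly int}) : (forall a, pc k a = pc l a) -> k = l.
Proof.
move=> H; apply/polyP => i; have := H i.+1; rewrite /pc !big_ord_recr /= -/(pc k i) -/(pc l i) H.
exact: addrI.
Qed.

Lemma pc_sum (J : Type) (l : seq J) (F : J -> {poly int}) a : pc (\sum_(j <- l) F j) a = \sum_(j <- l) pc (F j) a.
Proof.
elim: l => [|j l IH]; last by rewrite !big_cons pcD IH.
by rewrite !big_nil /pc big1 // => i _; rewrite coef0.
Qed.

Lemma pc_wP b a : pc (wP b) a = (0 < b <= a)%N%:R.
Proof.
rewrite /pc; elim: a => [|a IH]; first by rewrite big_ord0; case: b.
rewrite big_ord_recr /= IH coef_wP {IH}; case: b => [|b] //; rewrite /= !ltnS eqSS.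
by case: (ltngtP b a).
Qed.

Section Support.
Variables (n : nat) (z : 'I_n.+1).
(** For one constant label the occupation of a row follows the weight of the word; being a natural
    number, it later forces that weight to be nonnegative. *)
Lemma supp_Uf (phi : Fck n) (w : {poly int}) p c :
  (forall m, phi m != 0 -> (m (c.+1, z))%:Z = w`_c) ->
  forall m, Uf phi p (nseq (size p) z) m != 0 -> (m (c.+1, z))%:Z = (w + wtw p)`_c.
Proof.
elim: p phi w => [|[a b] p IH] phi w H m /=; first by rewrite /wtw big_nil addr0; apply: H.
rewrite wtw_cons addrA; apply: IH => {}m; rewrite /Dop /yy /wl !coefD coefN !coef_wP /=.
have K m1 : dd a z phi m1 != 0 -> (m1 (c.+1, z))%:Z = w`_c - (a == c.+1)%:R.
  rewrite /dd; case: (a =P 0%N) => [-> /H -> | a0 /H <-]; first by rewrite subr0.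
  by rewrite /oadd xpair_eqE eqxx andbT (eq_sym c.+1) PoszD natz addrK.
case: (b =P 0%N) => [-> /K -> | b0]; first by rewrite /= add0r.
rewrite mulf_eq0 negb_or pnatr_eq0 -lt0n => /andP [m0 /K]; rewrite /orem xpair_eqE eqxx andbT (eq_sym c.+1).
by case: (b =P c.+1) m0 => [-> m0 | _ m0] /=; lia.
Qed.

Lemma supp0 (phi : Fck n) : (forall c m, c != 0%N -> dd c z phi m = 0) ->
  forall c m, phi m != 0 -> m (c.+1, z) = 0%N.
Proof.
move=> H c m hm; apply/eqP/negPn/negP; rewrite -lt0n => m0.
case/eqP: hm; rewrite -[RHS](H c.+1 (orem (c.+1, z) m)) // /dd /=; congr (phi _).
by apply/funext => x; rewrite /oadd /orem; case: eqP => [->|_]; lia.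
Qed.

Lemma Uf_sum (J : Type) (r : seq J) (k : J -> rat) (phi : J -> Fck n) p g :
  Uf (fun m => \sum_(j <- r) k j * phi j m) p g = (fun m => \sum_(j <- r) k j * Uf (phi j) p g m).
Proof.
elim: p g phi => [|[a b] p IH] [|x g] phi //=; rewrite -IH; congr (Uf _ _ _).
by apply/funext => m; rewrite Dop_sum; apply: eq_bigr => j _; rewrite DopZ.
Qed.

Lemma Uf0 p g : Uf (fun _ : Occ n => 0 : rat) p g = fun=> 0.
Proof.
elim: p g => [|[a b] p IH] [|x g] //=; rewrite -[RHS](IH g); congr (Uf _ _ _).
by apply/funext => m; rewrite /Dop /yy /dd; case: (b == 0%N); case: (a == 0%N); rewrite /= ?mulr0.
Qed.

Lemma dd_Uz l c m : c != 0%N -> (forall p, p \in l -> vv p.2 z = 0) -> dd c z (Uz (@vac n) l) m = 0.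
Proof.
move=> c0; have : forall m, dd c z (@vac n) m = 0 by move=> *; apply: dd_vac.
elim: l (@vac n) m => [|[[a b] d] l IH] phi m H //= hl; apply: IH => [{}m|]; last first.
  by move=> p hp; apply: hl; rewrite inE hp orbT.
have vz : vv d z = 0 by apply: (hl (a, b, d)); rewrite mem_head.
rewrite /Dc dd_sum big1 // => x _; rewrite ddZ.
have [e | ne] := eqVneq z x; first by rewrite -e vz mul0r.
rewrite /Dop dd_yy (negPf ne) andbF mul0r addr0 (_ : dd c z (dd a x phi) = fun=> 0) ?yy0 ?mulr0 //.
by apply/funext => m'; rewrite dd_dd /dd; case: ifP => _; apply: H.
Qed.
End Support.

(** * Fillings of a diagram with distinct entries in columns *)

Section Cells.
Variable A : nat.
Local Notation T := ('I_A.+1 * 'I_A.+1)%type.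
Definition rown (x : T) : nat := (x.1 : 'I_A.+1).+1.
Definition cells (al : seq nat) : seq T := [seq x : T <- enum {: T} | (x.2 < nth 0%N al x.1)%N].

Lemma mem_cells al x : (x \in cells al) = (x.2 < nth 0%N al x.1)%N.
Proof. by rewrite mem_filter mem_enum andbT. Qed.
Lemma uniq_cells al : uniq (cells al).
Proof. by rewrite filter_uniq // enum_uniq. Qed.

Lemma rwf_flatten j l B : (size l <= B)%N -> rwf j l = flatten [seq nseq (nth 0%N l i) (j + i)%N | i <- iota 0 B].
Proof.
elim: l j B => [|x l IH] j B.
  by move=> _; elim: (iota 0 B) => //= i s <-; rewrite nth_nil.
case: B => // B hB; rewrite /= addn0 (IH j.+1 B) //; congr (_ ++ flatten _).
rewrite (iotaDl 1 0 B) -map_comp; apply: eq_map => i /=; by rewrite addSnnS.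
Qed.

Lemma cells_rw al : (size al <= A.+1)%N -> (forall i, nth 0%N al i <= A.+1)%N ->
  [seq rown x | x <- cells al] = rw al.
Proof.
move=> hs hv; rewrite /cells enumT unlock /= /prod_enum /rw (@rwf_flatten 1 al A.+1) //.
rewrite -(val_enum_ord A.+1) -map_comp filter_flatten map_flatten -!map_comp.
congr flatten; apply: eq_map => i /=.
transitivity (nseq (count (fun x : 'I_A.+1 => (x < nth 0%N al i)%N) (enum 'I_A.+1)) i.+1).
  by elim: (enum 'I_A.+1) => //= x s IH; case: ifP => _ /=; rewrite IH.
rewrite add1n; congr nseq.
rewrite -(count_map val (fun x => (x < nth 0%N al i)%N)) val_enum_ord.
have := hv i; move: (nth _ _ _) => a ha; rewrite -(subnKC ha) iotaD count_cat add0n.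
rewrite (@eq_in_count _ _ predT) ?count_predT ?size_iota; last by move=> x; rewrite mem_iota add0n => /andP [_ ->].
rewrite (@eq_in_count _ _ pred0) ?count_pred0 ?addn0 // => x; rewrite mem_iota => /andP [h _].
by rewrite ltnNge h.
Qed.

Lemma size_cells al : (size al <= A.+1)%N -> (forall i, nth 0%N al i <= A.+1)%N -> size (cells al) = sumn al.
Proof. by move=> h1 h2; rewrite -(size_map rown) cells_rw // size_rw. Qed.

Lemma count_rwf j l a : count (fun c => (c < j + a)%N) (rwf j l) = psum l a.
Proof.
elim: l j a => [|x l IH] j a; first by rewrite /psum; case: a.
rewrite /= count_cat count_nseq; case: a => [|a].
  rewrite addn0 ltnn mul0n add0n /psum take0 /=; apply/eqP; rewrite -leqn0 leqNgt -has_count.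
  by apply/hasP => -[c /rwf_ge h1]; rewrite ltnNge ltnW.
rewrite -{1}(addn0 j) ltn_add2l mul1n -addSnnS IH /psum //.
Qed.

Lemma cells_up al (x : T) (i : 'I_A.+1) : is_part al -> x \in cells al -> (i <= x.1)%N -> (i, x.2) \in cells al.
Proof.
move=> /is_partP [h _]; rewrite !mem_cells /= => hx hi; apply: leq_trans hx _.
case: x hi => [[x1 hx1] x2] /=; clear hx1; move: x1.
move=> x1 hi; rewrite -(subnKC hi); elim: (x1 - i)%N => [|d IH]; rewrite ?addn0 // addnS.
exact: leq_trans (h _) IH.
Qed.

(** Column by column: a column reaching below the first [a] rows has [a] cells there and room for at
    most [a] distinct small entries; any other column lies within these rows. *)
Lemma column_bound al (b : T -> nat) a : is_part al -> (forall x, x \in cells al -> 0 < b x)%N ->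
  (forall x y, x \in cells al -> y \in cells al -> x != y -> x.2 = y.2 -> b x <> b y) ->
  (count (fun x => b x <= a)%N (cells al) <= count (fun x : T => x.1 < a)%N (cells al))%N.
Proof.
move=> pal b0 inj; pose S := [set x in cells al].
have cE (P : pred T) : count P (cells al) = (\sum_(j : 'I_A.+1) #|[set x in S | P x & x.2 == j]|)%N.
  rewrite -size_filter -(card_uniqP (filter_uniq _ (uniq_cells al))) -sum1_card.
  rewrite (partition_big (fun x : T => x.2) predT) //=; apply: eq_bigr => j _.
  rewrite -sum1_card; apply: eq_bigl => x; rewrite !inE.
  by rewrite ?mem_filter /=; case: (P x); case: (x \in cells al); rewrite ?andbF.
rewrite !cE; apply: leq_sum => j _.
have [/exists_inP [x hx /andP [/eqP xj ax]] | /existsPn H] := boolP [exists x in S, (x.2 == j) && (a <= x.1)%N]; last first.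
  apply/subset_leq_card/subsetP => x; rewrite !inE => /and3P [hx _ /eqP e].
  rewrite hx e eqxx andbT /=; have := H x; rewrite inE hx e eqxx /= -ltnNge //.
apply: (@leq_trans a).
  rewrite cardE -(size_map b); rewrite -[X in (_ <= X)%N](size_iota 1 a).
  apply: uniq_leq_size.
    rewrite map_inj_in_uniq ?enum_uniq // => u v; rewrite !mem_enum !inE.
    move=> /and3P [h1 _ /eqP h2] /and3P [h3 _ /eqP h4] e; apply/eqP/negPn/negP => ne.
    by apply: (inj u v) => //; rewrite h2 h4.
  move=> y /mapP [u]; rewrite mem_enum !inE => /and3P [h1 h2 _] ->.
  by rewrite mem_iota add1n ltnS h2 b0.
have hb (i : nat) : (i < a)%N -> (i < A.+1)%N by have := ltn_ord x.1; lia.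
rewrite -[X in (X <= _)%N](card_ord a).
rewrite -(card_imset (f := fun i : 'I_a => (Ordinal (hb i (ltn_ord i)), j) : T)) //; last first.
  by move=> u v [] /val_inj.
apply/subset_leq_card/subsetP => y /imsetP [i _ ->]; rewrite !inE /= ltn_ord eqxx andbT.
rewrite -xj; rewrite andbT; apply: (@cells_up al x _ pal); first by move: hx; rewrite inE.
by apply: leq_trans ax; rewrite /= ltnW.
Qed.
End Cells.

Section Kill.
Variables (n A : nat) (al : seq nat) (cl : 'I_A.+1 * 'I_A.+1 -> nat) (z : 'I_n.+1).
Local Notation T := ('I_A.+1 * 'I_A.+1)%type.
Local Notation X := (cells A al).
Hypothesis pal : is_part al.
Hypothesis hs : (size al <= A.+1)%N.
Hypothesis hv : forall i, (nth 0%N al i <= A.+1)%N.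
Hypothesis inj : {in X &, injective cl}.
Hypothesis hcl : forall x, x \in X -> ((3 * cl x).+2 < n.+1)%N.
Hypothesis hz : forall x, x \in X -> vv (cl x) z = 0.

(* Column antisymmetry makes the words with at most [a] letters in [1..a] per column the only
   survivors, so the content of a surviving word is dominated by [al]. *)
Lemma specht_kill (p : seq (nat * nat)) j M : size p = (sumn al + j)%N -> domw al (wtw p) ->
  \sum_(g : {perm T} | colp X g) (-1) ^+ g *
    Uf (Uz (@vac n) (zip (take (sumn al) p) [seq cl (g x) | x <- X])) (drop (sumn al) p) (nseq j z) M = 0.
Proof.
move=> sp dom; set k := sumn al; set w := take k p; set w' := drop k p.
have sX : size X = k by rewrite size_cells.
have sw : size w = k by rewrite size_takel // sp leq_addr.
have sw' : size w' = j by rewrite size_drop sp addKn.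
pose bf (x : T) := nth (0, 0)%N w (index x X).
have eX : [seq bf x | x <- X] = w.
  apply: (@eq_from_nth _ (0, 0)%N); rewrite size_map sX ?sw // => i hi.
  have hi' : (i < size X)%N by rewrite sX.
  rewrite (nth_map (ord0, ord0)) // /bf index_uniq ?uniq_cells //.
have ez (g : {perm T}) : zip w [seq cl (g x) | x <- X] = [seq (bf x, cl (g x)) | x <- X].
  by rewrite -eX zip_map.
have [hb | hb] := boolP (has (fun ab : nat * nat => (ab.1 != 0%N) || (ab.2 == 0%N)) w).
  apply: big1 => g hg; rewrite ez Uz_bad.
  - by rewrite Uf0 /= mulr0.
  - by move=> *; apply: noc_vac.
  - rewrite -map_comp map_inj_in_uniq ?uniq_cells // => x y hx hy /= /inj.
    by rewrite !(colp_mem _ hg) hx hy => /(_ isT isT) /perm_inj.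
  - by move=> _ /mapP [x hx ->]; apply: hcl; rewrite (colp_mem _ hg).
  by rewrite has_map; move: hb; rewrite -eX has_map.
have hb1 x : x \in X -> (bf x).1 = 0%N /\ (0 < (bf x).2)%N.
  move=> hx; have := hasPn hb (bf x); rewrite -eX map_f // => /(_ isT).
  by rewrite negb_or negbK -lt0n => /andP [/eqP].
have [[x [y [hx hy xy [exy eb]]]]|H] := pselect (exists x y, [/\ x \in X, y \in X, x != y & x.2 = y.2 /\ bf x = bf y]).
  transitivity (Uf (fun m => \sum_(g <- [seq g <- index_enum {perm T} | colp X g]) (-1) ^+ g *
     Uz (@vac n) (zip w [seq cl (g x) | x <- X]) m) w' (nseq j z) M).
    by rewrite Uf_sum big_filter.
  rewrite (_ : (fun m : Occ n => _) = fun=> 0) ?Uf0 //.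
    apply/funext => m; rewrite big_filter.
    rewrite -[RHS](@colsum0 n A X bf cl x y m) //; first by apply: eq_bigr => g _; rewrite ez.
    - exact: uniq_cells.
    - by apply/allP => u /hb1 [->].
have cb a : (count (fun x => (bf x).2 <= a)%N X <= psum al a)%N.
  rewrite -(@count_rwf 1) -/(rw al) -(@cells_rw A) // count_map.
  rewrite [leqRHS](@eq_count _ _ (fun x : T => x.1 < a)%N); last by move=> x; rewrite /= /rown.
  apply: column_bound => //; first by move=> x /hb1 [].
  move=> x y hx hy xy exy eb; apply: H; exists x, y; split=> //; split=> //.
  have [b1 _] := hb1 x hx; have [b2 _] := hb1 y hy.
  by move: b1 b2 eb; case: (bf x) => ? ?; case: (bf y) => ? ? /= -> -> ->.
have ew : wtw w = \sum_(x <- X) wP (bf x).2.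
  rewrite -eX /wtw big_map; apply: eq_big_seq => x /hb1 [h _].
  by rewrite /wl h subr0.
have pcw a : pc (wtw w) a = (count (fun x => (bf x).2 <= a)%N X)%:Z.
  rewrite ew pc_sum -[RHS]natz -sum1_count natr_sum [RHS]big_mkcond /=; apply: eq_big_seq => x /hb1 [_ h].
  by rewrite pc_wP h /=; case: ifP.
have w1 : (wtw w).[1] = k%:Z.
  rewrite ew horner_sum (eq_big_seq (fun=> 1)); last first.
    by move=> x /hb1 [_]; case: (bf x).2 => // b _; rewrite /wP hornerXn expr1n.
  by rewrite big_const_seq count_predT sX iter_addr_0 natz.
apply: big1 => g hg; apply/eqP; rewrite mulf_eq0 signr_eq0 /=; apply/negPn/negP => hM.
(* All letters after the first [|al|] carry [z], so their total weight has no negative entry; the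
   bound on the size will make it vanish. *)
have W' c : 0 <= (wtw w')`_c.
  have := @supp_Uf n z (Uz (@vac n) (zip w [seq cl (g x) | x <- X])) 0 w' c _ M.
  rewrite sw' add0r => <- //; move=> m hm; rewrite coef0; apply/eqP; rewrite eqz_nat; apply/eqP.
  apply: supp0 hm => {}c {}m c0; apply: dd_Uz => // u; rewrite ez => /mapP [x hx ->].
  by apply: hz; rewrite (colp_mem _ hg).
have e : wtw p = wtw w + wtw w' by rewrite -wtw_cat cat_take_drop.
case: dom; rewrite e hornerD w1.
  by have := horner1_ge0 W'; lia.
move=> [h1 h2 /eqP []]; have z0 : wtw w' = 0 by apply: horner1_eq0 => //; move: h1; rewrite /k; lia.
move: h2; rewrite z0 addr0 => h2; apply: pc_eq => a; rewrite pc_pw; apply/eqP; rewrite eq_le h2 andbT.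
by rewrite pcw lez_nat.
Qed.
End Kill.

(* The multiset of (colour, class) pairs carried by a product of smeared creation operators,
   and its evolution under a list of smeared letters. *)
Definition kstep (K : seq (nat * nat)) (p : (nat * nat) * nat) : seq (nat * nat) :=
  let K1 := if p.1.1 == 0%N then K else rem (p.1.1, p.2) K in
  if p.1.2 == 0%N then K1 else (p.1.2, p.2) :: K1.
Fixpoint krun (K : seq (nat * nat)) (l : seq ((nat * nat) * nat)) : bool :=
  if l is p :: l' then ((p.1.1 == 0%N) || ((p.1.1, p.2) \in K)) && krun (kstep K p) l' else K == [::].

Lemma perm_rem (T : eqType) (x : T) (K K' : seq T) : perm_eq K K' -> perm_eq (rem x K) (rem x K').
Proof.
move=> e; case hx: (x \in K); last by rewrite !rem_id // -?(perm_mem e) hx.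
rewrite -(perm_cons x) -(permPl (perm_to_rem hx)) (permPl e) perm_to_rem // -(perm_mem e) hx //.
Qed.

Lemma perm_kstep K K' p : perm_eq K K' -> perm_eq (kstep K p) (kstep K' p).
Proof.
move=> e; have H : perm_eq (if p.1.1 == 0%N then K else rem (p.1.1, p.2) K) (if p.1.1 == 0%N then K' else rem (p.1.1, p.2) K').
  by case: ifP => // _; apply: perm_rem.
by rewrite /kstep; case: ifP => // _; rewrite perm_cons.
Qed.

Lemma krun_perm l K K' : perm_eq K K' -> krun K l = krun K' l.
Proof.
elim: l K K' => [|p l IH] K K' e /=.
  by apply/eqP/eqP => h; rewrite h in e; apply/perm_nilP; rewrite // perm_sym.
by rewrite (perm_mem e) (IH _ _ (perm_kstep p e)).
Qed.

Definition kf (c : nat) (K : seq (nat * nat)) := [seq x <- K | x.2 == c].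
Definition lf (c : nat) (l : seq ((nat * nat) * nat)) := [seq x <- l | x.2 == c].

Lemma filter_rem (T : eqType) (P : pred T) (x : T) (s : seq T) :
  [seq y <- rem x s | P y] = if P x then rem x [seq y <- s | P y] else [seq y <- s | P y].
Proof.
elim: s => [|y s IH] /=; first by rewrite if_same.
case: (eqVneq y x) => [-> | ne] /=; first by case: (P x); rewrite //= eqxx.
rewrite IH; case: (P y); case: (P x) => //=; by rewrite (negPf ne).
Qed.

Lemma kf_kstep c K p : kf c (kstep K p) = if p.2 == c then kstep (kf c K) p else kf c K.
Proof.
have H : kf c (if p.1.1 == 0%N then K else rem (p.1.1, p.2) K) =
    if p.2 == c then (if p.1.1 == 0%N then kf c K else rem (p.1.1, p.2) (kf c K)) else kf c K.
  by case: (p.1.1 == 0%N); rewrite ?if_same // /kf filter_rem.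
rewrite /kstep; case: (p.1.2 == 0%N) => //; rewrite /kf /= -/(kf _ _) H.
by case: (p.2 == c).
Qed.

(** A step changes only pairs of its own class, so the classes evolve independently. *)
Lemma krun_classes l K : krun K l <-> forall c, krun (kf c K) (lf c l).
Proof.
elim: l K => [|p l IH] K /=.
  split=> [/eqP -> // | H]; case: K H => // x K H; have := H x.2.
  by rewrite /kf /= eqxx.
split.
  move=> /andP [h1 /IH h2] c; have := h2 c; rewrite kf_kstep /lf /= -/(lf c l).
  by case: eqP => [<- | _] //= ->; rewrite andbT /kf mem_filter /= eqxx.
move=> H; have Hp := H p.2; move: Hp; rewrite /lf /= eqxx /= -/(lf _ l) => /andP [h1 _].
rewrite /kf mem_filter /= eqxx /= in h1; rewrite h1; apply/IH => c.
have := H c; rewrite kf_kstep /lf /= -/(lf c l); case: eqP => //= _ /andP [] //.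
Qed.

(** * Positivity of smeared vacuum expectations *)

Section Value.
Variable n : nat.
Local Notation I := 'I_n.+1.
Local Notation Fck := (Fck n).
Local Notation o0 := ((fun _ => 0%N) : Occ n).
Local Notation fac := ((nat * nat) * nat)%type.

(** A power sum in the variables of row [f.1.1] over the labels of class [f.1.2]; the exponent
    counts the smeared operators merged into this factor. In row 0 it is a scalar. *)
Definition Yf (f : fac) (phi : Fck) : Fck := fun m => \sum_(x : I) vv f.1.2 x ^+ f.2 * yy f.1.1 x phi m.
Definition prodY (S : seq fac) : Fck := foldr Yf (@vac n) S.

Lemma Yf_sum (J : Type) (r : seq J) (F : J -> Fck) f m :
  Yf f (fun m => \sum_(j <- r) F j m) m = \sum_(j <- r) Yf f (F j) m.
Proof.
rewrite /Yf; under eq_bigr => x _ do rewrite yy_sum mulr_sumr.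
exact: exchange_big.
Qed.

(** The removal either passes the factor or is contracted with it; contraction moves the factor to
    row [b] and raises its exponent by one. *)
Lemma Dc_Yf a b c f (phi : Fck) m : a != 0%N -> (0 < f.2)%N ->
  Dc a b c (Yf f phi) m = Yf f (Dc a b c phi) m + (f.1 == (a, c))%:R * Yf ((b, c), f.2.+1) phi m.
Proof.
move=> a0 k0; case: f k0 => [[b1 c1] k] /= k0.
have E x : Dop a b x (Yf (b1, c1, k) phi) m = \sum_(y : I) vv c1 y ^+ k * (yy b1 y (Dop a b x phi) m
    + ((a == b1) && (x == y))%:R * yy b x phi m).
  have -> : Yf (b1, c1, k) phi = fun m => \sum_(y <- index_enum I) 1 * (vv c1 y ^+ k * yy b1 y phi m).
    by apply/funext => m'; apply: eq_bigr => y _; rewrite mul1r.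
  rewrite /Dop (_ : dd a x _ = fun m => \sum_(y <- index_enum I) dd a x (fun m => vv c1 y ^+ k * yy b1 y phi m) m); last first.
    by apply/funext => m'; rewrite dd_sum; apply: eq_bigr => y _; rewrite !ddZ mul1r.
  rewrite yy_sum; apply: eq_bigr => y _.
  rewrite (_ : dd a x _ = fun m => vv c1 y ^+ k * (yy b1 y (dd a x phi) m + ((a == b1) && (x == y))%:R * phi m)); last first.
    by apply/funext => m'; rewrite ddZ dd_yy a0 andbT.
  by rewrite yyZ yyD yyZ yy_yy.
rewrite {1}/Dc; under eq_bigr => x _ do rewrite E mulr_sumr.
rewrite exchange_big /=.
transitivity (\sum_(y : I) (vv c1 y ^+ k * yy b1 y (Dc a b c phi) m + (a == b1)%:R * (vv c y * vv c1 y ^+ k * yy b y phi m))).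
  apply: eq_bigr => y _.
  have -> : yy b1 y (Dc a b c phi) m = \sum_(x : I) vv c x * yy b1 y (Dop a b x phi) m.
    by rewrite /Dc yy_sum; apply: eq_bigr => x _; rewrite yyZ.
  rewrite mulr_sumr.
  have -> : (a == b1)%:R * (vv c y * vv c1 y ^+ k * yy b y phi m) =
      \sum_(x : I) (x == y)%:R * ((a == b1)%:R * (vv c x * vv c1 y ^+ k * yy b x phi m)).
    by rewrite sum_pick.
  rewrite -big_split; apply: eq_bigr => x _ /=.
  by case: (a == b1); case: (x == y) => /=; ring.
rewrite big_split /=; congr (_ + _); rewrite -mulr_sumr xpair_eqE (eq_sym b1).
case: (a == b1); rewrite ?mul0r //= !mul1r.
have [<- | ne] := eqVneq c1 c.
  by rewrite mul1r /Yf /=; apply: eq_bigr => y _; rewrite exprS.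
rewrite mul0r big1 // => y _; have [-> | vy] := eqVneq (vv c1 y) 0; first by rewrite expr0n (gtn_eqF k0) mulr0 mul0r.
have [-> | vy'] := eqVneq (vv c y) 0; first by rewrite !mul0r.
by case/eqP: ne; apply: vv_disj vy vy'.
Qed.

Fixpoint ycon (a b c : nat) (S : seq fac) : seq (seq fac) :=
  if S is f :: S' then
    (if f.1 == (a, c) then [:: ((b, c), f.2.+1) :: S'] else [::]) ++ [seq f :: S2 | S2 <- ycon a b c S']
  else [::].

Lemma Dc_prodY a b c S : a != 0%N -> all (fun f => 0 < f.2)%N S ->
  Dc a b c (prodY S) = (fun m => \sum_(S' <- ycon a b c S) prodY S' m).
Proof.
move=> a0; elim: S => [|f S IH] /=.
  by move=> _; apply/funext => m; rewrite big_nil (noc_D0 _ a0) //; apply: noc_vac.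
move=> /andP [f0 hS]; apply/funext => m; rewrite Dc_Yf // IH // big_cat big_map /= Yf_sum addrC.
by congr (_ + _); case: ifP => _; rewrite ?big_seq1 ?big_nil ?mul1r ?mul0r.
Qed.

Definition keys (S : seq fac) : seq (nat * nat) := [seq x <- [seq f.1 | f <- S] | x.1 != 0%N].
(** A factor in row 0 arises only by contraction, hence the exponent at least 2, which makes the
    scalar positive. *)
Definition wff (f : fac) : bool := [&& (0 < f.2)%N, (f.1.1 == 0%N) ==> (1 < f.2)%N & ((3 * f.1.2).+2 < n.+1)%N].

Lemma keys_cons f S : keys (f :: S) = if f.1.1 == 0%N then keys S else f.1 :: keys S.
Proof. by rewrite /keys /=; case: (_ == 0%N). Qed.

Lemma ycon_spec a b c S : a != 0%N -> all wff S -> ((3 * c).+2 < n.+1)%N ->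
  (ycon a b c S != [::]) = ((a, c) \in keys S) /\
  forall S', S' \in ycon a b c S -> all wff S' /\ perm_eq (keys S') (kstep (keys S) ((a, b), c)).
Proof.
move=> a0 + hc; have xa : ((a, c).1 == 0%N) = false by rewrite (negPf a0).
elim: S => // f S IH /= /andP [wf aS]; have [IH1 IH2] := IH aS; split.
  rewrite keys_cons; case: (f.1 =P (a, c)) => [e | ne] /=; first by rewrite e (negPf a0) mem_head.
  have -> : ((a, c) \in (if f.1.1 == 0%N then keys S else f.1 :: keys S)) = ((a, c) \in keys S).
    by case: ifP => // _; rewrite inE eq_sym; case: eqP.
  by rewrite -IH1; case: (ycon a b c S).
move=> S'; rewrite mem_cat => /orP [|/mapP [S2 h2 ->]].
  case: (f.1 =P (a, c)) => // e; rewrite inE => /eqP ->; split.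
    by rewrite /= aS andbT; case/and3P: wf => h1 h2 h3; rewrite /wff /= hc andbT ltnS h1 implybT.
  by rewrite !keys_cons e /= (negPf a0) /kstep /= (negPf a0) eqxx.
have [w2 p2] := IH2 _ h2; split; first by rewrite /= wf.
have hac : (a, c) \in keys S by rewrite -IH1; case: (ycon a b c S) h2.
rewrite !keys_cons; case: ifP => // _.
move: p2; rewrite -(perm_cons f.1) => /perm_trans -> //; rewrite /kstep /= (negPf a0).
have H : perm_eq (f.1 :: rem (a, c) (keys S)) (if f.1 == (a, c) then keys S else f.1 :: rem (a, c) (keys S)).
  by case: eqP => // ->; rewrite perm_sym; apply: perm_to_rem.
case: (b == 0%N) => //; rewrite -(perm_cons (b, c)) in H; apply: perm_trans H.
by rewrite (perm_catCA [:: f.1] [:: (b, c)]).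
Qed.

Lemma prodY_o0 S : all wff S -> 0 <= prodY S o0 /\ (0 < prodY S o0) = (keys S == [::]).
Proof.
elim: S => [|f S IH] /=; first by move=> _; rewrite /vac (_ : asbool _ = true) //; apply/asboolP.
move=> /andP [/and3P [k0 k1 hc] /IH [h1 h2]]; rewrite keys_cons /Yf.
case: (f.1.1 =P 0%N) => [e | /eqP ne]; last first.
  rewrite big1 ?ltxx // => x _; by rewrite /yy (negPf ne) mul0r mulr0.
rewrite /yy e /= -mulr_suml sum_vv //.
have P : 0 < 2 ^+ f.2 + 2 * (-1) ^+ f.2 :> rat.
  move: k1; rewrite e /=; case: (f.2) => [|[|k]] // _.
  rewrite -signr_odd !exprS; have : 1 <= 2 ^+ k :> rat by apply: exprn_ege1.
  by case: odd => /= h; rewrite ?expr1 ?expr0; lra.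
by rewrite pmulr_rge0 // pmulr_rgt0.
Qed.

Definition okl (p : (nat * nat) * nat) := (p.1 != (0, 0)%N) && ((3 * p.2).+2 < n.+1)%N.

(** Every term is a product of nonnegative power sums, so nothing cancels, and all terms share the
    same multiset of pairs row, class. *)
Lemma Uz_pos l S : all wff S -> all okl l ->
  0 <= Uz (prodY S) l o0 /\ (0 < Uz (prodY S) l o0) = krun (keys S) l.
Proof.
elim: l S => [|[[a b] c] l IH] S wS /=; first by move=> _; apply: prodY_o0.
move=> /andP [/andP [/= ne hc] ol]; case: (eqVneq a 0%N) ne => [-> ne | a0 _] /=.
  have b0 : b != 0%N by apply: contraNneq ne => ->.
  have -> : Dc 0 b c (prodY S) = prodY (((b, c), 1%N) :: S).
    by apply/funext => m; apply: eq_bigr => x _; rewrite expr1.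
  have [|h1 h2] := IH (((b, c), 1%N) :: S) _ ol; first by rewrite /= wS /wff /= hc (negPf b0).
  by rewrite h1 h2 keys_cons /= (negPf b0) /kstep /= (negPf b0).
have wS' : all (fun f => 0 < f.2)%N S by apply: sub_all wS => f /and3P [].
have [y1 y2] := ycon_spec b a0 wS hc.
rewrite Dc_prodY //.
have -> : (fun m => \sum_(S' <- ycon a b c S) prodY S' m) = fun m => \sum_(S' <- ycon a b c S) 1 * prodY S' m.
  by apply/funext => m; apply: eq_bigr => S' _; rewrite mul1r.
rewrite Uz_sum -y1.
have H S' : S' \in ycon a b c S -> 0 <= 1 * Uz (prodY S') l o0 /\
    (0 < 1 * Uz (prodY S') l o0) = krun (kstep (keys S) (a, b, c)) l.
  by move=> /y2 [w2 p2]; rewrite mul1r -(krun_perm _ p2); apply: IH.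
move: H; elim: (ycon a b c S) => [|S' L IHL] H; first by rewrite big_nil ltxx.
have [h1 h2] := H S' (mem_head _ _); rewrite big_cons /=.
have [h3 h4] := IHL (fun S2 hS2 => H S2 (mem_behead (s := S' :: L) hS2)).
split; first exact: addr_ge0.
case E: (krun _ _) h2 => h2; first by apply: ltr_pwDl.
apply/negbTE; rewrite -leNgt -(addr0 0) lerD // leNgt ?h2 // h4 E andbF //.
Qed.
End Value.

(** * Separating functionals *)

Section Theta.
Variables (n s : nat) (y : dg s) (ids : seq nat).
Local Notation I := 'I_n.+1.
Hypothesis s0 : (0 < s)%N.
Hypothesis sids : size ids = s.
Hypothesis uids : uniq ids.
Hypothesis hids : forall c, c \in ids -> ((3 * c).+2 < n.+1)%N.

Lemma wgt_neq0 cs (f : seq I) i : wgt cs f != 0 -> size f = size cs -> (i < size cs)%N ->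
  vv (nth 0%N cs i) (nth ord0 f i) != 0.
Proof.
elim: cs f i => [|c cs IH] [|x f] //= [|i]; rewrite wgt_cons mulf_eq0 negb_or => /andP [h1 h2] // [sf].
exact: IH.
Qed.

Lemma cst_upd (h h' : nat -> I) (b : 'I_(s + s)) u :
  (forall a : 'I_(s + s), y a != y b -> h' a = h a) -> (forall a : 'I_(s + s), y a = y b -> h' a = u) ->
  cst y h -> cst y h'.
Proof.
move=> H1 H2 /cstP H; apply/cstP => a a' e.
have [eb | ne] := eqVneq (y a) (y b); first by rewrite !H2 // -e.
by rewrite !H1 -?e //; apply: H.
Qed.

(* By pigeonhole two bottom vertices are joined, or some bottom vertex is joined at most to the last
   top vertex, whose label is summed out. *)
Lemma theta0 (H : seq I) : size H = s.-1 ->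
  \sum_(v : I) \sum_(g <- alls n s) rho (bas y) (rcons H v) g * wgt ids g = 0.
Proof.
move=> sH.
have bot (k : nat) : (k < s)%N -> (s + k < s + s)%N by rewrite ltn_add2l.
have [[k [k' [kk' e]]]|nA] := pselect (exists k k' : 'I_s, k != k' /\ y (Ordinal (bot k (ltn_ord k))) = y (Ordinal (bot k' (ltn_ord k')))).
  apply: big1 => v _; apply: big1_seq => g; rewrite mem_alls => /= /eqP sg; rewrite rho_bas.
  case: cstP => [/(_ _ _ e) | _]; last by rewrite mul0r.
  rewrite /= !(@valsr n s) ?size_rcons ?sH ?prednK // => eg; apply/eqP; rewrite mul1r; apply/negPn/negP => hw.
  have h1 := wgt_neq0 hw (etrans sg (esym sids)).
  have := h1 k; have := h1 k'; rewrite sids !ltn_ord eg => /(_ isT) v1 /(_ isT) v2.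
  have := vv_disj v2 v1 => /eqP; rewrite nth_uniq ?sids // => /eqP /val_inj; exact/eqP.
have [[k hk]|nB] := pselect (exists k : 'I_s, forall a : 'I_(s + s), y a = y (Ordinal (bot k (ltn_ord k))) -> a = (s + k)%N :> nat \/ a = s.-1 :> nat); last first.
  have F (k : 'I_s) : exists a : 'I_s.-1, forall h, y (Ordinal (bot k (ltn_ord k))) = y (Ordinal (h : (a < s + s)%N)).
    have [[a [ea a1 a2]]|N] := pselect (exists a : 'I_(s + s), [/\ y a = y (Ordinal (bot k (ltn_ord k))), a != (s + k)%N :> nat & a != s.-1 :> nat]); last first.
      case: nB; exists k => a ea; case: (a =P (s + k)%N :> nat) => [|n1]; first by left.
      case: (a =P s.-1 :> nat) => [|n2]; first by right.
      by case: N; exists a; split=> //; apply/eqP.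
    have ha : (a < s.-1)%N.
      rewrite ltn_neqAle a2 /=; rewrite leqNgt; apply/negP => hh; apply: nA.
      have h3 : (a - s < s)%N by have := ltn_ord a; lia.
      have h4 : (s <= a)%N by lia.
      exists (Ordinal h3), k; split; first by apply/eqP => /(congr1 val) /= e; move: a1; rewrite -e subnKC // eqxx.
      by rewrite -ea; congr (y _); apply: val_inj; rewrite /= subnKC.
    exists (Ordinal ha) => h; rewrite -ea; congr (y _); exact: val_inj.
  pose a k := projT1 (cid (F k)).
  have inj : injective a.
    move=> k k' e; apply/eqP/negPn/negP => ne; apply: nA; exists k, k'; split=> //.
    have hk : (a k < s + s)%N by have := ltn_ord (a k); lia.
    have hk' : (a k' < s + s)%N by have := ltn_ord (a k'); lia.
    rewrite (projT2 (cid (F k)) hk) (projT2 (cid (F k')) hk'); congr (y _); apply: val_inj => /=.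
    exact: (congr1 val e).
  by have := leq_card a inj; rewrite !card_ord; lia.
set b := Ordinal _ in hk; have hks := ltn_ord k.
pose L (v u : I) (g1 g2 : seq I) := H ++ v :: (g1 ++ u :: g2).
have nL v u v' u' g1 g2 i : size g1 = k -> i != s.-1 -> i != (s + k)%N ->
    nth ord0 (L v u g1 g2) i = nth ord0 (L v' u' g1 g2) i.
  move=> s1 i1 i2; rewrite /L !nth_cat sH; case: ltnP => // h1.
  case e1 : (i - s.-1)%N => [|j]; first by lia.
  rewrite /= !nth_cat s1; case: ltnP => // h2; case e2: (j - k)%N => [|j'] //; lia.
have nL1 v u g1 g2 : nth ord0 (L v u g1 g2) s.-1 = v by rewrite /L nth_cat sH ltnn subnn.
have nL2 v u g1 g2 : size g1 = k -> nth ord0 (L v u g1 g2) (s + k) = u.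
  move=> s1; rewrite /L nth_cat sH ifF; last by lia.
  by rewrite (_ : s + k - s.-1 = k.+1)%N /= ?nth_cat ?s1 ?ltnn ?subnn //; lia.
have vL v u g1 g2 : vals (rcons H v) (g1 ++ u :: g2) = nth ord0 (L v u g1 g2).
  by rewrite /vals -cats1 -catA.
have sk : s = (k + (1 + (s - k.+1)))%N by lia.
have eids : ids = take k ids ++ nth 0%N ids k :: drop k.+1 ids.
  by rewrite -drop_nth ?cat_take_drop ?sids.
have st : size (take k ids) = k by rewrite size_takel // sids ltnW.
transitivity (\sum_(v : I) \sum_(g1 <- alls n k) \sum_(u : I) \sum_(g2 <- alls n (s - k.+1))
   (cst y (nth ord0 (L v u g1 g2)))%:R * (wgt (take k ids) g1 * vv (nth 0%N ids k) u * wgt (drop k.+1 ids) g2)).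
  apply: eq_bigr => v _; rewrite {1}sk sum_alls_cat; apply: eq_big_seq => g1; rewrite mem_alls => /eqP s1.
  rewrite add1n sum_allsS; apply: eq_bigr => u _; apply: eq_bigr => g2 _.
  rewrite rho_bas vL {1}eids wgt_cat ?s1 // wgt_cons; ring.
have vz : \sum_(u : I) vv (nth 0%N ids k) u = 0.
  by apply: sum_vv1; apply: hids; apply: mem_nth; rewrite sids.
rewrite exchange_big big1_seq //= => g1; rewrite mem_alls => /eqP s1.
have lt1 : (s.-1 < s + s)%N by lia.
(* If the chosen bottom vertex is joined to the last top vertex, the sum over [v] absorbs the
   constraint; otherwise nothing constrains [u]. Either way the weight of [u] sums to zero. *)
have [eb | nb] := eqVneq (y (Ordinal lt1)) (y b).
  have cE v u g2 : cst y (nth ord0 (L v u g1 g2)) = (u == v) && cst y (nth ord0 (L ord0 ord0 g1 g2)).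
    apply/idP/andP => [h | [/eqP -> h]].
      have euv : u = v by have /cstP/(_ _ _ eb) := h; rewrite /= nL1 nL2.
      split; first by rewrite euv.
      apply: (@cst_upd (nth ord0 (L v u g1 g2)) _ b ord0) => // a; last by case/hk => ->; rewrite ?nL1 ?nL2.
      move=> na; apply: nL => //; apply/eqP => ea; case/eqP: na.
        by rewrite -eb; congr (y _); apply: val_inj.
      by congr (y _); apply: val_inj.
    apply: (@cst_upd (nth ord0 (L ord0 ord0 g1 g2)) _ b v) => // a; last by case/hk => ->; rewrite ?nL1 ?nL2.
    move=> na; apply: nL => //; apply/eqP => ea; case/eqP: na.
      by rewrite -eb; congr (y _); apply: val_inj.
    by congr (y _); apply: val_inj.
  rewrite exchange_big /=.
  transitivity (\sum_(u : I) vv (nth 0%N ids k) u * (\sum_(g2 <- alls n (s - k.+1))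
     (cst y (nth ord0 (L ord0 ord0 g1 g2)))%:R * (wgt (take k ids) g1 * wgt (drop k.+1 ids) g2))); last first.
    by rewrite -mulr_suml vz mul0r.
  apply: eq_bigr => u _; rewrite exchange_big mulr_sumr; apply: eq_bigr => g2 _ /=.
  rewrite (bigD1 u) //= cE eqxx /= big1 ?addr0; first by ring.
  by move=> v /negPf nv; rewrite cE eq_sym nv mul0r.
apply: big1 => v _.
have cE u g2 : cst y (nth ord0 (L v u g1 g2)) = cst y (nth ord0 (L v ord0 g1 g2)).
  have D u1 u2 : cst y (nth ord0 (L v u1 g1 g2)) -> cst y (nth ord0 (L v u2 g1 g2)).
    apply: (@cst_upd _ _ b u2) => a.
      move=> na; have [ea | nea] := eqVneq (a : nat) s.-1; first by rewrite ea !nL1.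
      apply: nL => //; apply/eqP => ea; case/eqP: na; congr (y _); exact: val_inj.
    move=> ea; case: (hk a ea) => e'; first by rewrite e' nL2.
    by case/eqP: nb; rewrite -ea; congr (y _); apply: val_inj.
  by apply/idP/idP; apply: D.
transitivity (\sum_(u : I) vv (nth 0%N ids k) u * (\sum_(g2 <- alls n (s - k.+1))
   (cst y (nth ord0 (L v ord0 g1 g2)))%:R * (wgt (take k ids) g1 * wgt (drop k.+1 ids) g2))); last first.
  by rewrite -mulr_suml vz mul0r.
apply: eq_bigr => u _; rewrite mulr_sumr; apply: eq_bigr => g2 _; rewrite cE; ring.
Qed.
End Theta.

(** * The functionals and their vanishing on relations *)

Section Functional.
Variables (n s : nat) (lam nu : seq nat).
Local Notation m := (sumn lam).
Local Notation k := (sumn nu).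
Local Notation r := (m + s)%N.
Local Notation q := (n.+1%:R : rat).
Local Notation I := 'I_n.+1.
Local Notation T := ('I_r.+1 * 'I_r.+1)%type.
Local Notation o0 := ((fun _ => 0%N) : Occ n).
Variables (cm cn : T -> nat) (ids : seq nat) (z : I).
Hypothesis hn : (r + r <= n.+1)%N.
Hypothesis plam : is_part lam.
Hypothesis pnu : is_part nu.
Hypothesis knu : (k <= r)%N.
Hypothesis s0 : (0 < s)%N.
Local Notation Xl := (cells r lam).
Local Notation Xn := (cells r nu).
Hypothesis injm : {in Xl &, injective cm}.
Hypothesis injn : {in Xn &, injective cn}.
Hypothesis hcm : forall x, x \in Xl -> ((3 * cm x).+2 < n.+1)%N.
Hypothesis hcn : forall x, x \in Xn -> ((3 * cn x).+2 < n.+1)%N.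
Hypothesis zcm : forall x, x \in Xl -> vv (cm x) z = 0.
Hypothesis zcn : forall x, x \in Xn -> vv (cn x) z = 0.
Hypothesis sids : size ids = s.
Hypothesis uids : uniq ids.
Hypothesis hids : forall c, c \in ids -> ((3 * c).+2 < n.+1)%N.

Lemma part_nth al i : is_part al -> (nth 0%N al i <= sumn al)%N.
Proof.
move=> _; elim: al i => [|x al IH] [|i] //=; first exact: leq_addr.
exact: leq_trans (IH i) (leq_addl _ _).
Qed.

Definition Xi (f : seq I) : rat := \sum_(p : {perm T} | colp Xn p) (-1) ^+ p * wgt [seq cn (p x) | x <- Xn] f.
Definition Eta (g : seq I) : rat := \sum_(p : {perm T} | colp Xl p) (-1) ^+ p * wgt ([seq cm (p x) | x <- Xl] ++ ids) g.
Definition fz (f : seq I) : seq I := f ++ nseq (r - k) z.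
(** On top the first [|nu|] letters carry the columns of [nu], and the padding is a label outside
    all supports. At the bottom the letters of [t^lam] carry the columns of [lam] and each later
    letter a class from [ids]. *)
Definition Phi (a : alg r) : rat :=
  \sum_(f <- alls n k) \sum_(g <- alls n r) Xi f * Eta g * rho a (fz f) g.

Lemma size_fz f : size f = k -> size (fz f) = r.
Proof. by move=> sf; rewrite size_cat size_nseq sf subnKC. Qed.

Lemma sXl : size Xl = m.
Proof.
apply: size_cells; first by apply: leq_trans (size_part plam) _; lia.
by move=> i; apply: leq_trans (part_nth i plam) _; lia.
Qed.
Lemma sXn : size Xn = k.
Proof.
apply: size_cells; first by apply: leq_trans (size_part pnu) _; lia.
by move=> i; apply: leq_trans (part_nth i pnu) _; lia.
Qed.

Lemma PhiD a b : Phi (a + b) = Phi a + Phi b.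
Proof.
rewrite -big_split; apply: eq_bigr => f _; rewrite -big_split; apply: eq_bigr => g _ /=.
by rewrite rhoD mulrDr.
Qed.
Lemma PhiZ c a : Phi (scl c a) = c * Phi a.
Proof.
rewrite mulr_sumr; apply: eq_bigr => f _; rewrite mulr_sumr; apply: eq_bigr => g _ /=.
by rewrite rho_scl mulrCA.
Qed.
Lemma Phi0 : Phi 0 = 0.
Proof. by apply: big1 => f _; apply: big1 => g _; rewrite rho0 mulr0. Qed.

Lemma Phi_left a : (forall g, size g = r -> \sum_(f <- alls n k) Xi f * rho a (fz f) g = 0) -> Phi a = 0.
Proof.
move=> H; rewrite /Phi exchange_big big1_seq //= => g; rewrite mem_alls => /eqP sg.
have := congr1 (fun x => Eta g * x) (H g sg); rewrite mulr0 mulr_sumr; apply: etrans.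
by apply: eq_bigr => f _; rewrite mulrA [Eta g * _]mulrC.
Qed.

Lemma Phi_right a : (forall f, size f = r -> \sum_(g <- alls n r) Eta g * rho a f g = 0) -> Phi a = 0.
Proof.
move=> H; apply: big1_seq => f /=; rewrite mem_alls => /eqP sf.
have := congr1 (fun x => Xi f * x) (H _ (size_fz sf)); rewrite mulr0 mulr_sumr; apply: etrans.
by apply: eq_bigr => g _; rewrite mulrA.
Qed.

Lemma Lf_sum (J : Type) (l : seq J) (c : J -> rat) (phi : J -> Fck n) t g mm :
  \sum_(j <- l) c j * Lf t g (phi j) mm = Lf t g (fun mm => \sum_(j <- l) c j * phi j mm) mm.
Proof.
elim: l => [|j l IH].
  rewrite big_nil -[LHS](mul0r (Lf t g (fun=> 0) mm)) -LfZ; apply: Lf_E => m'.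
  by rewrite big_nil mul0r.
by rewrite big_cons IH -LfZ -LfD; apply: Lf_E => m'; rewrite big_cons.
Qed.

Lemma Xi_kill t mm : size t = r -> domw nu (wtw t) ->
  \sum_(f <- alls n k) Xi f * Uf (@vac n) t (fz f) mm = 0.
Proof.
move=> st dom.
have st1 : size (take k t) = k by rewrite size_takel // st.
have sc (p : {perm T}) : size [seq cn (p x) | x <- Xn] = size (take k t) by rewrite size_map sXn st1.
transitivity (\sum_(p : {perm T} | colp Xn p) (-1) ^+ p *
   Uf (Uz (@vac n) (zip (take k t) [seq cn (p x) | x <- Xn])) (drop k t) (nseq (r - k) z) mm).
  under eq_bigr => f _ do rewrite mulr_suml.
  rewrite exchange_big; apply: eq_bigr => p _ /=.
  have -> : Uz (@vac n) (zip (take k t) [seq cn (p x) | x <- Xn]) =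
      fun mm => \sum_(f <- alls n k) wgt [seq cn (p x) | x <- Xn] f * Uf (@vac n) (take k t) f mm.
    by apply/funext => m'; rewrite -Uz_Uf // st1.
  rewrite Uf_sum mulr_sumr; apply: eq_big_seq => f; rewrite mem_alls => /eqP sf.
  by rewrite -Uf_cat ?st1 // cat_take_drop mulrA.
apply: specht_kill => //.
- by apply: leq_trans (size_part pnu) _; lia.
- by move=> i; apply: leq_trans (part_nth i pnu) _; lia.
- by rewrite st subnKC.
Qed.

(** Transposing the pairing lets the top word act on the vacuum, where [Xi_kill] applies because the
    middle shape is above [nu]. *)
Lemma Phi_Pgt v : v \in Pgt r q nu -> Phi v = 0.
Proof.
move=> /allpairsPdep [t [t' []]]; rewrite mem_alltab mem_filter mem_alltab.
move=> /andP [/eqP st h1] /and3P [/andP [/eqP sh hg] /eqP st' h2] ->.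
have [al e1] : exists al, kend [::] t = Some al by case: (kend _ t) h1 => [al|] // _; exists al.
have [al' e2] : exists al, kend [::] t' = Some al by case: (kend _ t') h2 => [al'|] // _; exists al'.
have e3 : al' = al by move: sh; rewrite /shp e1 e2.
have [pal wal] := kend0_part e1.
apply: Phi_left => g sg.
transitivity (\sum_(f <- alls n k) Xi f * Lf t' g (Uf (@vac n) t (fz f)) o0).
  apply: eq_big_seq => f; rewrite mem_alls => /eqP sf; congr (_ * _).
  rewrite (rho_dT_uT e1) ?e2 ?e3 ?size_fz //.
  have := @KK_sym n t t' (fz f) g; rewrite size_fz // st st' sg => /(_ erefl erefl).
  by rewrite /KK !uvec_Uf ?size_fz ?st ?st' ?sg.
rewrite Lf_sum -[RHS](mul0r (Lf t' g (fun=> 0) o0)) -LfZ; apply: Lf_E => m'.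
rewrite mul0r; apply: Xi_kill => //; rewrite -wal; apply/gdomP => //.
by move: hg; rewrite /shp e1.
Qed.

Lemma Eta_cat g1 g2 : size g1 = m -> Eta (g1 ++ g2) =
  (\sum_(p : {perm T} | colp Xl p) (-1) ^+ p * wgt [seq cm (p x) | x <- Xl] g1) * wgt ids g2.
Proof.
move=> s1; rewrite mulr_suml; apply: eq_bigr => p _.
by rewrite wgt_cat ?size_map ?sXl ?s1 // mulrA.
Qed.

(** The first [m] steps end above [lam], so antisymmetrizing along the columns of [lam] already
    kills the vector they build. *)
Lemma Phi_Dgt v : v \in Dgt r q lam nu s -> Phi v = 0.
Proof.
move=> /mem_DgtP [t [-> st hk [[st1 h1] hg]]].
have [al e1] : exists al, kend [::] (take m t) = Some al by case: (kend _ (take m t)) h1 => [al|] // _; exists al.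
have [pal wal] := kend0_part e1.
have dom : domw lam (wtw (take m t)) by rewrite -wal; apply/gdomP => //; move: hg; rewrite /shp e1.
apply: Phi_right => f sf.
have sc (p : {perm T}) : size [seq cm (p x) | x <- Xl] = size (take m t) by rewrite size_map sXl st1.
pose om : Fck n := fun mm => \sum_(p : {perm T} | colp Xl p) (-1) ^+ p * Uz (@vac n) (zip (take m t) [seq cm (p x) | x <- Xl]) mm.
have om0 : om = fun=> 0.
  apply/funext => mm; have := @specht_kill n r lam cm z plam _ _ injm hcm zcm (take m t) 0 mm.
  have e2 : take m (take m t) = take m t by rewrite take_oversize ?st1.
  have e3 : drop m (take m t) = [::] by rewrite drop_oversize ?st1.
  rewrite addn0 st1 e2 e3; apply=> //.
  - by apply: leq_trans (size_part plam) _; lia.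
  - by move=> i; apply: leq_trans (part_nth i plam) _; lia.
transitivity (\sum_(g2 <- alls n s) wgt ids g2 * Uf om (drop m t) g2 (occ (zip (rw nu) (take k f)))); last first.
  by rewrite om0 big1 // => g2 _; rewrite Uf0 mulr0.
rewrite sum_alls_cat exchange_big; apply: eq_big_seq => g2; rewrite mem_alls => /eqP sg2 /=.
have -> : om = fun mm => \sum_(g1 <- alls n m)
   (\sum_(p : {perm T} | colp Xl p) (-1) ^+ p * wgt [seq cm (p x) | x <- Xl] g1) * Uf (@vac n) (take m t) g1 mm.
  apply/funext => mm; rewrite /om.
  under [RHS]eq_bigr => g1 _ do rewrite mulr_suml.
  rewrite [RHS]exchange_big; apply: eq_bigr => p _ /=.
  rewrite -Uz_Uf // st1 mulr_sumr; apply: eq_bigr => g1 _; exact: mulrA.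
rewrite Uf_sum mulr_sumr big_seq [RHS]big_seq; apply: eq_bigr => g1; rewrite mem_alls => /eqP s1.
rewrite Eta_cat //.
rewrite (rho_uT hk) // ?size_cat ?s1 ?sg2 // -{1}(cat_take_drop m t) Uf_cat ?st1 ?s1 //; ring.
Qed.

Lemma Eta_embd (y : dg s) (A : seq I) : size A = r.-1 ->
  \sum_(v : I) \sum_(g <- alls n r) rho (bas (embd r s y)) (rcons A v) g * Eta g = 0.
Proof.
move=> sA; have sAv v : size (rcons A v) = r by rewrite size_rcons sA; lia.
have tA v : take m (rcons A v) = take m A by rewrite -cats1 takel_cat // sA; lia.
have dA v : drop m (rcons A v) = rcons (drop m A) v by rewrite drop_rcons // sA; lia.
transitivity (\sum_(v : I) (\sum_(p : {perm T} | colp Xl p) (-1) ^+ p * wgt [seq cm (p x) | x <- Xl] (take m A)) *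
    \sum_(g2 <- alls n s) rho (bas y) (rcons (drop m A) v) g2 * wgt ids g2).
  apply: eq_bigr => v _.
  transitivity (\sum_(g <- alls n r) (take m (rcons A v) == take m g)%:R *
     (rho (bas y) (drop m (rcons A v)) (drop m g) * Eta g)).
    apply: eq_big_seq => g; rewrite mem_alls => /eqP sg; rewrite [X in X * _](rho_embd _ (sAv v) sg).
    by rewrite mulrA.
  rewrite sum_take // mulr_sumr; apply: eq_big_seq => g2; rewrite mem_alls => /eqP sg2.
  have stA : size (take m A) = m by rewrite size_takel // sA; lia.
  rewrite tA dA drop_size_cat // Eta_cat //; ring.
by rewrite -mulr_sumr theta0 ?mulr0 // size_drop sA; lia.
Qed.

(** The factor [p_r] above the diagram [y] sums over its last top letter, which is the sum that
    [theta0] evaluates. *)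
Lemma Eta_I a : Iset r s q a -> forall f, size f = r -> \sum_(g <- alls n r) rho a f g * Eta g = 0.
Proof.
apply: (@spanP_ind r _ (fun a => forall f, size f = r -> \sum_(g <- alls n r) rho a f g * Eta g = 0)).
- by move=> f _; apply: big1 => g _; rewrite rho0 mul0r.
- move=> v w h1 h2 f sf; rewrite (eq_bigr (fun g => rho v f g * Eta g + rho w f g * Eta g)).
    by rewrite big_split /= h1 // h2 // addr0.
  by move=> g _; rewrite rhoD mulrDl.
- move=> c v h f sf; have := congr1 (fun x => c * x) (h f sf); rewrite mulr0 mulr_sumr; apply: etrans.
  by apply: eq_bigr => g _; rewrite rho_scl mulrA.
move=> v [x [y [hx hy ->]]] f sf; rewrite (amulA hn).
transitivity (\sum_(h <- alls n r) rho (bas (embd r s x)) f h *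
   (\sum_(g <- alls n r) rho (amul q (pg r r) (bas (embd r s y))) h g * Eta g)).
  under [RHS]eq_bigr => h _ do rewrite mulr_sumr.
  rewrite exchange_big; apply: eq_big_seq => g; rewrite mem_alls => /eqP sg.
  rewrite [X in X * _](rho_amul _ _ sf sg) mulr_suml; apply: eq_bigr => h _; by rewrite mulrA.
apply: big1_seq => h /=; rewrite mem_alls => /eqP sh.
suff -> : \sum_(g <- alls n r) rho (amul q (pg r r) (bas (embd r s y))) h g * Eta g = 0 by rewrite mulr0.
transitivity (\sum_(g <- alls n r) lact (pg r r) (fun h => rho (bas (embd r s y)) h g * Eta g) h).
  apply: eq_big_seq => g; rewrite mem_alls => /eqP sg.
  rewrite [X in X * _](rho_amul _ _ sh sg) mulr_suml; apply: eq_bigr => h' _; by rewrite mulrA.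
have r0 : (0 < r)%N by lia.
have [A [v0 [sA eh]]] : exists A v, size A = r.-1 /\ h = A ++ v :: [::].
  by case/lastP: h sh => [|A v0]; [move=> /= sh0; lia | rewrite size_rcons => e; exists A, v0; rewrite cats1; split=> //; lia].
transitivity (\sum_(g <- alls n r) \sum_(u : I) rho (bas (embd r s y)) (rcons A u) g * Eta g).
  apply: eq_bigr => g _; rewrite eh (@lact_pg n r r) -?eh //.
  by apply: eq_bigr => u _; rewrite cats1.
by rewrite exchange_big Eta_embd.
Qed.

Lemma Phi_B v : Bset r q lam nu s v -> Phi v = 0.
Proof.
apply: (@spanP_ind r _ (fun a => Phi a = 0)).
- exact: Phi0.
- by move=> a b h1 h2; rewrite PhiD h1 h2 addr0.
- by move=> c a h; rewrite PhiZ h mulr0.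
move=> a [|[w [b [hw hb ->]]]].
  by rewrite mem_cat => /orP [/Phi_Pgt|/Phi_Dgt].
apply: Phi_right => f sf.
transitivity (\sum_(h <- alls n r) rho w f h * (\sum_(g <- alls n r) rho b h g * Eta g)).
  under [RHS]eq_bigr => h _ do rewrite mulr_sumr.
  rewrite exchange_big; apply: eq_big_seq => g; rewrite mem_alls => /eqP sg.
  rewrite [X in _ * X](rho_amul _ _ sf sg) mulr_sumr; apply: eq_bigr => h _; by rewrite mulrC mulrA.
by apply: big1_seq => h /=; rewrite mem_alls => /eqP sh; rewrite (Eta_I hb) // mulr0.
Qed.

(** Reading off a weighted coefficient amounts to removing the boxes one at a time, so the top word
    becomes a string of letters too and a value of [Phi] a signed sum of smeared vacuum
    expectations. *)
Lemma Uz_eval (R cs : seq nat) (phi : Fck n) : size cs = size R -> all (fun c => c != 0%N) R ->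
  \sum_(f <- alls n (size R)) wgt cs f * phi (occ (zip R f)) = Uz phi (zip [seq (c, 0%N) | c <- R] cs) o0.
Proof.
elim: R cs phi => [|c R IH] [|d cs] phi //=.
  by move=> _ _; rewrite big_seq1 /wgt big_nil mul1r.
move=> [sc] /andP [c0 hR]; rewrite sum_allsS -IH // exchange_big; apply: eq_bigr => f _ /=.
rewrite /Dc mulr_sumr; apply: eq_bigr => x _; rewrite wgt_cons /Dop /yy /= /dd (negPf c0).
by rewrite occ_cons mulrCA mulrA.
Qed.

Definition lpq (t : seq (nat * nat)) (p g : {perm T}) :=
  zip (tlam lam) [seq cm (g x) | x <- Xl] ++ zip t ids ++ zip [seq (c, 0%N) | c <- rw nu] [seq cn (p x) | x <- Xn].

Lemma Phi_uT t : size t = s -> kend lam t = Some nu ->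
  Phi (uT r q (tlam lam ++ t)) = \sum_(p : {perm T} | colp Xn p) \sum_(g : {perm T} | colp Xl g)
    (-1) ^+ p * (-1) ^+ g * Uz (@vac n) (lpq t p g) o0.
Proof.
move=> st hk.
have hk' : kend [::] (tlam lam ++ t) = Some nu by rewrite kend_cat kend_tlam.
have stt : size (tlam lam ++ t) = r by rewrite size_cat size_tlam st.
transitivity (\sum_(f <- alls n k) \sum_(g <- alls n r) Xi f * Eta g * Uf (@vac n) (tlam lam ++ t) g (occ (zip (rw nu) f))).
  apply: eq_big_seq => f; rewrite mem_alls => /eqP sf; apply: eq_big_seq => g; rewrite mem_alls => /eqP sg.
  by rewrite (rho_uT hk') ?size_fz // /fz take_size_cat.
have E (g : {perm T}) (f : seq I) : \sum_(h <- alls n r) wgt ([seq cm (g x) | x <- Xl] ++ ids) h *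
    Uf (@vac n) (tlam lam ++ t) h (occ (zip (rw nu) f)) =
    Uz (@vac n) (zip (tlam lam ++ t) ([seq cm (g x) | x <- Xl] ++ ids)) (occ (zip (rw nu) f)).
  by rewrite -Uz_Uf ?stt // !size_cat size_map sXl sids.
have rw0 : all (fun c => c != 0%N) (rw nu) by apply/allP => c /rwf_ge; rewrite lt0n.
transitivity (\sum_(f <- alls n k) \sum_(p : {perm T} | colp Xn p) \sum_(g : {perm T} | colp Xl g)
   (-1) ^+ p * (-1) ^+ g * (wgt [seq cn (p x) | x <- Xn] f *
   Uz (@vac n) (zip (tlam lam ++ t) ([seq cm (g x) | x <- Xl] ++ ids)) (occ (zip (rw nu) f)))).
  apply: eq_bigr => f _.
  transitivity (Xi f * \sum_(h <- alls n r) Eta h * Uf (@vac n) (tlam lam ++ t) h (occ (zip (rw nu) f))).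
    by rewrite mulr_sumr; apply: eq_bigr => h _; rewrite mulrA.
  rewrite mulr_suml; apply: eq_bigr => p _.
  have -> : \sum_(h <- alls n r) Eta h * Uf (@vac n) (tlam lam ++ t) h (occ (zip (rw nu) f)) =
     \sum_(g : {perm T} | colp Xl g) (-1) ^+ g * Uz (@vac n) (zip (tlam lam ++ t) ([seq cm (g x) | x <- Xl] ++ ids)) (occ (zip (rw nu) f)).
    under eq_bigr => h _ do rewrite mulr_suml.
    rewrite exchange_big; apply: eq_bigr => g _ /=; rewrite -E mulr_sumr.
    by apply: eq_bigr => h _; rewrite mulrA.
  by rewrite mulr_sumr; apply: eq_bigr => g _; rewrite mulrACA.
rewrite exchange_big; apply: eq_bigr => p _ /=; rewrite exchange_big; apply: eq_bigr => g _ /=.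
rewrite -mulr_sumr; congr (_ * _).
rewrite -(size_rw nu) Uz_eval //; last by rewrite size_map sXn size_rw.
by rewrite /lpq catA Uz_cat zip_cat // size_map sXl size_tlam.
Qed.
End Functional.

(** * Classes of cells adapted to a tableau *)

Section Classes.
Variables (A s : nat) (al : seq nat) (w : seq nat) (c : nat -> nat).
Local Notation T := ('I_A.+1 * 'I_A.+1)%type.
Local Notation C0 := #|{: T}|.
Local Notation X := (cells A al).
Hypothesis pal : is_part al.
Hypothesis bal : (sumn al <= A)%N.
Hypothesis sw : size w = s.
Hypothesis hc : forall i, (c i + count_mem i.+1 w = nth 0 al i)%N.
Hypothesis hb : forall i, (nth 0 al i.+1 <= c i)%N.

Definition pos (i : nat) := [seq k <- iota 0 s | nth 0%N w k == i.+1].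
Lemma size_pos i : size (pos i) = count_mem i.+1 w.
Proof.
rewrite size_filter -[in RHS](mkseq_nth 0%N w) sw /mkseq count_map.
by apply: eq_count => k.
Qed.

(* Core cells (columns below [c]) are numbered by themselves; the remaining cells of row [i], from left
   to right, by the steps of [w] that involve row [i]. *)
Definition clf (x : T) : nat :=
  if (x.2 < c x.1)%N then enum_rank x : nat else (C0 + nth 0 (pos x.1) (x.2 - c x.1))%N.

Lemma clf_core (x : T) : (x.2 < c x.1)%N -> clf x = enum_rank x.
Proof. by rewrite /clf => ->. Qed.

Lemma clf_step (x : T) : x \in X -> (c x.1 <= x.2)%N -> exists k, [/\ (k < s)%N, clf x = (C0 + k)%N & nth 0%N w k = rown x].
Proof.
rewrite mem_cells => hx h; have hp : (x.2 - c x.1 < size (pos x.1))%N 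
  by rewrite size_pos -(ltn_add2l (c x.1)) subnKC // hc.
exists (nth 0 (pos x.1) (x.2 - c x.1))%N; have := mem_nth 0%N hp; rewrite mem_filter mem_iota add0n /= => /andP [/eqP h1 h2].
by split=> //; rewrite /clf ltnNge h.
Qed.

Definition ccell (k : nat) : T :=
  let i := (nth 0%N w k).-1 in (inord i, inord (c i + index k (pos i))%N).

Lemma ccellP k : (k < s)%N -> nth 0%N w k != 0%N ->
  [/\ ccell k \in X, clf (ccell k) = (C0 + k)%N, rown (ccell k) = nth 0%N w k & (c (ccell k).1 <= (ccell k).2)%N].
Proof.
move=> ks; case e: (nth 0%N w k) => [//|i] _; rewrite /ccell e /=.
have kp : k \in pos i by rewrite mem_filter e eqxx mem_iota.
have hi := kp; rewrite -index_mem size_pos in hi.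
have hal : (c i + index k (pos i) < nth 0 al i)%N by have := hc i; lia.
have nal := part_nth i pal.
have isz : (i < size al)%N by rewrite ltnNge; apply/negP => h; move: hal; rewrite nth_default.
have iA : (i < A.+1)%N by have := size_part pal; lia.
have jA : (c i + index k (pos i) < A.+1)%N by lia.
split.
- by rewrite mem_cells /= !inordK.
- by rewrite /clf /= !inordK // ltnNge leq_addr /= addKn nth_index.
- by rewrite /rown /= inordK.
- by rewrite /= !inordK // leq_addr.
Qed.

Lemma clf_lt (x : T) : (x.2 < c x.1)%N -> (clf x < C0)%N.
Proof. by move=> /clf_core ->; apply: ltn_ord. Qed.

Lemma clf_bound (x : T) : x \in X -> (clf x < C0 + s)%N.
Proof.
move=> hx; case: (ltnP x.2 (c x.1)) => h; first by apply: leq_trans (clf_lt h) _; apply: leq_addr.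
by have [k [ks -> _]] := clf_step hx h; rewrite ltn_add2l.
Qed.

Lemma clf_inj : {in X &, injective clf}.
Proof.
move=> x y hx hy; case: (ltnP x.2 (c x.1)) => h; case: (ltnP y.2 (c y.1)) => h'.
- by rewrite !clf_core // => /ord_inj /enum_rank_inj.
- by have [k [_ -> _]] := clf_step hy h'; have := clf_lt h; lia.
- by have [k [_ -> _]] := clf_step hx h; have := clf_lt h'; lia.
have [k [ks e1 w1]] := clf_step hx h; have [k' [ks' e2 w2]] := clf_step hy h'.
rewrite e1 e2 => /addnI e; have exy : x.1 = y.1 by apply: val_inj; move: w1; rewrite e w2 => -[].
move: e1 e2; rewrite e => <-; rewrite /clf !ltnNge h h' /= exy => /addnI /eqP.
rewrite nth_uniq ?size_pos ?filter_uniq ?iota_uniq //.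
- move=> /eqP e3; case: x y exy h h' hx hy {w1 w2} e3 => [x1 x2] [y1 y2] /= -> h h' _ _ e3.
  by congr (_, _); apply: val_inj => /=; lia.
- by rewrite -(ltn_add2l (c y.1)) subnKC // hc -mem_cells.
- by rewrite -exy -(ltn_add2l (c x.1)) subnKC // hc -mem_cells.
Qed.

(** The next row is no longer than the core of the present one, so nothing lies below a cell outside
    the core. *)
Lemma step_bottom (x y : T) : x \in X -> (c x.1 <= x.2)%N -> y \in X -> y.2 = x.2 -> (y.1 <= x.1)%N.
Proof.
rewrite !mem_cells => hx h hy e; rewrite leqNgt; apply/negP => lt.
have /is_partP [mono _] := pal.
have : (nth 0 al y.1 <= nth 0 al x.1.+1)%N.
  by rewrite -(subnKC lt); elim: (y.1 - _)%N => [|d IH]; rewrite ?addn0 // addnS; apply: leq_trans (mono _) IH.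
by move=> h1; have := leq_trans (leq_trans h1 (hb x.1)) h; rewrite leqNgt -e hy.
Qed.
End Classes.

Lemma lf_map (T : eqType) (X : seq T) (F : T -> nat * nat) (G : T -> nat) x c : uniq X ->
  {in X &, injective G} -> x \in X -> G x = c -> lf c [seq (F x, G x) | x <- X] = [:: (F x, c)].
Proof.
move=> uX inj hx <-; rewrite /lf filter_map.
have -> : [seq y <- X | preim (fun x => (F x, G x)) (fun u => u.2 == G x) y] = [:: x]; last by [].
rewrite -(filter_pred1_uniq uX hx); apply: eq_in_filter => y hy /=.
by apply/eqP/eqP => [/inj -> // | ->].
Qed.

Lemma lf_map0 (T : eqType) (X : seq T) (F : T -> nat * nat) (G : T -> nat) c :
  (forall x, x \in X -> G x <> c) -> lf c [seq (F x, G x) | x <- X] = [::].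
Proof.
move=> H; rewrite /lf filter_map (eq_in_filter (a2 := pred0)) ?filter_pred0 // => y hy /=.
by apply/eqP/H.
Qed.

(** The class of a step contains at most a box of [lam] in row [l], the step, and a box of [nu] in
    row [q], with 0 for no box. They cancel exactly when the step carries the first into the
    second. *)
Lemma krun3 (l a b q c : nat) : (a, b) != (0, 0)%N ->
  krun [::] ((if l == 0%N then [::] else [:: ((0, l), c)]) ++ ((a, b), c) :: (if q == 0%N then [::] else [:: ((q, 0), c)]))%N
  = (a == l) && (b == q).
Proof.
move=> ne; case: (eqVneq l 0%N) => [-> | l0] /=.
  case: (eqVneq a 0%N) ne => [-> | a0 _] /=; last by [].
  rewrite xpair_eqE eqxx /= /kstep /= => b0; rewrite (negPf b0).
  case: (eqVneq q 0%N) => [-> | q0] /=; first by rewrite (negPf b0).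
  rewrite (negPf q0) inE xpair_eqE eqxx andbT /kstep /= (negPf q0) eq_sym.
  by case: eqP => //= ->; rewrite eqxx.
rewrite {1}/kstep /= (negPf l0).
case: (eqVneq a 0%N) ne => [-> | a0 _] /=.
  rewrite xpair_eqE eqxx /= => b0; rewrite /kstep /= (negPf b0) (eq_sym 0%N) (negPf l0) /=.
  case: (eqVneq q 0%N) => [_ | q0] //=.
  by rewrite /kstep /= (negPf q0); case: ifP => // _; rewrite /= andbF.
rewrite inE xpair_eqE eqxx andbT; case: (eqVneq a l) => [-> | //] /=.
rewrite /kstep /= (negPf l0) /= ?xpair_eqE ?eqxx /=.
case: (eqVneq b 0%N) => [-> | b0] /=.
  by case: (eqVneq q 0%N) => H /=; rewrite ?(negPf H).
case: (eqVneq q 0%N) => [-> | q0] /=; first by rewrite (negPf b0).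
rewrite (negPf q0) inE xpair_eqE eqxx andbT /kstep /= (negPf q0) eq_sym.
by case: eqP => //= ->; rewrite eqxx.
Qed.

Lemma krun2 (l q c : nat) : l != 0%N -> q != 0%N ->
  krun [::] [:: ((0, l), c); ((q, 0), c)]%N = (l == q).
Proof.
move=> l0 q0; rewrite /= /kstep /= (negPf l0) (negPf q0) /= inE xpair_eqE eqxx andbT eq_sym.
by case: eqP => //= ->; rewrite eqxx.
Qed.

(** * Triangularity of the functionals *)

Section Test.
Variables (n s : nat) (lam nu : seq nat) (w : seq (nat * nat)).
Local Notation m := (sumn lam).
Local Notation k := (sumn nu).
Local Notation r := (m + s)%N.
Local Notation q := (n.+1%:R : rat).
Local Notation T := ('I_r.+1 * 'I_r.+1)%type.
Local Notation C0 := #|{: T}|.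
Local Notation o0 := ((fun _ => 0%N) : Occ n).
Local Notation Xl := (cells r lam).
Local Notation Xn := (cells r nu).
Hypothesis hN : (3 * (C0 + s) <= n)%N.
Hypothesis hn : (r + r <= n.+1)%N.
Hypothesis plam : is_part lam.
Hypothesis pnu : is_part nu.
Hypothesis knu : (k <= r)%N.
Hypothesis s0 : (0 < s)%N.
Hypothesis sw : size w = s.
Hypothesis w00 : (0, 0)%N \notin w.
Let w1 := [seq ab.1 | ab <- w].
Let w2 := [seq ab.2 | ab <- w].
Variable c : nat -> nat.
Hypothesis hc1 : forall i, (c i + count_mem i.+1 w1 = nth 0 lam i)%N.
Hypothesis hc2 : forall i, (c i + count_mem i.+1 w2 = nth 0 nu i)%N.
Hypothesis hb1 : forall i, (nth 0 lam i.+1 <= c i)%N.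
Hypothesis hb2 : forall i, (nth 0 nu i.+1 <= c i)%N.

Let cm : T -> nat := clf s w1 c.
Let cn : T -> nat := clf s w2 c.
Let ids := iota C0 s.
(** The classes use labels below [3 * (C0 + s)], so the largest label lies outside all supports. *)
Let z : 'I_n.+1 := ord_max.
Definition Phiw : alg r -> rat := Phi nu cm cn ids z.

Lemma sw1 : size w1 = s. Proof. by rewrite size_map. Qed.
Lemma sw2 : size w2 = s. Proof. by rewrite size_map. Qed.
Lemma bl : (m <= r)%N. Proof. exact: leq_addr. Qed.

Lemma cm_bound x : x \in Xl -> (cm x < C0 + s)%N.
Proof. exact: (clf_bound sw1 hc1). Qed.
Lemma cn_bound x : x \in Xn -> (cn x < C0 + s)%N.
Proof. exact: (clf_bound sw2 hc2). Qed.
Lemma cl_ok d : (d < C0 + s)%N -> ((3 * d).+2 < n.+1)%N /\ vv d z = 0.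
Proof.
move=> h; split; first by move: hN; lia.
by apply/eqP/negPn/negP => /vv_supp; rewrite /z /=; move: hN; lia.
Qed.
Lemma ids_ok d : d \in ids -> (d < C0 + s)%N.
Proof. by rewrite mem_iota => /andP []. Qed.

Lemma cm_inj : {in Xl &, injective cm}. Proof. exact: (clf_inj plam bl sw1 hc1). Qed.
Lemma cn_inj : {in Xn &, injective cn}. Proof. exact: (clf_inj pnu knu sw2 hc2). Qed.

Lemma Phiw_B v : Bset r q lam nu s v -> Phiw v = 0.
Proof.
apply: Phi_B => //.
- exact: cm_inj.
- exact: cn_inj.
- by move=> x /cm_bound /cl_ok [].
- by move=> x /cn_bound /cl_ok [].
- by move=> x /cm_bound /cl_ok [].
- by move=> x /cn_bound /cl_ok [].
- by rewrite size_iota.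
- exact: iota_uniq.
- by move=> d /ids_ok /cl_ok [].
Qed.

Lemma szl : (size lam <= r.+1)%N. Proof. by apply: leq_trans (size_part plam) _; lia. Qed.
Lemma nvl i : (nth 0 lam i <= r.+1)%N. Proof. by apply: leq_trans (part_nth i plam) _; lia. Qed.
Lemma szn : (size nu <= r.+1)%N. Proof. by apply: leq_trans (size_part pnu) _; lia. Qed.
Lemma nvn i : (nth 0 nu i <= r.+1)%N. Proof. by apply: leq_trans (part_nth i pnu) _; lia. Qed.

Lemma lpqE t (p g : {perm T}) : size t = s -> lpq nu cm cn ids t p g =
  [seq ((0, rown x), cm (g x))%N | x <- Xl] ++ [seq (nth (0, 0) t j, C0 + j)%N | j <- iota 0 s] ++
  [seq ((rown x, 0), cn (p x))%N | x <- Xn].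
Proof.
move=> st; rewrite /lpq tlam_rw -(cells_rw szl nvl) -(cells_rw szn nvn) -!map_comp !zip_map.
congr (_ ++ (_ ++ _)).
have -> : ids = [seq (C0 + j)%N | j <- iota 0 s] by rewrite -iotaDl addn0.
by rewrite -{1}(mkseq_nth (0, 0)%N t) st /mkseq zip_map.
Qed.

Let xl j := ccell r s w1 c j.
Let xn j := ccell r s w2 c j.

(** The row of the cell that bears class [C0 + j] after the column permutation, and 0 when step [j]
    of the word touches no row. *)
Definition lrow (w' : seq nat) (x : nat -> T) (g : {perm T}) (j : nat) : nat :=
  if nth 0%N w' j == 0%N then 0%N else rown ((g^-1)%g (x j)).

Lemma colpV (X : seq T) (g : {perm T}) : colp X g -> colp X (g^-1)%g.
Proof.
move=> /andP [h1 /forallP h2]; rewrite /colp (perm_onV h1) /=; apply/forallP => x.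
by rewrite -(eqP (h2 _)) permKV.
Qed.

Lemma lf_part (al : seq nat) (w' : seq nat) (F : T -> nat * nat) (g : {perm T}) j : is_part al -> (sumn al <= r)%N ->
  size w' = s -> (forall i, (c i + count_mem i.+1 w' = nth 0 al i)%N) -> colp (cells r al) g -> (j < s)%N ->
  lf (C0 + j) [seq (F x, clf s w' c (g x)) | x <- cells r al] =
  if nth 0%N w' j == 0%N then [::] else [:: (F ((g^-1)%g (ccell r s w' c j)), C0 + j)%N].
Proof.
move=> pal bal s' hc' hg hj; case: eqP => [e | /eqP ne].
  apply: lf_map0 => x hx ex; have hgx : g x \in cells r al by rewrite (colp_mem _ hg).
  case: (ltnP (g x).2 (c (g x).1)) => h; first by have := clf_lt s w' h; rewrite ex; lia.
  have [j' [_ e' w'']] := clf_step s' hc' hgx h; move: w''; rewrite -[j'](addKn C0) -e' ex addKn e //.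
have [h1 h2 h3 h4] := ccellP pal bal s' hc' hj ne.
apply: lf_map; first exact: uniq_cells.
- move=> x y hx hy /(clf_inj pal bal s' hc') e; apply: (@perm_inj _ g); apply: e; by rewrite (colp_mem _ hg).
- by rewrite (colp_mem _ (colpV hg)).
- by rewrite permKV.
Qed.

Lemma lf_ids t j : (j < s)%N -> lf (C0 + j) [seq (nth (0, 0) t i, C0 + i)%N | i <- iota 0 s] = [:: (nth (0, 0)%N t j, C0 + j)%N].
Proof.
move=> hj; apply: lf_map; rewrite ?iota_uniq //; first by move=> i i' _ _ /addnI.
by rewrite mem_iota.
Qed.

Lemma lf_lpq t (p g : {perm T}) j : size t = s -> colp Xn p -> colp Xl g -> (j < s)%N ->
  lf (C0 + j) (lpq nu cm cn ids t p g) =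
  (if lrow w1 xl g j == 0%N then [::] else [:: ((0, lrow w1 xl g j), C0 + j)%N]) ++ (nth (0, 0)%N t j, C0 + j)%N ::
  (if lrow w2 xn p j == 0%N then [::] else [:: ((lrow w2 xn p j, 0), C0 + j)%N]).
Proof.
move=> st hp hg hj; rewrite lpqE // /lf !filter_cat -!/(lf _ _) lf_ids //.
rewrite (lf_part _ plam bl sw1 hc1 hg hj) (lf_part _ pnu knu sw2 hc2 hp hj) /lrow.
by case: (nth 0%N w1 j =P 0%N) => _; case: (nth 0%N w2 j =P 0%N) => _.
Qed.

Lemma krun_step t (p g : {perm T}) j : size t = s -> (0, 0)%N \notin t -> colp Xn p -> colp Xl g -> (j < s)%N ->
  krun [::] (lf (C0 + j) (lpq nu cm cn ids t p g)) =
  ((nth (0, 0)%N t j).1 == lrow w1 xl g j) && ((nth (0, 0)%N t j).2 == lrow w2 xn p j).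
Proof.
move=> st t0 hp hg hj; rewrite lf_lpq //; case e: (nth _ t j) => [a b].
apply: krun3; apply: contraNneq t0 => <-; rewrite -e; apply: mem_nth; by rewrite st.
Qed.

(** A step cell is the lowest of its column, so a column permutation can only move its class
    upwards. *)
Lemma lrow_le w' al (g : {perm T}) j : is_part al -> (sumn al <= r)%N ->
  size w' = s -> (forall i, (c i + count_mem i.+1 w' = nth 0 al i)%N) -> (forall i, (nth 0 al i.+1 <= c i)%N) ->
  colp (cells r al) g -> (j < s)%N -> (lrow w' (ccell r s w' c) g j <= nth 0%N w' j)%N.
Proof.
move=> pal bal s' hc' hb' hg hj; rewrite /lrow; case: eqP => // /eqP ne.
have [h1 h2 <- h4] := ccellP pal bal s' hc' hj ne; rewrite /rown ltnS.
apply: (step_bottom pal hb' h1 h4); first by rewrite (colp_mem _ (colpV hg)).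
by rewrite (colp_col _ (colpV hg)).
Qed.

Lemma nth_w1 j : (nth (0, 0)%N w j).1 = nth 0%N w1 j.
Proof.
have [h|h] := ltnP j (size w); first by rewrite (nth_map (0, 0)%N).
by rewrite !nth_default // size_map.
Qed.
Lemma nth_w2 j : (nth (0, 0)%N w j).2 = nth 0%N w2 j.
Proof.
have [h|h] := ltnP j (size w); first by rewrite (nth_map (0, 0)%N).
by rewrite !nth_default // size_map.
Qed.

Lemma lpq_ok t (p g : {perm T}) : size t = s -> (0, 0)%N \notin t -> colp Xn p -> colp Xl g ->
  all (@okl n) (lpq nu cm cn ids t p g).
Proof.
move=> st t0 hp hg; rewrite lpqE // !all_cat; apply/and3P; split; apply/allP => _ /mapP [x hx ->]; rewrite /okl /=.
- have hb0 : (cm (g x) < C0 + s)%N by apply: cm_bound; rewrite (colp_mem _ hg).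
  by have [h _] := cl_ok hb0; rewrite h.
- rewrite mem_iota add0n /= in hx; have hb0 : (C0 + x < C0 + s)%N by rewrite ltn_add2l.
  have [h _] := cl_ok hb0; rewrite h andbT.
  apply: contraNneq t0 => <-; apply: mem_nth; by rewrite st.
- have hb0 : (cn (p x) < C0 + s)%N by apply: cn_bound; rewrite (colp_mem _ hp).
  by have [h _] := cl_ok hb0; rewrite h.
Qed.

Lemma val_krun t (p g : {perm T}) : size t = s -> (0, 0)%N \notin t -> colp Xn p -> colp Xl g ->
  0 <= Uz (@vac n) (lpq nu cm cn ids t p g) o0 /\
  (0 < Uz (@vac n) (lpq nu cm cn ids t p g) o0) = krun [::] (lpq nu cm cn ids t p g).
Proof. by move=> st t0 hp hg; apply: (@Uz_pos n _ [::]) => //; apply: lpq_ok. Qed.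

Lemma Phiw_uT t : size t = s -> kend lam t = Some nu ->
  Phiw (uT r q (tlam lam ++ t)) = \sum_(p : {perm T} | colp Xn p) \sum_(g : {perm T} | colp Xl g)
    (-1) ^+ p * (-1) ^+ g * Uz (@vac n) (lpq nu cm cn ids t p g) o0.
Proof. by move=> st hk; apply: Phi_uT => //; first [exact: size_iota | exact: iota_uniq]. Qed.

(** In a nonzero term every class cancels, so step [j] of [t] uses the rows given by [lrow], and
    these are at or above the rows of [w]. *)
Lemma Phiw_tri t : size t = s -> kend lam t = Some nu -> (0, 0)%N \notin t ->
  Phiw (uT r q (tlam lam ++ t)) != 0 ->
  forall j, (j < s)%N -> ((nth (0, 0) t j).1 <= (nth (0, 0) w j).1)%N /\ ((nth (0, 0) t j).2 <= (nth (0, 0) w j).2)%N.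
Proof.
move=> st hk t0 ne j hj; apply/andP/negPn/negP => H; case/eqP: ne; rewrite Phiw_uT //.
apply: big1 => p hp; apply: big1 => g hg; have [h1 h2] := val_krun st t0 hp hg.
have [-> | n0] := eqVneq (Uz (@vac n) (lpq nu cm cn ids t p g) o0) 0; first by rewrite mulr0.
have : 0 < Uz (@vac n) (lpq nu cm cn ids t p g) o0 by rewrite lt_def n0.
rewrite h2 => /krun_classes /(_ (C0 + j)%N); rewrite krun_step // => /andP [/eqP e1 /eqP e2].
case/negP: H; rewrite e1 e2 nth_w1 nth_w2.
by rewrite (lrow_le plam bl sw1 hc1 hb1 hg hj) (lrow_le pnu knu sw2 hc2 hb2 hp hj).
Qed.

Lemma core_mem (x : T) : (x.2 < c x.1)%N -> x \in Xl /\ x \in Xn.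
Proof.
by move=> h; rewrite !mem_cells -hc1 -hc2; split; apply: (leq_trans h); apply: leq_addr.
Qed.

Lemma lf_core t (p g : {perm T}) (x : T) : size t = s -> colp Xn p -> colp Xl g -> (x.2 < c x.1)%N ->
  lf (enum_rank x) (lpq nu cm cn ids t p g) =
  [:: ((0, rown ((g^-1)%g x)), enum_rank x : nat); ((rown ((p^-1)%g x), 0), enum_rank x : nat)]%N.
Proof.
move=> st hp hg hx; have [hl hn'] := core_mem hx; rewrite lpqE // /lf !filter_cat -!/(lf _ _).
rewrite (@lf_map _ Xl _ _ ((g^-1)%g x)) ?uniq_cells //; first last.
- by rewrite permKV; apply: clf_core.
- by rewrite (colp_mem _ (colpV hg)).
- move=> u v hu hv /cm_inj e; apply: (@perm_inj _ g); apply: e; by rewrite (colp_mem _ hg).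
rewrite (@lf_map _ Xn _ _ ((p^-1)%g x)) ?uniq_cells //; first last.
- by rewrite permKV; apply: clf_core.
- by rewrite (colp_mem _ (colpV hp)).
- move=> u v hu hv /cn_inj e; apply: (@perm_inj _ p); apply: e; by rewrite (colp_mem _ hp).
rewrite lf_map0 // => j _ e; have := clf_lt s w1 hx; by rewrite (clf_core s w1 hx) -e ltnNge leq_addr.
Qed.

Lemma fix_step (al : seq nat) (w' : seq nat) (g : {perm T}) (x : T) : is_part al -> (sumn al <= r)%N ->
  size w' = s -> (forall i, (c i + count_mem i.+1 w' = nth 0 al i)%N) -> colp (cells r al) g ->
  (forall j, (j < s)%N -> nth 0%N w' j = lrow w' (ccell r s w' c) g j) ->
  (c x.1 <= x.2)%N -> (g^-1)%g x = x.
Proof.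
move=> pal bal s' hc' hg H h; have hgV := colpV hg.
have [hx|hx] := boolP (x \in cells r al); last first.
  have /andP [h1 _] := hgV; apply: (out_perm h1); by rewrite inE.
have [j [hj e1 e2]] := clf_step s' hc' hx h.
have ne : nth 0%N w' j != 0%N by rewrite e2.
have [h1 h2 h3 h4] := ccellP pal bal s' hc' hj ne.
have ex : ccell r s w' c j = x by apply: (clf_inj pal bal s' hc') => //; rewrite h2 e1.
have := H j hj; rewrite /lrow (negPf ne) ex e2 /rown => -[e].
by rewrite [LHS]surjective_pairing [RHS]surjective_pairing (colp_col _ hgV); congr (_, _); apply: val_inj.
Qed.

(** Agreement of rows fixes every step cell under both permutations, and cancellation of the core
    classes makes their inverses agree on the core. *)
Lemma krun_diag (p g : {perm T}) : colp Xn p -> colp Xl g -> krun [::] (lpq nu cm cn ids w p g) -> p = g.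
Proof.
move=> hp hg /krun_classes H.
have Hs j : (j < s)%N -> nth 0%N w1 j = lrow w1 xl g j /\ nth 0%N w2 j = lrow w2 xn p j.
  move=> hj; have := H (C0 + j)%N; rewrite krun_step // nth_w1 nth_w2.
  by move=> /andP [/eqP -> /eqP ->].
apply: (@invg_inj _ p g); apply/permP => x; case: (ltnP x.2 (c x.1)) => h; last first.
  rewrite (@fix_step lam w1 g x plam bl sw1 hc1 hg _ h); last by move=> j /Hs [].
  by rewrite (@fix_step nu w2 p x pnu knu sw2 hc2 hp _ h) //; move=> j /Hs [].
have := H (enum_rank x); rewrite lf_core // krun2 // /rown => /eqP [e].
rewrite [LHS]surjective_pairing [RHS]surjective_pairing (colp_col _ (colpV hg)) (colp_col _ (colpV hp)).
by congr (_, _); apply: val_inj.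
Qed.

Lemma lrow1 (al w' : seq nat) j : is_part al -> (sumn al <= r)%N ->
  size w' = s -> (forall i, (c i + count_mem i.+1 w' = nth 0 al i)%N) -> (j < s)%N ->
  lrow w' (ccell r s w' c) 1%g j = nth 0%N w' j.
Proof.
move=> pal bal s' hc' hj; rewrite /lrow; case: eqP => [-> // | /eqP ne].
by have [_ _ e _] := ccellP pal bal s' hc' hj ne; rewrite invg1 perm1.
Qed.

Lemma krun_one : krun [::] (lpq nu cm cn ids w 1 1).
Proof.
apply/krun_classes => d.
have [hd | hd] := ltnP d C0.
  pose x : T := enum_val (Ordinal hd); have ex : enum_rank x = d :> nat by rewrite enum_valK.
  have [h | h] := ltnP x.2 (c x.1).
    by rewrite -ex lf_core ?colp1 // krun2 // invg1 perm1.
  rewrite lpqE // /lf !filter_cat -!/(lf _ _) !lf_map0 //.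
  - move=> u hu; rewrite perm1 /cn => e; case: (ltnP u.2 (c u.1)) => h'.
      move: e; rewrite clf_core // -ex => /ord_inj /enum_rank_inj e; by move: h; rewrite -e leqNgt h'.
    have [j [_ e' _]] := clf_step sw2 hc2 hu h'; have : (C0 + j < C0)%N by rewrite -e' e.
    by rewrite ltnNge leq_addr.
  - by move=> j _; lia.
  move=> u hu; rewrite perm1 /cm => e; case: (ltnP u.2 (c u.1)) => h'.
    move: e; rewrite clf_core // -ex => /ord_inj /enum_rank_inj e; by move: h; rewrite -e leqNgt h'.
  have [j [_ e' _]] := clf_step sw1 hc1 hu h'; have : (C0 + j < C0)%N by rewrite -e' e.
  by rewrite ltnNge leq_addr.
have [hs | hs] := ltnP d (C0 + s).
  have -> : d = (C0 + (d - C0))%N by rewrite subnKC.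
  have hj : (d - C0 < s)%N by lia.
  by rewrite krun_step ?colp1 // nth_w1 nth_w2 (lrow1 plam bl sw1 hc1 hj) (lrow1 pnu knu sw2 hc2 hj) !eqxx.
rewrite lpqE // /lf !filter_cat -!/(lf _ _) !lf_map0 //.
- by move=> u hu; rewrite perm1 => e; have := cn_bound hu; rewrite e ltnNge hs.
- by move=> j; rewrite mem_iota => hj; lia.
by move=> u hu; rewrite perm1 => e; have := cm_bound hu; rewrite e ltnNge hs.
Qed.

(** By [krun_diag] the surviving pairs have sign [+1], and the pair of identities survives. *)
Lemma Phiw_diag : kend lam w = Some nu -> 0 < Phiw (uT r q (tlam lam ++ w)).
Proof.
move=> hk; rewrite Phiw_uT //.
have V0 (p g : {perm T}) : colp Xn p -> colp Xl g ->
    0 <= (-1) ^+ p * (-1) ^+ g * Uz (@vac n) (lpq nu cm cn ids w p g) o0.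
  move=> hp hg; have [h1 h2] := val_krun sw w00 hp hg.
  have [-> | ne] := eqVneq (Uz (@vac n) (lpq nu cm cn ids w p g) o0) 0; first by rewrite mulr0.
  have : 0 < Uz (@vac n) (lpq nu cm cn ids w p g) o0 by rewrite lt_def ne.
  by rewrite h2 => /(krun_diag hp hg) e; rewrite {1}e -signr_addb addbb expr0 mul1r.
rewrite (bigD1 1%g) ?colp1 //= (bigD1 1%g) ?colp1 //= -addrA ltr_pwDl //.
  have [_ h2] := val_krun sw w00 (colp1 Xn) (colp1 Xl).
  by rewrite odd_perm1 expr0 !mul1r h2 krun_one.
apply: addr_ge0; first by apply: sumr_ge0 => g /andP [hg _]; apply: V0; rewrite ?colp1.
by apply: sumr_ge0 => p /andP [hp _]; apply: sumr_ge0 => g hg; apply: V0.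
Qed.
End Test.

(** * Removals and additions counted by rows *)

Definition remc (t : seq (nat * nat)) (i : nat) : nat := count_mem i.+1 [seq ab.1 | ab <- t].
Definition addc (t : seq (nat * nat)) (i : nat) : nat := count_mem i.+1 [seq ab.2 | ab <- t].

Lemma coef_wtw t i : (wtw t)`_i = (addc t i)%:Z - (remc t i)%:Z.
Proof.
elim: t => [|[a b] t IH]; first by rewrite /wtw big_nil coef0.
rewrite wtw_cons coefD IH /wl coefB !coef_wP /addc /remc /= !PoszD.
by case: (a == i.+1); case: (b == i.+1) => /=; lia.
Qed.

Lemma remc_cons ab t i : remc (ab :: t) i = ((ab.1 == i.+1) + remc t i)%N. Proof. by []. Qed.
Lemma addc_cons ab t i : addc (ab :: t) i = ((ab.2 == i.+1) + addc t i)%N. Proof. by []. Qed.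
Lemma remc_perm t t' i : perm_eq t t' -> remc t i = remc t' i.
Proof. by move=> h; apply/seq.permP/perm_map. Qed.
Lemma addc_perm t t' i : perm_eq t t' -> addc t i = addc t' i.
Proof. by move=> h; apply/seq.permP/perm_map. Qed.
Lemma remc_take t j i : (remc (take j t) i <= remc t i)%N.
Proof. by rewrite -{2}(cat_take_drop j t) /remc map_cat count_cat leq_addr. Qed.
Lemma addc_take t j i : (addc (take j t) i <= addc t i)%N.
Proof. by rewrite -{2}(cat_take_drop j t) /addc map_cat count_cat leq_addr. Qed.

Lemma kend_nth al t be i : is_part al -> kend al t = Some be ->
  (nth 0%N be i + remc t i = nth 0%N al i + addc t i)%N.
Proof.
move=> pal /(kend_part pal) [_ e]; have := congr1 (fun p : {poly int} => p`_i) e.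
by rewrite coefD !coef_pw coef_wtw; lia.
Qed.

(** The bounds [c] and [d] separate consecutive rows, so row lengths kept between them stay
    decreasing whatever the order of the steps. *)
Lemma kend_ok t al (c d : nat -> nat) : is_part al -> (forall i, d i.+1 <= c i)%N ->
  (forall i, c i + remc t i <= nth 0%N al i)%N -> (forall i, nth 0%N al i + addc t i <= d i)%N ->
  exists be, kend al t = Some be.
Proof.
elim: t al => [|[a b] t IH] al pal dc Hc Hd; first by exists al.
have d1 : dominant (pw al - wP a).
  move=> i; rewrite !coefB !coef_pw !coef_wP; have := Hc i; have := Hd i.+1; have := dc i.
  by rewrite !remc_cons !addc_cons /=; case: (a == i.+1); case: (a == i.+2) => /=; lia.
have [be e1 e2] := rmbox_dom pal d1; have [pb ab] := rmbox_ad pal e1.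
have nb i : (nth 0%N be i)%:Z = (nth 0%N al i)%:Z - (a == i.+1)%:R by rewrite -!coef_pw e2 coefB coef_wP.
have d2 : dominant (pw be + wP b).
  move=> i; rewrite !coefD !coef_pw !nb !coef_wP; have := Hc i; have := Hd i.+1; have := dc i.
  rewrite !remc_cons !addc_cons /=; case: (a == i.+1); case: (a == i.+2); case: (b == i.+1); case: (b == i.+2) => /=; lia.
have [ga e3] := adbox_dom pb d2; have pg := adbox_part pb e3.
have ng i : (nth 0%N ga i)%:Z = (nth 0%N be i)%:Z + (b == i.+1)%:R by rewrite -!coef_pw (pw_adbox e3) coefD coef_wP.
have h1 j : (c j + remc t j <= nth 0%N ga j)%N.
  have := Hc j; have := ng j; have := nb j; rewrite remc_cons /=.
  by case: (a == j.+1); case: (b == j.+1) => /=; lia.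
have h2 j : (nth 0%N ga j + addc t j <= d j)%N.
  have := Hd j; have := ng j; have := nb j; rewrite addc_cons /=.
  by case: (a == j.+1); case: (b == j.+1) => /=; lia.
by have [be' h] := IH ga pg dc h1 h2; exists be'; rewrite /= e1 e3.
Qed.

Lemma sum_count B (l : seq nat) : (\sum_(j < B) count_mem j.+1 l <= size l)%N.
Proof.
elim: l => [|x l IH]; first by rewrite big1.
rewrite /= big_split /= -add1n leq_add //.
case: x => [|x]; first by rewrite big1.
have [h | h] := ltnP x B; last by rewrite big1 // => j _; rewrite eqSS; have := ltn_ord j; case: eqP => //=; lia.
rewrite (bigD1 (Ordinal h)) //= eqxx big1 // => j /eqP ne; rewrite eqSS.
by case: eqP => // e; case: ne; apply: val_inj.
Qed.

Lemma sum_two (F : nat -> nat) B i : (i.+1 < B)%N -> (F i + F i.+1 <= \sum_(j < B) F j)%N.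
Proof.
move=> h; have h0 := ltnW h; rewrite (bigD1 (Ordinal h0)) //= leq_add2l.
by rewrite (bigD1 (Ordinal h)) ?leq_addr // -val_eqE /=; apply/eqP; lia.
Qed.

Lemma sumn_sum l B : (size l <= B)%N -> sumn l = (\sum_(j < B) nth 0%N l j)%N.
Proof. by move=> h; rewrite -psum_sum psum_over. Qed.

Lemma nth_pcap a b i : nth 0%N (pcap a b) i = minn (nth 0%N a i) (nth 0%N b i).
Proof.
rewrite /pcap; elim: a b i => [|x a IH] [|y b] [|i] //=; rewrite ?nth_nil ?minn0 ?min0n //.
Qed.

Lemma size_pcap a b : (size (pcap a b) <= size a)%N.
Proof. by rewrite size_map size_zip geq_minl. Qed.

Lemma foldr_min_le (x : int) (l : seq int) : foldr Num.min x l <= x /\ forall y, y \in l -> foldr Num.min x l <= y.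
Proof.
elim: l => [|z l [h1 h2]] //=; split; first by rewrite ge_min h1 orbT.
by move=> y; rewrite inE => /orP [/eqP -> | /h2 h]; rewrite ge_min ?lexx // h orbT.
Qed.

(** * Co-Pieri triples *)

Section CoPieri.
Variables (lam nu : seq nat) (s : nat).
Hypothesis plam : is_part lam.
Hypothesis pnu : is_part nu.
Hypothesis cop : copieri lam nu s.

Lemma cop_s : (0 < s)%N.
Proof. by move: cop => /and3P [_ _ /orP [/eqP -> // | /andP [/ltnW]]]. Qed.
Lemma cop_knu : (sumn nu <= sumn lam + s)%N.
Proof. by move: cop => /and3P []. Qed.

Lemma std0P t : t \in std0 lam nu s -> [/\ size t = s, kend lam t = Some nu, (0, 0)%N \notin t &
  forall i, (remc t i <= nth 0%N lam i)%N].
Proof.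
rewrite mem_std0 // => /and4P [/eqP st /eqP hk h0 /allP ha]; split=> // i.
have [hi | hi] := ltnP i.+1 (sumn lam + s + 3).
  by have := ha i.+1; rewrite mem_iota /remc count_map; apply; lia.
rewrite /remc count_map (eq_in_count (a2 := pred0)) ?count_pred0 // => ab hab /=.
have := allP (kend_letters plam hk) ab hab; rewrite st => /andP [h _].
by apply/eqP => e; move: h hi; rewrite e; lia.
Qed.

(** The boxes of row [i+1] that no step touches; by [corec_nu] the same number remains when the
    additions are taken off [nu]. *)
Definition corec (t : seq (nat * nat)) (i : nat) : nat := (nth 0%N lam i - remc t i)%N.

Lemma corec_lam t i : t \in std0 lam nu s -> (corec t i + remc t i = nth 0%N lam i)%N.
Proof. by move=> /std0P [_ _ _ h]; rewrite /corec subnK. Qed.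
Lemma corec_nu t i : t \in std0 lam nu s -> (corec t i + addc t i = nth 0%N nu i)%N.
Proof.
move=> ht; have [_ hk _ _] := std0P ht; have := corec_lam i ht; have := kend_nth i plam hk; lia.
Qed.

(** Put [e j = min (lam_j, nu_j) - corec_j]. Then [X] plus the sum of all [e j] is the larger of the
    numbers of removals and additions, hence at most [s]. The co-Pieri inequality thus leaves a gap
    of at least [e i + e (i+1)] between the two rows, which rearranges to the claim. *)
Lemma core_gap t i : t \in std0 lam nu s -> (1 < s)%N -> (nth 0%N lam i.+1 + addc t i.+1 <= corec t i)%N.
Proof.
move=> ht s1; have [st _ _ _] := std0P ht.
have c1 := fun j => corec_lam j ht; have c2 := fun j => corec_nu j ht.
set L := maxn (size lam) (size nu).
have [hL | hL] := leqP L i.+1.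
  have := c2 i.+1; rewrite !nth_default; try by move: hL; rewrite /L geq_max; case/andP.
  lia.
move: cop => /and3P [_ _]; rewrite (gtn_eqF s1) s1 /= -/L ltnNge (leq_trans _ hL) //=.
set f := fun j : nat => _; set X := maxn _ _; set gap := foldr _ _ _ => hs.
have hgap : gap <= f i.+2.
  have [g1 g2] := foldr_min_le (f 2) [seq f i | i <- iota 3 (L - 2)].
  case: (i) hL => [|i'] hL; first exact: g1.
  by apply: g2; apply: map_f; rewrite mem_iota; lia.
pose B := (L + i.+2)%N; pose e j := (minn (nth 0%N lam j) (nth 0%N nu j) - corec t j)%N.
have el : sumn lam = (\sum_(j < B) corec t j + \sum_(j < B) remc t j)%N.
  rewrite (@sumn_sum _ B) -?big_split; first by apply: eq_bigr => j _; rewrite /= c1.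
  by rewrite /B /L; lia.
have en : sumn nu = (\sum_(j < B) corec t j + \sum_(j < B) addc t j)%N.
  rewrite (@sumn_sum _ B) -?big_split; first by apply: eq_bigr => j _; rewrite /= c2.
  by rewrite /B /L; lia.
have ec : sumn (pcap lam nu) = (\sum_(j < B) corec t j + \sum_(j < B) e j)%N.
  rewrite (@sumn_sum _ B) -?big_split.
    apply: eq_bigr => j _; rewrite /= nth_pcap /e; have := c1 j; have := c2 j; lia.
  by apply: leq_trans (size_pcap _ _) _; rewrite /B /L; lia.
have r1 : (\sum_(j < B) remc t j <= s)%N by rewrite -st -(size_map fst); apply: sum_count.
have r2 : (\sum_(j < B) addc t j <= s)%N by rewrite -st -(size_map snd); apply: sum_count.
have cl : (sumn (pcap lam nu) <= sumn lam)%N.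
  rewrite ec el leq_add2l; apply: leq_sum => j _; rewrite /e; have := c1 j; lia.
have cn : (sumn (pcap lam nu) <= sumn nu)%N.
  rewrite ec en leq_add2l; apply: leq_sum => j _; rewrite /e; have := c2 j; lia.
have e2 : (e i + e i.+1 <= \sum_(j < B) e j)%N by apply: sum_two; rewrite /B; lia.
have fE : f i.+2 = (minn (nth 0%N lam i) (nth 0%N nu i))%:Z - (maxn (nth 0%N lam i.+1) (nth 0%N nu i.+1))%:Z by [].
have hE : (\sum_(j < B) e j + X <= s)%N by rewrite /X; lia.
rewrite fE in hgap.
have h4 : (e i + e i.+1 + X <= s)%N.
  by apply: leq_trans hE; rewrite leq_add2r; apply: sum_two; rewrite /B; lia.
have := c1 i; have := c1 i.+1; have := c2 i; have := c2 i.+1.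
by move: hs hgap h4; rewrite /e; clear; lia.
Qed.

(** For a single step no inequality is available, but the core is the partition at the half step,
    one box at most away from [lam] and [nu]. *)
Lemma core_one t i : t \in std0 lam nu s -> s = 1%N ->
  (nth 0%N lam i.+1 <= corec t i)%N /\ (nth 0%N nu i.+1 <= corec t i)%N.
Proof.
move=> ht s1; have [st hk _ _] := std0P ht.
have c1 := corec_lam i ht; have c2 := corec_lam i.+1 ht; have c3 := corec_nu i ht; have c4 := corec_nu i.+1 ht.
case: t ht st hk c1 c2 c3 c4 => [|[a b] [|]] ht; try by rewrite s1.
move=> _ hk; have [be [ga [ea eb [ega] ab [pb pg]]]] := kend_cons hk plam.
rewrite /corec /remc /addc /= !addn0.
have nb j : (nth 0%N lam j)%:Z = (nth 0%N be j)%:Z + (a == j.+1)%:R by rewrite -!coef_pw (pw_adbox ab) coefD coef_wP.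
have ng j : (nth 0%N nu j)%:Z = (nth 0%N be j)%:Z + (b == j.+1)%:R by rewrite -ega -!coef_pw (pw_adbox eb) coefD coef_wP.
have /is_partP [m1 _] := pb; have /is_partP [m2 _] := plam; have /is_partP [m3 _] := pnu.
have := nb i; have := nb i.+1; have := ng i; have := ng i.+1; have := m1 i; have := m2 i; have := m3 i.
case E1: (a == i.+1); case E2: (a == i.+2); case E3: (b == i.+1); case E4: (b == i.+2) => /=;
  move: E1 E2 E3 E4; lia.
Qed.

Lemma core_lam t i : t \in std0 lam nu s -> (nth 0%N lam i.+1 <= corec t i)%N.
Proof.
move=> ht; have [s1 | s1] := eqVneq s 1%N; first by have [] := core_one i ht s1.
have hs : (1 < s)%N by have := cop_s; lia.
exact: leq_trans (leq_addr _ _) (core_gap i ht hs).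
Qed.
Lemma core_nu t i : t \in std0 lam nu s -> (nth 0%N nu i.+1 <= corec t i)%N.
Proof.
move=> ht; have [s1 | s1] := eqVneq s 1%N; first by have [] := core_one i ht s1.
have hs : (1 < s)%N by have := cop_s; lia.
by have := core_gap i ht hs; have := corec_nu i.+1 ht; have := corec_lam i.+1 ht; lia.
Qed.

(** In any order of the steps the shapes stay between the core and [lam] with all additions, and
    [core_gap] separates consecutive rows within these bounds. *)
Lemma std0_perm t t' : t \in std0 lam nu s -> perm_eq t t' -> t' \in std0 lam nu s.
Proof.
move=> ht pe; have [st hk h0 hr] := std0P ht.
have [s1 | s1] := eqVneq s 1%N.
  suff -> : t' = t by [].
  by apply/esym/(perm_small_eq _ pe); rewrite -(perm_size pe) st s1.
have hs : (1 < s)%N by have := cop_s; lia.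
have [be hk'] : exists be, kend lam t' = Some be.
  apply: (@kend_ok _ _ (corec t) (fun i => nth 0%N lam i + addc t i)%N) => // i.
  - exact: core_gap.
  - by rewrite -(remc_perm i pe) corec_lam.
  - by rewrite -(addc_perm i pe).
have e : be = nu.
  have [pb wb] := kend_part plam hk'; have [_ wn] := kend_part plam hk.
  by apply: pw_inj => //; rewrite wb wn; congr (_ + _); apply: perm_big; rewrite perm_sym.
rewrite mem_std0 // hk' e eqxx -(perm_size pe) st eqxx -(perm_mem pe) h0 /=.
apply/allP => i; rewrite mem_iota => /andP [i0 _]; rewrite -(seq.permP pe).
by have := hr i.-1; rewrite /remc count_map (prednK i0).
Qed.

(** An upper bound for the rows along [t]. For [s = 1] it is taken from the two end shapes, as
    [core_gap] requires [s > 1]. *)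
Definition upc (t : seq (nat * nat)) (i : nat) : nat :=
  if s == 1%N then maxn (nth 0%N lam i) (nth 0%N nu i) else (nth 0%N lam i + addc t i)%N.

Lemma upc_core t i : t \in std0 lam nu s -> (upc t i.+1 <= corec t i)%N.
Proof.
move=> ht; rewrite /upc; case: eqP => s1.
  by have [h1 h2] := core_one i ht s1; rewrite geq_max h1.
by apply: core_gap => //; have := cop_s; lia.
Qed.

Lemma prefix_bounds t j i : t \in std0 lam nu s -> (j <= s)%N ->
  (corec t i <= nth 0%N (tat lam t j) i <= upc t i)%N.
Proof.
move=> ht hj; have [st hk _ _] := std0P ht; have hl := corec_lam i ht; have hn := corec_nu i ht.
have [al ha] : exists al, kend lam (take j t) = Some al.
  move: hk; rewrite -{1}(cat_take_drop j t) kend_cat; case: (kend _ _) => // al _; by exists al.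
have E := kend_nth i plam ha; rewrite /tat ha /=.
have := remc_take t j i; have := addc_take t j i; rewrite /upc; case: (s =P 1%N) => s1; last first.
  move: E hl; clear => E1 E2 h1 h2; rewrite -(leq_add2r (remc t i)) E2.
  have h3 := leq_add (leqnn (nth 0%N al i)) h2; rewrite E1 in h3.
  rewrite (leq_trans _ h3) ?leq_addr //=; apply: leq_trans (leq_addr (remc (take j t) i) _) _.
  by rewrite E1 leq_add2l.
have [j0 | j0] := posnP j.
  by move: ha; rewrite j0 take0 => -[<-]; rewrite leq_maxl andbT -hl leq_addr.
have ej : j = s by lia.
by move: ha; rewrite ej take_oversize ?st // hk => -[<-]; rewrite leq_maxr andbT -hn leq_addr.
Qed.

Lemma twocol_false be ch : (forall i, nth 0%N be i.+1 <= nth 0%N ch i)%N -> (forall i, nth 0%N be i.+1 <= nth 0%N be i)%N ->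
  twocol be ch = false.
Proof.
move=> H mono; apply/negbTE/hasPn => c _; rewrite -leqNgt leqNgt; apply/negP.
rewrite -size_filter => hs.
set l := [seq i <- _ | _] in hs.
have ul : uniq l by rewrite filter_uniq // iota_uniq.
have h0 := mem_nth 0%N (ltnW hs); have h1 := mem_nth 0%N hs.
have ne : nth 0%N l 0 != nth 0%N l 1 by rewrite nth_uniq // ltnW.
move: h0 h1 ne; rewrite !mem_filter; move: (nth 0%N l 0)%N (nth 0%N l 1)%N => a b /andP [/andP [a1 a2] _] /andP [/andP [b1 b2] _] ab.
have K x y : (x < y)%N -> (nth 0%N ch x < c)%N -> (c <= nth 0%N be y)%N -> False.
  move=> xy h1 h2; suff : (nth 0%N be y <= nth 0%N be x.+1)%N by have := H x; lia.
  by rewrite -(subnKC xy); elim: (y - _)%N => [|d IH]; rewrite ?addn0 // addnS; apply: leq_trans (mono _) IH.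
case: (ltngtP a b) => h; [exact: K h a1 b2 | exact: K h b1 a2 | by rewrite h eqxx in ab].
Qed.

(** Along [t] a row never drops below its core, and by [upc_core] the row beneath never exceeds that
    core; so any two of the shapes differ by horizontal strips. *)
Lemma ssrep_std0 mu t : is_part mu -> sumn mu = s -> t \in std0 lam nu s -> ssrep lam mu t.
Proof.
move=> pmu smu ht; apply/allP => c _; have pb c' : (psum mu c' <= s)%N.
  by rewrite -smu -{2}(cat_take_drop c' mu) sumn_cat leq_addr.
have B j i := prefix_bounds i ht (pb j).
have U i := upc_core i ht.
by rewrite /= !twocol_false // => i; rewrite ?nth_pcap; have := B c i; have := B c i.+1; have := B c.-1 i; have := B c.-1 i.+1; have := U i; lia.
Qed.
End CoPieri.

Lemma size_swapk t i : (i.+1 < size t)%N -> size (swapk t i.+1) = size t.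
Proof. by move=> h; rewrite swapkE // [in RHS](split2w h) !size_cat. Qed.

Lemma swapk_perm t i : (i.+1 < size t)%N -> perm_eq t (swapk t i.+1).
Proof.
move=> h; rewrite swapkE // {1}(split2w h); apply/seq.permP => P; rewrite !count_cat /=.
by congr (_ + _)%N; rewrite addnCA.
Qed.

Lemma nth_swapk t i j : (i.+1 < size t)%N -> nth (0, 0)%N (swapk t i.+1) j =
  nth (0, 0)%N t (if j == i then i.+1 else if j == i.+1 then i else j).
Proof.
move=> h; rewrite /swapk nth_set_nth /= nth_set_nth /=.
case: (eqVneq j i.+1) => [-> | ne]; first by rewrite (gtn_eqF (ltnSn i)).
by case: ifP.
Qed.

Lemma swapkK t i : (i.+1 < size t)%N -> swapk (swapk t i.+1) i.+1 = t.
Proof.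
move=> h; apply: (@eq_from_nth _ (0, 0)%N); first by rewrite !size_swapk.
move=> j _; rewrite !nth_swapk ?size_swapk //.
case: (eqVneq j i) => [-> | n1]; first by rewrite (gtn_eqF (ltnSn i)) eqxx.
by case: (eqVneq j i.+1) => [-> | n2]; rewrite ?eqxx // (negPf n1) (negPf n2).
Qed.

(** * Linear independence of [Std^0] in the quotient *)

Section Independence.
Variables (n s : nat) (lam nu : seq nat).
Local Notation r := (sumn lam + s)%N.
Local Notation q := (n.+1%:R : rat).
Hypothesis hN : (3 * (#|{: 'I_r.+1 * 'I_r.+1}| + s) <= n)%N.
Hypothesis hn : (r + r <= n.+1)%N.
Hypothesis plam : is_part lam.
Hypothesis pnu : is_part nu.
Hypothesis cop : copieri lam nu s.
Local Notation BSet := (Bset r q lam nu s).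
Local Notation u t := (uT r q (tlam lam ++ t)).

(** A statistic strictly increasing for the componentwise order, used to choose a minimal
    tableau. *)
Definition tot (t : seq (nat * nat)) : nat := sumn [seq ab.1 + ab.2 | ab <- t]%N.

Lemma tot_le (t t' : seq (nat * nat)) : size t = size t' ->
  (forall j, (j < size t)%N -> (nth (0, 0)%N t j).1 <= (nth (0, 0)%N t' j).1 /\ (nth (0, 0)%N t j).2 <= (nth (0, 0)%N t' j).2)%N ->
  (tot t <= tot t')%N /\ (tot t = tot t' -> t = t').
Proof.
elim: t t' => [|[a b] t IH] [|[a' b'] t'] //= [st] H.
have [|h1 h2] := IH t' st; first by move=> j hj; apply: (H j.+1).
have := H 0%N isT; rewrite /= /tot /= -/(tot t) -/(tot t') => -[h3 h4]; split; first by lia.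
by move=> e; rewrite h2; [congr ((_, _) :: _); lia | lia].
Qed.

(** Take [t0] of least [tot] with nonzero coefficient. The functional of [t0] is positive at [t0]
    and otherwise sees only componentwise smaller tableaux, whose coefficients vanish. *)
Lemma std0_indep (c : seq (nat * nat) -> rat) :
  BSet (\sum_(t <- std0 lam nu s) scl (c t) (u t)) -> forall t, t \in std0 lam nu s -> c t = 0.
Proof.
move=> hB; apply: contrapT => /existsNP [t1 /not_implyP [ht1 /eqP c1]].
pose P k := `[< exists t, [/\ t \in std0 lam nu s, c t != 0 & tot t = k] >].
have [k0 [t0 [ht0 c0 e0]] kmin] : exists2 k, exists t, [/\ t \in std0 lam nu s, c t != 0 & tot t = k] &
    forall t, t \in std0 lam nu s -> c t != 0 -> (k <= tot t)%N.
  have ex : exists k, P k by exists (tot t1); apply/asboolP; exists t1.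
  have [k /asboolP hk km] := ex_minnP ex; exists k => // t ht ct.
  by apply: km; apply/asboolP; exists t.
have [st0 hk0 z0 _] := std0P plam pnu cop ht0.
have knu := cop_knu cop; have s0 := cop_s cop.
have hc1 i := corec_lam plam pnu cop i ht0; have hc2 i := corec_nu plam pnu cop i ht0.
have hb1 i := core_lam plam pnu cop i ht0; have hb2 i := core_nu plam pnu cop i ht0.
have FD : {morph (@Phiw n s lam nu t0 (corec lam t0)) : x y / x + y} by move=> x y; apply: PhiD.
have F0 : @Phiw n s lam nu t0 (corec lam t0) 0 = 0 by apply: Phi0.
have := Phiw_B hN hn plam pnu knu s0 st0 z0 hc1 hc2 hB.
rewrite (big_morph _ FD F0) (bigD1_seq t0) ?uniq_std0 //= big1_seq ?addr0; last first.
  move=> t /andP [ne ht]; rewrite /Phiw PhiZ -/(@Phiw n s lam nu t0 (corec lam t0) _).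
  have [-> | ct] := eqVneq (c t) 0; first by rewrite mul0r.
  have [e | nz] := eqVneq (@Phiw n s lam nu t0 (corec lam t0) (u t)) 0; first by rewrite e mulr0.
  have [st hk z1 _] := std0P plam pnu cop ht.
  have H := Phiw_tri hN hn plam pnu knu s0 st0 z0 hc1 hc2 hb1 hb2 st hk z1 nz.
  have [|h1 h2] := @tot_le t t0 (etrans st (esym st0)); first by rewrite st.
  by case/eqP: ne; apply: h2; apply/eqP; rewrite eqn_leq h1 e0 kmin.
rewrite /Phiw PhiZ -/(@Phiw n s lam nu t0 (corec lam t0) _) => /eqP.
have := Phiw_diag hN hn plam pnu knu s0 st0 z0 hc1 hc2 hk0.
by rewrite mulf_eq0 (negPf c0) /= => h /eqP e; rewrite e ltxx in h.
Qed.
End Independence.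

(** * The equivalence classes of tableaux *)

Section Classes.
Variables (lam nu mu : seq nat) (s : nat).
Hypothesis plam : is_part lam.
Hypothesis pnu : is_part nu.
Hypothesis cop : copieri lam nu s.
Local Notation S0 := (std0 lam nu s).
Local Notation nb := (nbrs mu s S0).

Lemma mem_nbrs x y : y \in nb x <-> exists i, [/\ (i.+1 < s)%N, allowed mu s i.+1, y = swapk x i.+1 & y \in S0].
Proof.
split=> [/mapP [k] | [i [hi ha -> hy]]].
  rewrite mem_filter => /andP [/andP [ha hy] _] ->; case: k ha hy => // i ha hy.
  by exists i; split=> //; case/andP: ha.
by apply/mapP; exists i.+1 => //; rewrite mem_filter ha hy mem_iota; lia.
Qed.

Lemma swap_S0 x i : x \in S0 -> (i.+1 < s)%N -> swapk x i.+1 \in S0.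
Proof.
move=> hx hi; have [sx _ _ _] := std0P plam pnu cop hx.
by apply: (std0_perm plam pnu cop hx); apply: swapk_perm; rewrite sx.
Qed.

Definition cstep (L : seq (seq (nat * nat))) := undup (L ++ flatten [seq nb x | x <- L]).

Lemma mem_cstep L y : y \in cstep L <-> y \in L \/ exists2 x, x \in L & y \in nb x.
Proof.
rewrite mem_undup mem_cat; split=> [/orP [-> | /flattenP [z /mapP [x hx ->] hy]] | [-> // | [x hx hy]]].
- by left.
- by right; exists x.
by apply/orP; right; apply/flattenP; exists (nb x) => //; apply: map_f.
Qed.

Lemma closit_sub k L x : x \in L -> x \in closit mu s S0 k L.
Proof. by elim: k L => //= k IH L hx; apply: IH; apply/mem_cstep; left. Qed.

Lemma closit_ind (P : seq (nat * nat) -> Prop) k L : (forall x, x \in L -> P x) ->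
  (forall x y, P x -> y \in nb x -> P y) -> forall x, x \in closit mu s S0 k L -> P x.
Proof.
move=> + H; elim: k L => //= k IH L HL; apply: IH => x /mem_cstep [/HL // | [z /HL hz]]; exact: H.
Qed.

(* Each unsaturated iteration adds an element of [std0], so [size std0] iterations suffice. *)
Lemma closit_closed k L : {subset L <= S0} -> uniq L -> (size S0 <= k + size L)%N ->
  forall x y, x \in closit mu s S0 k L -> y \in nb x -> y \in closit mu s S0 k L.
Proof.
elim: k L => [|k IH] L sub uL hs x y.
  move=> /= _ /mem_nbrs [i [_ _ _ hy]]; have [_ e] := uniq_min_size uL sub hs; by rewrite e.
have [H | /existsNP [x0 /existsNP [y0 /not_implyP [hx0 /not_implyP [hy0 n0]]]]] :=
    pselect (forall x y, x \in L -> y \in nb x -> y \in L).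
  move=> hx hy; apply: closit_sub; apply: (H x) => //.
  by apply: (@closit_ind (fun x => x \in L) k.+1 L) hx => // u v hu; apply: H.
apply: (IH (cstep L)); rewrite ?undup_uniq //.
  by move=> z /mem_cstep [/sub // | [u _ /mem_nbrs [i []]]].
apply: leq_trans hs _; rewrite addSnnS leq_add2l.
have u1 : uniq (y0 :: L) by rewrite /= uL andbT; apply/negP.
apply: (uniq_leq_size u1) => z; rewrite inE => /orP [/eqP -> | hz]; apply/mem_cstep; last by left.
by right; exists x0.
Qed.

Local Notation cl := (cls lam nu s mu).

Lemma mem_cls t x : (x \in cl t) = (x \in closit mu s S0 (size S0) [:: t]) && (x \in S0).
Proof. by rewrite [LHS]mem_filter. Qed.
Lemma cls_S0 t x : x \in cl t -> x \in S0.
Proof. by rewrite mem_cls => /andP []. Qed.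
Lemma uniq_cls t : uniq (cl t).
Proof. by rewrite filter_uniq // uniq_std0. Qed.
Lemma cls_self t : t \in S0 -> t \in cl t.
Proof. by move=> ht; rewrite mem_cls ht andbT; apply: closit_sub; rewrite inE. Qed.

Lemma cls_closed t x i : t \in S0 -> x \in cl t -> allowed mu s i.+1 -> swapk x i.+1 \in cl t.
Proof.
move=> ht; rewrite !mem_cls => /andP [h1 h2] ha; have hi : (i.+1 < s)%N by case/andP: ha.
rewrite (swap_S0 h2 hi) andbT; apply: (@closit_closed _ [:: t] _ _ _ x) => //.
- by move=> y; rewrite inE => /eqP ->.
- exact: leq_addr.
by apply/mem_nbrs; exists i; split=> //; apply: swap_S0.
Qed.

Lemma cls_ind (P : seq (nat * nat) -> Prop) t : t \in S0 -> P t ->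
  (forall x i, x \in S0 -> allowed mu s i.+1 -> P x -> P (swapk x i.+1)) -> forall x, x \in cl t -> P x.
Proof.
move=> ht Pt H x; rewrite mem_cls => /andP [hx _].
suff [] : x \in S0 /\ P x by [].
apply: (@closit_ind (fun x => x \in S0 /\ P x) _ [:: t]) hx.
  by move=> y; rewrite inE => /eqP ->.
by move=> y z [hy Py] /mem_nbrs [i [hi ha -> hz]]; split=> //; apply: H.
Qed.

Lemma cls_sub t x : t \in S0 -> x \in cl t -> {subset cl x <= cl t}.
Proof.
move=> ht hx y; apply: (@cls_ind (fun y => y \in cl t)) => //; first exact: cls_S0 hx.
by move=> z i _ ha hz; apply: cls_closed.
Qed.

(** Moves are involutive and stay in [Std^0], so reachability is symmetric. *)
Lemma cls_eq t x : t \in S0 -> x \in cl t -> cl x = cl t.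
Proof.
move=> ht hx; have hx0 := cls_S0 hx.
have back : t \in cl x.
  move: x hx {hx0}; apply: cls_ind => //; first exact: cls_self.
  move=> z i hz ha; have hi : (i.+1 < s)%N by case/andP: ha.
  have hz' := swap_S0 hz hi; have [sz _ _ _] := std0P plam pnu cop hz.
  apply: cls_sub => //; rewrite -{1}[z](@swapkK z i) ?sz //; apply: cls_closed => //; exact: cls_self.
apply: eq_in_filter => y hy.
have H := cls_sub ht hx; have H' := cls_sub hx0 back.
by apply/idP/idP => h; [have := H y | have := H' y]; rewrite !mem_cls hy !andbT; apply.
Qed.
End Classes.

Lemma flatten_uniq (E : eqType) (L : seq (seq E)) : uniq L -> (forall T, T \in L -> uniq T) ->
  (forall T T' x, T \in L -> T' \in L -> x \in T -> x \in T' -> T = T') -> uniq (flatten L).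
Proof.
elim: L => //= T L IH /andP [TL uL] H1 H2; rewrite cat_uniq H1 ?mem_head //=; apply/andP; split.
  apply/hasPn => x /flattenP [T' hT' hx]; apply/negP => hx'.
  have e : T = T' by apply: (H2 T T' x); rewrite ?inE ?eqxx ?hT' ?orbT.
  by rewrite e hT' in TL.
apply: IH => // [T' hT' | T' T2 x h h']; first by apply: H1; rewrite inE hT' orbT.
by apply: H2; rewrite inE ?h ?h' orbT.
Qed.

Section Semistandard.
Variables (lam nu mu : seq nat) (s : nat).
Hypothesis plam : is_part lam.
Hypothesis pnu : is_part nu.
Hypothesis cop : copieri lam nu s.
Hypothesis pmu : is_part mu.
Hypothesis smu : sumn mu = s.
Local Notation S0 := (std0 lam nu s).
Local Notation SS := (sstd lam nu s mu).

Lemma mem_sstd T : T \in SS <-> exists2 t, t \in S0 & T = cls lam nu s mu t.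
Proof.
rewrite mem_undup; split=> [/mapP [t] | [t ht ->]].
  by rewrite mem_filter => /andP [_ ht] ->; exists t.
by apply: map_f; rewrite mem_filter ht andbT (ssrep_std0 plam pnu cop).
Qed.

Lemma sstd_disj T T' x : T \in SS -> T' \in SS -> x \in T -> x \in T' -> T = T'.
Proof.
move=> /mem_sstd [t ht ->] /mem_sstd [t' ht' ->] h h'.
by rewrite -(cls_eq plam pnu cop ht h) -(cls_eq plam pnu cop ht' h').
Qed.

(** Every class is semistandard by [ssrep_std0], so the classes partition [Std^0]. *)
Lemma sum_sstd (V : zmodType) (F : seq (nat * nat) -> V) :
  \sum_(T <- SS) \sum_(t <- T) F t = \sum_(t <- S0) F t.
Proof.
rewrite -big_flatten /=; apply: perm_big; apply: uniq_perm; last first.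
- move=> x; apply/flattenP/idP => [[T /mem_sstd [t ht ->]] | hx]; first exact: cls_S0.
  by exists (cls lam nu s mu x); [apply/mem_sstd; exists x | apply: cls_self].
- exact: uniq_std0.
apply: flatten_uniq; first exact: undup_uniq.
- by move=> T /mem_sstd [t _ ->]; apply: uniq_cls.
exact: sstd_disj.
Qed.
End Semistandard.

(** * The basis of homomorphisms *)

Section Main.
Variables (n s : nat) (lam nu mu : seq nat).
Local Notation r := (sumn lam + s)%N.
Local Notation q := (n.+1%:R : rat).
Hypothesis hN : (3 * (#|{: 'I_r.+1 * 'I_r.+1}| + s) <= n)%N.
Hypothesis hn : (r + r <= n.+1)%N.
Hypothesis plam : is_part lam.
Hypothesis pnu : is_part nu.
Hypothesis cop : copieri lam nu s.
Hypothesis pmu : is_part mu.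
Hypothesis smu : sumn mu = s.
Local Notation ASet := (Aset r q lam nu s).
Local Notation BSet := (Bset r q lam nu s).
Local Notation S0 := (std0 lam nu s).
Local Notation SS := (sstd lam nu s mu).
Local Notation u t := (uT r q (tlam lam ++ t)).
Let knu := cop_knu cop.
Let s0 := cop_s cop.

Lemma BsetB a b : BSet a -> BSet b -> BSet (a - b).
Proof. by move=> h1 h2; apply/spanP_D/spanP_N. Qed.

Lemma permd_B h a : BSet a -> BSet (amul q a (permd r s h)).
Proof. exact: (sym_B hn plam pnu knu). Qed.
Lemma permd_A h a : ASet a -> ASet (amul q a (permd r s h)).
Proof. exact: (sym_A hn plam pnu knu). Qed.

Lemma u_A t : t \in S0 -> ASet (u t).
Proof. by move=> /(std0P plam pnu cop) [st hk _ _]; apply: Aset_uT. Qed.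

Lemma u_swap t (i j : 'I_s) : t \in S0 -> val j = i.+1 ->
  BSet (amul q (u t) (permd r s (tperm i j)) - u (swapk t i.+1)).
Proof.
move=> ht ij; have [st hk _ _] := std0P plam pnu cop ht.
have hi : (i.+1 < s)%N by have := ltn_ord j; rewrite -[nat_of_ord j]/(val j) ij.
have [st' hk' _ _] := std0P plam pnu cop (swap_S0 plam pnu cop ht hi).
by apply: swap_B.
Qed.

Lemma sum_swap (L : seq (seq (nat * nat))) (c : seq (nat * nat) -> rat) (i j : 'I_s) :
  {subset L <= S0} -> val j = i.+1 ->
  BSet (amul q (\sum_(t <- L) scl (c t) (u t)) (permd r s (tperm i j)) - \sum_(t <- L) scl (c t) (u (swapk t i.+1))).
Proof.
move=> sub ij; rewrite amul_suml -sumrB; apply: spanP_sum => t ht.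
rewrite amulZl -sclN1 scl_scl mulrC -scl_scl sclN1 -scl_add; apply: spanP_Z.
by apply: u_swap => //; apply: sub.
Qed.

Lemma swap_perm_map (L : seq (seq (nat * nat))) i : {subset L <= S0} -> uniq L -> (i.+1 < s)%N ->
  (forall x, x \in L -> swapk x i.+1 \in L) -> perm_eq [seq swapk t i.+1 | t <- L] L.
Proof.
move=> sub uL hi H.
have sz x : x \in L -> (i.+1 < size x)%N by move=> /sub /(std0P plam pnu cop) [-> _ _ _].
apply: uniq_perm => //.
  rewrite map_inj_in_uniq // => x y hx hy e.
  by rewrite -(swapkK (sz x hx)) e swapkK // sz.
move=> x; apply/mapP/idP => [[y hy ->] | hx]; first exact: H.
by exists (swapk x i.+1); [apply: H | rewrite swapkK // sz].
Qed.

Definition usum (T : seq (seq (nat * nat))) : alg r := \sum_(t <- T) u t.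

Lemma phiTE T g : phiT r q lam s T g = amul q (usum T) (permd r s g).
Proof. by []. Qed.

Lemma usum1 T : usum T = \sum_(t <- T) scl 1 (u t).
Proof. by apply: eq_bigr => t _; rewrite scl1. Qed.

Lemma sstd_S0 T : T \in SS -> {subset T <= S0}.
Proof. by move=> /(mem_sstd plam pnu cop pmu smu) [t ht ->] x; apply: cls_S0. Qed.

Lemma usum_A T : T \in SS -> ASet (usum T).
Proof. by move=> hT; apply: spanP_sum => t /(sstd_S0 hT); apply: u_A. Qed.

Lemma usum_swap T (i j : 'I_s) : T \in SS -> val j = i.+1 -> allowed mu s i.+1 ->
  BSet (amul q (usum T) (permd r s (tperm i j)) - usum T).
Proof.
move=> hT ij ha; have sub := sstd_S0 hT; have := sum_swap (fun=> 1) sub ij.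
have hi : (i.+1 < s)%N by case/andP: ha.
rewrite -usum1; congr (BSet (_ - _)).
rewrite -[LHS](big_map (fun t => swapk t i.+1) xpredT (fun t => scl 1 (u t))) usum1.
move: hT => /(mem_sstd plam pnu cop pmu smu) [t ht e].
apply: perm_big; apply: swap_perm_map => //; first by rewrite e uniq_cls.
by move=> x; rewrite e => hx; apply: cls_closed.
Qed.

(** It suffices to treat adjacent transpositions inside a block, and these permute the members of a
    class. *)
Lemma usum_young T x : T \in SS -> young s mu x -> BSet (amul q (usum T) (permd r s x) - usum T).
Proof.
move=> hT; move: x; apply: young_ind.
  rewrite (amul_permd1 hn) ?subrr; first exact: spanP_0.
  exact: Aset_good (usum_A hT).
move=> i j x ij ha hx; rewrite -(permdM _ _ hn) -(amulA hn).
have h := permd_B x (usum_swap hT ij ha); rewrite amulBl in h.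
by have := spanP_D h hx; rewrite addrA subrK.
Qed.

Lemma phiT_hom T : T \in SS -> isHom r q lam nu s mu (phiT r q lam s T).
Proof.
move=> hT; split.
- by move=> g; apply: permd_A; apply: usum_A.
- move=> x g hx; rewrite !phiTE -(permdM _ _ hn) -(amulA hn) -amulBl.
  by apply: permd_B; apply: usum_young.
by move=> g h; rewrite !phiTE -(permdM _ _ hn) -(amulA hn) subrr; apply: spanP_0.
Qed.

(* The coefficient function on [std0] that is constant, with value [c i], on the [i]-th class. *)
Definition lift (c : nat -> rat) (t : seq (nat * nat)) : rat := c (find (fun T => t \in T) SS).

Lemma lift_nth c i t : (i < size SS)%N -> t \in nth [::] SS i -> lift c t = c i.
Proof.
move=> hi ht; congr c; set j := find _ _.
have hs : has (fun T => t \in T) SS by apply/hasP; exists (nth [::] SS i) => //; apply: mem_nth.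
have hj : (j < size SS)%N by rewrite -has_find.
have htj : t \in nth [::] SS j by apply: (nth_find [::] hs).
have e := sstd_disj plam pnu cop pmu smu (mem_nth [::] hj) (mem_nth [::] hi) htj ht.
by apply/eqP; rewrite -(nth_uniq [::] hj hi) ?e // undup_uniq.
Qed.

Lemma sum_lift (c : nat -> rat) : \sum_(i < size SS) scl (c i) (usum (nth [::] SS i)) = \sum_(t <- S0) scl (lift c t) (u t).
Proof.
rewrite -(sum_sstd plam pnu cop pmu smu) (big_nth [::]) big_mkord; apply: eq_bigr => i _.
rewrite (big_morph (scl (c i)) (@scl_add r _) (scl0 r _)); apply: eq_big_seq => t ht.
by rewrite (lift_nth c (ltn_ord i) ht).
Qed.

Lemma sum_phiT (c : nat -> rat) g : \sum_(i < size SS) scl (c i) (phiT r q lam s (nth [::] SS i) g) =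
  amul q (\sum_(i < size SS) scl (c i) (usum (nth [::] SS i))) (permd r s g).
Proof.
rewrite (big_morph (fun a => amul q a (permd r s g)) (fun a a' => amulDl q a a' _) (amul0l q _)).
by apply: eq_bigr => i _; rewrite amulZl.
Qed.

Lemma sum_A c : ASet (\sum_(t <- S0) scl (c t) (u t)).
Proof. by apply: spanP_sum => t ht; apply/spanP_Z/u_A. Qed.

(** The value at the identity is a combination of [Std^0] with coefficients constant on classes, so
    [std0_indep] applies. *)
Lemma phiT_indep (c : nat -> rat) :
  (forall g : 'S_s, BSet (\sum_(i < size SS) scl (c i) (phiT r q lam s (nth [::] SS i) g))) ->
  forall i, (i < size SS)%N -> c i = 0.
Proof.
move=> /(_ 1%g); rewrite sum_phiT sum_lift (amul_permd1 hn); last exact: Aset_good (sum_A _).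
move=> /(std0_indep hN hn plam pnu cop) H i hi.
have /(mem_sstd plam pnu cop pmu smu) [t ht e] := mem_nth [::] hi.
by rewrite -(@lift_nth c i t hi) ?H // e cls_self.
Qed.

(** A homomorphism is determined by its value at the identity. By linear independence, invariance
    under the Young subgroup makes the coefficients of that value constant on classes. *)
Lemma phiT_span (F : 'S_s -> alg r) : isHom r q lam nu s mu F ->
  exists c : nat -> rat, forall g : 'S_s,
    BSet (F g - \sum_(i < size SS) scl (c i) (phiT r q lam s (nth [::] SS i) g)).
Proof.
move=> [FA FB FC].
have [c hc] := Aset_std0 hn plam pnu knu s0 (FA 1%g).
have csw t i : t \in S0 -> allowed mu s i.+1 -> c (swapk t i.+1) = c t.
  move=> ht ha; have hi : (i.+1 < s)%N by case/andP: ha.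
  pose i' : 'I_s := Ordinal (ltnW hi); pose j' : 'I_s := Ordinal hi.
  have yx : young s mu (tperm i' j').
    apply/forallP => k; have e : blk mu i = blk mu i.+1.
      rewrite /blk; apply: eq_in_count => d hd; rewrite [RHS]leq_eqVlt ltnS; case: eqP => //= ed.
      move: ha; rewrite /allowed hi /= => /mapP []; exists d => //.
      (* [allowed] excludes only proper partial sums; the full one equals [s], which is larger than
         [i+1]. *)
      have ne : d != size mu by apply/eqP => e; have := hi; move: ed; rewrite e psum_over // smu => {1}->; rewrite ltnn.
      by move: hd ne; rewrite !mem_iota; lia.
    by case: tpermP => [->|->|_ _] //=; rewrite e.
  have h1 : BSet (amul q (F 1%g) (permd r s (tperm i' j')) - F 1%g).
    have := BsetB (FB _ 1%g yx) (FC 1%g (tperm i' j')); rewrite mulg1 mul1g.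
    by rewrite opprB addrC subrKA.
  pose U := \sum_(t <- S0) scl (c t) (u t).
  have h2 : BSet (amul q U (permd r s (tperm i' j')) - U).
    have := spanP_D (BsetB h1 (permd_B (tperm i' j') hc)) hc; rewrite amulBl -/U.
    by rewrite opprB (addrC (amul _ _ _ - _)) !subrKA.
  have h3 := BsetB h2 (sum_swap c (fun x hx => hx) (erefl : val j' = i'.+1)).
  have e4 : \sum_(t <- S0) scl (c t) (u (swapk t i.+1)) = \sum_(t <- S0) scl (c (swapk t i.+1)) (u t).
    have sz x : x \in S0 -> (i.+1 < size x)%N by move=> /(std0P plam pnu cop) [-> _ _ _].
    have pe := swap_perm_map (L := S0) (fun x hx => hx) (uniq_std0 lam nu s) hi (fun x hx => swap_S0 plam pnu cop hx hi).
    rewrite -(perm_big _ pe) /= big_map; apply: eq_big_seq => x hx.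
    by rewrite swapkK // sz.
  have h4 : BSet (\sum_(t <- S0) scl (c (swapk t i.+1) - c t) (u t)).
    move: h3; congr BSet; rewrite -/U /= e4.
    rewrite [RHS](eq_bigr (fun t => scl (c (swapk t i.+1)) (u t) - scl (c t) (u t))); last first.
      by move=> x _; rewrite -sclN1 scl_scl mulN1r; apply/ffunP => d; rewrite !ffunE mulrBl mulNr.
    by rewrite sumrB opprB addrC subrKA.
  by have := std0_indep hN hn plam pnu cop h4 ht => /eqP; rewrite subr_eq0 => /eqP.
pose d (i : nat) := c (head [::] (nth [::] SS i)).
have cd t : t \in S0 -> c t = lift d t.
  move=> ht; rewrite /lift /d; set j := find _ _.
  have hs : has (fun T => t \in T) SS.
    apply/hasP; exists (cls lam nu s mu t); last exact: cls_self.
    by apply/(mem_sstd plam pnu cop pmu smu); exists t.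
  have hj : (j < size SS)%N by rewrite -has_find.
  have htj : t \in nth [::] SS j by apply: (nth_find [::] hs).
  have /(mem_sstd plam pnu cop pmu smu) [t' ht' e] := mem_nth [::] hj.
  have C x : x \in cls lam nu s mu t' -> c x = c t'.
    by move: x; apply: (@cls_ind lam nu mu s plam pnu cop (fun x => c x = c t') t') => // x i hx ha <-; apply: csw.
  have hh : head [::] (nth [::] SS j) \in nth [::] SS j by case: (nth [::] SS j) htj => // y l _; apply: mem_head.
  by rewrite e in htj hh *; rewrite (C t htj) (C _ hh).
exists d => g; rewrite sum_phiT sum_lift.
have -> : \sum_(t <- S0) scl (lift d t) (u t) = \sum_(t <- S0) scl (c t) (u t).
  by apply: eq_big_seq => t ht; rewrite (cd t ht).
have h1 := FC 1%g g; rewrite mul1g in h1.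
have h2 := permd_B g hc; rewrite amulBl in h2.
by have := spanP_D h1 h2; rewrite addrA subrK.
Qed.
End Main.

Local Close Scope ring_scope.

(* r = |lam| + s ; n is taken to be a natural number >= N(r), viewed in Q.
   Hom_{S_s}(M(mu), Delta^0_s(nu\lam)) is realized as the space of maps
   F : S_s -> P_r(n) with [isHom], modulo maps with values in [Bset]. *)
Theorem theorem5p7 :
  exists N : nat -> nat,
  forall (lam nu mu : seq nat) (s n : nat),
    is_part lam -> is_part nu -> copieri lam nu s ->
    is_part mu -> sumn mu = s ->
    N (sumn lam + s) <= n ->
    let r := sumn lam + s in
    let q : rat := n%:R%R in
    let SS := sstd lam nu s mu in
    [/\ (* each phi_T is a well-defined S_s-homomorphism *)
        forall T, T \in SS -> isHom r q lam nu s mu (phiT r q lam s T),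
        (* the phi_T are linearly independent in Hom *)
        forall c : nat -> rat,
          (forall g : 'S_s, Bset r q lam nu s
             (\sum_(i < size SS) scl (c i) (phiT r q lam s (nth [::] SS i) g))%R) ->
          forall i, i < size SS -> c i = 0%R &
        (* and they span Hom *)
        forall F : 'S_s -> alg r, isHom r q lam nu s mu F ->
          exists c : nat -> rat, forall g : 'S_s, Bset r q lam nu s
             (F g - \sum_(i < size SS) scl (c i) (phiT r q lam s (nth [::] SS i) g))%R].
Proof.
(* Three labels for each cell of a square of side [r+1] and for each of at most [r] steps, and one
   further label for the padding. *)
exists (fun r => (3 * (r.+1 * r.+1 + r)).+1) => lam nu mu s n plam pnu cop pmu smu hn.
case: n hn => // n; rewrite ltnS => hn /=.
have hC : 3 * (#|{: 'I_(sumn lam + s).+1 * 'I_(sumn lam + s).+1}| + s) <= n.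
  rewrite card_prod card_ord; apply: leq_trans hn.
  by rewrite leq_mul2l leq_add2l leq_addl.
have h2 : (sumn lam + s) + (sumn lam + s) <= n.+1.
  by apply: leq_trans (leqW hn); set r := (_ + s); nia.
split.
- by move=> T hT; apply: (phiT_hom h2 plam pnu cop pmu smu).
- exact: (phiT_indep hC h2 plam pnu cop pmu smu).
exact: (phiT_span hC h2 plam pnu cop pmu smu).
Qed.
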